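(* Let $\nu>0$ and $\Omega\in\mathbb{R}$, and let $u_0\in\chi^{-1}(\mathbb{R}^3)$ satisfy $\operatorname{div}u_0=0$ and $\|u_0\|_{\chi^{-1}}<(2\pi)^3\nu$. For $T>0$, assume that $u\in C([0,T);\chi^{-1})$ is a solution, in the distribution sense, on $(0,T)\times\mathbb{R}^3$ of the Navier-Stokes equations with the Coriolis force $$\partial_t u-\nu\Delta u+\Omega e_3\times u+(u,\nabla)u+\nabla p=0,\qquad \operatorname{div}u=0,\qquad u|_{t=0}=u_0,$$ satisfying $$u\in L^1(0,T;\chi^1),\qquad \partial_t u\in L^1(0,T;\chi^{-1}).$$ Then $u$ satisfies $$\|u(t)\|_{\chi^{-1}}+\bigl(\nu-(2\pi)^{-3}\|u_0\|_{\chi^{-1}}\bigr)\int_0^t\|u(\tau)\|_{\chi^1}\,d\tau\le\|u_0\|_{\chi^{-1}},\qquad 0\le t<T.$$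
   Context: The Fourier transform is $\widehat f(\xi)=\mathcal F[f](\xi)=\int_{\mathbb{R}^3}e^{-ix\cdot\xi}f(x)\,dx$, so that $\mathcal F[fg]=(2\pi)^{-3}\widehat f\ast\widehat g$. For $m\in\mathbb{R}$, $$\chi^m(\mathbb{R}^3)=\Bigl\{f\in\mathcal S'\;\Big|\;\widehat f\in L^1_{\mathrm{loc}},\ \|f\|_{\chi^m}:=\int_{\mathbb{R}^3}|\xi|^m|\widehat f(\xi)|\,d\xi<\infty\Bigr\};$$ for vector fields, $|\widehat f(\xi)|$ is the Euclidean norm in $\mathbb{C}^3$. The unknowns are the velocity field $u=u(t,x)=(u_1,u_2,u_3)$ ($\mathbb{R}^3$-valued) and the scalar pressure $p=p(t,x)$; $u_0$ is the initial velocity field, $\nu$ is the viscosity, $e_3=(0,0,1)$, $\Omega$ is the Coriolis parameter, and $(u,\nabla)u=\sum_{k=1}^3u_k\partial_k u$, which equals $\nabla\cdot(u\otimes u)$ since $\operatorname{div}u=0$. A solution in the distribution sense is a $u$ for which there exists a scalar distribution $p$ such that the equations hold in the sense of distributions on $(0,T)\times\mathbb{R}^3$, with $u(0)=u_0$. *)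

(* Defs.v *)
From mathcomp Require Import all_boot all_order all_algebra.
From mathcomp Require Import complex.
From mathcomp Require Import all_classical all_reals all_analysis.

Set Implicit Arguments.
Unset Strict Implicit.
Unset Printing Implicit Defensive.

Import Order.TTheory GRing.Theory Num.Theory.
Import numFieldNormedType.Exports.

Local Open Scope classical_set_scope.
Local Open Scope ring_scope.
Local Open Scope complex_scope.

Section SmoothFunctions.
Context {R : realType} {V : normedModType R}.

(* [iter_derive [:: v1; ...; vn] f] is the iterated directional derivative     *)
(* D_v1 (... (D_vn f)).                                                        *)
Definition iter_derive (vs : seq V) (f : V -> R) : V -> R :=
  foldr (fun v g => 'D_v g) f vs.

(* C^oo in finite dimension. [derive] is total, hence the explicit             *)
(* derivability requirement.                                                   *)
Definition smooth (f : V -> R) : Prop :=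
  forall vs : seq V,
    continuous (iter_derive vs f) /\
    forall x v, derivable (iter_derive vs f) x v.

Definition supported_in (K : set V) (f : V -> R) : Prop :=
  forall x, ~ K x -> f x = 0.

Definition test_function (U : set V) (f : V -> R) : Prop :=
  smooth f /\ exists K, [/\ compact K, K `<=` U & supported_in K f].

(* Real-valued distributions are functionals on real test functions. They are  *)
(* represented by functions on all of [V -> R], of which only the values on    *)
(* test functions (resp. Schwartz functions) are ever used.                    *)
Definition functional := (V -> R) -> R.

Definition linear_on (P : set (V -> R)) (f : functional) : Prop :=
  forall a phi psi, P phi -> P psi ->
    f (fun x => a * phi x + psi x) = a * f phi + f psi.

(* D'(U): linear and sequentially continuous, which for linear functionals on  *)
(* the LF-space of test functions is the same as continuous.                   *)
Definition distribution_on (U : set V) (f : functional) : Prop :=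
  linear_on (test_function U) f /\
  forall phi : nat -> V -> R,
    (forall k, test_function U (phi k)) ->
    (exists K, [/\ compact K, K `<=` U & forall k, supported_in K (phi k)]) ->
    (forall vs e, 0 < e ->
       \forall k \near \oo, forall x, `|iter_derive vs (phi k) x| <= e) ->
    (fun k => f (phi k)) @ \oo --> (0 : R).

Definition dderive (v : V) (f : functional) : functional :=
  fun phi => - f ('D_v phi).

End SmoothFunctions.
Arguments functional {R} V.

Section Space.
Variable R : realType.

Definition R3 := (R * R * R)%type.

Local Notation leb1 := (@lebesgue_measure R).
Definition leb3 := ((leb1 \x leb1) \x leb1)%E.

Definition xcoord (x : R3) (j : 'I_3) : R := [:: x.1.1; x.1.2; x.2]`_j.
Definition ebasis (j : 'I_3) : R3 :=
  ((j == 0 :> nat)%:R, (j == 1 :> nat)%:R, (j == 2 :> nat)%:R).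
Definition dot (x y : R3) : R := \sum_(j < 3) xcoord x j * xcoord y j.
(* The Euclidean norm; the library norm on the product is the sup norm.        *)
Definition enorm (x : R3) : R := Num.sqrt (dot x x).

Definition schwartz (phi : R3 -> R) : Prop :=
  smooth phi /\
  forall (vs : seq R3) (n : nat), exists M : R,
    forall x, (1 + enorm x) ^+ n * `|iter_derive vs phi x| <= M.

(* S': linear and sequentially continuous for the Schwartz topology, i.e.      *)
(* continuous, the Schwartz space being metrizable.                            *)
Definition tempered (f : functional R3) : Prop :=
  linear_on schwartz f /\
  forall phi : nat -> R3 -> R,
    (forall k, schwartz (phi k)) ->
    (forall vs n e, 0 < e -> \forall k \near \oo,
       forall x, (1 + enorm x) ^+ n * `|iter_derive vs (phi k) x| <= e) ->
    (fun k => f (phi k)) @ \oo --> (0 : R).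

Definition locally_integrable3 (h : R3 -> R) : Prop :=
  measurable_fun setT h /\
  forall K : set R3, compact K -> leb3.-integrable K (EFin \o h).

Definition cintegral (g : R3 -> R[i]) : R[i] :=
  Rintegral leb3 setT (fun x => complex.Re (g x)) +i*
  Rintegral leb3 setT (fun x => complex.Im (g x)).

Definition cexp (theta : R) : R[i] := cos theta +i* sin theta.

Definition fourier (phi : R3 -> R) : R3 -> R[i] :=
  fun xi => cintegral (fun x => cexp (- dot x xi) * (phi x)%:C).

(* Complex-linear extension of a real functional to complex test functions.    *)
Definition cpair (f : functional R3) (g : R3 -> R[i]) : R[i] :=
  f (fun x => complex.Re (g x)) +i* f (fun x => complex.Im (g x)).

(* The Fourier transform of [f], defined by <F f, phi> = <f, F phi>, is the    *)
(* regular distribution given by [g] in L^1_loc.                               *)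
Definition fourier_function (f : functional R3) (g : R3 -> R[i]) : Prop :=
  [/\ locally_integrable3 (fun xi => complex.Re (g xi)),
      locally_integrable3 (fun xi => complex.Im (g xi)) &
      forall phi, test_function setT phi ->
        cpair f (fourier phi) = cintegral (fun xi => g xi * (phi xi)%:C)].

(* Unique up to null sets; a junk value when [f] has no Fourier transform      *)
(* in L^1_loc.                                                                 *)
Definition fhat (f : functional R3) : R3 -> R[i] :=
  xget (fun=> 0) [set g | fourier_function f g].

Definition vdist := 'I_3 -> functional R3.

Definition cnorm3 (z : 'I_3 -> R[i]) : R :=
  Num.sqrt (\sum_(j < 3) Normc.normc (z j) ^+ 2).

Definition chi_norm (m : R) (f : vdist) : \bar R :=
  (\int[leb3]_xi ((enorm xi `^ m * cnorm3 (fun j => fhat (f j) xi))%:E))%E.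

Definition in_chi (m : R) (f : vdist) : Prop :=
  (forall j, tempered (f j) /\ exists g, fourier_function (f j) g) /\
  (chi_norm m f < +oo)%E.

Definition divergence (f : vdist) : functional R3 :=
  fun phi => \sum_(k < 3) dderive (ebasis k) (f k) phi.

(* A locally integrable function representing a regular distribution, unique   *)
(* up to null sets, and the pointwise product of two regular distributions.    *)
(* An element of chi^(-1) `&` chi^1 has an integrable Fourier transform, hence *)
(* is regular and bounded.                                                     *)
Definition function_of (f : functional R3) : R3 -> R :=
  xget (fun=> 0) [set h | locally_integrable3 h /\
    forall phi, test_function setT phi ->
      f phi = Rintegral leb3 setT (fun x => h x * phi x)].

Definition dmul (f g : functional R3) : functional R3 :=
  fun phi => Rintegral leb3 setT
    (fun x => function_of f x * function_of g x * phi x).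

Definition C_chi (T m : R) (u : R -> vdist) : Prop :=
  (forall t, 0 <= t < T -> in_chi m (u t)) /\
  forall t, 0 <= t < T ->
    chi_norm m (u s - u t)
      @[s --> within [set s | 0 <= s < T] (nbhs t)] --> 0%E.

Definition chi_simple (m : R) (s : R -> vdist) : Prop :=
  [/\ finite_set (range s), forall v, measurable (s @^-1` [set v]) &
      forall t, in_chi m (s t)].

(* Bochner integrability: strong measurability and integrability of the norm.  *)
Definition L1_chi (T m : R) (u : R -> vdist) : Prop :=
  [/\ {ae leb1, forall t, 0 < t < T -> in_chi m (u t)},
      exists s : nat -> R -> vdist, (forall n, chi_simple m (s n)) /\
        {ae leb1, forall t, 0 < t < T ->
           chi_norm m (s n t - u t) @[n --> \oo] --> 0%E} &
      (\int[leb1]_(t in `]0%R, T[) chi_norm m (u t) < +oo)%E].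

End Space.

Section SpaceTime.
Variable R : realType.

Definition spacetime := (R * R3 R)%type.

Definition strip (T : R) : set spacetime := [set z | 0 < z.1 < T].

Definition dir_t : spacetime := (1, 0).
Definition dir_x (k : 'I_3) : spacetime := (0, ebasis R k).

(* The distribution on (0,T) x R^3 defined by a time-dependent family of       *)
(* distributions on R^3.                                                       *)
Definition st (T : R) (f : R -> functional (R3 R)) : functional spacetime :=
  fun Phi =>
    Rintegral lebesgue_measure `]0, T[ (fun t => f t (fun x => Phi (t, x))).

(* Indices are taken modulo 3.                                                 *)
Definition cross (a b : 'I_3 -> R) : 'I_3 -> R :=
  fun j => a (j + 1) * b (j + 2%:R) - a (j + 2%:R) * b (j + 1).

Definition e3 : 'I_3 -> R := fun j => (j == 2 :> nat)%:R.

(* The convection term (u, nabla) u is written as div (u (x) u), which is the  *)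
(* same since div u = 0.                                                       *)
Definition momentum_eq (nu Omega T : R) (u : R -> vdist R)
    (p : functional spacetime) : Prop :=
  forall Phi, test_function (strip T) Phi -> forall j : 'I_3,
    let U k := st T (fun t => u t k) in
    dderive dir_t (U j) Phi
    - nu * (\sum_(k < 3) dderive (dir_x k) (dderive (dir_x k) (U j)) Phi)
    + Omega * cross e3 (fun k => U k Phi) j
    + \sum_(k < 3)
        dderive (dir_x k) (st T (fun t => dmul (u t k) (u t j))) Phi
    + dderive (dir_x j) p Phi = 0.

Definition divergence_free (T : R) (u : R -> vdist R) : Prop :=
  forall Phi, test_function (strip T) Phi ->
    \sum_(k < 3) dderive (dir_x k) (st T (fun t => u t k)) Phi = 0.

Definition initial_value (u0 : vdist R) (u : R -> vdist R) : Prop :=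
  forall j phi, schwartz phi -> u 0 j phi = u0 j phi.

Definition NSC_solution (nu Omega T : R) (u0 : vdist R)
    (u : R -> vdist R) : Prop :=
  [/\ exists p, distribution_on (strip T) p /\ momentum_eq nu Omega T u p,
      divergence_free T u & initial_value u0 u].

(* [w] is the time derivative of [u] in the sense of distributions.            *)
Definition time_derivative (T : R) (u w : R -> vdist R) : Prop :=
  forall j Phi, test_function (strip T) Phi ->
    dderive dir_t (st T (fun t => u t j)) Phi = st T (fun t => w t j) Phi.

End SpaceTime.

(* Main.v *)
(* In frequency space, put g(t) = (u(t))^. Testing the equation against b(t) phi(x) with
   div phi = 0 removes the pressure; letting b approximate the indicator function of
   [s, t] gives <g(s), m> - <g(t), m> = \int_s^t F(m), where m = phi^ and F collects the
   viscous, Coriolis and convection terms. By density this holds for every bounded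
   multiplier m of compact support that vanishes near 0 and is orthogonal to xi.
   The equation div u = 0 says that g(t) is itself orthogonal to xi, so that
   m = conj (g(t)) / (|xi| |g(t)|), cut off to 1/n <= |xi| <= n, is admissible. With this m
   the Coriolis term is purely imaginary and drops out, the viscous term is
   nu ||u(t)||_{chi^1} and the convection term is at most
   (2 pi)^-3 ||u||_{chi^-1} ||u||_{chi^1}, up to an error (replacing g(tau) by g(t) in the
   linear terms) which is o(t - s). Adding up over short intervals and letting n -> oo,
     X(t) + \int_s^t (nu - (2 pi)^-3 X) ||u||_{chi^1} <= X(s)   for X = ||u||_{chi^-1}.
   As (2 pi)^-3 X(0) < nu and X is continuous, X never exceeds X(0). *)
From HB Require Import structures.
Require Import Defs.
From mathcomp Require Import all_boot all_order all_algebra.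
From mathcomp Require Import complex ring lra.
From mathcomp Require Import all_classical all_reals all_analysis measurable_realfun.

Set Implicit Arguments.
Unset Strict Implicit.
Unset Printing Implicit Defensive.

Import Order.TTheory GRing.Theory Num.Theory.
Import numFieldNormedType.Exports.

Local Open Scope classical_set_scope.
Local Open Scope ring_scope.

(** * Smooth functions *)

(** Distributions act here on real test functions, so the Fourier calculus is written with cosine
    and sine transforms and each complex identity splits into two real ones. The equation itself
    only yields the multipliers [qf phi], coming from real fields; the complex span that the density
    argument needs is supplied by the reality of [u]: for i times such a multiplier both sides of
    the evolution identity are 0.

    The norm is never differentiated in time. The multiplier is frozen at the right end t of a short
    interval: its pairing with g(t) is the truncated norm of g(t), its pairing with g(s) is at most
    that of g(s), and this inequality has the favourable sign. The errors are controlled by the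
    chi^(-1) distance alone, since all powers of |xi| are comparable on the shell 1/n <= |xi| <= n.

    Measurability in time is derived from chi^(-1) continuity by truncating in frequency. The
    constant (2 pi)^-3 is sharp in the convection estimate because |xi| |m| <= 1 absorbs the
    derivative and the rest is Cauchy-Schwarz between chi^(-1) and chi^1. *)

Section SmoothCalculus.
Context {R : realType}.

(** Stability under directional derivatives keeps every [iter_derive vs f] inside [P], so smoothness
    is proved for a whole explicit family at once, without formulas for higher derivatives. *)
Lemma smoothI (V : normedModType R) (P : set (V -> R)) :
  (forall f, P f -> continuous f) ->
  (forall f x v, P f -> derivable f x v) ->
  (forall f v, P f -> P ('D_v f)) ->
  forall f, P f -> smooth f.
Proof.
move=> Pc Pd PD f Pf vs.
suff : P (iter_derive vs f) by move=> Pvs; split=> [|x v]; [exact: Pc|exact: Pd].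
by elim: vs => //= v vs IH; exact: PD.
Qed.

Lemma smooth_continuous (V : normedModType R) (f : V -> R) :
  smooth f -> continuous f.
Proof. by move=> /(_ [::]) []. Qed.

Lemma smooth_derivable (V : normedModType R) (f : V -> R) x v :
  smooth f -> derivable f x v.
Proof. by move=> /(_ [::]) []. Qed.

Lemma iter_derive_rcons (V : normedModType R) (f : V -> R) vs v :
  iter_derive (rcons vs v) f = iter_derive vs ('D_v f).
Proof. by rewrite /iter_derive foldr_rcons. Qed.

Lemma smooth_derive (V : normedModType R) (f : V -> R) v :
  smooth f -> smooth ('D_v f).
Proof. by move=> sf vs; rewrite -iter_derive_rcons; exact: sf. Qed.

Lemma smooth_iter_derive (V : normedModType R) (f : V -> R) vs :
  smooth f -> smooth (iter_derive vs f).
Proof. by move=> sf; elim: vs => [|v vs IH]; [exact: sf|exact: smooth_derive IH]. Qed.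

Lemma is_derive_smooth (V : normedModType R) (f : V -> R) x v :
  smooth f -> is_derive x v f ('D_v f x).
Proof. by move=> sf; apply: DeriveDef => //; exact: smooth_derivable sf. Qed.

Lemma is_derive_mul (V : normedModType R) (f g : V -> R) x v (df dg : R) :
  is_derive x v f df -> is_derive x v g dg ->
  is_derive x v (fun y => f y * g y) (f x * dg + g x * df).
Proof. by move=> df' dg'; have := is_deriveM df' dg'. Qed.

Lemma is_derive_mull (V : normedModType R) (a : R) (g : V -> R) x v (dg : R) :
  is_derive x v g dg -> is_derive x v (fun y => a * g y) (a * dg).
Proof.
move=> dg'; have := is_derive_mul (is_derive_cst a x v) dg'.
by rewrite mulr0 addr0.
Qed.

Lemma smooth_cst (V : normedModType R) (a : R) : smooth (fun _ : V => a).
Proof.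
apply: (@smoothI _ [set f | exists b, f = cst b]); last by exists a.
- by move=> _ [b ->] x; exact: cvg_cst.
- by move=> _ x v [b ->]; exact: derivable_cst.
- by move=> _ v [b ->]; exists 0; apply/funext => x; rewrite derive_cst.
Qed.

(** Products of two smooth functions are not stable under differentiation, but their finite sums
    are, by the Leibniz rule; this is the class given to [smoothI]. *)
Inductive prodsum (V : normedModType R) : (V -> R) -> Prop :=
| Prodsum_mul f g : smooth f -> smooth g -> prodsum (fun x => f x * g x)
| Prodsum_add f g : prodsum f -> prodsum g -> prodsum (fun x => f x + g x).

Lemma prodsum_smooth (V : normedModType R) (f : V -> R) : prodsum f -> smooth f.
Proof.
have cd h : prodsum h ->
    continuous h /\ forall x v, derivable h x v /\ prodsum ('D_v h).
  elim=> {h} [f1 f2 sf1 sf2|f1 f2 _ [c1 d1] _ [c2 d2]]; split.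
  - by move=> x; apply: cvgM; exact: smooth_continuous.
  - move=> x v.
    have d y : derivable (fun x => f1 x * f2 x) y v.
      by apply: derivableM; exact: smooth_derivable.
    split => //.
    rewrite (_ : 'D_v _ = fun y => f1 y * 'D_v f2 y + f2 y * 'D_v f1 y).
      exact: (Prodsum_add (Prodsum_mul sf1 (smooth_derive v sf2))
        (Prodsum_mul sf2 (smooth_derive v sf1))).
    by apply/funext => y; rewrite deriveM//; exact: smooth_derivable.
  - by move=> x; apply: cvgD; [exact: c1|exact: c2].
  - move=> x v; split; first by apply: derivableD; [exact: (d1 x v).1|exact: (d2 x v).1].
    rewrite (_ : 'D_v _ = fun y => 'D_v f1 y + 'D_v f2 y).
      exact: Prodsum_add (d1 x v).2 (d2 x v).2.
    by apply/funext => y; rewrite deriveD//; [exact: (d1 y v).1|exact: (d2 y v).1].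
apply: smoothI => [h /cd []|h x v /cd [_ /(_ x v) []]|h v /cd [_ /(_ 0 v) []]] //.
Qed.

Lemma smoothM (V : normedModType R) (f g : V -> R) :
  smooth f -> smooth g -> smooth (fun x => f x * g x).
Proof. by move=> sf sg; apply/prodsum_smooth/Prodsum_mul. Qed.

Lemma smoothZ (V : normedModType R) (a : R) (f : V -> R) :
  smooth f -> smooth (fun x => a * f x).
Proof. by apply: smoothM; exact: smooth_cst. Qed.

Lemma smoothD (V : normedModType R) (f g : V -> R) :
  smooth f -> smooth g -> smooth (fun x => f x + g x).
Proof.
move=> sf sg; apply: prodsum_smooth.
have E (h : V -> R) : h = fun x => 1 * h x by apply/funext => x; rewrite mul1r.
rewrite [X in prodsum X](_ : _ = fun x => 1 * f x + 1 * g x).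
  exact: (Prodsum_add (Prodsum_mul (smooth_cst 1) sf) (Prodsum_mul (smooth_cst 1) sg)).
by apply/funext => x; rewrite !mul1r.
Qed.

Section Affine.
Context (V W : normedModType R) (a l : V -> W).
Context (aE : forall x (h : R) v, a (h *: v + x) = h *: l v + a x).

(** By [aE], the map [a] is affine with linear part [l], so the difference quotient of [f \o a] in
    direction [v] is that of [f] in direction [l v]. *)
Lemma derive_affine (f : W -> R) v : 'D_v (f \o a) = 'D_(l v) f \o a.
Proof.
by apply/funext => x; rewrite /derive /=; under eq_fun do rewrite aE.
Qed.

Lemma derivable_affine (f : W -> R) x v :
  derivable f (a x) (l v) -> derivable (f \o a) x v.
Proof.
rewrite /derivable [X in _ -> cvg (fmap X _)](_ : _ =
  fun h => h^-1 *: (f (h *: l v + a x) - f (a x)))//.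
by apply/funext => h; rewrite /= aE.
Qed.

Lemma iter_derive_affine (f : W -> R) vs :
  iter_derive vs (f \o a) = iter_derive (map l vs) f \o a.
Proof. by elim: vs => //= v vs ->; rewrite derive_affine. Qed.

Lemma smooth_affine (f : W -> R) : continuous a -> smooth f -> smooth (f \o a).
Proof.
move=> ca sf vs; rewrite iter_derive_affine; split=> [x|x v].
  by apply: continuous_comp; [exact: ca|exact: (sf _).1].
by apply: derivable_affine; exact: (sf _).2.
Qed.
End Affine.
End SmoothCalculus.

(** * Functions that vanish to infinite order at 0 *)

Section Flat.
Context {R : realType}.
Implicit Types p : {poly R}.

(** The functions p(1/x) exp(-1/x), extended by 0, contain exp(-1/x) and are stable under
    differentiation, which replaces p by X^2 (p - p'). *)
Definition flat p (x : R) : R :=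
  if 0 < x then p.[x^-1] * expR (- x^-1) else 0.

(** The exponential series dominates each of its terms, so y^i exp(-y) <= i! for every monomial. *)
Lemma poly_expRN_bound p : exists2 C : R, 0 <= C &
  forall y, 0 <= y -> `|p.[y] * expR (- y)| <= C.
Proof.
exists (\sum_(i < size p) `|p`_i| * (i`!)%:R).
  by apply: sumr_ge0 => i _; rewrite mulr_ge0.
move=> y y0; rewrite horner_coef mulr_suml (le_trans (ler_norm_sum _ _ _))//.
apply: ler_sum => i _; rewrite -mulrA normrM ler_wpM2l// ger0_norm; last first.
  by rewrite mulr_ge0 ?exprn_ge0 ?expR_ge0.
case: i => -[|i] /= _.
  by rewrite expr0 mul1r fact0 -expR0 ler_expR oppr_le0.
rewrite expRN ler_pdivrMr ?expR_gt0// -ler_pdivrMl ?ltr0n ?fact_gt0//.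
by rewrite mulrC (le_trans _ (expR_ge1Dxn i y0))// lerDr.
Qed.

(** The previous bound for X^2 p gains a factor x^2; it is this quadratic decay that makes the
    difference quotient at 0 tend to 0. *)
Lemma flat_bound p : exists2 C : R, 0 <= C & forall x, `|flat p x| <= C * x ^+ 2.
Proof.
have [C C0 Cp] := poly_expRN_bound ('X^2 * p); exists C => // x.
rewrite /flat; case: ifPn => [x0|_]; last by rewrite normr0 mulr_ge0 ?sqr_ge0.
have := Cp x^-1; rewrite invr_ge0 ltW// => /(_ isT).
rewrite hornerM hornerXn -mulrA exprVn normrM ger0_norm ?invr_ge0 ?sqr_ge0//.
by rewrite mulrC ler_pdivrMr// exprn_gt0.
Qed.

Lemma is_derive_flat p (x : R) : is_derive x 1 (flat p) (flat ('X^2 * (p - p^`())) x).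
Proof.
have [x0|x0|->] := ltgtP x 0.
- apply: (@near_eq_is_derive _ _ _ (cst 0)).
    near=> z; rewrite /flat ltNge; suff -> : z <= 0 by [].
    by apply: ltW; near: z; exact: lt_nbhsl.
  by rewrite /flat ltNge (ltW x0)/=; exact: is_derive_cst.
- apply: (@near_eq_is_derive R R R (fun x : R => p.[x^-1] * expR (- x^-1))).
  + near=> z; rewrite /flat; suff -> : 0 < z by [].
    by near: z; exact: lt_nbhsr.
  + have iv : is_derive x 1 (GRing.inv : R -> R) (- x ^- 2).
      have := is_deriveV (lt0r_neq0 x0) (is_derive_id x 1).
      by rewrite scaler1.
    have ipv : is_derive x 1 (fun z => p.[z^-1]) (- x ^- 2 * p^`().[x^-1]).
      have := is_derive1_comp (is_derive_poly p x^-1) iv.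
      by rewrite mulrC.
    have iN : is_derive x 1 (fun z => - z^-1) (x ^- 2).
      by have := is_deriveN iv; rewrite opprK.
    have ie : is_derive x 1 (fun z => expR (- z^-1)) (x ^- 2 * expR (- x^-1)).
      have := @is_derive1_comp _ expR (fun z : R => - z^-1) x _ _
        (is_derive_expR (- x^-1)) iN.
      by rewrite mulrC.
    have H := is_deriveM ipv ie; apply: (is_derive_eq H).
    rewrite /flat x0 hornerM hornerXn hornerD hornerN /GRing.scale/= exprVn.
    by ring.
- have [C C0 Cp] := flat_bound p.
  have f0 q : flat q 0 = 0 by rewrite /flat ltxx.
  have H : (fun h : R => h^-1 *: ((flat p \o shift 0) (h *: 1) - flat p 0))
      @ 0^' --> (0 : R).
    apply/cvgr0Pnorm_le => e e0; near=> h.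
    have h0 : h != 0 by near: h; exact: nbhs_dnbhs_neq.
    rewrite f0 /= subr0 addr0 /GRing.scale/= mulr1 normrM normfV mulrC.
    rewrite ler_pdivrMr ?normr_gt0// (le_trans (Cp h))//.
    rewrite -[h ^+ 2]ger0_norm ?sqr_ge0// normrX expr2 mulrA ler_wpM2r//.
    have : `|h| <= e / (C + 1).
      near: h; apply: dnbhs0_le.
      by rewrite divr_gt0// ltr_wpDl.
    rewrite ler_pdivlMr ?ltr_wpDl// mulrC; apply: le_trans.
    by rewrite ler_wpM2r// lerDl.
  by apply: DeriveDef; [apply/cvg_ex; exists 0|rewrite f0; exact/cvg_lim].
Unshelve. all: by end_near. Qed.

Lemma is_derive1_dir (f : R -> R) (x v d : R) :
  is_derive x 1 f d -> is_derive x v f (v * d).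
Proof.
move=> fd; have df : differentiable f x by apply/derivable1_diffP; exact: ex_derive.
apply: DeriveDef; first exact: diff_derivable.
have -> : 'D_v f x = v *: 'D_1 f x.
  by rewrite !deriveE// -linearZ/= /GRing.scale/= mulr1.
by rewrite derive_val.
Qed.

Lemma smooth_flat p : smooth (flat p).
Proof.
apply: (@smoothI _ _ [set f | exists q, f = flat q]); last by exists p.
- move=> _ [q ->] x; apply/differentiable_continuous/derivable1_diffP.
  by have [] := is_derive_flat q x.
- move=> _ x v [q ->].
  by have [] := is_derive1_dir v (is_derive_flat q x).
- move=> _ v [q ->]; exists (v *: ('X^2 * (q - q^`()))); apply/funext => x.
  have [_ ->] := is_derive1_dir v (is_derive_flat q x).
  by rewrite /flat; case: ifP => _; rewrite ?mulr0// hornerZ mulrA.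
Qed.

Lemma flat1E x : flat 1 x = if 0 < x then expR (- x^-1) else 0.
Proof. by rewrite /flat hornerC mul1r. Qed.

Lemma flat1_ge0 x : 0 <= flat 1 x.
Proof. by rewrite flat1E; case: ifP => // _; exact: expR_ge0. Qed.

Lemma flat1_le1 x : flat 1 x <= 1.
Proof.
rewrite flat1E; case: ifP => // x0.
by rewrite -expR0 ler_expR oppr_le0 invr_ge0 ltW.
Qed.

Lemma cvg_flat1 (x : R) :
  flat 1 (n.+1%:R * x) @[n --> \oo] --> ((0 < x)%R%:R : R).
Proof.
case: ltP => x0; last first.
  rewrite (_ : (fun _ => _) = cst 0); first exact: cvg_cst.
  by apply/funext => n; rewrite flat1E pmulr_rgt0// ltNge x0.
rewrite (_ : (fun _ => _) = fun n : nat => expR (- ((n.+1%:R)^-1 * x^-1))).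
  rewrite -[X in _ --> X]expR0.
  apply: continuous_cvg; first exact: continuous_expR.
  rewrite -oppr0; apply: cvgN; rewrite -[X in _ --> X](mul0r x^-1).
  apply: cvgM; last exact: cvg_cst.
  exact: cvg_harmonic.
by apply/funext => n; rewrite flat1E pmulr_rgt0// x0 invfM.
Qed.
End Flat.

(** * Test functions on R^3 *)

Section Space3.
Context {R : realType}.
Local Notation V := (R3 R).
Implicit Types (x y v w : V) (j : 'I_3) (phi : V -> R).

Lemma ord3_ind (P : 'I_3 -> Prop) : P 0 -> P 1 -> P 2%:R -> forall j, P j.
Proof.
move=> P0 P1 P2 j; have [->//|->//|->//] : [\/ j = 0, j = 1 | j = 2%:R].
case: j => -[|[|[|//]]] ?; [apply: Or31|apply: Or32|apply: Or33]; exact: val_inj.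
Qed.

Lemma sum3E (M : nmodType) (F : 'I_3 -> M) : \sum_(j < 3) F j = F 0 + F 1 + F 2%:R.
Proof.
rewrite !big_ord_recl big_ord0 addr0 addrA; congr (_ + F _ + F _);
exact: val_inj.
Qed.

Lemma dotE x y : dot x y = x.1.1 * y.1.1 + x.1.2 * y.1.2 + x.2 * y.2.
Proof. by rewrite /dot sum3E. Qed.

Lemma xcoord_linear x v (h : R) j :
  xcoord (h *: v + x) j = h * xcoord v j + xcoord x j.
Proof. by elim/ord3_ind: j. Qed.

Lemma xcoord_continuous j : continuous (fun x => xcoord x j).
Proof.
elim/ord3_ind: j => x; rewrite /xcoord/=.
- by apply: continuous_comp; [exact: cvg_fst|exact: cvg_fst].
- by apply: continuous_comp; [exact: cvg_fst|exact: cvg_snd].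
- exact: cvg_snd.
Qed.

Lemma norm3E x : `|x| = Num.max (Num.max `|x.1.1| `|x.1.2|) `|x.2|.
Proof. by case: x => [[a b] c]. Qed.

Lemma norm3_le x (N : R) :
  (`|x| <= N) = [&& `|x.1.1| <= N, `|x.1.2| <= N & `|x.2| <= N].
Proof. by rewrite norm3E !ge_max andbA. Qed.

Lemma xcoord_le_norm x j : `|xcoord x j| <= `|x|.
Proof.
by elim/ord3_ind: j; rewrite norm3E /xcoord/= !le_max lexx ?orbT.
Qed.

Lemma enorm_ge0 x : 0 <= enorm x. Proof. exact: sqrtr_ge0. Qed.

Lemma xcoord_le_enorm x j : `|xcoord x j| <= enorm x.
Proof.
rewrite -[leLHS]sqrtr_sqr ler_wsqrtr// dotE !expr2.
have := sqr_ge0 x.1.1; have := sqr_ge0 x.1.2; have := sqr_ge0 x.2.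
by elim/ord3_ind: j; rewrite /xcoord/= !expr2; lra.
Qed.

Lemma norm_le_enorm x : `|x| <= enorm x.
Proof.
rewrite norm3_le; apply/and3P; split.
- exact: (xcoord_le_enorm x 0).
- exact: (xcoord_le_enorm x 1).
- exact: (xcoord_le_enorm x 2%:R).
Qed.

Lemma enorm_le_norm x : enorm x <= 2 * `|x|.
Proof.
rewrite -(@ger0_norm _ (2 * `|x|))// ?mulr_ge0// -sqrtr_sqr ler_wsqrtr// dotE.
have h (a : R) : `|a| <= `|x| -> a * a <= `|x| ^+ 2.
  move=> ax; rewrite -expr2 -real_normK ?num_real// ler_sqr ?nnegrE//.
have := h _ (xcoord_le_norm x 0); have := h _ (xcoord_le_norm x 1).
have := h _ (xcoord_le_norm x 2%:R); rewrite /xcoord/= exprMn.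
by have := sqr_ge0 `|x|; lra.
Qed.

Lemma enorm_eq0 x : (enorm x == 0) = (x == 0).
Proof.
apply/idP/idP => [/eqP e0|/eqP ->].
  by rewrite -normr_le0 -e0 norm_le_enorm.
by rewrite eq_le enorm_ge0 andbT (le_trans (enorm_le_norm _))// normr0 mulr0.
Qed.

Lemma enorm_gt0 x : (0 < enorm x) = (x != 0).
Proof. by rewrite lt_neqAle enorm_ge0 andbT eq_sym enorm_eq0. Qed.

Lemma dot_continuous v : continuous (dot v : V -> R).
Proof.
move=> x; rewrite /dot [X in continuous_at _ X](_ : _ =
  fun y => xcoord v 0 * xcoord y 0 + xcoord v 1 * xcoord y 1
     + xcoord v 2%:R * xcoord y 2%:R); last by apply/funext => y; rewrite sum3E.
have c j : {for x, continuous (fun y => xcoord v j * xcoord y j)}.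
  by apply: cvgM; [exact: cvg_cst|exact: xcoord_continuous].
by apply: cvgD; [apply: cvgD|]; exact: c.
Qed.

Lemma dotC x y : dot x y = dot y x.
Proof. by rewrite !dotE; ring. Qed.

Lemma dotDZ u x v (h : R) : dot u (h *: v + x) = h * dot u v + dot u x.
Proof.
by rewrite !dotE/= /GRing.scale/=; ring.
Qed.

Definition cube (N : R) : set V := [set x | `|x| <= N].

Lemma cubeE N : cube N = (`[- N, N] `*` `[- N, N]) `*` `[- N, N].
Proof.
apply/seteqP; split=> [x|x [[/=]]]; rewrite /cube /= norm3_le !in_itv/= -!ler_norml.
  by move/and3P => [].
by move=> -> -> ->.
Qed.

Lemma compact_cube N : compact (cube N).
Proof.
rewrite cubeE; apply: compact_setX; last exact: segment_compact.
by apply: compact_setX; exact: segment_compact.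
Qed.

Lemma compact_sub_cube (K : set V) : compact K -> exists N, K `<=` cube N.
Proof.
move=> /compact_bounded[M [_ MK]]; exists (M + 1) => x Kx; rewrite /cube/=.
by apply: MK => //; rewrite ltrDl.
Qed.

Definition test phi := test_function setT phi.

Lemma testP phi :
  test phi <-> smooth phi /\ exists N : R, supported_in (cube N) phi.
Proof.
split=> -[sphi].
  move=> [K [/compact_sub_cube[N KN] _ sK]]; split=> //; exists N => x xN.
  by apply: sK => /KN.
move=> [N sN]; split => //; exists (cube N); split => //; exact: compact_cube.
Qed.

Lemma supported_derive (W : normedModType R) (K : set W) (f : W -> R) (v : W) :
  closed K -> supported_in K f -> supported_in K ('D_v f).
Proof.
move=> cK sK x nKx; rewrite -(derive_cst (0 : R) v (x : W)).
apply: near_eq_derive; near=> z; rewrite sK//.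
by near: z; apply: open_nbhs_nbhs; split => //; exact: closed_openC.
Unshelve. all: by end_near. Qed.

Lemma closed_cube N : closed (cube N).
Proof.
by apply: compact_closed; [exact: norm_hausdorff|exact: compact_cube].
Qed.

Lemma test_derive phi v : test phi -> test ('D_v phi).
Proof.
move=> /testP[sphi [N sN]]; apply/testP; split; first exact: smooth_derive.
by exists N; apply: supported_derive => //; exact: closed_cube.
Qed.

Lemma test_iter_derive phi vs : test phi -> test (iter_derive vs phi).
Proof. by move=> t; elim: vs => [|v vs IH]; [exact: t|exact: test_derive IH]. Qed.

Lemma testM (f : V -> R) phi : smooth f -> test phi -> test (fun x => f x * phi x).
Proof.
move=> sf /testP[sphi [N sN]]; apply/testP; split; first exact: smoothM.
by exists N => x /sN ->; rewrite mulr0.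
Qed.

Lemma testZ (a : R) phi : test phi -> test (fun x => a * phi x).
Proof. by apply: testM; exact: smooth_cst. Qed.

Lemma testD phi psi : test phi -> test psi -> test (fun x => phi x + psi x).
Proof.
move=> /testP[s1 [N1 h1]] /testP[s2 [N2 h2]]; apply/testP; split.
  exact: smoothD.
exists (Num.max N1 N2) => x xN; rewrite h1 ?h2 ?addr0// => H; apply: xN;
by move: H; rewrite /cube/= le_max => ->; rewrite ?orbT.
Qed.

Lemma continuous_bounded_cube (f : V -> R) N : continuous f ->
  exists2 M : R, 0 <= M & forall x, `|x| <= N -> `|f x| <= M.
Proof.
move=> cf.
have : compact (f @` cube N).
  apply: continuous_compact; last exact: compact_cube.
  exact: continuous_subspaceT.
move=> /compact_bounded[M [_ MK]]; exists (`|M| + 1); first by rewrite addr_ge0.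
move=> x xN; apply: MK; last by exists x.
by rewrite (le_lt_trans (ler_norm _))// ltrDl.
Qed.

Lemma test_bounded phi : test phi ->
  exists2 M : R, 0 <= M & forall x, `|phi x| <= M.
Proof.
move=> /testP[sphi [N sN]].
have [M M0 MN] := continuous_bounded_cube N (smooth_continuous sphi).
exists M => // x; have [/MN//|xN] := boolP (`|x| <= N).
by rewrite sN ?normr0//; apply/negP.
Qed.

Lemma test_schwartz phi : test phi -> schwartz phi.
Proof.
move=> tphi; split=> [|vs n]; first by have [] := tphi.
have tD := test_iter_derive vs tphi.
have [M M0 MN] := test_bounded tD; have /testP[_ [N sN]] := tD.
exists ((1 + 2 * `|N|) ^+ n * M) => x.
have [xN|xN] := boolP (`|x| <= N); last first.
  rewrite sN ?normr0 ?mulr0; last by apply/negP.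
  by rewrite mulr_ge0// exprn_ge0// addr_ge0// mulr_ge0.
rewrite ler_pM ?exprn_ge0 ?addr_ge0 ?enorm_ge0 ?MN//.
rewrite lerXn2r ?nnegrE ?addr_ge0 ?mulr_ge0 ?enorm_ge0//.
rewrite lerD2l (le_trans (enorm_le_norm _))// ler_wpM2l//.
by rewrite (le_trans xN)// ler_norm.
Qed.

Lemma smooth_flat_linear (W : normedModType R) (l : W -> R) (a b : R) :
  (forall (x v : W) (h : R), l (h *: v + x) = h * l v + l x) -> continuous l ->
  smooth (fun x : W => flat 1 (a * l x + b)).
Proof.
move=> ll cl.
have := @smooth_affine _ W R (fun x : W => a * l x + b) (fun v : W => a * l v).
move=> /(_ _ (flat 1)); apply.
- by move=> x h v; rewrite ll /GRing.scale/=; ring.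
- move=> x; apply: cvgD; last exact: cvg_cst.
  by apply: cvgM; [exact: cvg_cst|exact: cl].
- exact: smooth_flat.
Qed.

(** As [n] grows, both factors tend to 1 inside ]a, b[ and their product is 0 outside, so the limit
    is exactly the indicator of the open interval, with values in [0, 1] throughout. *)
Definition bump1 (n : nat) (a b s : R) : R :=
  flat 1 (n.+1%:R * (s - a)) * flat 1 (n.+1%:R * (b - s)).

Lemma bump1_ge0 n a b s : 0 <= bump1 n a b s.
Proof. by rewrite mulr_ge0// flat1_ge0. Qed.

Lemma bump1_le1 n a b s : bump1 n a b s <= 1.
Proof. by rewrite -[leRHS]mulr1 ler_pM ?flat1_ge0 ?flat1_le1. Qed.

Lemma bump1_out n a b s : ~~ (a < s < b) -> bump1 n a b s = 0.
Proof.
by rewrite /bump1 !flat1E !pmulr_rgt0// !subr_gt0; case: (a < s); case: (s < b);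
  rewrite ?(mulr0, mul0r).
Qed.

Lemma cvg_bump1 a b s : bump1 n a b s @[n --> \oo] --> ((a < s < b)%R%:R : R).
Proof.
have -> : (a < s < b)%R%:R = (0 < s - a)%R%:R * (0 < b - s)%R%:R :> R.
  by rewrite !subr_gt0; case: (a < s); case: (s < b); rewrite ?mulr0 ?mul0r ?mulr1.
by apply: cvgM; exact: cvg_flat1.
Qed.

Lemma smooth_bump1 (W : normedModType R) (l : W -> R) n (a b : R) :
  (forall (x v : W) (h : R), l (h *: v + x) = h * l v + l x) -> continuous l ->
  smooth (fun x : W => bump1 n a b (l x)).
Proof.
move=> ll cl; apply: smoothM.
  rewrite (_ : (fun _ => _) = fun x : W => flat 1 (n.+1%:R * l x - n.+1%:R * a)).
    exact: smooth_flat_linear.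
  by apply/funext => x; rewrite mulrBr.
rewrite (_ : (fun _ => _) = fun x : W => flat 1 ((- n.+1%:R) * l x + n.+1%:R * b)).
  exact: smooth_flat_linear.
by apply/funext => x; rewrite mulrBr mulNr addrC.
Qed.

Definition bump3 n (a b : V) (x : V) : R :=
  bump1 n a.1.1 b.1.1 x.1.1 * bump1 n a.1.2 b.1.2 x.1.2 * bump1 n a.2 b.2 x.2.

Lemma bump3_out n a b (N : R) x : `|a| <= N -> `|b| <= N -> N < `|x| ->
  bump3 n a b x = 0.
Proof.
rewrite !norm3_le => /and3P[a1 a2 a3] /and3P[b1 b2 b3].
rewrite ltNge norm3_le !negb_and -!ltNge.
have h (s c d : R) : `|c| <= N -> `|d| <= N -> N < `|s| -> bump1 n c d s = 0.
  move=> cN dN sN; apply: bump1_out; apply/negP => /andP[cs sd].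
  move: cN dN sN; rewrite !ler_norml => /andP[? ?] /andP[? ?].
  by rewrite ltNge ler_norml => /negP; apply; apply/andP; split; lra.
by move=> /or3P[] H; rewrite /bump3 (h _ _ _ _ _ H)// ?(mulr0,mul0r).
Qed.

Lemma test_bump3 n a b : test (bump3 n a b).
Proof.
apply/testP; split.
  have sj j c d : smooth (fun x : V => bump1 n c d (xcoord x j)).
    apply: smooth_bump1; last exact: xcoord_continuous.
    by move=> x v h; exact: xcoord_linear.
  exact: smoothM (smoothM (sj 0 _ _) (sj 1 _ _)) (sj 2%:R _ _).
exists (Num.max `|a| `|b|) => x /negP; rewrite -ltNge => xN.
by apply: bump3_out xN; rewrite le_max lexx ?orbT.
Qed.

Lemma bump3_ge0 n a b x : 0 <= bump3 n a b x.
Proof. by apply: mulr_ge0; [apply: mulr_ge0|]; exact: bump1_ge0. Qed.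

Lemma bump3_le1 n a b x : bump3 n a b x <= 1.
Proof.
have B j := (bump1_ge0 n (xcoord a j) (xcoord b j) (xcoord x j),
  bump1_le1 n (xcoord a j) (xcoord b j) (xcoord x j)).
have [[a0 b0] [a1 b1] [a2 b2]] := And3 (B 0) (B 1) (B 2%:R).
apply: mulr_ile1 => //; first exact: mulr_ge0 a0 a1.
exact: mulr_ile1 a0 a1 b0 b1.
Qed.

Lemma cvg_bump3 a b x : bump3 n a b x @[n --> \oo] -->
  ((a.1.1 < x.1.1 < b.1.1)%R%:R * (a.1.2 < x.1.2 < b.1.2)%R%:R
   * (a.2 < x.2 < b.2)%R%:R : R).
Proof. by apply: cvgM; [apply: cvgM|]; exact: cvg_bump1. Qed.
End Space3.

(** * Integration *)

Import HBNNSimple.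

Section Integration.
Context {R : realType}.

Section generic.
Context d (T : measurableType d) (mu : {measure set T -> \bar R}).
Implicit Types (f g : T -> R) (D : set T).

Lemma integrable_EFin_le D f g : measurable D ->
  measurable_fun D f -> (forall x, D x -> `|f x| <= g x) ->
  mu.-integrable D (EFin \o g) -> mu.-integrable D (EFin \o f).
Proof.
move=> mD mf fg; apply: le_integrable => //; first exact/measurable_EFinP.
move=> x Dx /=; by rewrite lee_fin (le_trans (fg _ Dx))// ler_norm.
Qed.

Lemma integrable_EFin_measurable D f :
  mu.-integrable D (EFin \o f) -> measurable_fun D f.
Proof. by move=> /integrableP[/measurable_EFinP]. Qed.

Lemma integrable_EFinD D f g : measurable D ->
  mu.-integrable D (EFin \o f) -> mu.-integrable D (EFin \o g) ->
  mu.-integrable D (EFin \o (fun x => f x + g x)).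
Proof. by move=> mD fi gi; have := integrableD mD fi gi. Qed.

Lemma integrable_EFinB D f g : measurable D ->
  mu.-integrable D (EFin \o f) -> mu.-integrable D (EFin \o g) ->
  mu.-integrable D (EFin \o (fun x => f x - g x)).
Proof. by move=> mD fi gi; have := integrableB mD fi gi. Qed.

Lemma integrable_EFinZ D (a : R) f : measurable D ->
  mu.-integrable D (EFin \o f) ->
  mu.-integrable D (EFin \o (fun x => a * f x)).
Proof. by move=> mD fi; have := integrableZl mD a fi. Qed.

Lemma integrable_EFin_sum D n (f : 'I_n -> T -> R) : measurable D ->
  (forall j, mu.-integrable D (EFin \o f j)) ->
  mu.-integrable D (EFin \o (fun x => \sum_(j < n) f j x)).
Proof.
move=> mD fi; rewrite (_ : _ \o _ = fun x => (\sum_(j < n) (f j x)%:E)%E).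
  by apply: integrable_sum => // j _; exact: fi.
by apply/funext => x /=; rewrite sumEFin.
Qed.

Lemma integrable_EFin_norm D f : measurable D ->
  mu.-integrable D (EFin \o f) -> mu.-integrable D (EFin \o (fun x => `|f x|)).
Proof. by move=> mD fi; have := integrable_norm fi. Qed.

Lemma integrable_EFin_ltey D f : measurable D -> measurable_fun D f ->
  (\int[mu]_(x in D) `|f x|%:E < +oo)%E -> mu.-integrable D (EFin \o f).
Proof. by move=> mD mf h; apply/integrableP; split => //; exact/measurable_EFinP. Qed.

Lemma Rintegral_sum D n (f : 'I_n -> T -> R) : measurable D ->
  (forall j, mu.-integrable D (EFin \o f j)) ->
  Rintegral mu D (fun x => \sum_(j < n) f j x) = \sum_(j < n) Rintegral mu D (f j).
Proof.
elim: n f => [|n IH] f mD fi.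
  rewrite big_ord0 -[RHS](mul0r (0 : R)) -(@Rintegral_set0 _ _ _ mu (cst 0)).
  rewrite Rintegral_set0 mulr0 /Rintegral.
  under eq_integral do rewrite big_ord0.
  by rewrite integral0.
rewrite big_ord_recr/= -IH// -RintegralD//; last first.
  by apply: integrable_EFin_sum => // j; exact: fi.
by apply: eq_Rintegral => x _; rewrite big_ord_recr.
Qed.

Lemma Rintegral_dominated D (f_ : nat -> T -> R) f g : measurable D ->
  (forall n, measurable_fun D (f_ n)) ->
  (forall x, D x -> f_ n x @[n --> \oo] --> f x) ->
  (forall n x, D x -> `|f_ n x| <= g x) ->
  mu.-integrable D (EFin \o g) ->
  mu.-integrable D (EFin \o f) /\
  Rintegral mu D (f_ n) @[n --> \oo] --> Rintegral mu D f.
Proof.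
move=> mD mf_ ff fg gi.
have mfn n : measurable_fun D (EFin \o f_ n) by exact/measurable_EFinP.
have cv x : D x -> (EFin \o f_ n) x @[n --> \oo] --> (EFin \o f) x.
  by move=> Dx; apply: cvg_EFin; [exact: nearW|exact: ff].
have mf : measurable_fun D (EFin \o f) by exact: emeasurable_fun_cvg mfn cv.
have [fi _ cvi] := dominated_convergence mD mfn mf (aeW _ cv) gi
  (aeW _ (fun x n Dx => fg n x Dx)).
split=> //; rewrite /Rintegral; apply: fine_cvg.
rewrite fineK; first exact: cvi.
exact: integrable_fin_num.
Qed.

(** The integral of a nonnegative function is a supremum over simple functions below it, and a
    simple function cut to the complement of [N] keeps its integral. Hence [f] may be nonmeasurable,
    which matters for the time integrals of the statement, taken over families of distributions. *)
Lemma integral_setD_null D N (f : T -> \bar R) :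
  measurable D -> measurable N -> mu N = 0%E ->
  (\int[mu]_(x in D) f x = \int[mu]_(x in D `\` N) f x)%E.
Proof.
move=> mD mN N0.
(* Only one inequality has content: a simple function below [g] is cut to the complement of [N],
   where [g] and [g'] agree, and is then below [g']. *)
have key (g g' : T -> \bar R) : (forall x, 0 <= g' x)%E ->
    (forall x, g' x <= g x)%E -> (forall x, ~ N x -> g x = g' x) ->
    ereal_sup [set sintegral mu h | h in
      [set h : {nnsfun T >-> R} | forall x, ((h x)%:E <= g x)%E]] =
    ereal_sup [set sintegral mu h | h in
      [set h : {nnsfun T >-> R} | forall x, ((h x)%:E <= g' x)%E]].
  move=> g'0 g'g gg'; apply/eqP; rewrite eq_le; apply/andP; split.
    apply: ge_ereal_sup => _ [h hg <-].
    have mNc : measurable (~` N) by exact: measurableC.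
    pose h' := proj_nnsfun h mNc.
    apply: ereal_sup_ubound; exists h' => /=.
      move=> x; rewrite mindicE; case: (boolP (x \in ~` N)) => [/set_mem xN|_].
        by rewrite mulr1 -gg'.
      by rewrite mulr0.
    change (sintegral mu h' = sintegral mu h).
    rewrite -!integralT_nnsfun (@ge0_negligible_integral _ _ _ mu setT N)//.
    - rewrite [RHS](@ge0_negligible_integral _ _ _ mu setT N)//.
      + apply: eq_integral => x; rewrite inE => -[_ xN].
        by rewrite /h' -mrestrict /patch mem_set.
      + exact/measurable_EFinP.
      + by move=> x _; rewrite lee_fin.
    - exact/measurable_EFinP.
    - by move=> x _; rewrite lee_fin.
  apply: ereal_sup_le => _ [h hg' <-] /=.
  by exists h => //= x; exact: le_trans (hg' x) (g'g x).
have DN x : ~ N x -> (x \in D) = (x \in D `\` N).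
  by move=> xN; apply/idP/idP => /set_mem H; apply/mem_set; [split|exact: H.1].
rewrite /integral; congr (_ - _)%E; apply: key.
- exact: funepos_ge0.
- move=> x; rewrite !funeposE /patch; have [/set_mem xDN|_] := boolP (x \in _).
    by rewrite mem_set//; exact: xDN.1.
  by rewrite maxxx le_max lexx orbT.
- by move=> x xN; rewrite !funeposE /patch DN.
- exact: funeneg_ge0.
- move=> x; rewrite !funenegE /patch; have [/set_mem xDN|_] := boolP (x \in _).
    by rewrite mem_set//; exact: xDN.1.
  by rewrite oppe0 maxxx le_max lexx orbT.
- by move=> x xN; rewrite !funenegE /patch DN.
Qed.

End generic.

Section fubini.
Context d1 d2 (T1 : measurableType d1) (T2 : measurableType d2).
Context (m1 : {sigma_finite_measure set T1 -> \bar R})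
  (m2 : {sigma_finite_measure set T2 -> \bar R}).
Local Notation m12 := (m1 \x m2)%E.

Lemma integrable_prod_le (F : T1 * T2 -> R) (f : T1 -> R) (g : T2 -> R) :
  measurable_fun setT F -> (forall x y, `|F (x, y)| <= f x * g y) ->
  (forall x, 0 <= f x) -> (forall y, 0 <= g y) ->
  m1.-integrable setT (EFin \o f) -> m2.-integrable setT (EFin \o g) ->
  m12.-integrable setT (EFin \o F).
Proof.
move=> mF Ffg f0 g0 fi gi.
have mEF : measurable_fun setT (EFin \o F) by exact/measurable_EFinP.
apply/integrable12ltyP => //.
have mg := integrable_EFin_measurable gi.
have gfin : (\int[m2]_y (g y)%:E)%E \is a fin_num by exact: integrable_fin_num.
apply: (@le_lt_trans _ _ (\int[m1]_x ((f x)%:E * \int[m2]_y (g y)%:E))%E).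
  apply: ge0_le_integral => //.
  - by move=> x _; exact: integral_ge0.
  - apply: (measurable_fun_fubini_tonelli_F (abse \o (EFin \o F))) => //=.
    exact: measurableT_comp.
  - apply: emeasurable_funM => //.
    exact/measurable_EFinP/integrable_EFin_measurable/fi.
  - move=> x _; rewrite -ge0_integralZl//=; [|exact/measurable_EFinP| |]; last 2 first.
    + by move=> y _; rewrite lee_fin.
    + by rewrite lee_fin.
    apply: ge0_le_integral => //.
    + apply: measurableT_comp => //; apply: measurableT_comp => //.
      exact: measurable_fun_pair2.
    + by apply/measurable_EFinP; exact: measurable_funM.
    + by move=> y _; rewrite lee_fin.
rewrite ge0_integralZr//; last 3 first.
  - exact/measurable_EFinP/integrable_EFin_measurable/fi.
  - by move=> x _; rewrite lee_fin.
  - by apply: integral_ge0 => y _; rewrite lee_fin.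
rewrite lte_mul_pinfty//.
- by apply: integral_ge0 => x _; rewrite lee_fin.
- exact: integrable_fin_num.
- by rewrite ltey_eq gfin.
Qed.

Lemma integrable_fubini_G (F : T1 * T2 -> \bar R) : m12.-integrable setT F ->
  m2.-integrable setT (fubini_G m1 F).
Proof.
move=> Fi; have mF := measurable_int _ Fi.
apply/integrableP; split; first exact: (measurable_fubini_G Fi).
apply: le_lt_trans ((integrable21ltyP m1 m2 mF).1 Fi).
apply: ge0_le_integral => //.
- by apply: measurableT_comp => //; exact: (measurable_fubini_G Fi).
- apply: (measurable_fun_fubini_tonelli_G (abse \o F)) => //=.
  exact: measurableT_comp.
- by move=> y _; apply: le_abse_integral => //; exact: measurable_fun_pair1.
Qed.

Lemma Rintegral_fubini (F : T1 * T2 -> R) : m12.-integrable setT (EFin \o F) ->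
  Rintegral m12 setT F = Rintegral m1 setT (fun x => Rintegral m2 setT (fun y => F (x, y)))
  /\ Rintegral m12 setT F = Rintegral m2 setT (fun y => Rintegral m1 setT (fun x => F (x, y))).
Proof.
move=> Fi; split; rewrite /Rintegral; congr fine.
  rewrite -(integral12_prod_meas1 Fi); apply: ae_eq_integral => //.
  - exact: (measurable_fubini_F Fi).
  - apply/measurable_EFinP; apply: measurableT_comp => //.
    exact: (measurable_fubini_F Fi).
  - have := integrable_ae measurableT (integrable_fubini_F Fi).
    by apply: filterS => x /= /(_ I) h _; rewrite fineK.
rewrite -(integral21_prod_meas1 Fi); apply: ae_eq_integral => //.
- exact: (measurable_fubini_G Fi).
- apply/measurable_EFinP; apply: measurableT_comp => //.
  exact: (measurable_fubini_G Fi).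
- have := integrable_ae measurableT (integrable_fubini_G Fi).
  by apply: filterS => x /= /(_ I) h _; rewrite fineK.
Qed.

Lemma integrable_Rfubini (F : T1 * T2 -> R) : m12.-integrable setT (EFin \o F) ->
  m1.-integrable setT (EFin \o (fun x => Rintegral m2 setT (fun y => F (x, y)))) /\
  m2.-integrable setT (EFin \o (fun y => Rintegral m1 setT (fun x => F (x, y)))).
Proof.
move=> Fi; have fF := integrable_fubini_F Fi; have fG := integrable_fubini_G Fi.
split.
  have mF : measurable_fun setT (fun x => Rintegral m2 setT (fun y => F (x, y))).
    by apply: measurableT_comp => //; exact: (measurable_int _ fF).
  apply/integrableP; split; first exact/measurable_EFinP.
  have /integrableP[_] := fF; apply: le_lt_trans.
  apply: ge0_le_integral => //.
  - by apply: measurableT_comp => //; exact/measurable_EFinP.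
  - by apply: measurableT_comp => //; exact: (measurable_int _ fF).
  - move=> x _; rewrite /Rintegral /fubini_F /=.
    by case: (\int[_]_y _)%E => [r| |]//=; rewrite normr0 ?leey.
have mG : measurable_fun setT (fun y => Rintegral m1 setT (fun x => F (x, y))).
  by apply: measurableT_comp => //; exact: (measurable_int _ fG).
apply/integrableP; split; first exact/measurable_EFinP.
have /integrableP[_] := fG; apply: le_lt_trans.
apply: ge0_le_integral => //.
- by apply: measurableT_comp => //; exact/measurable_EFinP.
- by apply: measurableT_comp => //; exact: (measurable_int _ fG).
- move=> x _; rewrite /Rintegral /fubini_G /=.
  by case: (\int[_]_y _)%E => [r| |]//=; rewrite normr0 ?leey.
Qed.

Lemma Rintegral_prod (f : T1 -> R) (g : T2 -> R) :
  m1.-integrable setT (EFin \o f) -> m2.-integrable setT (EFin \o g) ->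
  m12.-integrable setT (EFin \o (fun z => f z.1 * g z.2)) /\
  Rintegral m12 setT (fun z => f z.1 * g z.2) = Rintegral m1 setT f * Rintegral m2 setT g.
Proof.
move=> fi gi.
have mf := integrable_EFin_measurable fi; have mg := integrable_EFin_measurable gi.
have i12 : m12.-integrable setT (EFin \o (fun z => f z.1 * g z.2)).
  apply: (@integrable_prod_le _ (fun x => `|f x|) (fun y => `|g y|)) => //.
  - by apply: measurable_funM; exact: measurableT_comp.
  - by move=> x y /=; rewrite normrM.
  - exact: integrable_EFin_norm.
  - exact: integrable_EFin_norm.
split=> //; rewrite (Rintegral_fubini i12).1 /=.
under eq_Rintegral do rewrite RintegralZl//.
by rewrite RintegralZr.
Qed.

(** The pushforward of the product measure, divided by c1 c2, agrees with the product measure on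
    rectangles, hence everywhere by uniqueness. *)
Lemma product_preimage (phi1 : T1 -> T1) (phi2 : T2 -> T2) (c1 c2 : R) :
  0 < c1 -> 0 < c2 ->
  measurable_fun setT phi1 -> measurable_fun setT phi2 ->
  (forall A, measurable A -> m1 (phi1 @^-1` A) = c1%:E * m1 A)%E ->
  (forall A, measurable A -> m2 (phi2 @^-1` A) = c2%:E * m2 A)%E ->
  forall X, measurable X ->
    (m12 ((fun z => (phi1 z.1, phi2 z.2)) @^-1` X) = (c1 * c2)%:E * m12 X)%E.
Proof.
move=> c10 c20 mphi1 mphi2 h1 h2.
pose phi z := (phi1 z.1, phi2 z.2).
have mphi : measurable_fun setT phi.
  by apply: measurable_fun_pair; exact: measurableT_comp.
have c0 : 0 <= (c1 * c2)^-1 by rewrite invr_ge0 mulr_ge0// ltW.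
pose m' := mscale (NngNum c0)
  (measure_function_pushforward__canonical__measure_function_Measure m12 mphi).
have m'X X : m' X = ((c1 * c2)^-1%:E * m12 (phi @^-1` X))%E by [].
have m'E : forall X, measurable X -> m12 X = m' X.
  apply: product_measure_unique => A B mA mB.
  transitivity (m' (A `*` B)); first by [].
  rewrite m'X (_ : _ @^-1` _ = (phi1 @^-1` A) `*` (phi2 @^-1` B)); last by [].
  have mA' : measurable (phi1 @^-1` A) by rewrite -[X in measurable X]setTI; exact: mphi1.
  have mB' : measurable (phi2 @^-1` B) by rewrite -[X in measurable X]setTI; exact: mphi2.
  rewrite product_measure1E//.
  transitivity ((c1 * c2)^-1%:E * ((c1%:E * m1 A) * (c2%:E * m2 B)))%E.
    by congr (_ * (_ * _))%E; [exact: h1|exact: h2].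
  rewrite (muleACA c1%:E) -EFinM (muleA (c1 * c2)^-1%:E) -(EFinM _^-1).
  by rewrite mulVf ?mul1e// lt0r_neq0// mulr_gt0.
move=> X mX; rewrite (m'E _ mX) m'X (muleA (c1 * c2)%:E) -(EFinM (_ * _)).
by rewrite mulfV ?mul1e// lt0r_neq0// mulr_gt0.
Qed.

Lemma product_sigma_finite : sigma_finite setT m12.
Proof.
have /sigma_finiteP[F [TF ndF Foo]] := sigma_finiteT m1.
have /sigma_finiteP[G [TG ndG Goo]] := sigma_finiteT m2.
exists (fun n => F n `*` G n).
  rewrite -setXTT TF TG predeqE => -[x y]; split; last first.
    by move=> [n _ []/= ? ?]; split; exists n.
  move=> [/= [n _ Fnx] [k _ Gky]]; exists (maxn n k) => //; split.
  - by move: x Fnx; exact/subsetPset/ndF/leq_maxl.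
  - by move: y Gky; exact/subsetPset/ndG/leq_maxr.
move=> k; have [? ?] := Foo k; have [? ?] := Goo k.
split; first exact: measurableX.
by rewrite product_measure1E// lte_mul_pinfty// ge0_fin_numE.
Qed.
End fubini.

End Integration.

(** A named product, so that a sigma-finite structure can be attached to it; [leb3] is then a
    product of two sigma-finite measures, as Fubini's theorem demands. *)
Definition leb2 {R : realType} := (@lebesgue_measure R \x @lebesgue_measure R)%E.
HB.instance Definition _ (R : realType) := Measure.on (@leb2 R).
Lemma leb2_sigma_finite (R : realType) : sigma_finite setT (@leb2 R).
Proof. exact: product_sigma_finite. Qed.
HB.instance Definition _ (R : realType) :=
  Measure_isSigmaFinite.Build _ _ _ (@leb2 R) (@leb2_sigma_finite R).

HB.instance Definition _ (R : realType) := Measure.on (@leb3 R).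
Lemma leb3_sigma_finite (R : realType) : sigma_finite setT (@leb3 R).
Proof. exact: (@product_sigma_finite R _ _ _ _ leb2 lebesgue_measure). Qed.
HB.instance Definition _ (R : realType) :=
  Measure_isSigmaFinite.Build _ _ _ (@leb3 R) (@leb3_sigma_finite R).

(** * Lebesgue measure on R^3: measurable sets, changes of variables, weights *)

Section Lebesgue3.
Context {R : realType}.
Local Notation V := (R3 R).
Local Notation M1 := (measurableTypeR R).
Local Notation M3 := (M1 * M1 * M1)%type.
Local Notation mu1 := (@lebesgue_measure R).
Local Notation mu3 := (@leb3 R).
Local Notation mf3 f := (@measurable_fun _ _ M3 R setT f).

Lemma leb2_rect (A B : set R) : measurable A -> measurable B ->
  leb2 (A `*` B) = (mu1 A * mu1 B)%E.
Proof. by move=> mA mB; exact: product_measure1E. Qed.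

Lemma leb3_rect (A B C : set R) : measurable A -> measurable B -> measurable C ->
  mu3 ((A `*` B) `*` C) = (mu1 A * mu1 B * mu1 C)%E.
Proof.
move=> mA mB mC; rewrite -leb2_rect//.
by apply: (@product_measure1E _ _ _ _ _ leb2 mu1) => //; exact: measurableX.
Qed.

Definition cell (k : nat) (a : int) : set R :=
  `[(a%:~R / k.+1%:R : R), ((a + 1)%:~R / k.+1%:R)[.

Lemma cell_floor k (s : R) : cell k (Num.floor (s * k.+1%:R)) s.
Proof.
rewrite /cell /= in_itv/= ler_pdivrMr// ltr_pdivlMr//.
exact: floor_itv.
Qed.

Lemma cell_dist k a (s t : R) : cell k a s -> cell k a t -> `|s - t| < k.+1%:R^-1.
Proof.
rewrite /cell /= !in_itv/= intrD mulrDl mul1r => /andP[s1 s2] /andP[t1 t2].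
move: s1 s2 t1 t2; set q := k.+1%:R^-1; move: (a%:~R * q) => p *.
by rewrite ltr_norml; apply/andP; split; lra.
Qed.

(** The sigma-algebra is the product one, so open sets have to be reached from rectangles: an open
    set is the countable union of the grid boxes of mesh 1/(k + 1) that it contains. *)
Lemma open_measurable3 (U : set V) : open U -> @measurable _ M3 U.
Proof.
move=> oU.
pose B (q : nat * (int * int * int)) : set V :=
  (cell q.1 q.2.1.1 `*` cell q.1 q.2.1.2) `*` cell q.1 q.2.2.
pose F q := if `[< B q `<=` U >] then B q else set0.
rewrite [X in measurable X](_ : U = \bigcup_q F q).
  apply: countable_bigcupT_measurable; first exact: countableP.
  move=> q; rewrite /F; case: ifP => // _.
  by apply: measurableX; first apply: measurableX; exact: measurable_itv.
apply/seteqP; split=> [x Ux|x [q _]]; last first.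
  by rewrite /F; case: ifPn => // /asboolP; exact.
have : nbhs x U by exact: open_nbhs_nbhs.
move=> /nbhs_normP[e /= e0 eU].
have [k ke] : exists k : nat, k.+1%:R^-1 < e.
  exists (Num.trunc e^-1).
  by rewrite invf_plt ?posrE// truncnS_gt.
pose fl (s : R) := Num.floor (s * k.+1%:R).
exists (k, (fl x.1.1, fl x.1.2, fl x.2)) => //.
have Bx : B (k, (fl x.1.1, fl x.1.2, fl x.2)) x.
  by split; [split|]; exact: cell_floor.
rewrite /F; case: ifPn => // /asboolP; case=> y [[/= y1 y2] y3].
apply: eU; rewrite /ball_/= norm3E/= !gt_max.
move: Bx => [[/= x1 x2] x3].
by rewrite (lt_trans (cell_dist x1 y1) ke) (lt_trans (cell_dist x2 y2) ke)
  (lt_trans (cell_dist x3 y3) ke).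
Qed.

Lemma continuous_measurable3 (f : V -> R) : continuous f -> mf3 f.
Proof.
move=> cf; apply: (measurability _ (RGenOpens.measurableE R)).
move=> _ [_ [a [b ->] <-]]; rewrite setTI; apply: open_measurable3.
by move/continuousP : cf; apply; exact: interval_open.
Qed.

Lemma compact_measurable3 (K : set V) : compact K -> @measurable _ M3 K.
Proof.
move=> cK; rewrite -[K]setCK; apply: measurableC; apply: open_measurable3.
by apply: closed_openC; apply: compact_closed => //; exact: norm_hausdorff.
Qed.

Lemma measurable_cube (N : R) : @measurable _ M3 (cube N).
Proof. by apply: compact_measurable3; exact: compact_cube. Qed.

Lemma leb3_cube (N : R) : (mu3 (cube N) < +oo)%E.
Proof.
rewrite cubeE leb3_rect//; try exact: measurable_itv.
have h : (mu1 `[(- N)%R, N]%classic < +oo)%E.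
  by apply: compact_finite_measure; exact: segment_compact.
have hf : mu1 `[(- N)%R, N]%classic \is a fin_num by rewrite ge0_fin_numE.
by rewrite ltey_eq !fin_numM.
Qed.

Lemma integrable_cube (f : V -> R) (N M : R) : mf3 f ->
  (forall x, `|f x| <= M) -> supported_in (cube N) f ->
  mu3.-integrable setT (EFin \o f).
Proof.
move=> mf fM sf.
apply: (@integrable_EFin_le R _ M3 mu3 setT f (fun x => M * \1_(cube N) x)) => //.
  move=> x _; rewrite indicE; case: (boolP (x \in _)) => [_|]; first by rewrite mulr1.
  by rewrite notin_setE => /sf ->; rewrite normr0 mulr0.
apply: integrable_EFinZ => //; apply: integrable_EFin_ltey => //.
  by apply: measurable_indic; exact: measurable_cube.
under eq_integral do rewrite ger0_norm//.
by rewrite integral_indic ?setIT ?leb3_cube//; exact: measurable_cube.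
Qed.

Lemma test_integrable (f : V -> R) : test f -> mu3.-integrable setT (EFin \o f).
Proof.
move=> tf; have /testP[sf [N sN]] := tf; have [M _ fM] := test_bounded tf.
apply: (integrable_cube _ fM sN).
exact: (continuous_measurable3 (smooth_continuous sf)).
Qed.

(** Lebesgue measure is determined by its values on the intervals ]c, d]. For negative [a] the
    preimage is closed on the left instead of the right, which does not change its length. *)
Lemma leb1_affine (a b : R) (A : set R) : a != 0 -> measurable A ->
  mu1 ((fun s => a * s + b) @^-1` A) = (`|a|^-1%:E * mu1 A)%E.
Proof.
move=> a0 mA.
have mphi : @measurable_fun _ _ M1 M1 setT (fun s => a * s + b).
  by apply: measurable_funD => //; exact: measurable_funM.
pose m' := mscale (NngNum (normr_ge0 a))
  (measure_function_pushforward__canonical__measure_function_Measure mu1 mphi).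
have m'X X : m' X = (`|a|%:E * mu1 ((fun s => a * s + b)%R @^-1` X))%E by [].
transitivity (`|a|^-1%:E * m' A)%E.
  by rewrite m'X (muleA (_^-1)%:E) -EFinM mulVf ?normr_eq0// mul1e.
congr (_ * _)%E; apply/esym; apply: lebesgue_measure_unique => //.
move=> _ [[c d] _ <-]; transitivity (m' `]c, d]%classic); last by [].
have [alt0|agt0|] := ltgtP a 0; last by move/eqP; rewrite (negbTE a0).
  rewrite m'X (_ : _ @^-1` _ = `[(d - b) / a, (c - b) / a[%classic); last first.
    apply/seteqP; split => s /=; rewrite !in_itv/=;
    rewrite ler_ndivrMr// ltr_ndivlMr// !(mulrC s); lra.
  rewrite !lebesgue_measure_itv/= !lte_fin ltr_nM2r ?invr_lt0// ltrD2r.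
  case: ifP => _; last by rewrite mule0.
  by rewrite -!EFinD -EFinM ltr0_norm//; congr EFin; field.
rewrite m'X (_ : _ @^-1` _ = `](c - b) / a, (d - b) / a]%classic); last first.
  apply/seteqP; split => s /=; rewrite !in_itv/=;
  rewrite ltr_pdivrMr// ler_pdivlMr// !(mulrC s); lra.
rewrite !lebesgue_measure_itv/= !lte_fin ltr_pM2r ?invr_gt0// ltrD2r.
case: ifP => _; last by rewrite mule0.
by rewrite -!EFinD -EFinM gtr0_norm//; congr EFin; field.
Qed.

Lemma measurable_affine1 (a b : R) :
  @measurable_fun _ _ M1 M1 setT (fun s => a * s + b).
Proof. by apply: measurable_funD => //; exact: measurable_funM. Qed.

Lemma measurable_affine3 (a : R) (v : V) :
  @measurable_fun _ _ M3 M3 setT (fun x : V => a *: x + v).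
Proof.
apply: measurable_fun_pair; first apply: measurable_fun_pair.
- apply: (measurableT_comp (measurable_affine1 a v.1.1)).
  by apply: measurableT_comp; exact: measurable_fst.
- apply: (measurableT_comp (measurable_affine1 a v.1.2)).
  by apply: measurableT_comp; [exact: measurable_snd|exact: measurable_fst].
- by apply: (measurableT_comp (measurable_affine1 a v.2)); exact: measurable_snd.
Qed.

Lemma leb3_affine (a : R) (v : V) (X : set V) : a != 0 -> @measurable _ M3 X ->
  mu3 ((fun x => a *: x + v) @^-1` X) = ((`|a| ^- 3)%:E * mu3 X)%E.
Proof.
move=> a0 mX; have c0 : 0 < `|a|^-1 by rewrite invr_gt0 normr_gt0.
pose p2 (x : R * R) : R * R := (a * x.1 + v.1.1, a * x.2 + v.1.2).
have h2 (Y : set (R * R)) : @measurable _ (M1 * M1)%type Y ->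
    leb2 (p2 @^-1` Y) = ((`|a|^-1 * `|a|^-1)%:E * leb2 Y)%E.
  apply: (@product_preimage R _ _ M1 M1 mu1 mu1 (fun s => a * s + v.1.1)
    (fun s => a * s + v.1.2)) => //.
  - exact: measurable_affine1.
  - exact: measurable_affine1.
  - by move=> A mA; exact: leb1_affine.
  - by move=> A mA; exact: leb1_affine.
have mp2 : @measurable_fun _ _ (M1 * M1)%type (M1 * M1)%type setT p2.
  apply: measurable_fun_pair.
    by apply: (measurableT_comp (measurable_affine1 a v.1.1)); exact: measurable_fst.
  by apply: (measurableT_comp (measurable_affine1 a v.1.2)); exact: measurable_snd.
have := @product_preimage R _ _ (M1 * M1)%type M1 leb2 mu1 p2
  (fun s => a * s + v.2) (`|a|^-1 * `|a|^-1) (`|a|^-1) (mulr_gt0 c0 c0) c0 mp2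
  (measurable_affine1 a v.2) h2 (fun A mA => leb1_affine v.2 a0 mA) X mX.
rewrite -exprVn !exprS expr0 mulr1 mulrA; apply.
Qed.

Lemma ge0_integral_affine (a : R) (v : V) (f : V -> \bar R) : a != 0 ->
  @measurable_fun _ _ M3 (\bar R) setT f -> (forall x, 0 <= f x)%E ->
  (\int[mu3]_x f (a *: (x : V) + v)%R = (`|a| ^- 3)%:E * \int[mu3]_x f x)%E.
Proof.
move=> a0 mf f0.
have c0 : 0 <= `|a| ^- 3 by rewrite invr_ge0 exprn_ge0.
pose phi (x : M3) : M3 := (a *: (x : V) + v).
have mphi : measurable_fun setT phi by exact: measurable_affine3.
rewrite -[LHS](@ge0_integral_pushforward _ _ M3 M3 R phi mphi mu3 setT f)//.
transitivity (\int[mscale (NngNum c0) mu3]_x f x)%E.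
  by apply: eq_measure_integral => //= A mA _; exact: leb3_affine.
by rewrite ge0_integral_mscale.
Qed.

Lemma integral_affine (a : R) (v : V) (f : V -> R) : a != 0 ->
  mu3.-integrable setT (EFin \o f) ->
  mu3.-integrable setT (EFin \o (fun x => f (a *: x + v))) /\
  Rintegral mu3 setT (fun x => f (a *: x + v)) = `|a| ^- 3 * Rintegral mu3 setT f.
Proof.
move=> a0 fi; have mf := integrable_EFin_measurable fi.
have mEf : @measurable_fun _ _ M3 (\bar R) setT (EFin \o f) by exact/measurable_EFinP.
have mphi := measurable_affine3 a v.
split.
  apply: integrable_EFin_ltey => //; first exact: (measurableT_comp mf).
  have := @ge0_integral_affine a v (fun x => `|f x|%:E) a0.
  move=> ->//; last first.
    by apply/measurable_EFinP; exact: measurableT_comp.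
  by rewrite lte_mul_pinfty//; have /integrableP[] := fi.
have E : (\int[mu3]_x (f (a *: (x : V) + v)%R)%:E =
    (`|a| ^- 3)%:E * \int[mu3]_x (f x)%:E)%E.
  rewrite [LHS]integralE [in RHS]integralE.
  have := @ge0_integral_affine a v ((EFin \o f)^\+)%E a0.
  have := @ge0_integral_affine a v ((EFin \o f)^\-)%E a0.
  move=> En Ep; transitivity (\int[mu3]_x (EFin \o f)^\+ (a *: (x : V) + v)%R
      - \int[mu3]_x (EFin \o f)^\- (a *: (x : V) + v)%R)%E.
    congr (_ - _)%E; apply: eq_integral => x _; first by rewrite !funeposE.
    by rewrite !funenegE.
  rewrite En//; last exact: measurable_funeneg.
  rewrite Ep//; last exact: measurable_funepos.
  rewrite -muleBr//; last first.
    by apply: fin_num_adde_defr; exact: integrable_pos_fin_num.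
rewrite /Rintegral E fineM//; exact: integrable_fin_num.
Qed.

Lemma integrable_oneDsqrV :
  mu1.-integrable setT (EFin \o (fun s : R => (1 + s ^+ 2)^-1)) /\
  Rintegral mu1 setT (fun s : R => (1 + s ^+ 2)^-1) = pi.
Proof.
have c : continuous (fun s : R => (1 + s ^+ 2)^-1) by exact: continuous_oneDsqrV.
have E : (\int[mu1]_s ((1 + s ^+ 2)^-1)%:E = pi%:E)%E.
  rewrite ge0_symfun_integralT//; last 2 first.
  - by move=> s; rewrite invr_ge0 addr_ge0// sqr_ge0.
  - by move=> s /=; rewrite sqrrN.
  rewrite -set_itvcy integral0y_oneDsqr -EFinM; congr EFin; by field.
split; last by rewrite /Rintegral E.
apply: integrable_EFin_ltey => //; first exact: continuous_measurable_fun.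
under eq_integral do rewrite ger0_norm ?invr_ge0 ?addr_ge0 ?sqr_ge0//.
by rewrite E ltry.
Qed.

(** This weight serves twice: as an integrable majorant, with integral pi^3, and, up to the factor
    8, as the Fourier transform of [ex3]. *)
Definition wt (x : V) : R :=
  (1 + x.1.1 ^+ 2)^-1 * (1 + x.1.2 ^+ 2)^-1 * (1 + x.2 ^+ 2)^-1.

Lemma Rintegral3_prod (f g h : R -> R) :
  mu1.-integrable setT (EFin \o f) -> mu1.-integrable setT (EFin \o g) ->
  mu1.-integrable setT (EFin \o h) ->
  mu3.-integrable setT (EFin \o (fun x : V => f x.1.1 * g x.1.2 * h x.2)) /\
  Rintegral mu3 setT (fun x : V => f x.1.1 * g x.1.2 * h x.2) =
  Rintegral mu1 setT f * Rintegral mu1 setT g * Rintegral mu1 setT h.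
Proof.
move=> fi gi hi.
have [fgi fgE] := Rintegral_prod fi gi.
have [i E] := @Rintegral_prod R _ _ _ _ leb2 mu1 _ _ fgi hi.
by split => //; rewrite -fgE.
Qed.

Lemma integrable_wt : mu3.-integrable setT (EFin \o wt).
Proof.
have [i _] := integrable_oneDsqrV.
exact: (Rintegral3_prod i i i).1.
Qed.

Lemma wt_ge0 x : 0 <= wt x.
Proof. by rewrite !mulr_ge0// invr_ge0 addr_ge0// sqr_ge0. Qed.

(** Each of the three factors satisfies 1 + s^2 <= (1 + |x|)^2; this is the origin of the exponent 6
    in [integrable_decay]. *)
Lemma norm_wt x : (1 + `|x|) ^- 6 <= wt x.
Proof.
have h (s : R) : `|s| <= `|x| -> (1 + `|x|) ^- 2 <= (1 + s ^+ 2)^-1.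
  move=> sx; rewrite lef_pV2 ?posrE ?exprn_gt0 ?ltr_pwDl ?sqr_ge0//.
  have : s ^+ 2 <= `|x| ^+ 2.
    by rewrite -[s ^+ 2]real_normK ?num_real// ler_sqr ?nnegrE.
  by have := normr_ge0 x; nra.
have p : 0 <= (1 + `|x|) ^- 2 by rewrite invr_ge0 exprn_ge0.
have -> : (1 + `|x|) ^- 6 =
    (1 + `|x|) ^- 2 * (1 + `|x|) ^- 2 * (1 + `|x|) ^- 2.
  by rewrite -!invfM -!exprD.
by rewrite !ler_pM ?mulr_ge0// h//; move: (lexx `|x|); rewrite norm3_le => /and3P[].
Qed.

Lemma integrable_decay (f : V -> R) (M : R) : mf3 f ->
  (forall x, (1 + `|x|) ^+ 6 * `|f x| <= M) -> mu3.-integrable setT (EFin \o f).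
Proof.
move=> mf fM; apply: (@integrable_EFin_le R _ M3 mu3 setT f (fun x => M * wt x)) => //.
  move=> x _; have p : 0 < (1 + `|x|) ^+ 6 by rewrite exprn_gt0// ltr_pwDl.
  rewrite (le_trans _ (ler_wpM2l _ (norm_wt x)))//.
    by rewrite ler_pdivlMr// mulrC fM.
  by rewrite (le_trans _ (fM x))// mulr_ge0// ltW.
by apply: integrable_EFinZ => //; exact: integrable_wt.
Qed.
End Lebesgue3.

(** * Cosine and sine transforms *)

Section DerivativeUnderIntegral.
Context {R : realType}.

(** Dominated convergence is a statement about sequences, so continuity of parameter integrals is
    reduced to sequential continuity. *)
Lemma seq_continuous (V : normedModType R) (F : V -> R) (x : V) :
  (forall y : nat -> V, y n @[n --> \oo] --> x -> F (y n) @[n --> \oo] --> F x) ->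
  {for x, continuous F}.
Proof.
move=> H; apply/cvgrPdist_lt => e e0; apply: contrapT => nH.
have {}nH n : exists y, `|x - y| < n.+1%:R^-1 /\ e <= `|F x - F y|.
  apply: contrapT => /forallNP nH'; apply: nH.
  apply/nbhs_normP; exists n.+1%:R^-1; first by rewrite /= invr_gt0.
  move=> y /= xy; have := nH' y; rewrite not_andP => -[//|/negP].
  by rewrite -ltNge.
have [y yP] := choice nH.
have /H : y n @[n --> \oo] --> x.
  apply/cvgrPdist_lt => d d0; near=> n.
  apply: (lt_trans (yP n).1); near: n.
  exact: (near_infty_natSinv_lt (PosNum d0)).
move=> /cvgrPdist_lt/(_ e e0)[n _ /(_ n (leqnn n))].
by move=> /=; rewrite ltNge (yP n).2.
Unshelve. all: by end_near. Qed.

Lemma continuous_mul (V : normedModType R) (f g : V -> R) :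
  continuous f -> continuous g -> continuous (fun x => f x * g x).
Proof. by move=> cf cg x; apply: cvgM; [exact: cf|exact: cg]. Qed.

Lemma continuous_Rintegral d (T : measurableType d)
    (mu : {measure set T -> \bar R}) (V : normedModType R)
    (f : V -> T -> R) (G : T -> R) :
  (forall y, measurable_fun setT (f y)) ->
  (forall t, continuous (f^~ t)) ->
  (forall y t, `|f y t| <= G t) -> mu.-integrable setT (EFin \o G) ->
  continuous (fun y => Rintegral mu setT (f y)).
Proof.
move=> mf cf fG Gi x; apply: seq_continuous => y yx.
have := @Rintegral_dominated R _ T mu setT (fun n => f (y n)) (f x) G.
move=> H; apply: (H _ _ _ _ _).2 => //.
by move=> t _; exact: (cvg_comp y (f^~ t) yx (cf t x)).
Qed.

Lemma is_derive_Rintegral1 d (T : measurableType d)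
    (mu : {measure set T -> \bar R}) (f f' : R -> T -> R) (G : T -> R) :
  (forall h : R, -1 < h < 1 -> mu.-integrable setT (EFin \o f h)) ->
  (forall (h : R) t, -1 < h < 1 -> is_derive h 1 (f^~ t) (f' h t)) ->
  (forall (h : R) t, -1 < h < 1 -> `|f' h t| <= G t) ->
  mu.-integrable setT (EFin \o G) ->
  is_derive (0 : R) 1 (fun h : R => Rintegral mu setT (f h)) (Rintegral mu setT (f' 0)).
Proof.
move=> fi df f'G Gi.
have I0 : (`]-1, 1[%classic : set R) 0 by rewrite /= in_itv/= ltrN10 ltr01.
have p1 h t : -1 < h < 1 -> partial1of2 f h t = f' h t.
  by move=> h1; rewrite partial1of2E; have [] := df h t h1.
have G0 t : 0 <= G t by rewrite (le_trans _ (f'G 0 t _))// ltrN10 ltr01.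
have intf x : (`]-1, 1[%classic : set R) x -> mu.-integrable setT (EFin \o f x).
  by rewrite /= in_itv/=; exact: fi.
have derf x t : (`]-1, 1[%classic : set R) x -> setT t -> derivable (f^~ t) x 1.
  by rewrite /= in_itv/= => x1 _; have [] := df x t x1.
have Gub x t : (`]-1, 1[%classic : set R) x -> setT t -> `|partial1of2 f x t| <= G t.
  by rewrite /= in_itv/= => x1 _; rewrite p1//; exact: f'G.
have dF := derivable_under_integral measurableT I0 intf derf G0 Gi Gub.
have := differentiation_under_integral measurableT I0 intf derf G0 Gi Gub.
rewrite derive1E => E; apply: DeriveDef => //.
rewrite E; apply: eq_Rintegral => t _.
by apply: p1; rewrite ltrN10 ltr01.
Qed.

Lemma line_affine (V : normedModType R) (v x : V) (s h u : R) :
  (h *: u + s) *: v + x = h *: (u *: v) + (s *: v + x).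
Proof. by rewrite scalerDl scalerA addrA. Qed.

Lemma is_derive_line (V : normedModType R) (v x : V) (f : V -> R) (h d : R) :
  is_derive (h *: v + x) v f d <-> is_derive h 1 (fun s : R => f (s *: v + x)) d.
Proof.
have E1 := @derive_affine R R V (fun h : R => h *: v + x) (fun u : R => u *: v)
  (fun s h u => line_affine v x s h u) f 1.
have E : 'D_1 (fun h : R => f (h *: v + x)) h = 'D_v f (h *: v + x).
  by rewrite [LHS](congr1 (fun g => g h) E1) /= scale1r.
have D : derivable (fun h : R => f (h *: v + x)) h 1 <-> derivable f (h *: v + x) v.
  rewrite /derivable; suff -> : (fun s : R => s^-1 *:
      (((fun h => f (h *: v + x)) \o shift h) (s *: 1) - f (h *: v + x))) =
      (fun s => s^-1 *: ((f \o shift (h *: v + x)) (s *: v) - f (h *: v + x))) by [].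
  by apply/funext => s /=; rewrite scalerDl addrA /GRing.scale/= mulr1.
split=> -[d1 d2]; apply: DeriveDef.
- exact: (D.2 d1).
- by rewrite E.
- exact: (D.1 d1).
- by rewrite -E.
Qed.

(** Along h |-> h v + x a derivative in direction [v] becomes one in a real parameter, to which
    differentiation under the integral sign applies. *)
Lemma is_derive_Rintegral d (T : measurableType d)
    (mu : {measure set T -> \bar R}) (V : normedModType R)
    (f f' : V -> T -> R) (G : T -> R) (x v : V) :
  (forall y, mu.-integrable setT (EFin \o f y)) ->
  (forall y t, is_derive y v (f^~ t) (f' y t)) ->
  (forall y t, `|f' y t| <= G t) ->
  mu.-integrable setT (EFin \o G) ->
  is_derive x v (fun y => Rintegral mu setT (f y)) (Rintegral mu setT (f' x)).
Proof.
move=> fi df f'G Gi; have E : x = 0 *: v + x by rewrite scale0r add0r.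
rewrite [X in is_derive X](_ : x = 0 *: v + x)// [in X in is_derive _ _ _ X]E.
apply/is_derive_line.
apply: (@is_derive_Rintegral1 _ _ mu (fun h => f (h *: v + x))
  (fun h => f' (h *: v + x)) G) => //.
by move=> h t _; apply: (is_derive_line v x (f^~ t) h _).1; exact: df.
Qed.
End DerivativeUnderIntegral.

Section Trig.
Context {R : realType}.
Local Notation V := (R3 R).
Local Notation M1 := (measurableTypeR R).
Local Notation M3 := (M1 * M1 * M1)%type.
Local Notation mu3 := (@leb3 R).
Local Notation mf3 f := (@measurable_fun _ _ M3 R setT f).

Lemma is_derive_cosD (a s : R) : is_derive s 1 (fun s : R => cos (s + a)) (cos (s + a + pi / 2)).
Proof.
have -> : cos (s + a + pi / 2) = - sin (s + a) * (1 + 0).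
  by rewrite cosDpihalf addr0 mulr1.
by apply: (@is_derive1_comp R cos (fun s => s + a)).
Qed.

Lemma smooth_cosD (a : R) : smooth (fun s : R => cos (s + a)).
Proof.
apply: (@smoothI R R [set f | exists b c, f = fun s => c * cos (s + b)]).
- move=> _ [b [c ->]] x; apply: cvgM; first exact: cvg_cst.
  apply: continuous_cvg; first exact: continuous_cos.
  by apply: cvgD => //; exact: cvg_cst.
- move=> _ x v [b [c ->]].
  by have [] := is_derive_mull c (is_derive1_dir v (is_derive_cosD b x)).
- move=> _ v [b [c ->]]; exists (b + pi / 2), (c * v); apply/funext => x.
  have [_ ->] := is_derive_mull c (is_derive1_dir v (is_derive_cosD b x)).
  by rewrite addrA mulrA.
- by exists a, 1; apply/funext => s; rewrite mul1r.
Qed.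

Lemma dot_affine (xi v x : V) (h a : R) :
  dot (h *: v + x) xi + a = h *: dot v xi + (dot x xi + a).
Proof. by rewrite !(dotC _ xi) dotDZ addrA. Qed.

Lemma dot_continuousl (xi : V) : continuous (fun x : V => dot x xi).
Proof.
rewrite (_ : (fun _ => _) = dot xi); first exact: dot_continuous.
by apply/funext => x; rewrite dotC.
Qed.

Lemma smooth_cos_dot (xi : V) (a : R) : smooth (fun x : V => cos (dot x xi + a)).
Proof.
have := @smooth_affine R V R (fun x => dot x xi) (fun v => dot v xi).
move=> /(_ _ (fun s : R => cos (s + a))); apply.
- by move=> x h v; rewrite -[LHS]addr0 dot_affine addr0.
- exact: dot_continuousl.
- exact: smooth_cosD.
Qed.

Lemma is_derive_cos_dot (xi x v : V) (a : R) :
  is_derive x v (fun x : V => cos (dot x xi + a)) (dot v xi * cos (dot x xi + a + pi / 2)).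
Proof.
have H := @derive_affine R V R (fun x => dot x xi) (fun v => dot v xi)
  (fun x h v => _) (fun s : R => cos (s + a)) v.
apply: DeriveDef; first by apply: smooth_derivable; exact: smooth_cos_dot.
rewrite [LHS](congr1 (fun g => g x) (H _))/=; last first.
  by move=> y h w; rewrite -[LHS]addr0 dot_affine addr0.
by have /= [_ ->] := is_derive1_dir (dot v xi) (is_derive_cosD a (dot x xi)).
Qed.

(* Bounded, measurable, with compact support. *)
Definition bcs (w : V -> R) := mf3 w /\
  exists N M : R, (forall x, `|w x| <= M) /\ supported_in (cube N) w.

Lemma test_bcs (w : V -> R) : test w -> bcs w.
Proof.
move=> tw; split; first by apply: continuous_measurable3; have [/smooth_continuous] := tw.
have [M M0 wM] := test_bounded tw; have /testP[_ [N sN]] := tw.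
by exists N, M.
Qed.

Lemma bcsM (f w : V -> R) : continuous f -> bcs w -> bcs (fun x => f x * w x).
Proof.
move=> cf [mw [N [M [wM sN]]]]; split.
  by apply: measurable_funM => //; exact: continuous_measurable3.
have [M' M'0 fM] := continuous_bounded_cube N cf.
exists N, (M' * M); split=> [x|x /sN ->]; last by rewrite mulr0.
have [xN|/negP xN] := boolP (`|x| <= N); first by rewrite normrM ler_pM// fM.
by rewrite sN// mulr0 normr0 mulr_ge0// (le_trans _ (wM 0)).
Qed.

Lemma bcs_integrable (w : V -> R) : bcs w -> mu3.-integrable setT (EFin \o w).
Proof. by move=> [mw [N [M [wM sN]]]]; exact: integrable_cube mw wM sN. Qed.

(* [a = 0] gives the cosine transform and [a = - pi / 2] the sine transform; derivatives
   and multiplications by xi shift [a] by [pi / 2]. *)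
Definition Tr (a : R) (w : V -> R) (xi : V) : R :=
  Rintegral mu3 setT (fun x => cos (dot x xi + a) * w x).

Lemma bcs_cos (a : R) (xi : V) w : bcs w -> bcs (fun x => cos (dot x xi + a) * w x).
Proof. by move=> bw; apply: bcsM => //; exact/smooth_continuous/smooth_cos_dot. Qed.

Lemma norm_cos_le (s r : R) : `|cos s * r| <= `|r|.
Proof. by rewrite normrM ler_piMl// ler_norml cos_geN1 cos_le1. Qed.

Lemma is_derive_Tr a w xi v : bcs w ->
  is_derive xi v (Tr a w) (Tr (a + pi / 2) (fun x => dot x v * w x) xi).
Proof.
move=> bw; have bvw : bcs (fun x => dot x v * w x) by apply: bcsM => //; exact: dot_continuousl.
apply: (@is_derive_Rintegral _ _ M3 mu3 V (fun xi x => cos (dot x xi + a) * w x)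
  (fun xi x => cos (dot x xi + (a + pi / 2)) * (dot x v * w x))
  (fun x => `|dot x v * w x|)).
- by move=> y; apply: bcs_integrable; exact: bcs_cos.
- move=> y x; have H := is_derive_cos_dot x y v a.
  have -> : (fun z => cos (dot x z + a) * w x) = fun z => w x * cos (dot z x + a).
    by apply/funext => z; rewrite mulrC dotC.
  have := is_derive_mull (w x) H; congr is_derive.
  by rewrite addrA (dotC y) (dotC v); ring.
- by move=> y x; exact: norm_cos_le.
- by apply: integrable_EFin_norm => //; exact: bcs_integrable.
Qed.

Lemma continuous_Tr a w : bcs w -> continuous (Tr a w).
Proof.
move=> bw.
apply: (@continuous_Rintegral _ _ M3 mu3 V (fun xi x => cos (dot x xi + a) * w x)
  (fun x => `|w x|)).
- by move=> xi; have [] := bcs_cos a xi bw.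
- move=> x; apply: (@continuous_mul R V _ (cst (w x))); last by move=> ?; exact: cvg_cst.
  have -> : (fun z => cos (dot x z + a)) = fun z => cos (dot z x + a).
    by apply/funext => z; rewrite dotC.
  exact: smooth_continuous (smooth_cos_dot x a).
- by move=> y x; exact: norm_cos_le.
- by apply: integrable_EFin_norm => //; exact: bcs_integrable.
Qed.

Lemma smooth_Tr a w : bcs w -> smooth (Tr a w).
Proof.
move=> bw; apply: (@smoothI R V [set f | exists b w', bcs w' /\ f = Tr b w']).
- by move=> _ [b [w' [bw' ->]]]; exact: continuous_Tr.
- by move=> _ xi v [b [w' [bw' ->]]]; have [] := is_derive_Tr b xi v bw'.
- move=> _ v [b [w' [bw' ->]]]; exists (b + pi / 2), (fun x => dot x v * w' x).
  split; first by apply: bcsM => //; exact: dot_continuousl.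
  by apply/funext => xi; have [_ ->] := is_derive_Tr b xi v bw'.
- by exists a, w.
Qed.

Lemma Tr_bound a w xi : bcs w -> `|Tr a w xi| <= Rintegral mu3 setT (fun x => `|w x|).
Proof.
move=> bw; have bc := bcs_integrable (bcs_cos a xi bw).
apply: le_trans (le_normr_Rintegral measurableT bc) _.
apply: le_Rintegral => //.
- exact: integrable_EFin_norm.
- by apply: integrable_EFin_norm => //; exact: bcs_integrable.
- by move=> x _; exact: norm_cos_le.
Qed.

(** By translation invariance h |-> \int w(x + h v) dx is constant, and its derivative at 0 can be
    taken under the integral. *)
Lemma Rintegral_derive0 (w : V -> R) (v : V) : test w ->
  Rintegral mu3 setT ('D_v w) = 0.
Proof.
move=> tw; have tD := test_derive v tw.
have [M M0 DM] := test_bounded tD; have /testP[_ [N sN]] := tD.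
have [sw _] := tw.
(* For |h| < 1 the point h v + x can meet the support of the derivative only if |x| <= N + |v|. *)
pose G (x : V) := M * \1_(cube (N + `|v|)) x.
have E : (fun h : R => Rintegral mu3 setT (fun x : V => w (1 *: x + h *: v))) =
    cst (Rintegral mu3 setT w).
  apply/funext => h.
  have [_ ->] := integral_affine (h *: v) (oner_neq0 R) (test_integrable tw).
  by rewrite normr1 expr1n invr1 mul1r.
have Gi : mu3.-integrable setT (EFin \o G).
  apply: integrable_EFinZ => //; apply: integrable_EFin_ltey => //.
    by apply: measurable_indic; exact: measurable_cube.
  under eq_integral do rewrite ger0_norm//.
  by rewrite integral_indic ?setIT ?leb3_cube//; exact: measurable_cube.
have H : is_derive (0 : R) 1
    (fun h : R => Rintegral mu3 setT (fun x : V => w (1 *: x + h *: v)))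
    (Rintegral mu3 setT (fun x : V => 'D_v w (0 *: v + x))).
  apply: (@is_derive_Rintegral1 _ _ M3 mu3 (fun h x => w (1 *: x + h *: v))
    (fun h x => 'D_v w (h *: v + x)) G) => //.
  - move=> h _; exact: (integral_affine (h *: v) (oner_neq0 R) (test_integrable tw)).1.
  - move=> h x _; under eq_fun do rewrite scale1r addrC.
    by apply/(is_derive_line v x w h); apply: DeriveDef => //; exact: smooth_derivable.
  - move=> h x /andP[h1 h2]; rewrite /G indicE.
    case: (boolP (x \in _)) => [_|]; first by rewrite mulr1.
    rewrite notin_setE /cube/= => /negP; rewrite -ltNge => xN.
    suff nc : ~ cube N (h *: v + x) by rewrite sN// normr0 mulr0.
    apply/negP; rewrite -ltNge.
    have : `|x| <= `|h *: v + x| + `|h *: v|.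
      by rewrite -{1}[x](addKr (h *: v)) (le_trans (ler_normD _ _))// normrN addrC.
    have : `|h *: v| <= `|v| by rewrite normrZ ler_piMl// ler_norml !ltW.
    by lra.
have [_] := H; rewrite E derive_cst => ->.
by apply: eq_Rintegral => x _; rewrite scale0r add0r.
Qed.

(** Integration by parts: the derivative of cos(x.xi + a + pi/2) w has integral 0, and
    differentiating the cosine shifts its phase to a + pi, which changes the sign. *)
Lemma Tr_mul a w xi v : test w -> dot v xi * Tr a w xi = Tr (a + pi / 2) ('D_v w) xi.
Proof.
move=> tw; have bw := test_bcs tw.
pose f (x : V) := cos (dot x xi + (a + pi / 2)) * w x.
have sc b := smooth_cos_dot xi b.
have tf : test f by apply: testM.
have := Rintegral_derive0 v tf.
have D x : 'D_v f x = - dot v xi * (cos (dot x xi + a) * w x) +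
    cos (dot x xi + (a + pi / 2)) * 'D_v w x.
  have dc := is_derive_cos_dot xi x v (a + pi / 2).
  have [_ ->] := is_derive_mul dc (is_derive_smooth x v tw.1).
  have -> : dot x xi + (a + pi / 2) + pi / 2 = dot x xi + a + pi.
    by rewrite -!addrA -splitr.
  by rewrite cosDpi; ring.
have -> : 'D_v f = fun x => - dot v xi * (cos (dot x xi + a) * w x) +
    cos (dot x xi + (a + pi / 2)) * 'D_v w x by exact/funext.
have i1 := bcs_integrable (bcs_cos a xi bw).
have i2 := bcs_integrable (bcs_cos (a + pi / 2) xi (test_bcs (test_derive v tw))).
rewrite RintegralD//; last exact: integrable_EFinZ.
by rewrite RintegralZl// mulNr => /eqP; rewrite addrC subr_eq0 => /eqP <-.
Qed.

Lemma dot_ebasis k (xi : V) : dot (ebasis R k) xi = xcoord xi k.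
Proof.
by elim/ord3_ind: k; rewrite dotE /ebasis /xcoord/= ?(mul1r, mul0r, addr0, add0r).
Qed.

(** Each power of the coordinate is traded for a derivative of [w] at the price of a phase shift,
    and the final bound by an L^1 norm does not see the phase. *)
Lemma Tr_decay1 a w k n : test w ->
  exists M : R, forall xi, `|xcoord xi k| ^+ n * `|Tr a w xi| <= M.
Proof.
move=> tw; exists (Rintegral mu3 setT
  (fun x => `|iter n (fun g : V -> R => 'D_(ebasis R k) g) w x|)) => xi.
elim: n a w tw => [|n IH] a w tw.
  by rewrite expr0 mul1r; apply: Tr_bound; exact: test_bcs.
rewrite exprSr -mulrA -normrM -[in X in _ * X]dot_ebasis Tr_mul// iterSr.
by apply: IH; exact: test_derive.
Qed.

Lemma one_add_norm_expn (xi : V) n :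
  (1 + `|xi|) ^+ n <= 2 ^+ n * (1 + \sum_(k < 3) `|xcoord xi k| ^+ n).
Proof.
have [x1|x1] := leP `|xi| 1.
  apply: (@le_trans _ _ (2 ^+ n)).
    by rewrite lerXn2r ?nnegrE ?addr_ge0// -[leRHS]natr1; rewrite [1%:R + 1]addrC lerD2l.
  by rewrite ler_peMr ?exprn_ge0// lerDl sumr_ge0// => k _; rewrite exprn_ge0.
have [k xk] : exists k, `|xi| = `|xcoord xi k|.
  rewrite norm3E; case: leP => _; last by case: leP => _; [exists 1|exists 0].
  by exists 2%:R.
rewrite (@le_trans _ _ ((2 * `|xi|) ^+ n))//.
  by rewrite lerXn2r ?nnegrE ?addr_ge0 ?mulr_ge0//; lra.
rewrite exprMn ler_wpM2l ?exprn_ge0// xk (bigD1 k)//= addrCA lerDl addr_ge0//.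
by rewrite sumr_ge0// => j _; rewrite exprn_ge0.
Qed.

Lemma Tr_decay a w n : test w ->
  exists M : R, forall xi, (1 + `|xi|) ^+ n * `|Tr a w xi| <= M.
Proof.
move=> tw; have /choice[M MP] : forall k : 'I_3, exists M : R,
    forall xi, `|xcoord xi k| ^+ n * `|Tr a w xi| <= M.
  by move=> k; exact: Tr_decay1.
exists (2 ^+ n * (Rintegral mu3 setT (fun x => `|w x|) + \sum_(k < 3) M k)) => xi.
apply: (le_trans (ler_wpM2r (normr_ge0 _) (one_add_norm_expn xi n))).
rewrite -mulrA ler_wpM2l ?exprn_ge0// mulrDl mul1r lerD//.
  by apply: Tr_bound; exact: test_bcs.
by rewrite mulr_suml ler_sum.
Qed.

Lemma test_dot (w : V -> R) v : test w -> test (fun x => dot x v * w x).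
Proof.
apply: testM; have := @smooth_affine R V R (fun x => dot x v) (fun y => dot y v).
move=> /(_ _ id); apply.
- by move=> x h y; rewrite -[LHS]addr0 dot_affine addr0.
- exact: dot_continuousl.
apply: (@smoothI R R [set f | exists a b, f = fun s => a * s + b]).
- move=> _ [a [b ->]] x; apply: cvgD; last exact: cvg_cst.
  by apply: cvgM => //; exact: cvg_cst.
- move=> _ x y [a [b ->]]; apply: derivableD; last exact: derivable_cst.
  by apply: derivableM; [exact: derivable_cst|exact: derivable_id].
- move=> _ y [a [b ->]]; exists 0, (a * y); apply/funext => x.
  have [_ E] := is_deriveD (is_derive_mull a (is_derive_id x y)) (is_derive_cst b x y).
  by rewrite [LHS]E mul0r add0r addr0.
- by exists 1, 0; apply/funext => s; rewrite mul1r addr0.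
Qed.

Lemma iter_derive_Tr a w vs : test w -> exists b w', test w' /\
  iter_derive vs (Tr a w) = Tr b w'.
Proof.
move=> tw; elim: vs => [|v vs [b [w' [tw' E]]]]; first by exists a, w.
exists (b + pi / 2), (fun x => dot x v * w' x); split; first exact: test_dot.
rewrite /= E; apply/funext => xi.
by have [_ ->] := is_derive_Tr b xi v (test_bcs tw').
Qed.

Lemma schwartz_Tr a w : test w -> schwartz (Tr a w).
Proof.
move=> tw; split; first by apply: smooth_Tr; exact: test_bcs.
move=> vs n; have [b [w' [tw' ->]]] := iter_derive_Tr a vs tw.
have [M MP] := Tr_decay b n tw'; exists (2 ^+ n * M) => xi.
apply: le_trans (ler_wpM2l _ (MP xi)); last by rewrite exprn_ge0.
rewrite mulrA ler_wpM2r// -exprMn lerXn2r ?nnegrE ?addr_ge0 ?mulr_ge0 ?enorm_ge0//.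
have := enorm_le_norm xi; lra.
Qed.
End Trig.

Section Integral3.
Context {R : realType}.
Local Notation V := (R3 R).
Local Notation M1 := (measurableTypeR R).
Local Notation M3 := (M1 * M1 * M1)%type.
Local Notation mu3 := (@leb3 R).
Implicit Types f g h : V -> R.

(** The type [R3 R] carries the normed structure; these abbreviations fix the product sigma-algebra
    [M3] on the same carrier. *)
Definition meas3 f : Prop := @measurable_fun _ _ M3 R setT f.
Definition I3 f : R := Rintegral mu3 setT f.
Definition ig3 f : Prop := mu3.-integrable setT (EFin \o f).

Lemma TrE a (w : V -> R) xi : Tr a w xi = I3 (fun x => cos (dot x xi + a) * w x).
Proof. by []. Qed.

Lemma meas3_cst (a : R) : meas3 (fun=> a). Proof. exact: measurable_cst. Qed.
Lemma meas3D f g : meas3 f -> meas3 g -> meas3 (fun x => f x + g x).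
Proof. by move=> mf mg; apply: measurable_funD. Qed.
Lemma meas3B f g : meas3 f -> meas3 g -> meas3 (fun x => f x - g x).
Proof. by move=> mf mg; apply: measurable_funB. Qed.
Lemma meas3M f g : meas3 f -> meas3 g -> meas3 (fun x => f x * g x).
Proof. by move=> mf mg; apply: measurable_funM. Qed.
Lemma meas3_norm f : meas3 f -> meas3 (fun x => `|f x|).
Proof. by move=> mf; apply: (measurableT_comp _ mf). Qed.
Lemma meas3_comp (u : R -> R) f : measurable_fun setT u -> meas3 f ->
  meas3 (fun x => u (f x)).
Proof. by move=> mu mf; exact: (measurableT_comp mu mf). Qed.
Lemma meas3X f n : meas3 f -> meas3 (fun x => f x ^+ n).
Proof. by move=> mf; apply: (@meas3_comp (fun r => r ^+ n)) => //; exact: measurable_funX. Qed.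
Lemma continuous_meas3 f : continuous f -> meas3 f.
Proof. exact: continuous_measurable3. Qed.
Lemma meas3_xcoord j : meas3 (fun x => xcoord x j).
Proof. by apply: continuous_meas3; exact: xcoord_continuous. Qed.
Lemma meas3_enorm : meas3 (@enorm R).
Proof.
apply: meas3_comp.
  by apply: continuous_measurable_fun; exact: sqrt_continuous.
under eq_fun do rewrite dotE.
have m j := meas3M (meas3_xcoord j) (meas3_xcoord j).
exact: meas3D (meas3D (m 0) (m 1)) (m 2%:R).
Qed.

Lemma ig3_meas f : ig3 f -> meas3 f.
Proof. exact: integrable_EFin_measurable. Qed.
Lemma ig3_le f g : meas3 f -> (forall x, `|f x| <= g x) -> ig3 g -> ig3 f.
Proof. by move=> mf fg; apply: integrable_EFin_le => // x _; exact: fg. Qed.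
Lemma ig3D f g : ig3 f -> ig3 g -> ig3 (fun x => f x + g x).
Proof. exact: integrable_EFinD. Qed.
Lemma ig3B f g : ig3 f -> ig3 g -> ig3 (fun x => f x - g x).
Proof. exact: integrable_EFinB. Qed.
Lemma ig3Z (a : R) f : ig3 f -> ig3 (fun x => a * f x).
Proof. exact: integrable_EFinZ. Qed.
Lemma ig3N f : ig3 f -> ig3 (fun x => - f x).
Proof. by move=> /(ig3Z (-1)); under eq_fun do rewrite mulN1r. Qed.
Lemma ig3_norm f : ig3 f -> ig3 (fun x => `|f x|).
Proof. exact: integrable_EFin_norm. Qed.
Lemma ig3_0 : ig3 (fun=> 0).
Proof. by have := @integrable0 _ _ _ mu3 setT. Qed.
Lemma ig3_sum n (f : 'I_n -> V -> R) : (forall j, ig3 (f j)) ->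
  ig3 (fun x => \sum_(j < n) f j x).
Proof. exact: integrable_EFin_sum. Qed.
Lemma ig3_bcs w : bcs w -> ig3 w. Proof. exact: bcs_integrable. Qed.
Lemma ig3_test w : test w -> ig3 w. Proof. by move=> /test_bcs /ig3_bcs. Qed.
Lemma ig3_lty f : meas3 f -> (\int[mu3]_x `|f x|%:E < +oo)%E -> ig3 f.
Proof. exact: integrable_EFin_ltey. Qed.

Lemma I3E f : ig3 f -> (\int[mu3]_x (f x)%:E = (I3 f)%:E)%E.
Proof. by move=> fi; rewrite /I3 /Rintegral fineK//; exact: integrable_fin_num. Qed.
Lemma eq_I3 f g : f =1 g -> I3 f = I3 g. Proof. by move=> /funext ->. Qed.
Lemma I3D f g : ig3 f -> ig3 g -> I3 (fun x => f x + g x) = I3 f + I3 g.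
Proof. by move=> fi gi; exact: RintegralD. Qed.
Lemma I3B f g : ig3 f -> ig3 g -> I3 (fun x => f x - g x) = I3 f - I3 g.
Proof. by move=> fi gi; exact: RintegralB. Qed.
Lemma I3Z (a : R) f : ig3 f -> I3 (fun x => a * f x) = a * I3 f.
Proof. by move=> fi; exact: RintegralZl. Qed.
Lemma I3N f : ig3 f -> I3 (fun x => - f x) = - I3 f.
Proof. by move=> fi; under eq_I3 do rewrite -mulN1r; rewrite I3Z// mulN1r. Qed.
Lemma I3_0 : I3 (fun=> 0) = 0.
Proof. rewrite -[RHS](mul0r (I3 (fun=> 0))) -I3Z; last exact: ig3_0.
by apply: eq_I3 => x; rewrite mulr0. Qed.
Lemma I3_sum n (f : 'I_n -> V -> R) : (forall j, ig3 (f j)) ->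
  I3 (fun x => \sum_(j < n) f j x) = \sum_(j < n) I3 (f j).
Proof. by move=> fi; exact: Rintegral_sum. Qed.
Lemma le_I3 f g : ig3 f -> ig3 g -> (forall x, f x <= g x) -> I3 f <= I3 g.
Proof. by move=> fi gi fg; apply: le_Rintegral => // x _; exact: fg. Qed.
Lemma le_norm_I3 f : ig3 f -> `|I3 f| <= I3 (fun x => `|f x|).
Proof. by move=> fi; exact: le_normr_Rintegral. Qed.
Lemma I3_ge0 f : (forall x, 0 <= f x) -> 0 <= I3 f.
Proof. by move=> f0; apply: Rintegral_ge0 => x _; exact: f0. Qed.
Lemma I3_dominated (f_ : nat -> V -> R) f g : (forall n, meas3 (f_ n)) ->
  (forall x, f_ n x @[n --> \oo] --> f x) ->
  (forall n x, `|f_ n x| <= g x) -> ig3 g ->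
  ig3 f /\ I3 (f_ n) @[n --> \oo] --> I3 f.
Proof.
move=> mf ff fg gi; apply: (@Rintegral_dominated R _ M3 mu3 setT f_ f g) => //.
Qed.
Lemma I3_affine (a : R) (v : V) f : a != 0 -> ig3 f ->
  ig3 (fun x => f (a *: x + v)) /\ I3 (fun x => f (a *: x + v)) = `|a| ^- 3 * I3 f.
Proof. by move=> a0 fi; exact: integral_affine. Qed.

Definition meas6 (F : V * V -> R) : Prop := @measurable_fun _ _ (M3 * M3)%type R setT F.
Definition I6 (F : V * V -> R) : R := Rintegral (mu3 \x mu3)%E setT F.
Definition ig6 (F : V * V -> R) : Prop := (mu3 \x mu3)%E.-integrable setT (EFin \o F).

Lemma meas6_fst f : meas3 f -> meas6 (fun z => f z.1).
Proof. by move=> mf; apply: (measurableT_comp mf); exact: measurable_fst. Qed.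
Lemma meas6_snd f : meas3 f -> meas6 (fun z => f z.2).
Proof. by move=> mf; apply: (measurableT_comp mf); exact: measurable_snd. Qed.
Lemma meas6D F G : meas6 F -> meas6 G -> meas6 (fun x => F x + G x).
Proof. by move=> mf mg; apply: measurable_funD. Qed.
Lemma meas6B F G : meas6 F -> meas6 G -> meas6 (fun x => F x - G x).
Proof. by move=> mf mg; apply: measurable_funB. Qed.
Lemma meas6M F G : meas6 F -> meas6 G -> meas6 (fun x => F x * G x).
Proof. by move=> mf mg; apply: measurable_funM. Qed.
Lemma meas6_comp (u : R -> R) F : measurable_fun setT u -> meas6 F ->
  meas6 (fun x => u (F x)).
Proof. by move=> mu mf; exact: (measurableT_comp mu mf). Qed.
Lemma meas6_sum n (F : 'I_n -> V * V -> R) : (forall j, meas6 (F j)) ->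
  meas6 (fun x => \sum_(j < n) F j x).
Proof. by move=> mf; apply: measurable_sum => j; exact: mf. Qed.
Lemma meas6_add f : meas3 f -> meas6 (fun z => f (z.1 + z.2)).
Proof.
move=> mf; suff mg : @measurable_fun _ _ (M3 * M3)%type M3 setT
    (fun z : V * V => z.1 + z.2) by exact: (measurableT_comp mf mg).
have mj j : meas6 (fun z => xcoord z.1 j + xcoord z.2 j).
  by apply: meas6D; [apply: (@meas6_fst (fun x => xcoord x j))|apply: (@meas6_snd (fun x => xcoord x j))];
  exact: meas3_xcoord.
apply: measurable_fun_pair; first apply: measurable_fun_pair.
- exact: (mj 0).
- exact: (mj 1).
- exact: (mj 2%:R).
Qed.
Lemma meas6_dot : meas6 (fun z => dot z.1 z.2).
Proof.
under eq_fun do rewrite /dot; apply: meas6_sum => j.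
apply: meas6M; [apply: (@meas6_fst (fun x => xcoord x j))|
  apply: (@meas6_snd (fun x => xcoord x j))]; exact: meas3_xcoord.
Qed.

Lemma ig6_prod_le F f g : meas6 F -> (forall x y, `|F (x, y)| <= f x * g y) ->
  (forall x, 0 <= f x) -> (forall y, 0 <= g y) -> ig3 f -> ig3 g -> ig6 F.
Proof. by move=> mF Ffg f0 g0 fi gi; exact: (@integrable_prod_le R _ _ M3 M3 mu3 mu3 F f g). Qed.
Lemma I6_fubini F : ig6 F ->
  I6 F = I3 (fun x => I3 (fun y => F (x, y))) /\
  I6 F = I3 (fun y => I3 (fun x => F (x, y))).
Proof. by move=> Fi; exact: (@Rintegral_fubini R _ _ M3 M3 mu3 mu3 F Fi). Qed.
Lemma ig6_fubini F : ig6 F ->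
  ig3 (fun x => I3 (fun y => F (x, y))) /\ ig3 (fun y => I3 (fun x => F (x, y))).
Proof. by move=> Fi; exact: (@integrable_Rfubini R _ _ M3 M3 mu3 mu3 F Fi). Qed.
Lemma I6_prod f g : ig3 f -> ig3 g ->
  ig6 (fun z => f z.1 * g z.2) /\ I6 (fun z => f z.1 * g z.2) = I3 f * I3 g.
Proof. by move=> fi gi; exact: (@Rintegral_prod R _ _ M3 M3 mu3 mu3 f g). Qed.
Lemma ig6Z (a : R) F : ig6 F -> ig6 (fun x => a * F x).
Proof. exact: integrable_EFinZ. Qed.
Lemma ig6_sum n (F : 'I_n -> V * V -> R) : (forall j, ig6 (F j)) ->
  ig6 (fun x => \sum_(j < n) F j x).
Proof. exact: integrable_EFin_sum. Qed.
Lemma eq_I6 F G : F =1 G -> I6 F = I6 G. Proof. by move=> /funext ->. Qed.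
Lemma I6D F G : ig6 F -> ig6 G -> I6 (fun x => F x + G x) = I6 F + I6 G.
Proof. by move=> fi gi; exact: RintegralD. Qed.
Lemma I6B F G : ig6 F -> ig6 G -> I6 (fun x => F x - G x) = I6 F - I6 G.
Proof. by move=> fi gi; exact: RintegralB. Qed.
Lemma I6Z (a : R) F : ig6 F -> I6 (fun x => a * F x) = a * I6 F.
Proof. by move=> fi; exact: RintegralZl. Qed.
Lemma I6_sum n (F : 'I_n -> V * V -> R) : (forall j, ig6 (F j)) ->
  I6 (fun x => \sum_(j < n) F j x) = \sum_(j < n) I6 (F j).
Proof. by move=> fi; exact: Rintegral_sum. Qed.
Lemma le_I6 F G : ig6 F -> ig6 G -> (forall x, F x <= G x) -> I6 F <= I6 G.
Proof. by move=> fi gi fg; apply: le_Rintegral => // x _; exact: fg. Qed.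
Lemma ig6_norm F : ig6 F -> ig6 (fun x => `|F x|).
Proof. exact: integrable_EFin_norm. Qed.
Lemma le_norm_I6 F : ig6 F -> `|I6 F| <= I6 (fun x => `|F x|).
Proof. by move=> fi; exact: le_normr_Rintegral. Qed.
Lemma I6_dominated (F_ : nat -> V * V -> R) F G : (forall n, meas6 (F_ n)) ->
  (forall x, F_ n x @[n --> \oo] --> F x) ->
  (forall n x, `|F_ n x| <= G x) -> ig6 G ->
  ig6 F /\ I6 (F_ n) @[n --> \oo] --> I6 F.
Proof.
move=> mf ff fg gi; apply: (@Rintegral_dominated R _ (M3 * M3)%type (mu3 \x mu3)%E setT F_ F G) => //.
Qed.
End Integral3.

(** * Fourier inversion *)

Section Kernel.
Context {R : realType}.
Local Notation V := (R3 R).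
Local Notation M1 := (measurableTypeR R).
Local Notation M3 := (M1 * M1 * M1)%type.
Local Notation mu3 := (@leb3 R).

Lemma measurable_cos : measurable_fun setT (@cos R).
Proof. by apply: continuous_measurable_fun; exact: continuous_cos. Qed.

Lemma dotBr (x y z : V) : dot x (y - z) = dot x y - dot x z.
Proof. by rewrite !dotE/=; ring. Qed.

Lemma dotZl (x y : V) (a : R) : dot (a *: x) y = a * dot x y.
Proof. by rewrite !dotE/= /GRing.scale/=; ring. Qed.

Lemma dotZr (x y : V) (a : R) : dot x (a *: y) = a * dot x y.
Proof. by rewrite !dotE/= /GRing.scale/=; ring. Qed.

Lemma cosB_pihalf (s : R) : cos (s - pi / 2) = sin s.
Proof. by rewrite cosB cos_pihalf sin_pihalf mulr0 add0r mulr1. Qed.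

(** By Fubini and the formula for cos(A - B), a transform of [phi], multiplied by [w] and
    transformed back, is an integral of [phi] against the transform of [w]. The phases c = 0 and c =
    - pi/2 give the two parts of the complex identity. *)
Lemma Tr_comb (w phi : V -> R) c x : bcs w -> bcs phi ->
  Tr 0 (fun xi => w xi * Tr c phi xi) x +
  Tr (- (pi / 2)) (fun xi => w xi * Tr (c - pi / 2) phi xi) x =
  I3 (fun y => phi y * Tr c w (y - x)).
Proof.
move=> bw bphi.
have bT b : bcs (fun xi => w xi * Tr b phi xi).
  rewrite (_ : (fun _ => _) = fun xi => Tr b phi xi * w xi).
    by apply: bcsM => //; exact: continuous_Tr.
  by apply/funext => xi; rewrite mulrC.
pose F (z : V * V) : R := cos (dot z.1 (z.2 - x) + c) * (w z.1 * phi z.2).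
have mF : meas6 F.
  apply: meas6M; last by apply: meas6M; [exact: meas6_fst bw.1|exact: meas6_snd bphi.1].
  apply: (meas6_comp measurable_cos); under eq_fun do rewrite dotBr.
  apply: meas6D; last exact: (meas6_fst (meas3_cst c)).
  apply: meas6B; first exact: meas6_dot.
  apply: (@meas6_fst _ (fun y => dot y x)); apply: continuous_meas3.
  exact: dot_continuousl.
have iF : ig6 F.
  apply: (@ig6_prod_le _ F (fun x => `|w x|) (fun x => `|phi x|)) => //.
  - by move=> xi y; rewrite -normrM norm_cos_le.
  - exact/ig3_norm/ig3_bcs.
  - exact/ig3_norm/ig3_bcs.
have [F1 F2] := I6_fubini iF.
have bcos b xi f : bcs f -> ig3 (fun y => cos (dot y xi + b) * f y).
  by move=> bf; apply: ig3_bcs; exact: bcs_cos.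
transitivity (I3 (fun xi : V => I3 (fun y : V => F (xi, y)))).
  rewrite !TrE -I3D; [|exact: bcos|exact: bcos].
  apply: eq_I3 => xi; rewrite !TrE !mulrA -!I3Z; [|exact: bcos|exact: bcos].
  rewrite -I3D; [|by apply: ig3Z; exact: bcos|by apply: ig3Z; exact: bcos].
  apply: eq_I3 => y; rewrite /F /=.
  rewrite addr0 cosB_pihalf addrA cosB_pihalf dotBr (dotC y xi).
  by rewrite (addrAC (dot xi y)) cosB; ring.
rewrite -F1 F2; apply: eq_I3 => y; rewrite /F/= TrE -I3Z; last exact: bcos.
by apply: eq_I3 => xi; ring.
Qed.

(** The factor exp(6) normalises the value at 0 to 1, as [bump3] is there a product of six factors
    exp(-1). The cut-off is even, so its sine transform vanishes. *)
Definition chi (x : V) : R := expR 6 * bump3 0 ((-1, -1), -1) ((1, 1), 1) x.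

Lemma test_chi : test chi.
Proof. by apply: testZ; exact: test_bump3. Qed.

Lemma chi0 : chi 0 = 1.
Proof.
rewrite /chi /bump3 /bump1 /= !flat1E !mul1r sub0r opprK subr0 ltr01 invr1.
by rewrite -!expRD -expR0; congr expR; lra.
Qed.

Lemma chiN x : chi (- x) = chi x.
Proof.
have h (s : R) : bump1 0 (-1) 1 (- s) = bump1 0 (-1) 1 s.
  rewrite /bump1 mulrC; congr (flat 1 (_ * _) * flat 1 (_ * _)); lra.
by rewrite /chi /bump3 /= !h.
Qed.

Lemma chi_bound : exists2 M : R, 0 <= M & forall x, `|chi x| <= M.
Proof. exact: test_bounded test_chi. Qed.

Definition chin (n : nat) (x : V) : R := chi (n.+1%:R^-1 *: x).

Lemma test_chin n : test (chin n).
Proof.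
have n0 : (n.+1%:R : R) != 0 by rewrite pnatr_eq0.
have /testP[sc [N sN]] := test_chi.
have := @smooth_affine R V V (fun x => n.+1%:R^-1 *: x) (fun x => n.+1%:R^-1 *: x).
move=> /(_ _ chi) H; apply/testP; split.
  apply: H => //.
  - by move=> x h v; rewrite scalerDr scalerA mulrC -scalerA.
  - by move=> x; apply: cvgZr; exact: cvg_id.
exists (n.+1%:R * N) => x; rewrite /cube/= => /negP xN; apply: sN.
apply/negP; rewrite /cube/=; apply: contra xN.
by rewrite normrZ ger0_norm ?invr_ge0// mulrC ler_pdivrMr// mulrC.
Qed.

Lemma cvg_chin (x : V) : chin n x @[n --> \oo] --> (1 : R).
Proof.
rewrite -chi0; have := smooth_continuous test_chi.1; move=> /(_ (0 : V)) c.
rewrite /chin; apply: (cvg_comp (fun n => n.+1%:R^-1 *: x) chi _ c).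
rewrite -(scale0r x); apply: cvgZr_tmp; exact: cvg_harmonic.
Qed.

Definition Ker : V -> R := Tr 0 chi.

Lemma Tr_chin c n (z : V) : Tr c (chin n) z = n.+1%:R ^+ 3 * Tr c chi (n.+1%:R *: z).
Proof.
have n0 : (n.+1%:R : R) != 0 by rewrite pnatr_eq0.
have nV0 : (n.+1%:R^-1 : R) != 0 by rewrite invr_eq0.
have bc := ig3_bcs (bcs_cos c (n.+1%:R *: z) (test_bcs test_chi)).
have [_ E] := I3_affine 0 nV0 bc.
rewrite ger0_norm ?invr_ge0// exprVn invrK in E.
rewrite [in RHS]TrE; apply: etrans E.
apply: eq_Rintegral => x _; rewrite addr0 dotZl dotZr mulrA mulVf// mul1r.
by [].
Qed.

Lemma Tr_sin_chi z : Tr (- (pi / 2)) chi z = 0.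
Proof.
have bc := ig3_bcs (bcs_cos (- (pi / 2)) z (test_bcs test_chi)).
have m0 : (-1 : R) != 0 by rewrite oppr_eq0 oner_eq0.
pose F (x : V) := cos (dot x z + - (pi / 2)) * chi x.
have [_] := @I3_affine _ _ 0 F m0 bc; rewrite normrN1 expr1n invr1 mul1r => E.
have H : I3 F = - I3 F.
  apply: etrans (esym E) _; rewrite -(I3N bc); apply: eq_I3 => x.
  rewrite /F addr0 scaleN1r chiN !cosB_pihalf -scaleN1r dotZl mulN1r sinN.
  by rewrite mulNr.
by rewrite TrE; apply/eqP; rewrite -[_ == 0](mulrn_eq0 _ 2) mulr2n {2}H subrr.
Qed.

Lemma Ker_decay n : exists M : R, forall z, (1 + `|z|) ^+ n * `|Ker z| <= M.
Proof. exact: Tr_decay test_chi. Qed.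

Lemma continuous_Ker : continuous Ker.
Proof. by apply: continuous_Tr; exact: test_bcs test_chi. Qed.

Lemma integrable_Ker : mu3.-integrable setT (EFin \o Ker).
Proof.
have [M MP] := Ker_decay 6.
apply: integrable_decay MP; apply: continuous_measurable3; exact: continuous_Ker.
Qed.

Lemma integrable_Ker_moment m :
  mu3.-integrable setT (EFin \o (fun z => (1 + `|z|) ^+ m * `|Ker z|)).
Proof.
have [M MP] := Ker_decay (6 + m).
apply: (@integrable_decay _ _ M).
  apply: continuous_measurable3; apply: continuous_mul.
    move=> x; apply: (@continuous_comp V R R (fun x => 1 + `|x|) (fun r => r ^+ m)).
      by apply: (@cvgD _ R); [exact: cvg_cst|exact: norm_continuous].
    exact: exprn_continuous.
  by move=> x; apply: cvg_norm; exact: continuous_Ker.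
move=> x; rewrite normrM normr_id ger0_norm ?exprn_ge0 ?addr_ge0// mulrA -exprD.
exact: MP.
Qed.

(* Up to the factor [I3 Ker], the Fourier inversion of [phi] regularised by the cut-off
   [chin n]; see [TnE]. *)
Definition Tn n (phi : V -> R) (x : V) : R :=
  I3 (fun z : V => Ker z * phi (n.+1%:R^-1 *: z + x)).

(** This is [Tr_comb] for the cut-off [chin n]; in the substitution y = z/(n + 1) + x the Jacobian
    cancels the factor (n + 1)^3 of [Tr_chin]. *)
Lemma TnE n phi x : test phi ->
  Tr 0 (fun xi => chin n xi * Tr 0 phi xi) x +
  Tr (- (pi / 2)) (fun xi => chin n xi * Tr (- (pi / 2)) phi xi) x = Tn n phi x.
Proof.
move=> tphi; have bphi := test_bcs tphi; have bc := test_bcs (test_chin n).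
have := @Tr_comb (chin n) phi 0 x bc bphi; rewrite add0r => ->.
have n0 : (n.+1%:R : R) != 0 by rewrite pnatr_eq0.
have nV0 : (n.+1%:R^-1 : R) != 0 by rewrite invr_eq0.
pose f (y : V) := phi y * Tr 0 (chin n) (y - x).
have fi : ig3 f.
  apply: ig3_bcs; rewrite /f.
  rewrite (_ : (fun _ => _) = fun y => Tr 0 (chin n) (y - x) * phi y); last first.
    by apply/funext => y; rewrite mulrC.
  apply: bcsM => // y.
  apply: (@continuous_comp _ _ _ (fun y : V => y - x) (Tr 0 (chin n))).
    by apply: cvgB; [exact: cvg_id|exact: cvg_cst].
  exact: continuous_Tr.
have [_ E] := I3_affine x nV0 fi.
rewrite -/f -[LHS]mul1r -[X in X * _](mulVf (expf_neq0 3 n0)) -mulrA.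
rewrite [X in _ * (X * _)](_ : _ = `|n.+1%:R^-1| ^- 3); last first.
  by rewrite ger0_norm ?invr_ge0// exprVn invrK.
rewrite -E -I3Z//; last exact: (I3_affine x nV0 fi).1.
apply: eq_I3 => z; rewrite /f addrK Tr_chin scalerA mulfV// scale1r.
by rewrite /Ker; field.
Qed.

Lemma Tr_Npi (w : V -> R) (xi : V) : bcs w -> Tr (- (pi / 2) - pi / 2) w xi = - Tr 0 w xi.
Proof.
move=> bw; rewrite !TrE -I3N; last by apply: ig3_bcs; exact: bcs_cos.
apply: eq_I3 => y; rewrite -opprD -splitr addr0 -mulNr.
by rewrite -cosN opprB addrC -[in RHS]cosN -cosDpi.
Qed.

(** The imaginary part of the regularised inversion is an integral against the sine transform of
    [chin n], which is 0 because [chi] is even. *)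
Lemma Tn_sin n (phi : V -> R) (x : V) : test phi ->
  Tr 0 (fun xi => chin n xi * Tr (- (pi / 2)) phi xi) x =
  Tr (- (pi / 2)) (fun xi => chin n xi * Tr 0 phi xi) x.
Proof.
move=> tphi; have bphi := test_bcs tphi; have bc := test_bcs (test_chin n).
have := @Tr_comb (chin n) phi (- (pi / 2)) x bc bphi.
have -> : I3 (fun y => phi y * Tr (- (pi / 2)) (chin n) (y - x)) = 0.
  by rewrite -[RHS]I3_0; apply: eq_I3 => y; rewrite Tr_chin Tr_sin_chi !mulr0.
have -> : (fun xi => chin n xi * Tr (- (pi / 2) - pi / 2) phi xi) =
    fun xi => - (chin n xi * Tr 0 phi xi).
  by apply/funext => xi; rewrite Tr_Npi// mulrN.
move=> /eqP; rewrite addr_eq0 => /eqP ->.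
rewrite !TrE -I3N.
  by apply: eq_I3 => y; rewrite mulrN opprK.
apply: ig3_bcs; apply: bcs_cos.
rewrite (_ : (fun _ => _) = fun xi => (-1 * Tr 0 phi xi) * chin n xi).
  apply: bcsM => //; apply: (@continuous_mul _ _ (cst (-1))).
    by move=> ?; exact: cvg_cst.
  exact: continuous_Tr.
by apply/funext => xi; ring.
Qed.

Lemma ig3_KerM (f : V -> R) : continuous f -> (exists M : R, forall x, `|f x| <= M) ->
  ig3 (fun z => Ker z * f z).
Proof.
move=> cf [M fM]; apply: (@ig3_le _ _ (fun z => M * `|Ker z|)).
- by apply: continuous_meas3; apply: continuous_mul => //; exact: continuous_Ker.
- by move=> z; rewrite normrM mulrC ler_wpM2r.
- by apply/ig3Z/ig3_norm; exact: integrable_Ker.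
Qed.

Lemma continuous_shift_scale (a : R) (x : V) (f : V -> R) : continuous f ->
  continuous (fun z : V => f (a *: z + x)).
Proof.
move=> cf z; apply: (@continuous_comp V V R (fun z => a *: z + x) f); last exact: cf.
by apply: cvgD; [apply: cvgZr; exact: cvg_id|exact: cvg_cst].
Qed.

Lemma ig3_Tn n phi x : test phi ->
  ig3 (fun z : V => Ker z * phi (n.+1%:R^-1 *: z + x)).
Proof.
move=> tphi; apply: ig3_KerM.
  by apply: continuous_shift_scale; exact: smooth_continuous tphi.1.
by have [M _ MP] := test_bounded tphi; exists M.
Qed.

(** Being an average of translates, [Tn n] commutes with derivatives; hence one estimate for
    [Tn n phi] gives convergence in all Schwartz seminorms. *)
Lemma is_derive_Tn n phi x v : test phi ->
  is_derive x v (Tn n phi) (Tn n ('D_v phi) x).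
Proof.
move=> tphi; have tD := test_derive v tphi; have [M M0 DM] := test_bounded tD.
apply: (@is_derive_Rintegral R _ M3 mu3 V
  (fun x z => Ker z * phi (n.+1%:R^-1 *: z + x))
  (fun x z => Ker z * 'D_v phi (n.+1%:R^-1 *: z + x)) (fun z => M * `|Ker z|)).
- by move=> y; exact: ig3_Tn.
- move=> y z; apply: is_derive_mull.
  have aE (w : V) (h : R) u : n.+1%:R^-1 *: z + (h *: u + w) =
      h *: id u + (n.+1%:R^-1 *: z + w) by rewrite addrCA.
  have DE := @derive_affine R V V (fun w => n.+1%:R^-1 *: z + w) id aE phi v.
  apply: DeriveDef; last by rewrite [LHS](congr1 (fun g => g y) DE).
  apply: (@derivable_affine R V V (fun w => n.+1%:R^-1 *: z + w) id aE phi).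
  exact: smooth_derivable tphi.1.
- by move=> y z; rewrite normrM mulrC ler_wpM2r.
- by apply/ig3Z/ig3_norm; exact: integrable_Ker.
Qed.

Lemma iter_derive_Tn n phi vs : test phi ->
  iter_derive vs (Tn n phi) = Tn n (iter_derive vs phi).
Proof.
move=> tphi; elim: vs => [//|v vs IH] /=; rewrite IH; apply/funext => x.
by have [_ ->] := is_derive_Tn n x v (test_iter_derive vs tphi).
Qed.

Lemma iter_deriveD (f g : V -> R) vs : smooth f -> smooth g ->
  iter_derive vs (fun x => f x + g x) = fun x => iter_derive vs f x + iter_derive vs g x.
Proof.
move=> sf sg; elim: vs => [//|v vs IH] /=; rewrite IH; apply/funext => x.
by rewrite deriveD//; apply: smooth_derivable; exact: smooth_iter_derive.
Qed.

Lemma iter_deriveZ (f : V -> R) (a : R) vs : smooth f ->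
  iter_derive vs (fun x => a * f x) = fun x => a * iter_derive vs f x.
Proof.
move=> sf; elim: vs => [//|v vs IH] /=; rewrite IH; apply/funext => x.
have H := is_derive_smooth x v (smooth_iter_derive vs sf).
by have [_ ->] := is_derive_mull a H.
Qed.

Lemma schwartzD (f g : V -> R) : schwartz f -> schwartz g ->
  schwartz (fun x => f x + g x).
Proof.
move=> [sf df] [sg dg]; split; first exact: smoothD.
move=> vs n; have [M MP] := df vs n; have [M' MP'] := dg vs n.
exists (M + M') => x; rewrite iter_deriveD//.
apply: le_trans (lerD (MP x) (MP' x)); rewrite -mulrDr ler_wpM2l ?ler_normD//.
by rewrite exprn_ge0// addr_ge0// enorm_ge0.
Qed.

Lemma schwartzZ (a : R) (f : V -> R) : schwartz f -> schwartz (fun x => a * f x).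
Proof.
move=> [sf df]; split; first exact: smoothZ.
move=> vs n; have [M MP] := df vs n.
exists (`|a| * M) => x; rewrite iter_deriveZ// normrM mulrCA.
by rewrite ler_wpM2l.
Qed.

Lemma MVT_line (f : V -> R) (x v : V) (M : R) : smooth f ->
  (forall y, `|'D_v f y| <= M) -> forall s : R, `|f (s *: v + x) - f x| <= `|s| * M.
Proof.
move=> sf fM.
have pos (h k : R) : h <= k -> `|f (k *: v + x) - f (h *: v + x)| <= (k - h) * M.
  move=> hk; have d (t : R) : is_derive t 1 (fun t : R => f (t *: v + x)) ('D_v f (t *: v + x)).
    by apply/(is_derive_line v x f); exact: is_derive_smooth.
  have [c _ ->] := @MVT_segment R (fun t : R => f (t *: v + x))
    (fun t => 'D_v f (t *: v + x)) h k hk (fun t _ => d t) (derivable_within_continuous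
      (fun t _ => let: DeriveDef e _ := d t in e)).
  by rewrite normrM mulrC (ger0_norm (_ : 0 <= k - h)) ?subr_ge0// ler_wpM2l// subr_ge0.
move=> s; have [s0|s0] := leP 0 s.
  by have := pos 0 s s0; rewrite scale0r add0r subr0 (ger0_norm s0).
by have := pos s 0 (ltW s0); rewrite scale0r add0r sub0r distrC (ltr0_norm s0).
Qed.

Lemma test_lipschitz phi : test phi -> exists2 L : R, 0 <= L &
  forall x v, `|phi (v + x) - phi x| <= L * `|v|.
Proof.
move=> tphi; have sphi := tphi.1.
have /choice[M MP] : forall k : 'I_3, exists M : R,
    forall y, `|'D_(ebasis R k) phi y| <= M.
  by move=> k; have [M _ MP] := test_bounded (test_derive (ebasis R k) tphi); exists M.
have M0 k : 0 <= M k by rewrite (le_trans _ (MP k 0)).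
exists (M 0 + M 1 + M 2%:R); first by rewrite !addr_ge0.
move=> x v.
have vE : v = xcoord v 2%:R *: ebasis R 2%:R + (xcoord v 1 *: ebasis R 1 + xcoord v 0 *: ebasis R 0).
  case: v => [[a b] c]; rewrite /xcoord /ebasis/=.
  by congr (_, _, _); rewrite /= /GRing.scale/= !(mulr0, mulr1, addr0, add0r).
set p0 := xcoord v 0 *: ebasis R 0 + x.
set p1 := xcoord v 1 *: ebasis R 1 + p0.
have -> : v + x = xcoord v 2%:R *: ebasis R 2%:R + p1 by rewrite {1}vE -!addrA.
have h0 := MVT_line x sphi (MP 0) (xcoord v 0).
have h1 := MVT_line p0 sphi (MP 1) (xcoord v 1).
have h2 := MVT_line p1 sphi (MP 2%:R) (xcoord v 2%:R).
have b k : `|xcoord v k| * M k <= `|v| * M k by rewrite ler_wpM2r// xcoord_le_norm.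
rewrite -(subrK (phi p1) (phi _)) -addrA (le_trans (ler_normD _ _))//.
rewrite -[X in _ + `|X|](subrK (phi p0)) addrAC.
have : `|phi p1 - phi x| <= `|phi p1 - phi p0| + `|phi p0 - phi x|.
  by rewrite -{1}(subrK (phi p0) (phi p1)) -addrA ler_normD.
have := b 0; have := b 1; have := b 2%:R.
rewrite addrAC subrK; move: h0 h1 h2; rewrite -/p0 -/p1; lra.
Qed.

(** The Lipschitz bound contributes |z|/(n + 1), and the weight (1 + |x|)^m is transferred to [z],
    where a moment of [Ker] of order m + 1 pays for both. *)
Lemma Tn_cvg_bound phi m : test phi -> exists C : R, forall n x,
  (1 + `|x|) ^+ m * `|Tn n phi x - I3 Ker * phi x| <= C * n.+1%:R^-1.
Proof.
move=> tphi; have [L L0 LP] := test_lipschitz tphi.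
have /testP[sphi [N sN]] := tphi.
pose g (z : V) := (1 + `|z|) ^+ m.+1 * `|Ker z|.
have gi : ig3 g by exact: integrable_Ker_moment.
exists ((1 + `|N|) ^+ m * L * I3 g) => n x.
have n1 : 0 < n.+1%:R^-1 :> R by rewrite invr_gt0.
have iT := ig3_Tn n x tphi.
have iK : ig3 (fun z => phi x * Ker z) by apply: ig3Z; exact: integrable_Ker.
have -> : Tn n phi x - I3 Ker * phi x =
    I3 (fun z => Ker z * phi (n.+1%:R^-1 *: z + x) - phi x * Ker z).
  by rewrite I3B// I3Z 1?mulrC//; exact: integrable_Ker.
have iB := ig3B iT iK.
have p0 : 0 <= (1 + `|x|) ^+ m by rewrite exprn_ge0// addr_ge0.
apply: le_trans (ler_wpM2l p0 (le_norm_I3 iB)) _.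
rewrite -I3Z; last exact: ig3_norm.
rewrite mulrAC -I3Z//; apply: le_I3; [by apply/ig3Z/ig3_norm|exact: ig3Z|move=> z].
rewrite (mulrC (phi x)) -mulrBr normrM /g exprS.
set v := n.+1%:R^-1 *: z.
have vz : `|v| = n.+1%:R^-1 * `|z| by rewrite normrZ ger0_norm ?ltW.
have vz1 : `|v| <= `|z| by rewrite vz ler_piMl// invf_le1 ?ler1n.
suff H : (1 + `|x|) ^+ m * `|phi (v + x) - phi x| <=
    (1 + `|N|) ^+ m * (1 + `|z|) ^+ m * (L * `|v|).
  rewrite mulrCA; apply: (le_trans (ler_wpM2l (normr_ge0 (Ker z)) H)).
  rewrite vz; set A := (1 + `|N|) ^+ m; set B := (1 + `|z|) ^+ m.
  have A0 : 0 <= A by rewrite exprn_ge0// addr_ge0.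
  have B0 : 0 <= B by rewrite exprn_ge0// addr_ge0.
  rewrite [leRHS](_ : _ = `|Ker z| * (A * B * (L * (n.+1%:R^-1 * (1 + `|z|))))); last by ring.
  apply: ler_wpM2l => //; apply: ler_wpM2l; first exact: mulr_ge0.
  by apply: ler_wpM2l => //; apply: ler_wpM2l; [exact: ltW|rewrite lerDr].
(* Beyond this radius both x and v + x are outside the support of [phi]; within it 1 + |x| <= (1 +
   |N|) (1 + |z|), because |v| <= |z|. *)
have [xN|xN] := leP `|x| (`|N| + `|v|).
  apply: ler_pM; [exact: p0|exact: normr_ge0| |exact: LP].
  rewrite -exprMn lerXn2r ?nnegrE ?mulr_ge0 ?addr_ge0//.
  rewrite mulrDl mul1r mulrDr mulr1 -addrA lerD2l.
  by rewrite (le_trans xN)// addrC lerD// ?ler_wpDr// ?mulr_ge0//; rewrite (le_trans vz1)// lerDl mulr_ge0.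
have NN := ler_norm N.
rewrite (sN x) ?(sN (v + x)) ?subrr ?normr0 ?mulr0 ?mulr_ge0 ?exprn_ge0 ?addr_ge0//; apply/negP; rewrite -ltNge.
  by have := ler_normB (v + x) v; rewrite addrAC subrr add0r; lra.
by have := normr_ge0 v; lra.
Qed.
End Kernel.

(** * The integral of the inversion kernel *)

Section KernelMass.
Context {R : realType}.
Local Notation V := (R3 R).
Local Notation mu1 := (@lebesgue_measure R).
Local Notation ig1 f := (mu1.-integrable setT (EFin \o f)).
Local Notation I1 f := (Rintegral mu1 setT f).

Lemma Rintegral_even_FTC (f F : R -> R) (l : R) : (forall y, 0 <= f y) ->
  continuous f -> (forall y, f (- y) = f y) ->
  (forall y : R, 0 < y -> is_derive y 1 F (f y)) -> continuous F ->
  F y @[y --> +oo] --> l ->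
  ig1 f /\ I1 f = 2 * (l - F 0).
Proof.
move=> f0 cf fe dF cF Fl.
have E : (\int[mu1]_y (f y)%:E = (2 * (l - F 0))%:E)%E.
  rewrite ge0_symfun_integralT//; last by move=> y; rewrite /= fe.
  rewrite -set_itvcy (@ge0_continuous_FTC2y _ f F 0 l)//.
  - by move=> x; exact: continuous_subspaceT.
  - by move=> y y0; have [] := dF y y0.
  - by apply: cvg_at_right_filter; exact: cF.
  - by move=> y; rewrite in_itv/= andbT => y0; rewrite derive1E; have [_] := dF y y0.
split; last by rewrite /Rintegral E.
apply: integrable_EFin_ltey => //; first exact: continuous_measurable_fun.
by under eq_integral do rewrite ger0_norm//; rewrite E ltry.
Qed.

Definition ex1 (y : R) : R := expR (- `|y|).

Lemma ex1_ge0 y : 0 <= ex1 y. Proof. exact: expR_ge0. Qed.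

Lemma ex1_le1 y : ex1 y <= 1.
Proof. by rewrite /ex1 -expR0 ler_expR oppr_le0. Qed.

Lemma continuous_ex1 : continuous ex1.
Proof.
move=> y; rewrite /ex1; apply: (@continuous_comp R R R (fun y => - `|y|) expR).
  by apply: cvgN; exact: norm_continuous.
exact: continuous_expR.
Qed.

Lemma continuous_cosM (s c : R) : continuous (fun y : R => cos (s * y + c)).
Proof.
move=> y; apply: (@continuous_comp R R R (fun y => s * y + c) cos).
  by apply: cvgD; [apply: cvgM; [exact: cvg_cst|exact: cvg_id]|exact: cvg_cst].
exact: continuous_cos.
Qed.

Lemma continuous_cosl (s : R) : continuous (fun y : R => cos (s * y)).
Proof.
rewrite (_ : (fun y => _) = fun y => cos (s * y + 0)); first exact: continuous_cosM.
by apply/funext => y; rewrite addr0.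
Qed.

(** The summand 1 keeps the integrand nonnegative, as the fundamental theorem on a half-line
    requires; the case s = 0 then gives the integral of [ex1], and subtracting it leaves the cosine.
    [F] is an explicit antiderivative that vanishes at infinity. *)
Lemma Rintegral_oneDcos_ex1 (s : R) :
  ig1 (fun y => (1 + cos (s * y)) * ex1 y) /\
  I1 (fun y => (1 + cos (s * y)) * ex1 y) = 2 * (1 + (1 + s ^+ 2)^-1).
Proof.
have s2 : 1 + s ^+ 2 != 0 by rewrite gt_eqF// ltr_pwDl// sqr_ge0.
pose G y : R := (s * sin (s * y) - cos (s * y)) / (1 + s ^+ 2) - 1.
pose F y : R := expR (- y) * G y.
have dF (y : R) : is_derive y 1 F (expR (- y) * (1 + cos (s * y))).
  have dN : is_derive y 1 (fun y : R => expR (- y)) (- expR (- y)).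
    rewrite -mulrN1.
    exact: (@is_derive1_comp R expR -%R y (expR (- y)) (-1) (is_derive_expR _) (is_deriveNid y 1)).
  have dl : is_derive y 1 (fun y : R => s * y) s.
    by have := is_derive_mull s (is_derive_id y (1 : R)); rewrite mulr1.
  have dS : is_derive y 1 (fun y => sin (s * y)) (cos (s * y) * s).
    exact: (@is_derive1_comp R sin (fun y => s * y) y (cos (s * y)) s _ dl).
  have dC : is_derive y 1 (fun y => cos (s * y)) (- sin (s * y) * s).
    exact: (@is_derive1_comp R cos (fun y => s * y) y (- sin (s * y)) s _ dl).
  have dG : is_derive y 1 G (s * cos (s * y) * s / (1 + s ^+ 2) + sin (s * y) * s / (1 + s ^+ 2)).
    rewrite /G; under eq_fun do rewrite mulrC.
    have := is_deriveB (is_derive_mull (1 + s ^+ 2)^-1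
      (is_deriveB (is_derive_mull s dS) dC)) (is_derive_cst (1 : R) y (1 : R)).
    by move=> /is_derive_eq; apply; ring.
  have := is_derive_mul dN dG; move=> /is_derive_eq; apply; rewrite /G; field.
  by [].
have cF : continuous F.
  move=> y; apply/differentiable_continuous/derivable1_diffP.
  by have [] := dF y.
suff [i E] : ig1 (fun y => (1 + cos (s * y)) * ex1 y) /\
    I1 (fun y => (1 + cos (s * y)) * ex1 y) = 2 * (0 - F 0).
  by split => //; rewrite E /F /G oppr0 expR0 mulr0 sin0 cos0; field.
apply: Rintegral_even_FTC cF _.
- by move=> y; rewrite mulr_ge0 ?ex1_ge0// -lerBlDl sub0r cos_geN1.
- apply: continuous_mul; last exact: continuous_ex1.
  move=> y; apply: cvgD; first exact: cvg_cst.
  exact: continuous_cosl.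
- by move=> y; rewrite /ex1 mulrN cosN normrN.
- move=> y y0; rewrite mulrC /ex1 gtr0_norm//.
- pose B : R := (`|s| + 1) / (1 + s ^+ 2) + 1.
  have GB y : `|G y| <= B.
    rewrite /G (le_trans (ler_normB _ _))// normr1 lerD2r normrM.
    rewrite [X in _ * X]ger0_norm ?invr_ge0 ?addr_ge0 ?sqr_ge0//.
    rewrite ler_wpM2r ?invr_ge0 ?addr_ge0 ?sqr_ge0//.
    rewrite (le_trans (ler_normB _ _))// lerD//; last first.
      by rewrite ler_norml cos_geN1 cos_le1.
    by rewrite normrM ler_piMr// ler_norml sin_geN1 sin_le1.
  apply: (@squeeze_cvgr _ _ _ _ (fun y => - (expR (- y) * B)) (fun y => expR (- y) * B)).
  + near=> y; rewrite -ler_norml normrM (ger0_norm (expR_ge0 _)).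
    by rewrite ler_wpM2l// expR_ge0.
  + rewrite -oppr0 -(mul0r B); apply: cvgN; apply: cvgMl; exact: cvgr_expR.
  + by rewrite -(mul0r B); apply: cvgMl; exact: cvgr_expR.
Unshelve. all: by end_near. Qed.

Lemma Rintegral_ex1 : ig1 ex1 /\ I1 ex1 = 2.
Proof.
have [i E] := Rintegral_oneDcos_ex1 0.
have h : (fun y => (1 + cos (0 * y)) * ex1 y) = fun y => 2 * ex1 y.
  by apply/funext => y; rewrite mul0r cos0.
have i1 : ig1 ex1.
  move: i; rewrite h => i; have := integrable_EFinZ 2^-1 measurableT i.
  rewrite (_ : (fun x => 2^-1 * (2 * ex1 x)) = ex1)//.
  by apply/funext => x; rewrite mulKf ?pnatr_eq0.
split=> //; move: E; rewrite h RintegralZl//.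
by rewrite expr0n addr0 invr1; lra.
Qed.

Lemma ig1_cos_ex1 s c : ig1 (fun y => cos (s * y + c) * ex1 y).
Proof.
apply: (@integrable_EFin_le _ _ _ mu1 setT _ ex1) => //.
- apply: continuous_measurable_fun; apply: continuous_mul.
    exact: continuous_cosM.
  exact: continuous_ex1.
- by move=> y _; rewrite normrM (ger0_norm (ex1_ge0 y)) ler_piMl ?ex1_ge0// ler_norml cos_geN1 cos_le1.
- exact: Rintegral_ex1.1.
Qed.

Lemma Rintegral_cos_ex1 s : I1 (fun y => cos (s * y) * ex1 y) = 2 / (1 + s ^+ 2).
Proof.
have [_] := Rintegral_oneDcos_ex1 s; have [i E1] := Rintegral_ex1.
have ic : ig1 (fun y => cos (s * y) * ex1 y).
  by have := ig1_cos_ex1 s 0; under eq_fun do rewrite addr0.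
under eq_Rintegral do rewrite mulrDl mul1r.
rewrite RintegralD// E1; lra.
Qed.

Definition ex3 (x : V) : R := ex1 x.1.1 * ex1 x.1.2 * ex1 x.2.

Lemma ig1_sin_ex1 s : ig1 (fun y => sin (s * y) * ex1 y).
Proof. by have := ig1_cos_ex1 s (- (pi / 2)); under eq_fun do rewrite cosB_pihalf. Qed.

(** Oddness, used through the reflection x |-> -x of [leb3]: the integral is first multiplied by two
    further factors [ex1], each of integral 2. *)
Lemma Rintegral_sin_ex1 s : I1 (fun y => sin (s * y) * ex1 y) = 0.
Proof.
have [i E1] := Rintegral_ex1; have is_ := ig1_sin_ex1 s.
have [i3 E3] := Rintegral3_prod is_ i i.
have m0 : (-1 : R) != 0 by rewrite oppr_eq0 oner_eq0.
have [_] := I3_affine 0 m0 i3; rewrite normrN1 expr1n invr1 mul1r.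
rewrite [RHS]E3 E1 => E; apply: (mulIf (x := 4)); first by rewrite pnatr_eq0.
rewrite mul0r; suff: I1 (fun y => sin (s * y) * ex1 y) * 2 * 2 =
   - (I1 (fun y => sin (s * y) * ex1 y) * 2 * 2) by lra.
rewrite -[LHS]E -E1 -E3 -I3N//; apply: eq_I3 => x.
rewrite addr0 scaleN1r /= /ex1 !normrN mulrN sinN; ring.
Qed.

Lemma ig3_ex3 : ig3 ex3.
Proof. by have [i _] := Rintegral_ex1; exact: (Rintegral3_prod i i i).1. Qed.

Lemma I3_cos_ex3 (eta : V) : I3 (fun x => cos (dot x eta) * ex3 x) = 8 * wt eta.
Proof.
pose C j y := cos (xcoord eta j * y) * ex1 y.
pose S j y := sin (xcoord eta j * y) * ex1 y.
have iC j : ig1 (C j).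
  by have := ig1_cos_ex1 (xcoord eta j) 0; under eq_fun do rewrite addr0.
have iS j : ig1 (S j) by exact: ig1_sin_ex1.
have EC j : I1 (C j) = 2 / (1 + xcoord eta j ^+ 2) by exact: Rintegral_cos_ex1.
have ES j : I1 (S j) = 0 by exact: Rintegral_sin_ex1.
have [i1 E1] := Rintegral3_prod (iC 0) (iC 1) (iC 2%:R).
have [i2 E2] := Rintegral3_prod (iC 0) (iS 1) (iS 2%:R).
have [i3 E3] := Rintegral3_prod (iS 0) (iC 1) (iS 2%:R).
have [i4 E4] := Rintegral3_prod (iS 0) (iS 1) (iC 2%:R).
pose P (f g h : R -> R) (x : V) := f x.1.1 * g x.1.2 * h x.2.
transitivity (I3 (fun x => P (C 0) (C 1) (C 2%:R) x - P (C 0) (S 1) (S 2%:R) x -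
    P (S 0) (C 1) (S 2%:R) x - P (S 0) (S 1) (C 2%:R) x)).
  apply: eq_I3 => x; rewrite dotE (mulrC (xcoord x 0)) (mulrC (xcoord x 1)) (mulrC (xcoord x 2%:R)).
  by rewrite !cosD !sinD /P /C /S /ex3 /xcoord/=; ring.
rewrite I3B//; last by apply: ig3B => //; exact: ig3B.
rewrite I3B//; last exact: ig3B.
rewrite I3B// [I3 (P (C 0) (C 1) _)]E1 [I3 (P (C 0) (S 1) _)]E2.
rewrite [I3 (P (S 0) (C 1) _)]E3 [I3 (P (S 0) (S 1) _)]E4 !ES !EC /wt.
rewrite !(mulr0, mul0r) !subr0.
have p s : 1 + s ^+ 2 != 0 :> R by rewrite gt_eqF// ltr_pwDl// sqr_ge0.
rewrite /xcoord/=; field.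
by rewrite !p.
Qed.

Lemma continuous_ex3 : continuous ex3.
Proof.
have h j : continuous (fun x : V => ex1 (xcoord x j)).
  move=> x; apply: (@continuous_comp V R R (fun x => xcoord x j) ex1).
    exact: xcoord_continuous.
  exact: continuous_ex1.
rewrite (_ : ex3 = fun x => ex1 (xcoord x 0) * ex1 (xcoord x 1) * ex1 (xcoord x 2%:R))//.
by apply: continuous_mul; [apply: continuous_mul|].
Qed.

Lemma norm_chin_wt (M : R) n (x : V) : (forall y : V, `|chi y| <= M) ->
  `|chin n x * (8 * wt x)| <= M * 8 * wt x.
Proof.
move=> MP; rewrite (normrM (chin n x)) -mulrA (@ger0_norm _ (8 * wt x)).
  by apply: ler_wpM2r; [rewrite mulr_ge0// wt_ge0|exact: MP].
by rewrite mulr_ge0// wt_ge0.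
Qed.

(** Parseval's identity: Fubini moves the cosine kernel from [chi] to the dilated [ex3], whose
    transform is known, and rescaling passes the dilation on to [chi]. *)
Lemma I3_Ker_ex3 n : I3 (fun z : V => Ker z * ex3 (n.+1%:R^-1 *: z)) =
  I3 (fun eta => chin n eta * (8 * wt eta)).
Proof.
have n0 : (n.+1%:R : R) != 0 by rewrite pnatr_eq0.
have nV0 : (n.+1%:R^-1 : R) != 0 by rewrite invr_eq0.
have bchi := test_bcs (@test_chi R).
have iE : ig3 (fun z : V => ex3 (n.+1%:R^-1 *: z)).
  by have := (I3_affine 0 nV0 ig3_ex3).1; under eq_fun do rewrite addr0.
have e30 x : 0 <= ex3 x by rewrite !mulr_ge0 ?ex1_ge0.
pose F (p : V * V) : R := cos (dot p.1 p.2) * (chi p.1 * ex3 (n.+1%:R^-1 *: p.2)).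
have iF : ig6 F.
  apply: (@ig6_prod_le _ F (fun x => `|chi x|) (fun z : V => ex3 (n.+1%:R^-1 *: z))) => //.
  - apply: meas6M; first by apply: (meas6_comp (@measurable_cos R)); exact: meas6_dot.
    apply: meas6M; first exact: (meas6_fst bchi.1).
    exact: (meas6_snd (ig3_meas iE)).
  - move=> x y; have -> : `|chi x| * ex3 (n.+1%:R^-1 *: y) = `|chi x * ex3 (n.+1%:R^-1 *: y)|.
      by rewrite (normrM (chi x)) (ger0_norm (e30 (n.+1%:R^-1 *: y))).
    exact: norm_cos_le.
  - exact/ig3_norm/ig3_bcs.
have [F1 F2] := I6_fubini iF.
transitivity (I6 F).
  rewrite F2; apply: eq_I3 => z; rewrite /Ker TrE mulrC -I3Z; last first.
    by apply: ig3_bcs; exact: bcs_cos.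
  by apply: eq_I3 => x; rewrite /F/= addr0; ring.
rewrite F1.
have iw : ig3 (fun eta : V => chin n eta * (8 * wt eta)).
  have [M M0 MP] := @chi_bound R.
  apply: (@ig3_le _ _ (fun eta => (M * 8) * wt eta)).
  - apply: meas3M; first exact: (test_bcs (test_chin n)).1.
    by apply: meas3M; [exact: meas3_cst|exact: ig3_meas (@integrable_wt R)].
  - by move=> x; exact: norm_chin_wt.
  - by apply: ig3Z; exact: integrable_wt.
have [_ E] := I3_affine 0 n0 iw.
have i2 : ig3 (fun x : V => chin n (n.+1%:R *: x + 0) * (8 * wt (n.+1%:R *: x + 0))).
  exact: (I3_affine 0 n0 iw).1.
transitivity (n.+1%:R ^+ 3 * I3 (fun x : V => chin n (n.+1%:R *: x + 0) * (8 * wt (n.+1%:R *: x + 0)))).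
  rewrite -I3Z; last exact: i2.
  apply: eq_I3 => x; rewrite (addr0 (n.+1%:R *: x)).
  have -> : chin n (n.+1%:R *: x) = chi x.
    by rewrite /chin scalerA (mulVf n0) scale1r.
  rewrite -I3_cos_ex3.
  have ic : ig3 (fun y => cos (dot y (n.+1%:R *: x)) * ex3 y).
    apply: (@ig3_le _ _ ex3); last exact: ig3_ex3.
      apply: meas3M; last exact: ig3_meas ig3_ex3.
      apply: (meas3_comp (@measurable_cos R)); apply: continuous_meas3.
      exact: dot_continuousl.
    move=> y; rewrite normrM (ger0_norm (e30 y)) ler_piMl// ler_norml.
    by rewrite cos_geN1 cos_le1.
  have [ic2 Ec] := I3_affine 0 nV0 ic.
  rewrite (mulrCA _ (chi x)) (_ : n.+1%:R ^+ 3 = `|n.+1%:R^-1| ^- 3); last first.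
    by rewrite ger0_norm ?invr_ge0// exprVn invrK.
  rewrite -Ec -I3Z; last exact: ic2.
  apply: eq_I3 => z; rewrite /F (addr0 (n.+1%:R^-1 *: z)).
  by rewrite dotZl dotZr (mulrA n.+1%:R^-1) (mulVf n0) mul1r (dotC z x) mulrCA.
by rewrite E ger0_norm// mulrA mulfV ?expf_neq0// mul1r.
Qed.

(** In [I3_Ker_ex3] the dilated [ex3] tends to 1 and [chin n] tends to 1, so the two limits are the
    mass of [Ker] and 8 times the integral of [wt], that is 8 pi^3. This is where the constant of
    Fourier inversion comes from. *)
Lemma I3_Ker : I3 Ker = (2 * pi) ^+ 3 :> R.
Proof.
have l1 : I3 (fun z : V => Ker z * ex3 (n.+1%:R^-1 *: z)) @[n --> \oo] --> I3 (@Ker R).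
  have iK : ig3 (@Ker R) by exact: integrable_Ker.
  apply: (@I3_dominated _ (fun n (z : V) => Ker z * ex3 (n.+1%:R^-1 *: z)) (@Ker R) (fun z => `|Ker z|) _ _ _ _).2.
  - move=> n; apply: meas3M; first exact: ig3_meas.
    have := @continuous_shift_scale R n.+1%:R^-1 0 ex3 continuous_ex3.
    by move=> /continuous_meas3; under eq_fun do rewrite addr0.
  - move=> z; rewrite -[X in _ --> X]mulr1; apply: cvgMr.
    have := continuous_ex3; move=> /(_ (0 : V)).
    have e0 : ex3 0 = 1 by rewrite /ex3 /ex1 /= normr0 oppr0 expR0 !mulr1.
    rewrite /continuous_at e0.
    apply: (cvg_comp (fun n => n.+1%:R^-1 *: z) ex3).
    by rewrite -(scale0r z); apply: cvgZr_tmp; exact: cvg_harmonic.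
  - move=> n z; rewrite normrM ler_piMr// ger0_norm ?mulr_ge0 ?ex1_ge0//.
    by rewrite !mulr_ile1 ?mulr_ge0 ?ex1_ge0 ?ex1_le1.
  - exact: ig3_norm.
have l2 : I3 (fun eta => chin n eta * (8 * wt eta)) @[n --> \oo] --> I3 (fun eta : V => 8 * wt eta).
  have [M M0 MP] := @chi_bound R.
  apply: (@I3_dominated _ (fun n (z : V) => chin n z * (8 * wt z)) _ (fun eta => (M * 8) * wt eta) _ _ _ _).2.
  - move=> n; apply: meas3M; first exact: (test_bcs (test_chin n)).1.
    by apply: meas3M; [exact: meas3_cst|exact: ig3_meas (@integrable_wt R)].
  - move=> z; rewrite -[X in _ --> X]mul1r; apply: cvgMl; exact: cvg_chin.
  - by move=> n x; exact: norm_chin_wt.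
  - by apply: ig3Z; exact: integrable_wt.
rewrite (_ : (fun n => _) = fun n => I3 (fun eta : V => chin n eta * (8 * wt eta))) in l1; last first.
  by apply/funext => n; exact: I3_Ker_ex3.
rewrite (cvg_unique _ l1 l2)// I3Z; last exact: integrable_wt.
have [i E] := @integrable_oneDsqrV R.
have -> : I3 (@wt R) = pi * pi * pi.
  by have [_] := Rintegral3_prod i i i; rewrite E.
by rewrite exprMn; ring.
Qed.
End KernelMass.

(** * Density of the test functions *)

Section Density.
Context {R : realType}.
Local Notation V := (R3 R).
Local Notation M1 := (measurableTypeR R).
Local Notation M3 := (M1 * M1 * M1)%type.

(** The hypotheses of a monotone class argument: linear combinations, and bounded pointwise limits
    with a common compact support. *)
Definition bdd_closed (P : set (V -> R)) : Prop :=
  (forall a f g, bcs f -> bcs g -> P f -> P g -> P (fun x => a * f x + g x)) /\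
  forall (f_ : nat -> V -> R) (f : V -> R) (N M : R), (forall k, bcs (f_ k)) ->
    (forall k, P (f_ k)) -> (forall k x, `|f_ k x| <= M) ->
    (forall k, supported_in (cube N) (f_ k)) ->
    (forall x, f_ n x @[n --> \oo] --> f x) -> P f.

Lemma bcsD (a : R) f g : bcs f -> bcs g -> bcs (fun x => a * f x + g x).
Proof.
move=> [mf [N [M [fM fN]]]] [mg [N' [M' [gM gN]]]]; split.
  by apply: meas3D => //; apply: meas3M => //; exact: meas3_cst.
exists (Num.max N N'), (`|a| * M + M'); split=> [x|x].
  by rewrite (le_trans (ler_normD _ _))// lerD// normrM ler_wpM2l.
rewrite /cube/= => /negP; rewrite -ltNge gt_max => /andP[xN xN'].
by rewrite fN ?gN ?mulr0 ?addr0// /cube/=; apply/negP; rewrite -ltNge.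
Qed.

Lemma cvgR_unique (v : nat -> R) (a b : R) :
  v n @[n --> \oo] --> a -> v n @[n --> \oo] --> b -> a = b.
Proof. by move=> va vb; exact: (cvg_unique _ va vb). Qed.

Lemma cvgR_le (v : nat -> R) (a M : R) :
  v n @[n --> \oo] --> a -> (forall n, v n <= M) -> a <= M.
Proof.
by move=> va vM; apply: (ler_cvg_to va (@cvg_cst R M nat \oo _)); exact: nearW.
Qed.

Lemma cvg_bcs (f_ : nat -> V -> R) (f : V -> R) (N M : R) : (forall k, bcs (f_ k)) ->
  (forall k x, `|f_ k x| <= M) -> (forall k, supported_in (cube N) (f_ k)) ->
  (forall x, f_ n x @[n --> \oo] --> f x) -> bcs f.
Proof.
move=> bf fM fN ff; split.
  apply: (@measurable_fun_cvg _ M3 R setT f_) => //.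
  by move=> k; have [] := bf k.
exists N, M; split=> x.
  by apply: (cvgR_le (cvg_norm (ff x))) => n; exact: fM.
move=> xN; apply: (cvgR_unique (ff x)).
rewrite (_ : (fun _ => _) = cst 0); first exact: cvg_cst.
by apply/funext => n; exact: fN.
Qed.

Section Dynkin.
Context (P : set (V -> R)) (b : V -> R).
Context (Pc : bdd_closed P).
Context (bb : bcs b) (Pb : P b).

(** The sets [A] for which [b] times the indicator of [A], composed with [p], lies in [P] form a
    Dynkin system: complements come from differences, disjoint unions from bounded limits of finite
    sums. *)
Lemma dynkin_indic d (X : measurableType d) (G : set (set X)) (p : V -> X) :
  @measurable _ X = <<s G >> -> setI_closed G -> @measurable_fun _ _ M3 X setT p ->
  (forall A, G A -> P (fun x => b x * \1_A (p x))) ->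
  forall A, measurable A -> P (fun x => b x * \1_A (p x)).
Proof.
move=> mG GI mp PG.
have [mb [N [M [bM bN]]]] := bb.
have bi (A : set X) : measurable A -> bcs (fun x => b x * \1_A (p x)).
  move=> mA; split.
    by apply: meas3M => //; apply: measurableT_comp => //; exact: measurable_indic.
  exists N, M; split=> [x|x /bN ->]; last by rewrite mul0r.
  rewrite normrM (le_trans _ (bM x))// ler_piMr// indicE.
  by case: (_ \in _); rewrite ?normr1 ?normr0.
have bM1 (A : set X) x : `|b x * \1_A (p x)| <= M.
  rewrite normrM (le_trans _ (bM x))// ler_piMr// indicE.
  by case: (_ \in _); rewrite ?normr1 ?normr0.
rewrite mG; apply: (@dynkin_induction _ X G (fun A => P (fun x => b x * \1_A (p x)))) => //.
- rewrite (_ : (fun _ => _) = b)//.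
  by apply/funext => x; rewrite indicT mulr1.
- move=> A mA PA; rewrite (_ : (fun _ => _) =
    fun x => -1 * (b x * \1_A (p x)) + b x); first by apply: Pc.1 => //; exact: bi.
  apply/funext => x; rewrite !indicE in_setC; case: (_ \in _) => /=; ring.
- move=> F mF tF PF.
  pose U k := \big[setU/set0]_(i < k) F i.
  have mU k : measurable (U k) by apply: bigsetU_measurable.
  have PU k : P (fun x => b x * \1_(U k) (p x)).
    elim: k => [|k IH].
      rewrite (_ : (fun _ => _) = fun x => -1 * b x + b x); first exact: Pc.1.
      by apply/funext => x; rewrite /U big_ord0 indic0 mulr0 mulN1r addNr.
    rewrite (_ : (fun _ => _) = fun x => 1 * (b x * \1_(U k) (p x)) + b x * \1_(F k) (p x)).
      by apply: Pc.1 => //; exact: bi.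
    apply/funext => x; rewrite mul1r -mulrDr /U big_ord_recr/= !indicE in_setU.
    have [xU|] := boolP (p x \in _); have [xF|] := boolP (p x \in F k) => //=;
      rewrite ?addr0 ?add0r//.
    exfalso; move: xU xF; rewrite !inE -bigcup_mkord => -[j /= jk Fj] Fk.
    have /trivIsetP/(_ j k I I) := tF; rewrite ltn_eqF// => /(_ isT).
    by rewrite -subset0 => /(_ (p x)); apply.
  apply: (Pc.2 (fun k x => b x * \1_(U k) (p x)) _ N M) => //.
  + by move=> k; exact: bi.
  + by move=> k x /bN ->; rewrite mul0r.
  + move=> x; apply: cvgMr; rewrite [X in _ --> X]indicE.
    have [|xF] := boolP (p x \in _).
      rewrite inE => -[k _ Fk]; apply: cvg_near_cst; exists k.+1 => // n /= kn.
      by rewrite indicE mem_set// /U -bigcup_mkord; exists k.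
    rewrite (_ : (fun _ => _) = cst 0); first exact: cvg_cst.
    apply/funext => n; rewrite indicE memNset//= /U -bigcup_mkord => -[k _ Fk].
    by move: xF; rewrite notin_setE; apply; exists k.
Qed.
End Dynkin.

(** The sum counts the positive integers up to [y], so it is the integer part of [y]. *)
Lemma sum_le_trunc (K : nat) (y : R) : 0 <= y <= K%:R ->
  y - 1 <= \sum_(i < K) (i.+1%:R <= y)%R%:R <= y.
Proof.
have full (k : nat) : k%:R <= y -> \sum_(i < k) (i.+1%:R <= y)%R%:R = k%:R :> R.
  move=> ky; rewrite (eq_bigr (fun=> 1)) ?sumr_const ?card_ord// => i _.
  by rewrite (le_trans _ ky)// ler_nat.
elim: K => [|K IH] /andP[y0 yK].
  by rewrite big_ord0 y0 andbT; move: yK; lra.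
have [Ky|yK1] := leP K.+1%:R y.
  by rewrite full//; move: yK Ky; lra.
rewrite big_ord_recr/= [K.+1%:R <= y]leNgt yK1/= addr0.
have [|Ky] := leP y K%:R; first by move=> yK'; apply: IH; rewrite y0.
by rewrite full ?ltW//; move: yK1; rewrite -natr1; lra.
Qed.

Definition box (a b x : V) : R := (a.1.1 < x.1.1 < b.1.1)%R%:R *
  (a.1.2 < x.1.2 < b.1.2)%R%:R * (a.2 < x.2 < b.2)%R%:R.

Lemma box_out (a b : V) : supported_in (cube (Num.max `|a| `|b|)) (box a b).
Proof.
move=> x /negP; rewrite -ltNge => xN; have E := @cvgR_unique (fun n => bump3 n a b x) (box a b x) 0 (@cvg_bump3 R a b x).
apply: E; rewrite (_ : (fun _ => _) = cst 0); first exact: cvg_cst.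
by apply/funext => n; apply: bump3_out xN; rewrite le_max lexx ?orbT.
Qed.

Lemma bcs_box a b : bcs (box a b).
Proof.
apply: (@cvg_bcs (fun n => bump3 n a b) _ (Num.max `|a| `|b|) 1).
- by move=> k; apply: test_bcs; exact: test_bump3.
- by move=> k x; rewrite ger0_norm ?bump3_ge0 ?bump3_le1.
- move=> k x /negP; rewrite -ltNge => xN; apply: bump3_out xN; by rewrite le_max lexx ?orbT.
- by move=> x; exact: cvg_bump3.
Qed.

Lemma box_le1 a b x : `|box a b x| <= 1.
Proof.
by rewrite /box; case: (_ < x.1.1 < _)%R; case: (_ < x.1.2 < _)%R; case: (_ < x.2 < _)%R;
  rewrite ?(mulr0, mul0r, mulr1) ?normr0 ?normr1.
Qed.

Lemma bcsD0 (a : R) f : bcs f -> bcs (fun x => a * f x).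
Proof.
move=> bf; have := bcsD (a - 1) bf bf.
rewrite (_ : (fun _ => _) = fun x => a * f x)//.
by apply/funext => x; ring.
Qed.

(** Open boxes are bounded limits of test functions, Dynkin's argument passes from boxes to
    measurable sets, and [w] is a uniform limit of averages of indicators of its superlevel sets. *)
Lemma bcs_density (P : set (V -> R)) : bdd_closed P ->
  (forall f, test f -> P f) -> forall w, bcs w -> P w.
Proof.
move=> Pc Pt.
have Pbox a b : P (box a b).
  apply: (Pc.2 (fun n => bump3 n a b) _ (Num.max `|a| `|b|) 1).
  - by move=> k; apply: test_bcs; exact: test_bump3.
  - by move=> k; apply: Pt; exact: test_bump3.
  - by move=> k x; rewrite ger0_norm ?bump3_ge0 ?bump3_le1.
  - move=> k x /negP; rewrite -ltNge => xN; apply: bump3_out xN; by rewrite le_max lexx ?orbT.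
  - by move=> x; exact: cvg_bump3.
have bi (w : V -> R) d (X : measurableType d) (p : V -> X) A : bcs w ->
    @measurable_fun _ _ M3 X setT p -> measurable A -> bcs (fun x => w x * \1_A (p x)).
  move=> [mw [N [M [wM wN]]]] mp mA; split.
    by apply: meas3M => //; apply: measurableT_comp => //; exact: measurable_indic.
  exists N, M; split=> [x|x /wN ->]; last by rewrite mul0r.
  rewrite normrM (le_trans _ (wM x))// ler_piMr// indicE.
  by case: (_ \in _); rewrite ?normr1 ?normr0.
have mR : @measurable _ M1 = <<s (@RGenOInfty.G R)>> by exact: RGenOInfty.measurableE.
have GI : setI_closed (@RGenOInfty.G R).
  move=> _ _ [x ->] [y ->]; exists (Num.max x y).
  by apply/seteqP; split => z /=; rewrite !in_itv/= !andbT gt_max => /andP.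
have m1 : @measurable_fun _ _ M3 M1 setT (fun x : V => x.1.1) by exact: (meas3_xcoord 0).
have m2 : @measurable_fun _ _ M3 M1 setT (fun x : V => x.1.2) by exact: (meas3_xcoord 1).
have m3 : @measurable_fun _ _ M3 M1 setT (fun x : V => x.2) by exact: (meas3_xcoord 2%:R).
(* Cutting a box by a half-line in one coordinate gives a box again, so the class is known on the
   generators of the sigma-algebra of the line. *)
have oI (c d e z : R) : (c < z < d)%R%:R * \1_(`]e, +oo[%classic) z =
    (Num.max c e < z < d)%R%:R :> R.
  rewrite indicE mem_setE in_itv/= andbT gt_max -natrM mulnb.
  by rewrite [in RHS]andbAC.
(* [s1] to [s3] treat the coordinates one at a time; [s4] and [s5] pass from rectangles to the two
   product sigma-algebras. *)
have s1 (A : set M1) a b : measurable A -> P (fun x => box a b x * \1_A x.1.1).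
  move: A; apply: (dynkin_indic Pc (bcs_box a b) (Pbox a b) mR GI m1) => _ [e ->].
  rewrite (_ : (fun _ => _) = box (Num.max a.1.1 e, a.1.2, a.2) b) => [|]; first exact: Pbox.
  by apply/funext => x; rewrite /box/= -oI; ring.
have s2 (A B : set M1) a b : measurable A -> measurable B ->
    P (fun x => (box a b x * \1_A x.1.1) * \1_B x.1.2).
  move=> mA; move: B; apply: (dynkin_indic Pc _ (s1 A a b mA) mR GI m2) => [|_ [e ->]].
    by apply: (bi) => //; exact: bcs_box.
  rewrite (_ : (fun _ => _) = fun x => box (a.1.1, Num.max a.1.2 e, a.2) b x * \1_A x.1.1); first exact: s1.
  by apply/funext => x; rewrite /box/= -oI; ring.
have s3 (A B C : set M1) a b : measurable A -> measurable B -> measurable C ->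
    P (fun x => (box a b x * \1_A x.1.1) * \1_B x.1.2 * \1_C x.2).
  move=> mA mB; move: C; apply: (dynkin_indic Pc _ (s2 A B a b mA mB) mR GI m3) => [|_ [e ->]].
    by apply: (bi) => //; apply: (bi) => //; exact: bcs_box.
  rewrite (_ : (fun _ => _) = fun x => box (a.1.1, a.1.2, Num.max a.2 e) b x * \1_A x.1.1 * \1_B x.1.2); first exact: s2.
  by apply/funext => x; rewrite /box/= -oI; ring.
have rectI d1 d2 (X : measurableType d1) (Y : measurableType d2) :
    setI_closed [set A `*` B | A in @measurable _ X & B in @measurable _ Y].
  move=> _ _ [A mA [B mB <-]] [A' mA' [B' mB' <-]]; rewrite -setXI.
  by exists (A `&` A'); [exact: measurableI|exists (B `&` B') => //; exact: measurableI].
have indicX d1 d2 (X : measurableType d1) (Y : measurableType d2) (A : set X) (B : set Y) z :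
    \1_(A `*` B) z = \1_A z.1 * \1_B z.2 :> R.
  by rewrite !indicE in_setX -natrM mulnb.
have s4 (E : set (M1 * M1)) (C : set M1) a b : measurable E -> measurable C ->
    P (fun x => (box a b x * \1_C x.2) * \1_E x.1).
  move=> mE mC; move: E mE.
  have PC : P (fun x => box a b x * \1_C x.2).
    have := s3 setT setT C a b measurableT measurableT mC.
    by rewrite (_ : (fun _ => _) = fun x => box a b x * \1_C x.2)//; apply/funext => x; rewrite indicT !mulr1.
  have bC : bcs (fun x => box a b x * \1_C x.2) by apply: (bi) => //; exact: bcs_box.
  apply: (dynkin_indic Pc bC PC (@measurable_prod_measurableType _ _ M1 M1) (@rectI _ _ M1 M1)).
    exact: (@measurable_fst _ _ (M1 * M1)%type M1).
  move=> _ [A mA [B mB <-]].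
  rewrite (_ : (fun _ => _) = fun x => box a b x * \1_A x.1.1 * \1_B x.1.2 * \1_C x.2); first exact: s3.
  by apply/funext => x; rewrite indicX; ring.
have s5 (E : set M3) a b : measurable E -> P (fun x => box a b x * \1_E x).
  move: E; apply: (dynkin_indic Pc (bcs_box a b) (Pbox a b) (@measurable_prod_measurableType _ _ (M1 * M1)%type M1) (@rectI _ _ (M1 * M1)%type M1)).
    exact: measurable_id.
  move=> _ [A mA [C mC <-]].
  rewrite (_ : (fun _ => _) = fun x => box a b x * \1_C x.2 * \1_A x.1); first exact: s4.
  by apply/funext => x; rewrite indicX; ring.
move=> w [mw [N [M [wM wN]]]].
(* The box from -c to c contains the support of [w]; the margin 1 is there because boxes are
   open. *)
pose c : V := ((`|N| + 1, `|N| + 1), `|N| + 1).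
have M0 : 0 <= M by rewrite (le_trans _ (wM 0)).
have boxw x : box (- c) c x * w x = w x.
  have [xN|xN] := pselect (cube N x); last by rewrite wN ?mulr0.
  suff -> : box (- c) c x = 1 by rewrite mul1r.
  have h (s : R) : `|s| <= N -> (- (`|N| + 1) < s < `|N| + 1) = true.
    have := ler_norm N => NN; rewrite ler_norml => /andP[? ?]; apply/andP; split; lra.
  move: xN; rewrite /cube/= norm3_le => /and3P[x1 x2 x3].
  by rewrite /box/= !h// !mulr1.
(* The function (w + M) (n + 1) takes values in [0, 2 M (n + 1)] and [S n] is its integer part, so
   [S n] divided by n + 1 is within 1/(n + 1) of w + M. *)
pose K n := (Num.trunc (2 * M * n.+1%:R)).+1.
pose A n i : set V := [set x | i.+1%:R <= (w x + M) * n.+1%:R].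
pose S n x : R := \sum_(i < K n) \1_(A n i) x.
have mA n i : @measurable _ M3 (A n i).
  rewrite (_ : A n i = setT `&` (fun x => (w x + M) * n.+1%:R) @^-1` `[i.+1%:R, +oo[).
    apply: (_ : meas3 _) => //; apply: meas3M; last exact: meas3_cst.
    by apply: meas3D => //; exact: meas3_cst.
  by rewrite setTI; apply/seteqP; split => x; rewrite /A/= in_itv/= andbT.
have SE n x : `|n.+1%:R^-1 * S n x - (w x + M)| <= n.+1%:R^-1.
  have n0 : 0 < n.+1%:R :> R by [].
  have : 0 <= (w x + M) * n.+1%:R <= (K n)%:R.
    have := wM x; rewrite ler_norml => /andP[w1 w2]; apply/andP; split.
      by rewrite mulr_ge0// ; lra.
    apply: ltW; apply: le_lt_trans (truncnS_gt _); rewrite ler_wpM2r//; lra.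
  move=> /sum_le_trunc /andP[S1 S2].
  have -> : n.+1%:R^-1 * S n x - (w x + M) = n.+1%:R^-1 * (S n x - (w x + M) * n.+1%:R).
    by rewrite mulrBr mulrCA mulVf ?gt_eqF// mulr1.
  rewrite normrM ger0_norm ?invr_ge0// ler_piMr ?invr_ge0//.
  have -> : S n x = \sum_(i < K n) (i.+1%:R <= (w x + M) * n.+1%:R)%R%:R.
    by apply: eq_bigr => i _; rewrite indicE mem_setE.
  by rewrite ler_norml; apply/andP; split; lra.
have bS n m : bcs (fun x => box (- c) c x * \sum_(i < m) \1_(A n i) x) /\
    P (fun x => box (- c) c x * \sum_(i < m) \1_(A n i) x).
  elim: m => [|m [IH1 IH2]].
    rewrite (_ : (fun _ => _) = fun x => -1 * box (- c) c x + box (- c) c x); last first.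
      by apply/funext => x; rewrite big_ord0 mulr0 mulN1r addNr.
    by split; [apply: bcsD|apply: Pc.1]; (try exact: bcs_box); exact: Pbox.
  rewrite (_ : (fun _ => _) = fun x => 1 * (box (- c) c x * \sum_(i < m) \1_(A n i) x) +
      box (- c) c x * \1_(A n m) x); last first.
    by apply/funext => x; rewrite big_ord_recr/= mul1r mulrDr.
  have bA : bcs (fun x => box (- c) c x * \1_(A n m) x).
    apply: (@bi _ _ M3 id); [exact: bcs_box|exact: measurable_id|exact: mA].
  by split; [exact: bcsD|apply: Pc.1 => //; exact: s5].
apply: (Pc.2 (fun n x => n.+1%:R^-1 * (box (- c) c x * S n x) + - M * box (- c) c x) _ `|c| (M + 1)).
- by move=> n; apply: bcsD; [exact: (bS _ _).1|apply: bcsD0; exact: bcs_box].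
- move=> n; apply: Pc.1; [exact: (bS _ _).1|exact: bcsD0 (bcs_box _ _)|exact: (bS _ _).2|].
  have := Pc.1 (- M - 1) _ _ (bcs_box (- c) c) (bcs_box (- c) c) (Pbox _ _) (Pbox _ _).
  rewrite (_ : (fun _ => _) = fun x => - M * box (- c) c x)//.
  by apply/funext => x; ring.
- move=> n x.
  rewrite (_ : _ + _ = box (- c) c x * (n.+1%:R^-1 * S n x - M)); last by ring.
  rewrite normrM -[leRHS]mul1r ler_pM// ?box_le1//.
  have := SE n x; have : n.+1%:R^-1 <= 1 :> R by rewrite invf_le1 ?ler1n.
  move: (n.+1%:R^-1 * S n x) => y; move: n.+1%:R^-1 => q.
  by have := wM x; rewrite !ler_norml => /andP[? ?] ? /andP[? ?]; apply/andP; split; lra.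
- move=> n x xc; rewrite box_out ?mul0r ?mulr0 ?addr0//.
  by rewrite normrN maxxx.
- move=> x; rewrite -{1}boxw.
  rewrite (_ : (fun _ => _) = fun n => box (- c) c x * (n.+1%:R^-1 * S n x - M)); last first.
    by apply/funext => n; ring.
  apply: cvgMr; rewrite -(addrK M (w x)); apply: cvgB; last exact: cvg_cst.
  apply: (@squeeze_cvgr _ _ _ _ (fun n => (w x + M) - n.+1%:R^-1) (fun n => (w x + M) + n.+1%:R^-1)).
  + near=> n; have := SE n x; move: (n.+1%:R^-1 * S n x) => y; move: n.+1%:R^-1 => q.
    by rewrite ler_norml => /andP[? ?]; apply/andP; split; lra.
  + rewrite -[X in _ --> X]subr0; apply: cvgB; [exact: cvg_cst|exact: cvg_harmonic].
  + rewrite -[X in _ --> X]addr0; apply: cvgD; [exact: cvg_cst|exact: cvg_harmonic].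
Unshelve. all: by end_near. Qed.
End Density.

(** * Fourier transforms of tempered distributions *)

Section Fourier.
Context {R : realType}.
Local Notation V := (R3 R).
Local Notation M1 := (measurableTypeR R).
Local Notation M3 := (M1 * M1 * M1)%type.
Local Notation mu3 := (@leb3 R).

Local Notation aeq P := {ae mu3, forall x, P x}.

Lemma aeS (P Q : V -> Prop) : (forall x, P x -> Q x) -> aeq P -> aeq Q.
Proof.
move=> PQ [N [mN N0 NP]]; exists N; split=> // x /= nQ; apply: NP => /= Px.
by apply: nQ; exact: PQ.
Qed.

Lemma aeI (P Q : V -> Prop) : aeq P -> aeq Q -> aeq (fun x => P x /\ Q x).
Proof.
move=> P0 Q0; have [N [mN N0 NP]] := @negligibleU _ M3 R mu3 _ _ P0 Q0.
exists N; split=> // x /= nPQ; apply: NP => /=.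
by apply/not_andP; exact: nPQ.
Qed.

(** Local integrability tested against bounded functions of compact support instead of compact sets,
    the form in which it is paired. *)
Definition loc3 (h : V -> R) : Prop := meas3 h /\ forall w, bcs w -> ig3 (fun x => h x * w x).

Lemma loc3P h : locally_integrable3 h -> loc3 h.
Proof.
move=> [mh hK]; split=> // w [mw [N [M [wM wN]]]].
have iK : mu3.-integrable (cube N) (EFin \o h) by apply: hK; exact: compact_cube.
have iK1 : ig3 (fun x => `|h x| * \1_(cube N) x).
  have := (@integrable_mkcond _ M3 R mu3 (cube N) (EFin \o h) (@measurable_cube R N)).1 iK.
  move=> /integrable_abse; rewrite /ig3; congr (integrable _ _ _); apply/funext => x.
  rewrite /= patchE indicE; case: (_ \in _) => /=; first by rewrite mulr1.
  by rewrite mulr0 normr0.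
apply: (@ig3_le _ _ (fun x => M * (`|h x| * \1_(cube N) x))); last exact: ig3Z.
  exact: meas3M.
move=> x; have [xN|xN] := pselect (cube N x).
  by rewrite indicE mem_set// mulr1 normrM mulrC ler_wpM2r.
by rewrite wN// mulr0 normr0 indicE memNset// !mulr0.
Qed.

Lemma loc3B h k : loc3 h -> loc3 k -> loc3 (fun x => h x - k x).
Proof.
move=> [mh ih] [mk ik]; split; first exact: meas3B.
move=> w bw; rewrite (_ : (fun _ => _) = fun x => h x * w x - k x * w x).
  by apply: ig3B; [exact: ih|exact: ik].
by apply/funext => x; rewrite mulrBl.
Qed.

Lemma aeq_ig3_0 f : ig3 f -> I3 (fun x => `|f x|) = 0 -> aeq (fun x => f x = 0).
Proof.
move=> fi f0.
have := (@ae_eq_integral_abs _ M3 R mu3 setT measurableT (EFin \o f) _).1.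
have mf : measurable_fun setT (EFin \o f) by apply/measurable_EFinP; exact: ig3_meas.
move=> /(_ mf) [|N [mN N0 NP]].
  by rewrite (_ : (fun _ => _) = fun x => (`|f x|)%:E)// I3E ?f0//; exact: ig3_norm.
exists N; split => // x /= fx; apply: NP => /= H; apply: fx.
by have [] := H I.
Qed.

Lemma measurable_sg : measurable_fun setT (@Num.sg R).
Proof.
rewrite (_ : Num.sg = fun y : R => \1_(`]0, +oo[%classic) y - \1_(`]-oo, 0[%classic) y).
  by apply: measurable_funB; apply: measurable_indic; exact: measurable_itv.
apply/funext => y; rewrite !indicE !mem_setE !in_itv/= andbT.
by case: sgrP => y0; rewrite ?subr0 ?sub0r.
Qed.

(** By density the integral against every bounded function of compact support is 0; the sign of [h]
    on a cube is such a function, so |h| has integral 0 on each cube. *)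
Lemma loc3_eq0 h : loc3 h -> (forall phi, test phi -> I3 (fun x => h x * phi x) = 0) ->
  aeq (fun x => h x = 0).
Proof.
move=> [mh ih] h0.
have H : forall w, bcs w -> I3 (fun x => h x * w x) = 0.
  apply: (@bcs_density R (fun w => I3 (fun x => h x * w x) = 0)) => //; split.
    move=> a f g bf bg f0 g0.
    rewrite (_ : (fun _ => _) = fun x => a * (h x * f x) + h x * g x); last first.
      by apply/funext => x; ring.
    rewrite I3D; [|by apply: ig3Z; exact: ih|exact: ih].
    by rewrite I3Z ?f0 ?g0 ?mulr0 ?addr0//; exact: ih.
  move=> f_ f N M bf f0 fM fN ff.
  have [] := @I3_dominated R (fun n x => h x * f_ n x) (fun x => h x * f x)
    (fun x => M * (`|h x| * \1_(cube N) x)).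
  - by move=> n; apply: meas3M => //; have [] := bf n.
  - by move=> x; apply: cvgMr; exact: ff.
  - move=> n x; have [xN|xN] := pselect (cube N x).
      by rewrite indicE mem_set// mulr1 normrM mulrC ler_wpM2r.
    by rewrite fN// mulr0 normr0 indicE memNset// !mulr0.
  - apply: ig3Z.
    have bc : bcs (\1_(cube N) : V -> R).
      split; first by apply: measurable_indic; exact: measurable_cube.
      exists N, 1; split => [x|x xN]; rewrite indicE; first by case: (_ \in _); rewrite ?normr1 ?normr0.
      by rewrite memNset.
    have := ig3_norm (ih _ bc); congr ig3; apply/funext => x.
    by rewrite normrM (ger0_norm (_ : 0 <= \1_(cube N) x))// indicE ler0n.
  move=> _ c; apply: (cvgR_unique c).
  rewrite (_ : (fun _ => _) = cst 0); first exact: cvg_cst.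
  by apply/funext => n; exact: f0.
have : aeq (fun x => forall n, h x * \1_(cube n%:R) x = 0).
  apply: ae_foralln => n.
  have bc : bcs (fun x => Num.sg (h x) * \1_(cube n%:R) x).
    split; first apply: meas3M.
    - by apply: meas3_comp => //; exact: measurable_sg.
    - by apply: measurable_indic; exact: measurable_cube.
    exists n%:R, 1; split => [x|x xN]; rewrite indicE; last by rewrite memNset// mulr0.
    by rewrite normrM normr_sg; case: (_ == _); case: (_ \in _); rewrite /= ?(mulr0, mulr1, normr0, normr1).
  have E : (fun x => h x * (Num.sg (h x) * \1_(cube n%:R) x)) =
      fun x => `|h x * \1_(cube n%:R) x|.
    apply/funext => x; rewrite mulrA [h x * _]mulrC -normrEsg normrM; congr (_ * _).
    by rewrite indicE; case: (_ \in _); rewrite ?normr1 ?normr0.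
  have bc1 : bcs (\1_(cube n%:R) : V -> R).
    split; first by apply: measurable_indic; exact: measurable_cube.
    exists n%:R, 1; split => [x|x xN]; rewrite indicE; first by case: (_ \in _); rewrite ?normr1 ?normr0.
    by rewrite memNset.
  apply: aeq_ig3_0; first exact: ih.
  by rewrite -E; exact: H.
apply: aeS => x /(_ (Num.trunc `|x|).+1); rewrite indicE mem_set ?mulr1//.
by rewrite /cube/= ltW// truncnS_gt.
Qed.

Lemma fourierE (phi : V -> R) (xi : V) : test phi -> complex.Re (fourier phi xi) = Tr 0 phi xi /\
  complex.Im (fourier phi xi) = - Tr (- (pi / 2)) phi xi.
Proof.
move=> tphi; rewrite /fourier /cintegral /=; split.
  apply: eq_I3 => x; rewrite /cexp /= mulr0 subr0 cosN addr0//.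
rewrite TrE -I3N; last by apply: ig3_bcs; apply: bcs_cos; exact: test_bcs.
by apply: eq_I3 => x; rewrite /cexp /= mulr0 add0r sinN cosB_pihalf mulNr.
Qed.

(** The kernel exp(-i x.xi) puts a minus sign before the sine part; it is pulled out of [f] by
    linearity on Schwartz functions, which also gives f 0 = 0. *)
Lemma fourier_functionE f g : tempered f -> fourier_function f g ->
  [/\ loc3 (fun x => complex.Re (g x)), loc3 (fun x => complex.Im (g x)) &
  forall phi, test phi -> f (Tr 0 phi) = I3 (fun x => complex.Re (g x) * phi x) /\
    f (Tr (- (pi / 2)) phi) = - I3 (fun x => complex.Im (g x) * phi x)].
Proof.
move=> [lf _] [l1 l2 H]; split; [exact: loc3P|exact: loc3P|move=> phi tphi].
have := H phi tphi; rewrite /cpair /cintegral => -[].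
have -> : (fun x => complex.Re (fourier phi x)) = Tr 0 phi.
  by apply/funext => x; have [] := fourierE x tphi.
have -> : (fun x => complex.Im (fourier phi x)) = fun x => - Tr (- (pi / 2)) phi x.
  by apply/funext => x; have [] := fourierE x tphi.
move=> -> E; split.
  by apply: eq_I3 => x; case: (g x) => a b /=; rewrite mulr0 subr0.
have E' : f (fun x => - Tr (- (pi / 2)) phi x) = I3 (fun x => complex.Im (g x) * phi x).
  by rewrite E; apply: eq_I3 => x; case: (g x) => a b /=; rewrite mulr0 add0r.
have sT := schwartz_Tr (- (pi / 2)) tphi.
have s0 : schwartz (fun _ : V => 0 : R).
  have := schwartzZ 0 sT; congr schwartz; apply/funext => x; rewrite mul0r//.
have f0 : f (fun=> 0) = 0.
  have := lf 1 _ _ s0 s0; under [X in f X]eq_fun do rewrite mulr0 addr0.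
  by move=> h; lra.
have := lf (-1) _ _ sT s0.
rewrite f0 addr0 mulN1r -E' => h; apply: oppr_inj; rewrite -h opprK.
by congr (f _); apply/funext => x; rewrite addr0 mulN1r.
Qed.
Lemma fhatP (f : functional V) : (exists g, fourier_function f g) ->
  fourier_function f (fhat f).
Proof.
by move=> [g fg]; rewrite /fhat; exact: (@xgetPex _ (fun=> 0) [set g | fourier_function f g] (ex_intro _ g fg)).
Qed.

(** The definition of the transform evaluates [f] only at transforms of test functions, which are
    Schwartz. This identifies the norms of [u0] and of [u 0], functionals that need not coincide
    elsewhere. *)
Lemma eq_fhat (f f' : functional V) : (forall phi, schwartz phi -> f phi = f' phi) ->
  fhat f = fhat f'.
Proof.
move=> ff'; rewrite /fhat; congr xget; apply/seteqP.
suff H (k k' : functional V) (g : V -> R[i]) : (forall phi, schwartz phi -> k phi = k' phi) ->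
    fourier_function k g -> fourier_function k' g.
  by split=> g /=; apply: H => // phi sphi; rewrite ff'.
move=> kk' [l1 l2 H]; split=> // phi tphi; rewrite -H// /cpair.
have sc a : schwartz (Tr a phi) by exact: schwartz_Tr.
congr (_ +i* _)%C.
  rewrite (_ : (fun x => complex.Re _) = Tr 0 phi) ?kk'//.
  by apply/funext => x; have [] := fourierE x tphi.
rewrite (_ : (fun x => complex.Im _) = fun x => -1 * Tr (- (pi / 2)) phi x) ?kk'//.
  exact: schwartzZ.
by apply/funext => x; have [_ ->] := fourierE x tphi; rewrite mulN1r.
Qed.

Lemma cintegralE (g : V -> R[i]) (phi : V -> R) :
  cintegral (fun xi => g xi * (phi xi)%:C)%C =
  (I3 (fun x => complex.Re (g x) * phi x) +i* I3 (fun x => complex.Im (g x) * phi x))%C.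
Proof.
rewrite /cintegral; congr (_ +i* _)%C; apply: eq_I3 => x; case: (g x) => a b /=.
  by rewrite mulr0 subr0.
by rewrite mulr0 add0r.
Qed.

Lemma fourier_function_unique (f : functional V) (g g' : V -> R[i]) :
  fourier_function f g -> fourier_function f g' -> aeq (fun x => g x = g' x).
Proof.
move=> [r1 i1 H1] [r2 i2 H2].
have E phi : test phi ->
    I3 (fun x => complex.Re (g x) * phi x) = I3 (fun x => complex.Re (g' x) * phi x) /\
    I3 (fun x => complex.Im (g x) * phi x) = I3 (fun x => complex.Im (g' x) * phi x).
  by move=> tphi; have := H1 _ tphi; rewrite (H2 _ tphi) !cintegralE => -[-> ->].
have lR := loc3B (loc3P r1) (loc3P r2); have lI := loc3B (loc3P i1) (loc3P i2).
have B (h k : V -> R) phi : test phi -> loc3 h -> loc3 k ->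
    I3 (fun x => h x * phi x) = I3 (fun x => k x * phi x) ->
    I3 (fun x => (h x - k x) * phi x) = 0.
  move=> tphi [_ ih] [_ ik] hk; under eq_I3 do rewrite mulrBl.
  rewrite I3B ?hk ?subrr//; [apply: ih|apply: ik]; exact: test_bcs.
have aR := loc3_eq0 lR (fun phi t => B _ _ _ t (loc3P r1) (loc3P r2) (E phi t).1).
have aI := loc3_eq0 lI (fun phi t => B _ _ _ t (loc3P i1) (loc3P i2) (E phi t).2).
apply: aeS (aeI aR aI) => x [/eqP]; rewrite subr_eq0 => /eqP h1 /eqP.
by rewrite subr_eq0 => /eqP h2; apply/eqP; rewrite eq_complex h1 h2 !eqxx.
Qed.

Lemma locally_integrable3B (h k : V -> R) : locally_integrable3 h ->
  locally_integrable3 k -> locally_integrable3 (fun x => h x - k x).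
Proof.
move=> [mh ih] [mk ik]; split; first exact: meas3B.
move=> K cK; have mK := compact_measurable3 cK.
by apply: (integrable_EFinB mK); [exact: ih|exact: ik].
Qed.

Lemma fourier_functionB (f f' : functional V) (g g' : V -> R[i]) :
  fourier_function f g -> fourier_function f' g' ->
  fourier_function (f - f') (fun x => g x - g' x).
Proof.
move=> [r1 i1 H1] [r2 i2 H2]; split.
- by have := locally_integrable3B r1 r2; congr locally_integrable3; apply/funext => x;
    case: (g x); case: (g' x).
- by have := locally_integrable3B i1 i2; congr locally_integrable3; apply/funext => x;
    case: (g x); case: (g' x).
move=> phi tphi; have := H1 _ tphi; have := H2 _ tphi.
have b := test_bcs tphi.
rewrite !cintegralE /cpair => -[e1 e2] [e3 e4]; rewrite /GRing.opp/= /GRing.add/=.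
rewrite e1 e2 e3 e4 -!I3B; try by [apply: (loc3P r1).2|apply: (loc3P r2).2|apply: (loc3P i1).2|apply: (loc3P i2).2].
by congr (_ +i* _)%C; apply: eq_I3 => x; case: (g x); case: (g' x) => a b' c d /=; rewrite mulrBl.
Qed.

Lemma fhatB (f f' : functional V) :
  (exists g, fourier_function f g) -> (exists g, fourier_function f' g) ->
  aeq (fun x => fhat (f - f') x = fhat f x - fhat f' x).
Proof.
move=> ef ef'; have h := fourier_functionB (fhatP ef) (fhatP ef').
apply: (fourier_function_unique _ h); apply: fhatP; eexists; exact: h.
Qed.
End Fourier.

(** * Inversion formulas for elements of the spaces chi *)

Section Inversion.
Context {R : realType}.
Local Notation V := (R3 R).
Local Notation M1 := (measurableTypeR R).
Local Notation M3 := (M1 * M1 * M1)%type.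
Local Notation mu3 := (@leb3 R).

Local Notation aeq P := {ae mu3, forall x, P x}.
Local Notation "'Cf' w" := (Tr 0 w) (at level 10, w at level 8).
Local Notation "'Sf' w" := (Tr (- (pi / 2)) w) (at level 10, w at level 8).

Implicit Types (phi w a b k : V -> R) (f : functional V).

(* The real and imaginary parts of the Fourier transform of an element of chi^(-1)
   satisfy this. *)
Definition wig (a : V -> R) : Prop := meas3 a /\ ig3 (fun x => (1 + `|x|)^-1 * `|a x|).

Lemma wig_mul_ig3 a k (M : R) : wig a -> meas3 k ->
  (forall x, `|k x| <= M * (1 + `|x|)^-1) -> ig3 (fun x => a x * k x).
Proof.
move=> [ma ia] mk kM; apply: (@ig3_le _ _ (fun x => M * ((1 + `|x|)^-1 * `|a x|))).
- exact: meas3M.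
- by move=> x; rewrite normrM mulrC mulrA ler_wpM2r.
- exact: ig3Z.
Qed.

Lemma Tr_bound1 c phi : test phi -> exists M : R,
  forall x, `|Tr c phi x| <= M * (1 + `|x|)^-1.
Proof.
move=> tphi; have [M MP] := Tr_decay c 1 tphi; exists M => x.
by rewrite ler_pdivlMr ?ltr_pwDl// mulrC -[X in X * _]expr1; exact: MP.
Qed.

Lemma meas3_Tr c phi : test phi -> meas3 (Tr c phi).
Proof. by move=> tphi; apply: continuous_meas3; apply: continuous_Tr; exact: test_bcs. Qed.

Lemma wig_Tr a c phi : wig a -> test phi -> ig3 (fun x => a x * Tr c phi x).
Proof.
move=> wa tphi; have [M MP] := Tr_bound1 c tphi.
by apply: (wig_mul_ig3 wa _ MP); exact: meas3_Tr.
Qed.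

Lemma chin_bound : exists2 M : R, 0 <= M & forall n x, `|chin n x| <= M.
Proof. by have [M M0 MP] := @chi_bound R; exists M => // n x; exact: MP. Qed.

Lemma wig_chin_cvg a c phi : wig a -> test phi ->
  I3 (fun x => a x * (chin n x * Tr c phi x)) @[n --> \oo] -->
  I3 (fun x => a x * Tr c phi x).
Proof.
move=> wa tphi; have [M MP] := Tr_bound1 c tphi; have [M' M'0 MP'] := chin_bound.
have mT := meas3_Tr c tphi.
apply: (@I3_dominated _ (fun n x => a x * (chin n x * Tr c phi x)) _
  (fun x => (M' * M) * ((1 + `|x|)^-1 * `|a x|)) _ _ _ _).2.
- move=> n; apply: meas3M; first exact: wa.1.
  by apply: meas3M => //; exact: (test_bcs (test_chin n)).1.
- move=> x; apply: cvgMr; rewrite -[X in _ --> X]mul1r; apply: cvgMl; exact: cvg_chin.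
- move=> n x; rewrite (normrM (a x)) (normrM (chin n x)) [leRHS](_ : _ = `|a x| * (M' * (M * (1 + `|x|)^-1))); last by ring.
  by rewrite ler_wpM2l// ler_pM.
- by apply: ig3Z; exact: wa.2.
Qed.

Lemma test_chinTr n c phi : test phi -> test (fun xi => chin n xi * Tr c phi xi).
Proof.
move=> tphi; rewrite (_ : (fun _ => _) = fun xi => Tr c phi xi * chin n xi).
  apply: testM; [apply: smooth_Tr; exact: test_bcs|exact: test_chin].
by apply/funext => xi; rewrite mulrC.
Qed.

Lemma Tn_schwartz n phi : test phi -> schwartz (Tn n phi).
Proof.
move=> tphi; rewrite (_ : Tn n phi = fun x => Tr 0 (fun xi => chin n xi * Tr 0 phi xi) x +
  Tr (- (pi / 2)) (fun xi => chin n xi * Tr (- (pi / 2)) phi xi) x).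
  by apply: schwartzD; apply: schwartz_Tr; exact: test_chinTr.
by apply/funext => x; rewrite TnE.
Qed.

(** [Tn n phi] tends to (2 pi)^3 phi in every Schwartz seminorm, at the rate 1/(n + 1); continuity
    of [f] at 0 is applied to the difference. The factor 2^m compares the Euclidean norm with the
    sup norm. *)
Lemma tempered_Tn f phi : tempered f -> test phi ->
  f (Tn n phi) @[n --> \oo] --> (2 * pi) ^+ 3 * f phi.
Proof.
move=> [lf cf] tphi; have sphi := test_schwartz tphi.
set K := (2 * pi) ^+ 3.
have sD n : schwartz (fun x => - K * phi x + Tn n phi x).
  by apply: schwartzD; [exact: schwartzZ|exact: Tn_schwartz].
have E n : f (fun x => - K * phi x + Tn n phi x) = - K * f phi + f (Tn n phi).
  by apply: lf => //; exact: Tn_schwartz.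
have c0 : (fun n => f (fun x => - K * phi x + Tn n phi x)) @ \oo --> (0 : R).
  apply: cf => // vs m e e0.
  have [C CP] := Tn_cvg_bound m (test_iter_derive vs tphi).
  have cvC : 2 ^+ m * C * n.+1%:R^-1 @[n --> \oo] --> (0 : R).
    by rewrite -[X in _ --> X](mulr0 (2 ^+ m * C)); apply: cvgMr; exact: cvg_harmonic.
  have : \forall n \near \oo, `|2 ^+ m * C * n.+1%:R^-1| <= e by exact: cvgr0_norm_le.
  apply: filterS => n Hn x.
  rewrite iter_deriveD; [|by apply: smoothZ; exact: tphi.1|by have [] := Tn_schwartz n tphi].
  rewrite iter_deriveZ ?iter_derive_Tn//; last exact: tphi.1.
  apply: le_trans Hn; apply: le_trans (ler_norm _).
  have := CP n x; rewrite I3_Ker -/K => H.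
  rewrite -mulrA; apply: le_trans (ler_wpM2l _ H); last by rewrite exprn_ge0.
  rewrite [_ + Tn n _ x]addrC mulNr mulrA -exprMn ler_wpM2r//.
  rewrite lerXn2r ?nnegrE ?mulr_ge0 ?addr_ge0 ?enorm_ge0//.
  by have := enorm_le_norm x; have := normr_ge0 x; lra.
have : K * f phi + f (fun x => - K * phi x + Tn n phi x) @[n --> \oo] --> K * f phi + 0.
  by apply: cvgD => //; exact: cvg_cst.
rewrite addr0 (_ : (fun n => K * f phi + _) = fun n => f (Tn n phi))//.
by apply/funext => n; rewrite E; ring.
Qed.

(* [a + i b] is the Fourier transform of [f]. *)
Definition fpair (f : functional V) (a b : V -> R) : Prop := [/\ tempered f, wig a, wig b &
  forall phi, test phi -> f (Cf phi) = I3 (fun x => a x * phi x) /\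
    f (Sf phi) = - I3 (fun x => b x * phi x)].

(** Each half of the regularised inversion formula is the transform of a test function, so [f] acts
    on it through [a] or [b]; then n tends to infinity. The second identity expresses that [f] is
    real and comes from [Tn_sin]. *)
Lemma fpair_inversion f a b phi : fpair f a b -> test phi ->
  (2 * pi) ^+ 3 * f phi = I3 (fun x => a x * Cf phi x - b x * Sf phi x) /\
  I3 (fun x => a x * Sf phi x + b x * Cf phi x) = 0.
Proof.
move=> [tf wa wb H] tphi; split.
  apply: (cvgR_unique (tempered_Tn tf tphi)).
  rewrite I3B; [|exact: wig_Tr|exact: wig_Tr].
  rewrite (_ : (fun n => _) = fun n => I3 (fun x => a x * (chin n x * Cf phi x)) -
      I3 (fun x => b x * (chin n x * Sf phi x))).
    by apply: cvgB; exact: wig_chin_cvg.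
  apply/funext => n; have t0 := test_chinTr n 0 tphi; have t1 := test_chinTr n (- (pi / 2)) tphi.
  rewrite -(H _ t0).1 -(H _ t1).2.
  have := tf.1 1 _ _ (schwartz_Tr 0 t0) (schwartz_Tr (- (pi / 2)) t1).
  rewrite mul1r => <-; congr f.
  by apply/funext => x; rewrite mul1r; exact: esym (TnE n x tphi).
have c1 : I3 (fun x => a x * (chin n x * Sf phi x)) + I3 (fun x => b x * (chin n x * Cf phi x))
    @[n --> \oo] --> I3 (fun x => a x * Sf phi x) + I3 (fun x => b x * Cf phi x).
  by apply: cvgD; exact: wig_chin_cvg.
rewrite I3D; [|exact: wig_Tr|exact: wig_Tr].
apply: (cvgR_unique c1).
rewrite (_ : (fun n => _) = cst 0); first exact: cvg_cst.
apply/funext => n; have t0 := test_chinTr n 0 tphi; have t1 := test_chinTr n (- (pi / 2)) tphi.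
rewrite -(H _ t1).1; apply/eqP; rewrite addr_eq0 -(H _ t0).2.
have -> : Cf (fun xi => chin n xi * Sf phi xi) = Sf (fun xi => chin n xi * Cf phi xi).
  by apply/funext => x; exact: (Tn_sin n x tphi).
by [].
Qed.

Lemma continuous_Tr_ig3 c a : ig3 a -> continuous (Tr c a).
Proof.
move=> ia; apply: (@continuous_Rintegral R _ M3 mu3 V (fun x y => cos (dot y x + c) * a y)
  (fun y => `|a y|)).
- move=> x; apply: meas3M; last exact: ig3_meas.
  apply: (meas3_comp (@measurable_cos R)); apply: meas3D; last exact: meas3_cst.
  by apply: continuous_meas3; exact: dot_continuousl.
- move=> y; apply: continuous_mul; last by move=> ?; exact: cvg_cst.
  move=> x; have := smooth_continuous (smooth_cos_dot y c).
  by move=> /(_ x); under eq_fun do rewrite dotC; rewrite /continuous_at dotC.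
- by move=> x y; exact: norm_cos_le.
- exact: ig3_norm.
Qed.

Lemma ig3_cosM c a (x : V) : ig3 a -> ig3 (fun y => cos (dot y x + c) * a y).
Proof.
move=> ia; apply: (@ig3_le _ _ (fun y => `|a y|)); last exact: ig3_norm.
  apply: meas3M; last exact: ig3_meas.
  apply: (meas3_comp (@measurable_cos R)); apply: meas3D; last exact: meas3_cst.
  by apply: continuous_meas3; exact: dot_continuousl.
by move=> y; exact: norm_cos_le.
Qed.

Lemma I3_Tr_swap c a w : ig3 a -> ig3 w ->
  [/\ ig3 (fun x => a x * Tr c w x), ig3 (fun x => Tr c a x * w x) &
  I3 (fun x => a x * Tr c w x) = I3 (fun x => Tr c a x * w x)].
Proof.
move=> ia iw.
pose F (z : V * V) := cos (dot z.1 z.2 + c) * (a z.1 * w z.2).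
have iF : ig6 F.
  apply: (@ig6_prod_le _ F (fun x => `|a x|) (fun x => `|w x|)) => //.
  - apply: meas6M.
      apply: (meas6_comp (@measurable_cos R)); apply: meas6D; first exact: meas6_dot.
      exact: (meas6_fst (meas3_cst c)).
    by apply: meas6M; [exact: meas6_fst (ig3_meas ia)|exact: meas6_snd (ig3_meas iw)].
  - move=> x y; rewrite -normrM; exact: norm_cos_le.
  - exact: ig3_norm.
  - exact: ig3_norm.
have [E1 E2] := I6_fubini iF; have [j1 j2] := ig6_fubini iF.
have F1 : (fun x => I3 (fun y => F (x, y))) = fun x => a x * Tr c w x.
  apply/funext => x; rewrite TrE -I3Z; last exact: ig3_cosM.
  by apply: eq_I3 => y; rewrite /F/= (dotC x y) mulrCA.
have F2 : (fun y => I3 (fun x => F (x, y))) = fun x => Tr c a x * w x.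
  apply/funext => x; rewrite TrE mulrC -I3Z; last exact: ig3_cosM.
  by apply: eq_I3 => y; rewrite /F/= mulrA mulrC.
by rewrite -F1 -F2 -E1 -E2.
Qed.

Lemma loc3_locally_integrable (h : V -> R) : loc3 h -> locally_integrable3 h.
Proof.
move=> [mh ih]; split=> // K cK; have mK := compact_measurable3 cK.
have [N KN] := compact_sub_cube cK.
have bK : bcs (\1_K : V -> R).
  split; first exact: measurable_indic.
  exists N, 1; split => [x|x xN]; rewrite indicE; first by case: (_ \in _); rewrite ?normr1 ?normr0.
  by rewrite memNset// => /KN.
apply: (@integrable_mkcond _ M3 R mu3 K (EFin \o h) mK).2.
have := ih _ bK; rewrite /ig3; congr (integrable _ _ _); apply/funext => x.
by rewrite /= patchE indicE; case: (_ \in _) => /=; rewrite ?mulr1 ?mulr0.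
Qed.

Lemma loc3_bounded_continuous (h : V -> R) : continuous h -> loc3 h.
Proof.
move=> ch; split; first exact: continuous_meas3.
by move=> w bw; apply: ig3_bcs; exact: bcsM.
Qed.

Lemma function_ofP f (h : V -> R) : continuous h ->
  (forall phi, test phi -> f phi = I3 (fun x => h x * phi x)) ->
  aeq (fun x => function_of f x = h x).
Proof.
move=> ch fh; have lh := loc3_bounded_continuous ch.
pose S := [set h | locally_integrable3 h /\
    forall phi, test_function setT phi ->
      f phi = Rintegral mu3 setT (fun x => h x * phi x)].
have Sh : S h by split; [exact: loc3_locally_integrable|exact: fh].
have [l E] := @xgetPex _ (fun=> 0) S (ex_intro _ h Sh).
suff H : forall phi, test phi -> I3 (fun x => (function_of f x - h x) * phi x) = 0.
  by apply: aeS (loc3_eq0 (loc3B (loc3P l) lh) H) => x /eqP; rewrite subr_eq0 => /eqP.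
move=> phi tphi; under eq_I3 do rewrite mulrBl.
have b := test_bcs tphi.
rewrite I3B; [|exact: (loc3P l).2|exact: lh.2].
by rewrite -fh// -[X in X - _]E// subrr.
Qed.

(** For an integrable transform, Fubini moves the kernel from [phi] to [a] and [b], which exhibits a
    continuous function representing [f]. The second equation says that the imaginary part of the
    inverse transform is 0. *)
Lemma function_of_inversion f a b : fpair f a b -> ig3 a -> ig3 b ->
  aeq (fun x => (2 * pi) ^+ 3 * function_of f x = Cf a x - Sf b x /\ Sf a x + Cf b x = 0).
Proof.
move=> fab ia ib; apply: aeI.
  have K0 : (2 * pi) ^+ 3 != 0 :> R by rewrite expf_neq0// mulf_neq0// gt_eqF// pi_gt0.
  have ch : continuous (fun x => ((2 * pi) ^+ 3)^-1 * (Cf a x - Sf b x)).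
    apply: (@continuous_mul _ _ (fun=> _)); first by move=> ?; exact: cvg_cst.
    by move=> x; apply: cvgB; exact: continuous_Tr_ig3.
  suff H phi : test phi -> f phi = I3 (fun x => ((2 * pi) ^+ 3)^-1 * (Cf a x - Sf b x) * phi x).
    by apply: aeS (function_ofP ch H) => x ->; rewrite mulrA mulfV// mul1r.
  move=> tphi; apply: (mulfI K0); rewrite (fpair_inversion fab tphi).1.
  have iphi := ig3_test tphi.
  have [i1 j1 e1] := I3_Tr_swap 0 ia iphi; have [i2 j2 e2] := I3_Tr_swap (- (pi / 2)) ib iphi.
  have E : (fun x => ((2 * pi) ^+ 3)^-1 * (Cf a x - Sf b x) * phi x) =
      fun x => ((2 * pi) ^+ 3)^-1 * (Cf a x * phi x - Sf b x * phi x).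
    by apply/funext => x; rewrite -mulrA mulrBl.
  by rewrite E I3Z; [rewrite mulrA mulfV// mul1r I3B// e1 e2 -I3B|exact: ig3B].
have cs : continuous (fun x => Sf a x + Cf b x).
  by move=> x; apply: cvgD; exact: continuous_Tr_ig3.
apply: (loc3_eq0 (loc3_bounded_continuous cs)) => phi tphi.
rewrite -[RHS](fpair_inversion fab tphi).2; have iphi := ig3_test tphi.
have [i1 j1 e1] := I3_Tr_swap (- (pi / 2)) ia iphi; have [i2 j2 e2] := I3_Tr_swap 0 ib iphi.
rewrite I3D// e1 e2 -I3D//; apply: eq_I3 => x; exact: mulrDl.
Qed.
End Inversion.

(** * Vector fields in frequency space *)

Section ComplexVectors.
Context {R : realType}.
Local Notation C := R[i].
Local Notation V := (R3 R).
Implicit Types (z w : 'I_3 -> C) (c : C).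
Local Notation normc := (@Normc.normc R).
Local Notation re := (@complex.Re R).
Local Notation im := (@complex.Im R).
Local Notation cn := (@cnorm3 R).

Lemma reD c c' : re (c + c') = re c + re c'. Proof. by case: c; case: c'. Qed.
Lemma imD c c' : im (c + c') = im c + im c'. Proof. by case: c; case: c'. Qed.
Lemma reB c c' : re (c - c') = re c - re c'. Proof. by case: c; case: c'. Qed.
Lemma imB c c' : im (c - c') = im c - im c'. Proof. by case: c; case: c'. Qed.
Lemma reM c c' : re (c * c') = re c * re c' - im c * im c'.
Proof. by case: c; case: c'. Qed.
Lemma imM c c' : im (c * c') = re c * im c' + im c * re c'.
Proof. by case: c => a b; case: c' => a' b' /=. Qed.
Lemma reZ (a : R) c : re (a%:C%C * c) = a * re c.
Proof. by rewrite reM /= mul0r subr0. Qed.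

Lemma normc_sqrtE c : normc c = Num.sqrt (re c ^+ 2 + im c ^+ 2). Proof. by case: c. Qed.
Lemma normc_ge0 c : 0 <= normc c. Proof. by rewrite normc_sqrtE sqrtr_ge0. Qed.
Lemma normcD_le c c' : normc (c + c') <= normc c + normc c'.
Proof. exact: (@le_normcD R c c'). Qed.
Lemma sqr_normcE c : normc c ^+ 2 = re c ^+ 2 + im c ^+ 2.
Proof. by rewrite normc_sqrtE sqr_sqrtr// addr_ge0// sqr_ge0. Qed.
Lemma normr_re_le c : `|re c| <= normc c.
Proof. by rewrite -sqrtr_sqr normc_sqrtE ler_wsqrtr// lerDl sqr_ge0. Qed.
Lemma normr_im_le c : `|im c| <= normc c.
Proof. by rewrite -sqrtr_sqr normc_sqrtE ler_wsqrtr// lerDr sqr_ge0. Qed.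
Lemma normc_le c : normc c <= `|re c| + `|im c|.
Proof.
rewrite -(@ger0_norm _ (_ + _)) ?addr_ge0// -sqrtr_sqr normc_sqrtE ler_wsqrtr// sqrrD.
by rewrite !real_normK ?num_real// addrAC lerDl mulrn_wge0// mulr_ge0.
Qed.
Lemma normc_real (a : R) : normc a%:C%C = `|a|.
Proof. by rewrite normc_sqrtE/= expr0n/= addr0 sqrtr_sqr. Qed.

Lemma cauchy3 (x y : 'I_3 -> R) :
  \sum_(j < 3) x j * y j <= Num.sqrt (\sum_(j < 3) x j ^+ 2) * Num.sqrt (\sum_(j < 3) y j ^+ 2).
Proof.
have p (v : 'I_3 -> R) : 0 <= \sum_(j < 3) v j ^+ 2 by apply: sumr_ge0 => j _; exact: sqr_ge0.
rewrite -sqrtrM ?p// (le_trans (ler_norm _))// -sqrtr_sqr ler_wsqrtr//.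
rewrite !sum3E; move: (x 0) (x 1) (x 2%:R) (y 0) (y 1) (y 2%:R) => a b c d e f.
(* Lagrange's identity. *)
rewrite -subr_ge0 [leRHS](_ : _ = (a * e - b * d) ^+ 2 + (a * f - c * d) ^+ 2 + (b * f - c * e) ^+ 2); last by ring.
by rewrite !addr_ge0 ?sqr_ge0.
Qed.

Lemma cn_ge0 z : 0 <= cn z. Proof. exact: sqrtr_ge0. Qed.

Lemma sqr_cn z : cn z ^+ 2 = \sum_(j < 3) normc (z j) ^+ 2.
Proof. by rewrite sqr_sqrtr// sumr_ge0// => j _; rewrite exprn_ge0 ?normc_ge0. Qed.

Lemma normc_le_cn z j : normc (z j) <= cn z.
Proof.
rewrite -(@ger0_norm _ (normc (z j))) ?normc_ge0// -sqrtr_sqr ler_wsqrtr//.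
rewrite (bigD1 j)//= lerDl sumr_ge0// => k _; exact: sqr_ge0.
Qed.

Lemma cn_le_sum z : cn z <= \sum_(j < 3) normc (z j).
Proof.
rewrite -(@ger0_norm _ (\sum_(j < 3) _)) ?sumr_ge0//; last by move=> j _; exact: normc_ge0.
rewrite -sqrtr_sqr ler_wsqrtr// !sum3E.
have := normc_ge0 (z 0); have := normc_ge0 (z 1); have := normc_ge0 (z 2%:R).
move: (normc (z 0)) (normc (z 1)) (normc (z 2%:R)) => a b c; nra.
Qed.

(** Bilinear, without conjugation: the conjugate is put explicitly into the multipliers. *)
Definition cdot z w : C := \sum_(j < 3) z j * w j.

Lemma cdot_le z w : normc (cdot z w) <= cn z * cn w.
Proof.
apply: le_trans (cauchy3 (fun j => normc (z j)) (fun j => normc (w j))).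
rewrite /cdot !sum3E -!Normc.normcM (le_trans (normcD_le _ _))// lerD2r.
exact: normcD_le.
Qed.

Lemma cnD z w : cn (fun j => z j + w j) <= cn z + cn w.
Proof.
rewrite -(@ger0_norm _ (_ + _)) ?addr_ge0 ?cn_ge0// -sqrtr_sqr ler_wsqrtr//.
have H : \sum_(j < 3) normc (z j) * normc (w j) <= cn z * cn w.
  exact: cauchy3 (fun j => normc (z j)) (fun j => normc (w j)).
rewrite sqrrD !sqr_cn.
apply: (@le_trans _ _ (\sum_(j < 3) (normc (z j) + normc (w j)) ^+ 2)).
  by apply: ler_sum => j _; rewrite lerXn2r ?nnegrE ?addr_ge0 ?normc_ge0 ?normcD_le.
by move: H; rewrite !sum3E; lra.
Qed.

Lemma cnN z : cn (fun j => - z j) = cn z.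
Proof. by rewrite /cnorm3; under eq_bigr do rewrite (@normcN R). Qed.

Lemma cnB z w : cn (fun j => z j - w j) <= cn z + cn w.
Proof. by rewrite -(cnN w); exact: cnD. Qed.

Lemma cnZ c z : cn (fun j => c * z j) = normc c * cn z.
Proof.
rewrite /cnorm3; under eq_bigr do rewrite Normc.normcM exprMn.
by rewrite -mulr_sumr sqrtrM ?sqr_ge0// sqrtr_sqr ger0_norm// normc_ge0.
Qed.

Lemma cn_dist z w : `|cn z - cn w| <= cn (fun j => z j - w j).
Proof.
have h z1 z2 : cn z1 - cn z2 <= cn (fun j => z1 j - z2 j).
  rewrite lerBlDr (le_trans _ (cnD _ _))//.
  by rewrite (_ : (fun _ => _) = z1)//; apply/funext => j; rewrite subrK.
rewrite ler_norml h andbT lerNl opprB (le_trans (h w z))// -cnN.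
by rewrite (_ : (fun j => - (w j - z j)) = fun j => z j - w j)//; apply/funext => j; rewrite opprB.
Qed.

Definition cvec (x : V) : 'I_3 -> C := fun j => (xcoord x j)%:C%C.

Lemma cn_cvec x : cn (cvec x) = enorm x.
Proof.
rewrite /cnorm3 /enorm /dot; congr Num.sqrt; apply: eq_bigr => j _.
by rewrite normc_real real_normK ?num_real// expr2.
Qed.

Lemma cdotDr z w w' : cdot z (fun j => w j + w' j) = cdot z w + cdot z w'.
Proof. by rewrite /cdot !sum3E; ring. Qed.
Lemma cdotBl z z' w : cdot (fun j => z j - z' j) w = cdot z w - cdot z' w.
Proof. by rewrite /cdot !sum3E; ring. Qed.
Lemma cdotZr c z w : cdot z (fun j => c * w j) = c * cdot z w.
Proof. by rewrite /cdot !sum3E; ring. Qed.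
Lemma cdotZl c z w : cdot (fun j => c * z j) w = c * cdot z w.
Proof. by rewrite /cdot !sum3E; ring. Qed.
End ComplexVectors.

Section ComplexMeasurable.
Context {R : realType} d {T : measurableType d}.
Local Notation C := R[i].
Implicit Types (f g : T -> C) (u v : T -> 'I_3 -> C).
Local Notation re := (@complex.Re R).
Local Notation im := (@complex.Im R).

Definition cmeas f : Prop :=
  measurable_fun setT (fun x => re (f x)) /\ measurable_fun setT (fun x => im (f x)).
Definition vmeas u : Prop := forall j, cmeas (fun x => u x j).

Lemma cmeas_cst c : cmeas (fun=> c).
Proof. by split; exact: measurable_cst. Qed.
Lemma cmeasD f g : cmeas f -> cmeas g -> cmeas (fun x => f x + g x).
Proof.
move=> [rf jf] [rg jg]; split.
  by under eq_fun do rewrite reD; exact: measurable_funD.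
by under eq_fun do rewrite imD; exact: measurable_funD.
Qed.
Lemma cmeasB f g : cmeas f -> cmeas g -> cmeas (fun x => f x - g x).
Proof.
move=> [rf jf] [rg jg]; split.
  by under eq_fun do rewrite reB; exact: measurable_funB.
by under eq_fun do rewrite imB; exact: measurable_funB.
Qed.
Lemma cmeasM f g : cmeas f -> cmeas g -> cmeas (fun x => f x * g x).
Proof.
move=> [rf jf] [rg jg]; split.
  by under eq_fun do rewrite reM; apply: measurable_funB; exact: measurable_funM.
by under eq_fun do rewrite imM; apply: measurable_funD; exact: measurable_funM.
Qed.
Lemma cmeas_real (h : T -> R) : measurable_fun setT h -> cmeas (fun x => (h x)%:C%C).
Proof. by move=> mh; split=> //=; exact: measurable_cst. Qed.
Lemma cmeas_normc f : cmeas f -> measurable_fun setT (fun x => Normc.normc (f x)).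
Proof.
move=> [rf jf]; under eq_fun do rewrite normc_sqrtE.
apply: (measurableT_comp (f := @Num.sqrt R)).
  by apply: continuous_measurable_fun; exact: sqrt_continuous.
by apply: measurable_funD; apply: measurable_funX.
Qed.
Lemma cmeas_dot u v : vmeas u -> vmeas v -> cmeas (fun x => cdot (u x) (v x)).
Proof.
move=> mu mv; rewrite (_ : (fun _ => _) = fun x => u x 0 * v x 0 + u x 1 * v x 1 + u x 2%:R * v x 2%:R).
  by apply: cmeasD; [apply: cmeasD|]; apply: cmeasM; (try exact: mu); exact: mv.
by apply/funext => x; rewrite /cdot sum3E.
Qed.
Lemma vmeas_cn u : vmeas u -> measurable_fun setT (fun x => cnorm3 (u x)).
Proof.
move=> mu; rewrite /cnorm3; apply: (measurableT_comp (f := @Num.sqrt R)).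
  by apply: continuous_measurable_fun; exact: sqrt_continuous.
under eq_fun do rewrite sum3E.
have h j : measurable_fun setT (fun x => Normc.normc (u x j) ^+ 2).
  by apply: measurable_funX; exact: cmeas_normc.
by apply: measurable_funD; [apply: measurable_funD|].
Qed.
Lemma vmeasZ f u : cmeas f -> vmeas u -> vmeas (fun x j => f x * u x j).
Proof. by move=> mf mu j; exact: cmeasM. Qed.
Lemma vmeasB u v : vmeas u -> vmeas v -> vmeas (fun x j => u x j - v x j).
Proof. by move=> mu mv j; exact: cmeasB. Qed.
End ComplexMeasurable.

(** * Pairings of fields with multipliers and the convection form *)

Section Fields.
Context {R : realType}.
Local Notation V := (R3 R).
Local Notation M1 := (measurableTypeR R).
Local Notation M3 := (M1 * M1 * M1)%type.

Local Notation C := R[i].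
Local Notation re := (@complex.Re R).
Local Notation im := (@complex.Im R).
Local Notation cn := (@cnorm3 R).
Local Notation normc := (@Normc.normc R).
Local Notation field := (V -> 'I_3 -> C).
Implicit Types (g h m : field).

Lemma eq_ler (a b : R) : a = b -> a <= b. Proof. by move=> ->. Qed.

Lemma cvgR_dist (f_ e : nat -> R) (f : R) : (forall n, `|f_ n - f| <= e n) ->
  e n @[n --> \oo] --> 0 -> f_ n @[n --> \oo] --> f.
Proof.
move=> fe e0; apply: (@squeeze_cvgr _ _ _ _ (fun n => f - e n) (fun n => f + e n)).
- by apply: nearW => n; have := fe n; rewrite ler_norml => /andP[? ?]; apply/andP; split; lra.
- by rewrite -[X in _ --> X]subr0; apply: cvgB => //; exact: cvg_cst.
- by rewrite -[X in _ --> X]addr0; apply: cvgD => //; exact: cvg_cst.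
Qed.

Definition vm3 g : Prop := @vmeas R _ M3 g.
(** The weight is bounded at the origin and at most 2 |xi|^-1 elsewhere, so [nn] is controlled by
    the chi^(-1) norm; it is also exactly what a multiplier of decay 1 requires. *)
Definition wcn g (x : V) : R := (1 + `|x|)^-1 * cn (g x).
Definition fld g : Prop := vm3 g /\ ig3 (wcn g).
Definition nn g : R := I3 (wcn g).
Definition L1f g : Prop := vm3 g /\ ig3 (fun x => cn (g x)).
Definition n1 g : R := I3 (fun x => cn (g x)).
(* Multipliers of decay [k]; [Kf g m] and [Bf g h m] below are defined on [mlt 1]. *)
Definition mlt (k : nat) (M : R) m : Prop :=
  vm3 m /\ forall x, cn (m x) <= M * (1 + `|x|) ^- k.
Definition fsub g h : field := fun x j => g x j - h x j.
Definition flin (a : R) m m' : field := fun x j => a%:C%C * m x j + m' x j.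

Lemma w0 (x : V) : 0 < 1 + `|x|. Proof. by rewrite ltr_pwDl. Qed.
Lemma wV_le1 (x : V) k : 0 <= (1 + `|x|) ^- k <= 1.
Proof.
have w := w0 x; rewrite invr_ge0 exprn_ge0 ?(ltW w)//= invf_le1 ?exprn_gt0//.
by rewrite exprn_ege1// lerDl.
Qed.

Lemma meas3_wV k : meas3 (fun x : V => (1 + `|x|) ^- k).
Proof.
apply: continuous_meas3 => x; apply: cvgV; first by rewrite expf_neq0// gt_eqF// w0.
apply: (@continuous_comp V R R (fun x => 1 + `|x|) (fun r => r ^+ k)).
  by apply: (@cvgD _ R); [exact: cvg_cst|exact: norm_continuous].
exact: exprn_continuous.
Qed.

Lemma mltS k M m : mlt k.+1 M m -> mlt k M m.
Proof.
move=> [mm mM]; split=> // x; rewrite (le_trans (mM x))//.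
have M0 : 0 <= M.
  by have := le_trans (cn_ge0 _) (mM 0); rewrite pmulr_lge0.
have w := w0 x; rewrite ler_wpM2l// lef_pV2 ?posrE ?exprn_gt0//.
by rewrite exprS ler_peMl ?exprn_ge0 ?(ltW w)// lerDl.
Qed.

Lemma mlt_ge0 k M m : mlt k M m -> 0 <= M.
Proof.
by move=> [_ mM]; have := le_trans (cn_ge0 _) (mM 0); rewrite pmulr_lge0.
Qed.

Lemma vm3_cn g : vm3 g -> meas3 (fun x => cn (g x)).
Proof. exact: vmeas_cn. Qed.

Lemma wcn_ge0 g x : 0 <= wcn g x.
Proof. by rewrite mulr_ge0 ?cn_ge0// invr_ge0 (ltW (w0 x)). Qed.

Lemma L1f_fld g : L1f g -> fld g.
Proof.
move=> [mg ig]; split=> //; apply: (ig3_le _ _ ig) => [|x].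
  by apply: meas3M; [have := meas3_wV 1; under eq_fun do rewrite expr1|exact: vm3_cn].
rewrite (ger0_norm (wcn_ge0 g x)) /wcn ler_piMl ?cn_ge0//.
by have /andP[] := wV_le1 x 1; rewrite expr1.
Qed.

Lemma fld_sub g h : fld g -> fld h -> fld (fsub g h).
Proof.
move=> [mg ig] [mh ih]; have mgh : vm3 (fsub g h) by exact: vmeasB.
split=> //; apply: (ig3_le _ _ (ig3D ig ih)) => [|x].
  by apply: meas3M; [have := meas3_wV 1; under eq_fun do rewrite expr1|exact: vm3_cn].
rewrite (ger0_norm (wcn_ge0 _ x)) /wcn -mulrDr ler_wpM2l ?invr_ge0 ?(ltW (w0 x))//.
exact: cnB.
Qed.

Lemma L1f_sub g h : L1f g -> L1f h -> L1f (fsub g h).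
Proof.
move=> [mg ig] [mh ih]; have mgh : vm3 (fsub g h) by exact: vmeasB.
split=> //; apply: (ig3_le _ _ (ig3D ig ih)) => [|x]; first exact: vm3_cn.
by rewrite (ger0_norm (cn_ge0 _)); exact: cnB.
Qed.

(** For m = [qf phi] this is (2 pi)^3 times the value of the field on the test field [phi], by
    [Kf_qf]. *)
Definition Kf g m : R := I3 (fun x => re (cdot (g x) (m x))).

Lemma Kf_pt g m M x : mlt 1 M m -> `|re (cdot (g x) (m x))| <= M * wcn g x.
Proof.
move=> [_ mM]; rewrite (le_trans (normr_re_le _))// (le_trans (cdot_le _ _))//.
by rewrite /wcn mulrA mulrC ler_wpM2r ?cn_ge0//; have := mM x; rewrite expr1.
Qed.

Lemma Kf_ig g m M : fld g -> mlt 1 M m -> ig3 (fun x => re (cdot (g x) (m x))).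
Proof.
move=> [mg ig] mM; apply: (ig3_le _ _ (ig3Z M ig)) => [|x]; last exact: Kf_pt.
exact: (cmeas_dot mg mM.1).1.
Qed.

Lemma Kf_le g m M : fld g -> mlt 1 M m -> `|Kf g m| <= M * nn g.
Proof.
move=> fg mM; rewrite (le_trans (le_norm_I3 (Kf_ig fg mM)))// -I3Z; last exact: fg.2.
by apply: le_I3; [exact/ig3_norm/(Kf_ig fg mM)|exact: ig3Z fg.2|move=> x; exact: Kf_pt].
Qed.

Lemma Kf_diff g h m M : fld g -> fld h -> mlt 1 M m ->
  `|Kf g m - Kf h m| <= M * nn (fsub g h).
Proof.
move=> fg fh mM; rewrite /Kf -I3B; [|exact: Kf_ig mM|exact: Kf_ig mM].
rewrite (_ : (fun _ => _) = fun x => re (cdot (fsub g h x) (m x))).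
  by apply: Kf_le => //; exact: fld_sub.
by apply/funext => x; rewrite -reB -cdotBl.
Qed.

Lemma Kf_lin g a m m' M M' : fld g -> mlt 1 M m -> mlt 1 M' m' ->
  Kf g (flin a m m') = a * Kf g m + Kf g m'.
Proof.
move=> fg mM mM'; rewrite /Kf -I3Z; last exact: Kf_ig mM.
rewrite -I3D; [|by apply: ig3Z; exact: Kf_ig mM|exact: Kf_ig mM'].
by apply: eq_I3 => x; rewrite /flin cdotDr reD cdotZr reZ.
Qed.

Definition pcvg (m_ : nat -> field) m : Prop :=
  forall x, cn (fun j => m_ n x j - m x j) @[n --> \oo] --> 0.

Lemma pcvg_dot (m_ : nat -> field) m x (z : 'I_3 -> C) : pcvg m_ m ->
  re (cdot z (m_ n x)) @[n --> \oo] --> re (cdot z (m x)).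
Proof.
move=> mc; apply: (@cvgR_dist _ (fun n => cn z * cn (fun j => m_ n x j - m x j))) => [n|].
  rewrite -reB (le_trans (normr_re_le _))// (le_trans _ (cdot_le _ _))//.
  by rewrite /cdot !sum3E; apply: eq_ler; congr normc; ring.
by rewrite -[X in _ --> X](mulr0 (cn z)); apply: cvgMr; exact: mc.
Qed.

Lemma Kf_lim g (m_ : nat -> field) m M : fld g -> (forall n, mlt 1 M (m_ n)) ->
  pcvg m_ m -> Kf g (m_ n) @[n --> \oo] --> Kf g m.
Proof.
move=> [mg ig] mM mc.
apply: (@I3_dominated _ (fun n x => re (cdot (g x) (m_ n x))) _ (fun x => M * wcn g x) _ _ _ _).2.
- by move=> n; exact: (cmeas_dot mg (mM n).1).1.
- by move=> x; exact: pcvg_dot.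
- by move=> n x; exact: Kf_pt.
- exact: ig3Z.
Qed.

(** Writing the output frequency as xi + eta avoids forming the convolution of [g] and [h]. The
    factor i (xi + eta), contracted with [g], is the symbol of the divergence. *)
Definition Bpt g h m (z : V * V) : R :=
  re ('i%C * (cdot (cvec (z.1 + z.2)) (g z.1) * cdot (h z.2) (m (z.1 + z.2)))).
(* The Fourier side of the pairing of div (v (x) w) with a test field of transform [m],
   where [g], [h] are the transforms of [v], [w]. *)
Definition Bf g h m : R := I6 (Bpt g h m).

Lemma Bpt_le g h m z : `|Bpt g h m z| <=
  enorm (z.1 + z.2) * cn (m (z.1 + z.2)) * (cn (g z.1) * cn (h z.2)).
Proof.
rewrite (le_trans (normr_re_le _))// !Normc.normcM [X in X * _](_ : _ = 1) ?mul1r.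
  have := ler_pM (normc_ge0 _) (normc_ge0 _) (cdot_le (cvec (z.1 + z.2)) (g z.1))
    (cdot_le (h z.2) (m (z.1 + z.2))).
  by move=> /le_trans; apply; rewrite cn_cvec; apply: eq_ler; ring.
by rewrite normc_sqrtE/= expr0n expr1n add0r sqrtr1.
Qed.

Lemma mlt_enorm m M x : mlt 1 M m -> enorm x * cn (m x) <= 2 * M.
Proof.
move=> mM; have M0 := mlt_ge0 mM; have := mM.2 x; rewrite expr1 ler_pdivlMr ?w0// => H.
apply: le_trans (ler_wpM2l (ler0n _ 2) H).
rewrite mulrCA mulrC ler_wpM2l ?cn_ge0//.
by have := enorm_le_norm x; have := normr_ge0 x; lra.
Qed.

Lemma Bpt_mlt g h m M z : mlt 1 M m -> `|Bpt g h m z| <= 2 * M * cn (g z.1) * cn (h z.2).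
Proof.
move=> mM; rewrite (le_trans (Bpt_le _ _ _ _))// -[leRHS]mulrA ler_wpM2r ?mulr_ge0 ?cn_ge0//.
exact: mlt_enorm.
Qed.

Lemma meas6_Bpt g h m : vm3 g -> vm3 h -> vm3 m -> meas6 (Bpt g h m).
Proof.
move=> mg mh mm.
have V1 : @vmeas R _ (M3 * M3)%type (fun z => g z.1).
  by move=> j; split; [exact: (@meas6_fst _ (fun x => re (g x j)) (mg j).1)|
    exact: (@meas6_fst _ (fun x => im (g x j)) (mg j).2)].
have V2 : @vmeas R _ (M3 * M3)%type (fun z => h z.2).
  by move=> j; split; [exact: (@meas6_snd _ (fun x => re (h x j)) (mh j).1)|
    exact: (@meas6_snd _ (fun x => im (h x j)) (mh j).2)].
have V3 : @vmeas R _ (M3 * M3)%type (fun z => m (z.1 + z.2)).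
  by move=> j; split; [exact: (@meas6_add _ (fun x => re (m x j)) (mm j).1)|
    exact: (@meas6_add _ (fun x => im (m x j)) (mm j).2)].
have V4 : @vmeas R _ (M3 * M3)%type (fun z => cvec (z.1 + z.2)).
  by move=> j; apply: cmeas_real; exact: (@meas6_add _ (fun x => xcoord x j) (meas3_xcoord j)).
apply: (@cmeasM R _ (M3 * M3)%type (fun=> 'i%C) _ _ _).1; first exact: cmeas_cst.
by apply: cmeasM; exact: cmeas_dot.
Qed.

Lemma Bf_ig g h m M : L1f g -> L1f h -> mlt 1 M m -> ig6 (Bpt g h m).
Proof.
move=> [mg ig] [mh ih] mM.
apply: (@ig6_prod_le _ _ (fun x => 2 * M * cn (g x)) (fun x => cn (h x))).
- by apply: meas6_Bpt => //; exact: mM.1.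
- by move=> x y; exact: (@Bpt_mlt g h m M (x, y)).
- by move=> x; rewrite !mulr_ge0 ?cn_ge0// (mlt_ge0 mM).
- by move=> x; exact: cn_ge0.
- exact: ig3Z.
- exact: ih.
Qed.

Lemma ig6_cncn g h (M : R) : L1f g -> L1f h ->
  ig6 (fun z => M * cn (g z.1) * cn (h z.2)) /\
  I6 (fun z => M * cn (g z.1) * cn (h z.2)) = M * n1 g * n1 h.
Proof.
move=> [mg ig] [mh ih].
have [i E] := I6_prod (ig3Z M ig) ih; split=> //.
by rewrite E I3Z.
Qed.

Lemma Bf_le g h m M : L1f g -> L1f h -> mlt 1 M m -> `|Bf g h m| <= 2 * M * n1 g * n1 h.
Proof.
move=> fg fh mM; have iB := Bf_ig fg fh mM; have [ic Ec] := ig6_cncn (2 * M) fg fh.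
rewrite (le_trans (le_norm_I6 iB))// -Ec; apply: le_I6 => //; first exact: ig6_norm.
by move=> z; exact: Bpt_mlt.
Qed.

Lemma Bf_lin g h a m m' M M' : L1f g -> L1f h -> mlt 1 M m -> mlt 1 M' m' ->
  Bf g h (flin a m m') = a * Bf g h m + Bf g h m'.
Proof.
move=> fg fh mM mM'; have i1 := Bf_ig fg fh mM; have i2 := Bf_ig fg fh mM'.
rewrite /Bf -I6Z// -I6D//; last exact: ig6Z.
by apply: eq_I6 => z; rewrite /Bpt /flin cdotDr cdotZr -reZ -reD; congr re; ring.
Qed.

Lemma Bf_lim g h (m_ : nat -> field) m M : L1f g -> L1f h -> (forall n, mlt 1 M (m_ n)) ->
  pcvg m_ m -> Bf g h (m_ n) @[n --> \oo] --> Bf g h m.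
Proof.
move=> fg fh mM mc; have [ic Ec] := ig6_cncn (2 * M) fg fh.
apply: (@I6_dominated _ (fun n => Bpt g h (m_ n)) _ _ _ _ _ ic).2.
- by move=> n; apply: meas6_Bpt; [exact: fg.1|exact: fh.1|exact: (mM n).1].
- move=> z; rewrite /Bpt.
  have E m' : re ('i%C * (cdot (cvec (z.1 + z.2)) (g z.1) * cdot (h z.2) (m' (z.1 + z.2)))) =
    re (cdot (fun j => ('i%C * cdot (cvec (z.1 + z.2)) (g z.1)) * h z.2 j) (m' (z.1 + z.2))).
    by rewrite cdotZl mulrA.
  by rewrite E; under eq_fun do rewrite E; exact: pcvg_dot.
- by move=> n z; exact: Bpt_mlt.
Qed.

(** A single index isolates the products with one component of the advecting field; [xpredT] keeps
    the whole field, so the same estimates serve both. *)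
Definition sel (S : pred 'I_3) g : field := fun x j => if S j then g x j else 0.

Lemma cn_sel S g x : cn (sel S g x) <= cn (g x).
Proof.
rewrite /cnorm3 ler_wsqrtr// ler_sum// => j _; rewrite /sel; case: (S j) => //.
by rewrite Normc.normc0 expr0n sqr_ge0.
Qed.

Lemma L1f_sel S g : L1f g -> L1f (sel S g) /\ n1 (sel S g) <= n1 g.
Proof.
move=> [mg ig]; have ms : vm3 (sel S g).
  by move=> j; rewrite /sel; case: (S j); [exact: mg|exact: cmeas_cst].
have i : ig3 (fun x => cn (sel S g x)).
  apply: (ig3_le _ _ ig) => [|x]; first exact: vm3_cn.
  by rewrite (ger0_norm (cn_ge0 _)); exact: cn_sel.
by split=> //; apply: le_I3 => // x; exact: cn_sel.
Qed.

Lemma fsub_sel S g h : fsub (sel S g) (sel S h) = sel S (fsub g h).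
Proof.
by apply/funext => x; apply/funext => j; rewrite /fsub /sel; case: (S j); rewrite ?subr0.
Qed.

Lemma Bf_diff S g h m M : L1f g -> L1f h -> mlt 1 M m ->
  `|Bf (sel S g) g m - Bf (sel S h) h m| <= 2 * M * (n1 g + n1 h) * n1 (fsub g h).
Proof.
move=> fg fh mM; have fs := L1f_sub fg fh; have M0 := mlt_ge0 mM.
have [sg ng] := L1f_sel S fg; have [sh nh] := L1f_sel S fh; have [ss ns] := L1f_sel S fs.
have i1 := Bf_ig sg fg mM; have i2 := Bf_ig sh fh mM.
have i3 := Bf_ig ss fg mM; have i4 := Bf_ig sh fs mM.
have n0 k : 0 <= n1 k by apply: I3_ge0 => x; exact: cn_ge0.
have -> : Bf (sel S g) g m - Bf (sel S h) h m =
    Bf (sel S (fsub g h)) g m + Bf (sel S h) (fsub g h) m.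
  rewrite -fsub_sel in i3 *.
  rewrite /Bf -I6B// -I6D//; apply: eq_I6 => z; rewrite /Bpt /fsub -reB -reD; congr re.
  by rewrite /cdot !sum3E; ring.
rewrite (le_trans (ler_normD _ _))// (le_trans (lerD (Bf_le ss fg mM) (Bf_le sh fs mM)))//.
rewrite (@le_trans _ _ (2 * M * n1 (fsub g h) * n1 g + 2 * M * n1 h * n1 (fsub g h)))//.
  by rewrite lerD// ler_wpM2r// ler_wpM2l// mulr_ge0.
by apply: eq_ler; ring.
Qed.
End Fields.

Section ChiFields.
Context {R : realType}.
Local Notation V := (R3 R).
Local Notation M1 := (measurableTypeR R).
Local Notation M3 := (M1 * M1 * M1)%type.
Local Notation mu3 := (@leb3 R).

Local Notation aeq P := {ae mu3, forall x, P x}.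
Local Notation C := R[i].
Local Notation re := (@complex.Re R).
Local Notation im := (@complex.Im R).
Local Notation cn := (@cnorm3 R).
Local Notation field := (V -> 'I_3 -> C).
Implicit Types (g h m : field) (f : vdist R).

Lemma meas3_w1 : meas3 (fun x : V => (1 + `|x|)^-1).
Proof.
by have := @meas3_wV R 1; rewrite (_ : (fun x : V => (1 + `|x|) ^- 1) = fun x => (1 + `|x|)^-1).
Qed.

Lemma ae_integral (a b : V -> R) : meas3 a -> meas3 b -> aeq (fun x => a x = b x) ->
  (\int[mu3]_x (a x)%:E = \int[mu3]_x (b x)%:E)%E.
Proof.
move=> ma mb ab; apply: (@ae_eq_integral _ M3 R mu3 setT) => //; try exact/measurable_EFinP.
by apply: aeS ab => x -> _.
Qed.

Lemma ae_I3 (a b : V -> R) : meas3 a -> meas3 b -> aeq (fun x => a x = b x) -> I3 a = I3 b.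
Proof. by move=> ma mb ab; rewrite /I3 /Rintegral (ae_integral ma mb ab). Qed.

Lemma ae_ig3 (a b : V -> R) : meas3 a -> ig3 b -> aeq (fun x => a x = b x) -> ig3 a.
Proof.
move=> ma ib ab; apply: ig3_lty => //.
rewrite (@ae_integral _ (fun x => `|b x|)); first by rewrite I3E ?ltry//; exact: ig3_norm.
- exact: meas3_norm.
- by apply: meas3_norm; exact: ig3_meas.
- by apply: aeS ab => x ->.
Qed.

Lemma ae_le_I3 (a b : V -> R) : ig3 a -> ig3 b -> aeq (fun x => a x <= b x) -> I3 a <= I3 b.
Proof.
move=> ia ib ab; have ma := ig3_meas ia; have mb := ig3_meas ib.
have mm : meas3 (fun x => Num.min (a x) (b x)) by exact: measurable_minr.
have am : aeq (fun x => Num.min (a x) (b x) = a x) by apply: aeS ab => x; exact: min_l.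
rewrite -(ae_I3 mm ma am); apply: le_I3 => // [|x]; first exact: ae_ig3 am.
by rewrite ge_min lexx orbT.
Qed.

(** Since the origin is a null set, the convention 0^-1 = 0 for the weight |xi|^-1 is harmless in
    integrals. *)
Lemma ae_neq0 : aeq (fun x : V => x != 0).
Proof.
exists ([set 0] `*` [set 0] `*` [set 0]); split.
- by apply: measurableX; [apply: measurableX|]; exact: measurable_set1.
- by rewrite leb3_rect ?lebesgue_measure_set1 ?mule0//; exact: measurable_set1.
- by move=> x /= /negP/negPn/eqP ->.
Qed.

Definition hatf f : field := fun xi j => fhat (f j) xi.
(* [xm (hatf f)] and [xp (hatf f)] are the norms of [f] in chi^(-1) and chi^1. *)
Definition em g (x : V) : R := (enorm x)^-1 * cn (g x).
Definition ep g (x : V) : R := enorm x * cn (g x).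
Definition xm g : R := I3 (em g).
Definition xp g : R := I3 (ep g).

Lemma em_ge0 g x : 0 <= em g x.
Proof. by rewrite mulr_ge0 ?cn_ge0// invr_ge0 enorm_ge0. Qed.
Lemma ep_ge0 g x : 0 <= ep g x.
Proof. by rewrite mulr_ge0 ?cn_ge0// enorm_ge0. Qed.
Lemma meas3_em g : vm3 g -> meas3 (em g).
Proof.
move=> mg; apply: meas3M; last exact: vm3_cn.
rewrite (_ : (fun _ => _) = fun x => @enorm R x `^ (-1)).
  by apply: (@meas3_comp _ (fun r => r `^ (-1))); [exact: measurable_powR|exact: meas3_enorm].
by apply/funext => x; rewrite powR_inv1// enorm_ge0.
Qed.
Lemma meas3_ep g : vm3 g -> meas3 (ep g).
Proof. by move=> mg; apply: meas3M; [exact: meas3_enorm|exact: vm3_cn]. Qed.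

Lemma chi_normE1 f : chi_norm (-1) f = (\int[mu3]_x (em (hatf f) x)%:E)%E.
Proof. by apply: eq_integral => x _; rewrite powR_inv1// enorm_ge0. Qed.

Lemma chi_normE f : chi_norm 1 f = (\int[mu3]_x (ep (hatf f) x)%:E)%E.
Proof. by apply: eq_integral => x _; rewrite powRr1// enorm_ge0. Qed.

Lemma hatf_meas f : (forall j, exists k, fourier_function (f j) k) -> vm3 (hatf f).
Proof. by move=> ef j; have [[mr _] [mi _] _] := fhatP (ef j). Qed.

Lemma loc3_cn g : vm3 g -> (forall j, loc3 (fun x => re (g x j)) /\ loc3 (fun x => im (g x j))) ->
  loc3 (fun x => cn (g x)).
Proof.
move=> mg lg; split; first exact: vm3_cn.
move=> w bw; have [mw [N [M [wM sN]]]] := bw.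
apply: (@ig3_le _ _ (fun x => \sum_(j < 3) (`|re (g x j) * w x| + `|im (g x j) * w x|))).
- by apply: meas3M => //; exact: vm3_cn.
- move=> x; rewrite normrM (ger0_norm (cn_ge0 _)).
  rewrite (le_trans (ler_wpM2r (normr_ge0 _) (cn_le_sum _)))// mulr_suml ler_sum// => j _.
  by rewrite !normrM -mulrDl ler_wpM2r// normc_le.
- by apply: ig3_sum => j; have [[_ h1] [_ h2]] := lg j; apply: ig3D; apply: ig3_norm; [exact: h1|exact: h2].
Qed.

Lemma bcs_cube1 : bcs (\1_(cube 1) : V -> R).
Proof.
split; first by apply: measurable_indic; exact: measurable_cube.
exists 1, 1; split => [x|x xN]; rewrite indicE; first by case: (_ \in _); rewrite ?normr1 ?normr0.
by rewrite memNset.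
Qed.

Lemma in_chi_em f : in_chi (-1) f -> vm3 (hatf f) /\ ig3 (em (hatf f)).
Proof.
move=> [fj fn]; have mf : vm3 (hatf f) by apply: hatf_meas => j; have [] := fj j.
split=> //; apply: ig3_lty; first exact: meas3_em.
by under eq_integral do rewrite (ger0_norm (em_ge0 _ _)); rewrite -chi_normE1.
Qed.

Lemma in_chi_ep f : in_chi 1 f -> vm3 (hatf f) /\ ig3 (ep (hatf f)).
Proof.
move=> [fj fn]; have mf : vm3 (hatf f) by apply: hatf_meas => j; have [] := fj j.
split=> //; apply: ig3_lty; first exact: meas3_ep.
by under eq_integral do rewrite (ger0_norm (ep_ge0 _ _)); rewrite -chi_normE.
Qed.

Lemma in_chi_loc (s : R) f : in_chi s f ->
  forall j, loc3 (fun x => re (hatf f x j)) /\ loc3 (fun x => im (hatf f x j)).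
Proof.
move=> [fj _] j; have [_ ef] := fj j; have [l1 l2 _] := fhatP ef.
by split; exact: loc3P.
Qed.

(** A majorant valid at every point needs a local term, because [em] is 0 at the origin by the
    convention 0^-1 = 0; local integrability of the transform takes care of that term. *)
Lemma wcn_le_em g (x : V) : wcn g x <= cn (g x) * \1_(cube 1) x + 2 * em g x.
Proof.
have c0 := cn_ge0 (g x); have w := w0 x.
have [x1|x1] := leP `|x| 1.
  rewrite indicE mem_set// mulr1 ler_wpDr ?mulr_ge0//; first by rewrite invr_ge0 enorm_ge0.
  by rewrite /wcn ler_piMl//; have /andP[] := wV_le1 x 1; rewrite expr1.
rewrite indicE memNset ?mulr0 ?add0r; last by rewrite /cube/= leNgt x1.
have e0 : 0 < enorm x by rewrite (lt_le_trans ltr01)// (le_trans (ltW x1))// norm_le_enorm.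
rewrite /wcn /em mulrA ler_wpM2r// -ler_pdivrMl// -invfM lef_pV2 ?posrE ?mulr_gt0//.
by have := enorm_le_norm x; lra.
Qed.

Lemma in_chi_fld f : in_chi (-1) f -> fld (hatf f).
Proof.
move=> cf; have [mf ie] := in_chi_em cf; split=> //.
apply: (@ig3_le _ _ (fun x => cn (hatf f x) * \1_(cube 1) x + 2 * em (hatf f) x)).
- by apply: meas3M; [exact: meas3_w1|exact: vm3_cn].
- by move=> x; rewrite (ger0_norm (wcn_ge0 _ _)) wcn_le_em.
- by apply: ig3D; [exact: (loc3_cn mf (in_chi_loc cf)).2 bcs_cube1|exact: ig3Z].
Qed.

Lemma fld_L1f g : fld g -> ig3 (ep g) -> L1f g.
Proof.
move=> [mg iw] ie; split=> //.
apply: (@ig3_le _ _ (fun x => 2 * wcn g x + ep g x)); first exact: vm3_cn.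
  move=> x; rewrite (ger0_norm (cn_ge0 _)) /wcn /ep mulrA -mulrDl ler_peMl ?cn_ge0//.
  have [x1|x1] := leP `|x| 1.
    by rewrite ler_wpDr ?enorm_ge0// ler_pdivlMr ?w0// mul1r; lra.
  rewrite ler_wpDl ?mulr_ge0 ?invr_ge0 ?(ltW (w0 x))//.
  by rewrite (le_trans (ltW x1))// norm_le_enorm.
by apply: ig3D => //; exact: ig3Z.
Qed.

Lemma nn_le_xm g : fld g -> ig3 (em g) -> nn g <= 2 * xm g.
Proof.
move=> [mg iw] ie; rewrite -I3Z//; apply: ae_le_I3 => //; first exact: ig3Z.
apply: aeS ae_neq0 => x x0; have e0 : 0 < enorm x by rewrite enorm_gt0.
rewrite /wcn /em mulrA ler_wpM2r ?cn_ge0// -ler_pdivrMl// -invfM lef_pV2 ?posrE ?mulr_gt0 ?w0//.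
by have := enorm_le_norm x; have := normr_ge0 x; lra.
Qed.

(** Cauchy-Schwarz between chi^(-1) and chi^1, read off from the positivity, for all real l, of the
    integral of |xi|^-1 |g| (l - |xi|)^2. *)
Lemma sqr_n1_le g : L1f g -> ig3 (em g) -> ig3 (ep g) -> n1 g ^+ 2 <= xm g * xp g.
Proof.
move=> [mg i1] im ip.
have H (l : R) : 0 <= l ^+ 2 * xm g - 2 * l * n1 g + xp g.
  rewrite -!I3Z// -I3B; [|exact: ig3Z|exact: ig3Z].
  rewrite -I3D//; last by apply: ig3B; exact: ig3Z.
  rewrite -I3_0; apply: ae_le_I3; first exact: ig3_0.
    by apply: ig3D => //; apply: ig3B; exact: ig3Z.
  apply: aeS ae_neq0 => x x0; have e0 : 0 < enorm x by rewrite enorm_gt0.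
  rewrite /em /ep.
  rewrite [leRHS](_ : _ = (enorm x)^-1 * cn (g x) * (l - enorm x) ^+ 2); last by field; rewrite gt_eqF.
  by rewrite mulr_ge0 ?sqr_ge0// mulr_ge0 ?cn_ge0// invr_ge0 ltW.
have xm0 : 0 <= xm g by apply: I3_ge0 => x; exact: em_ge0.
have xp0 : 0 <= xp g by apply: I3_ge0 => x; exact: ep_ge0.
have n10 : 0 <= n1 g by apply: I3_ge0 => x; exact: cn_ge0.
have [x0|xN0] := eqVneq (xm g) 0.
  have [->|n0] := eqVneq (n1 g) 0; first by rewrite expr0n mulr_ge0.
  (* If [xm g] is 0 the quadratic in l is affine, and this l gives it the value - xp g - 2 < 0. *)
  have := H ((xp g + 1) / n1 g); rewrite x0 mulr0 sub0r -[2 * _ * _]mulrA divfK//; lra.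
have xp' : 0 < xm g by rewrite lt_def xN0.
have := H (n1 g / xm g); rewrite [X in 0 <= X](_ : _ = xp g - n1 g ^+ 2 / xm g); last by field.
by rewrite subr_ge0 ler_pdivrMr// mulrC.
Qed.

(** [fhat] is a choice among almost equal functions, so the transform of a difference is the
    difference of the transforms only almost everywhere. *)
Lemma hatfB f f' : (forall j, exists k, fourier_function (f j) k) ->
  (forall j, exists k, fourier_function (f' j) k) ->
  vm3 (hatf (f - f')) /\ aeq (fun x => cn (hatf (f - f') x) = cn (fsub (hatf f) (hatf f') x)).
Proof.
move=> ef ef'; split.
  by apply: hatf_meas => j; eexists; exact: fourier_functionB (fhatP (ef j)) (fhatP (ef' j)).
have A j := fhatB (ef j) (ef' j).
apply: aeS (aeI (A 0) (aeI (A 1) (A 2%:R))) => x [h0 [h1 h2]].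
rewrite /cnorm3 !sum3E /fsub /hatf.
by move: h0 h1 h2; rewrite /GRing.add/= /GRing.opp/= => -> -> ->.
Qed.

Lemma xm_sub f f' : in_chi (-1) f -> in_chi (-1) f' ->
  ig3 (em (fsub (hatf f) (hatf f'))) /\
  chi_norm (-1) (f - f') = (xm (fsub (hatf f) (hatf f')))%:E.
Proof.
move=> cf cf'; have [mf ie] := in_chi_em cf; have [mf' ie'] := in_chi_em cf'.
have ms : vm3 (fsub (hatf f) (hatf f')) by exact: vmeasB.
have i : ig3 (em (fsub (hatf f) (hatf f'))).
  apply: (ig3_le _ _ (ig3D ie ie')); first exact: meas3_em.
  move=> x; rewrite (ger0_norm (em_ge0 _ _)) /em -mulrDr ler_wpM2l ?invr_ge0 ?enorm_ge0//.
  exact: cnB.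
split=> //; rewrite -I3E// chi_normE1.
have [mh ah] := @hatfB f f' (fun j => (cf.1 j).2) (fun j => (cf'.1 j).2).
by apply: ae_integral; [exact: meas3_em|exact: meas3_em|apply: aeS ah => x; rewrite /em => ->].
Qed.

Lemma in_chi_fpair f j : in_chi (-1) f ->
  fpair (f j) (fun x => re (hatf f x j)) (fun x => im (hatf f x j)).
Proof.
move=> cf; have [tf ef] := cf.1 j; have [l1 l2 H] := fourier_functionE tf (fhatP ef).
have [mf iw] := in_chi_fld cf.
have h (k : V -> R) : meas3 k -> (forall x, `|k x| <= cn (hatf f x)) -> wig k.
  move=> mk kc; split=> //; apply: (ig3_le _ _ iw) => [|x].
    by apply: meas3M; [exact: meas3_w1|exact: meas3_norm].
  rewrite normrM normr_id (@ger0_norm _ (_^-1)) ?invr_ge0 ?(ltW (w0 x))//.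
  by rewrite ler_wpM2l ?invr_ge0 ?(ltW (w0 x)).
split=> //; apply: h; try by [have := mf j; case].
- by move=> x; rewrite (le_trans (normr_re_le _))// (normc_le_cn (hatf f x) j).
- by move=> x; rewrite (le_trans (normr_im_le _))// (normc_le_cn (hatf f x) j).
Qed.
End ChiFields.

(** * Integrals in time *)

Section Evolution.
Context {R : realType}.
Local Notation V := (R3 R).

Local Notation C := R[i].
Local Notation cn := (@cnorm3 R).
Local Notation field := (V -> 'I_3 -> C).
Implicit Types (g h m : field).
Context (T : R) (u : R -> vdist R) (hC : C_chi T (-1) u) (hL : L1_chi T 1 u).
Local Notation G t := (hatf (u t)).

Lemma G_chi t : 0 <= t < T -> in_chi (-1) (u t). Proof. exact: hC.1. Qed.
Lemma G_fld t : 0 <= t < T -> fld (G t). Proof. by move=> /G_chi/in_chi_fld. Qed.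
Lemma G_em t : 0 <= t < T -> ig3 (em (G t)). Proof. by move=> /G_chi/in_chi_em[]. Qed.

Definition dist s t : R := xm (fsub (G s) (G t)).

Lemma dist_ge0 s t : 0 <= dist s t. Proof. by apply: I3_ge0 => x; exact: em_ge0. Qed.

Lemma nn_dist s t : 0 <= s < T -> 0 <= t < T -> nn (fsub (G s) (G t)) <= 2 * dist s t.
Proof.
move=> sT tT; apply: nn_le_xm; first by apply: fld_sub; exact: G_fld.
by have [] := xm_sub (G_chi sT) (G_chi tT).
Qed.

Lemma dist_cvg t (e : R) : 0 <= t < T -> 0 < e ->
  exists2 d : R, 0 < d & forall s, 0 <= s < T -> `|s - t| < d -> dist s t < e.
Proof.
move=> tT e0; have := hC.2 t tT; move=> /(_ [set y | (y < e%:E)%E]) [].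
  have : \forall x \near (0 : R), x < e by apply: lt_nbhsl.
  by rewrite /nbhs/=; apply: filterS => x /= xe; rewrite lte_fin.
move=> d /= d0 H; exists d => // s sT st.
have := H s; rewrite /= distrC => /(_ st sT).
by rewrite (xm_sub (G_chi sT) (G_chi tT)).2 lte_fin.
Qed.

(** Continuity on [0, T), including the left end, with explicit radii because the functions of time
    are controlled only there. *)
Definition tcont (f : R -> R) : Prop := forall t e : R, 0 <= t < T -> 0 < e ->
  exists2 d : R, 0 < d & forall s, 0 <= s < T -> `|s - t| < d -> `|f s - f t| < e.

(** All functions of time in the argument are locally Lipschitz for the chi^(-1) distance; the
    restriction to distances at most 1 allows for the quadratic convection form. *)
Lemma tcont_dist (f : R -> R) :
  (forall t, 0 <= t < T -> exists2 c : R, 0 <= c & forall s, 0 <= s < T ->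
    dist s t <= 1 -> `|f s - f t| <= c * dist s t) -> tcont f.
Proof.
move=> H t e tT e0; have [c c0 cP] := H t tT.
have e1 : 0 < Num.min 1 (e / (c + 1)).
  by rewrite lt_min ltr01 divr_gt0// ltr_wpDl.
have [d d0 dP] := dist_cvg tT e1; exists d => // s sT /(dP s sT).
rewrite lt_min => /andP[d1 d2]; apply: le_lt_trans (cP s sT (ltW d1)) _.
move: d2; rewrite ltr_pdivlMr ?ltr_wpDl//; have := dist_ge0 s t; nra.
Qed.

(** Clamping the time to [s, t] extends the function continuously to the whole line, where the
    extreme value theorem can be used. *)
Lemma tcont_clamp (f : R -> R) s t : tcont f -> 0 <= s -> s <= t -> t < T ->
  continuous (fun x => f (Num.max s (Num.min x t))).
Proof.
move=> cf s0 st tT x; apply/cvgrPdist_lt => e e0.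
have cl y : 0 <= Num.max s (Num.min y t) < T.
  rewrite le_max s0/= gt_max (le_lt_trans st tT)/= gt_min tT orbT//.
have [d d0 dP] := cf _ e (cl x) e0; near=> y.
rewrite distrC; apply: dP => //; apply: (@le_lt_trans _ _ `|y - x|); last first.
  by near: y; exists d => // z /=; rewrite distrC.
have lipM (c a b : R) : `|Num.max c a - Num.max c b| <= `|a - b|.
  by case: (leP c a) => ca; case: (leP c b) => cb; rewrite ?subrr ?normr0// ler_norml;
    have := ler_norm (a - b); have := ler_norm (b - a); rewrite (distrC b) => *; apply/andP; split; lra.
have lipm (c a b : R) : `|Num.min a c - Num.min b c| <= `|a - b|.
  by case: (leP a c) => ca; case: (leP b c) => cb; rewrite ?subrr ?normr0// ler_norml;
    have := ler_norm (a - b); have := ler_norm (b - a); rewrite (distrC b) => *; apply/andP; split; lra.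
exact: le_trans (lipM _ _ _) (lipm _ _ _).
Unshelve. all: by end_near. Qed.

Lemma tcont_bounded (f : R -> R) s t : tcont f -> 0 <= s -> s <= t -> t < T ->
  exists M : R, forall x, s <= x <= t -> `|f x| <= M.
Proof.
move=> cf s0 st tT; have cc := tcont_clamp cf s0 st tT.
pose F x := `|f (Num.max s (Num.min x t))|.
have cF : continuous F by move=> x; apply: cvg_norm; exact: cc.
have [c _ cP] := @EVT_max R F s t st (continuous_subspaceT cF).
exists (F c) => x /andP[sx xt]; have := cP x; rewrite in_itv/= sx xt => /(_ isT).
by rewrite /F min_l// max_r.
Qed.

Lemma tcont_measurable (f : R -> R) : tcont f -> measurable_fun `]0%R, T[ f.
Proof.
move=> cf; apply: open_continuous_measurable_fun; first exact: interval_open.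
move=> x; rewrite inE/= in_itv/= => /andP[x0 xT]; apply/cvgrPdist_lt => e e0.
have xx : 0 <= x < T by rewrite (ltW x0).
have [d d0 dP] := cf x e xx e0.
near=> y; rewrite distrC; apply: dP.
  by apply/andP; split; [apply: ltW; near: y; exact: lt_nbhsr|near: y; exact: lt_nbhsl].
by near: y; exists d => // z /=; rewrite distrC.
Unshelve. all: by end_near. Qed.

Lemma tcont_Kf m M : mlt 1 M m -> tcont (fun t => Kf (G t) m).
Proof.
move=> mM; apply: tcont_dist => t tT; have M0 := mlt_ge0 mM; exists (M * 2); first by rewrite mulr_ge0.
move=> s sT _; rewrite (le_trans (Kf_diff (G_fld sT) (G_fld tT) mM))// -mulrA ler_wpM2l//.
exact: nn_dist.
Qed.

Lemma tcont_xm : tcont (fun t => xm (G t)).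
Proof.
apply: tcont_dist => t tT; exists 1 => // s sT _; rewrite mul1r /xm.
have is_ := G_em sT; have it := G_em tT.
have [id _] := xm_sub (G_chi sT) (G_chi tT).
rewrite -I3B// (le_trans (le_norm_I3 (ig3B is_ it)))//.
apply: le_I3 => //; first by apply: ig3_norm; exact: ig3B.
move=> x; rewrite /em -mulrBr normrM ger0_norm ?invr_ge0 ?enorm_ge0//.
by rewrite ler_wpM2l ?invr_ge0 ?enorm_ge0//; exact: cn_dist.
Qed.

(** On a cube the L^1 norm is bounded by [nn], so the convection form of truncated fields is
    continuous in time; that of the full field is measurable as a pointwise limit. *)
Definition trunc (n : nat) g : field := fun x j => (\1_(cube n%:R) x : R)%:C%C * g x j.

Lemma cn_trunc n g x : cn (trunc n g x) = \1_(cube n%:R) x * cn (g x).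
Proof. by rewrite cnZ normc_real ger0_norm// indicE ler0n. Qed.

Lemma vm3_trunc n g : vm3 g -> vm3 (trunc n g).
Proof.
move=> mg; apply: vmeasZ => //; apply: cmeas_real; apply: measurable_indic.
exact: measurable_cube.
Qed.

Lemma trunc_le n g x : cn (trunc n g x) <= (1 + n%:R) * wcn g x.
Proof.
rewrite cn_trunc indicE; have [xn|xn] := boolP (x \in _); last by rewrite mul0r mulr_ge0 ?wcn_ge0.
rewrite mul1r /wcn mulrA ler_peMl ?cn_ge0// ler_pdivlMr ?w0// mul1r lerD2l.
by move: xn; rewrite inE.
Qed.

Lemma L1f_trunc n g : fld g -> L1f (trunc n g) /\ n1 (trunc n g) <= (1 + n%:R) * nn g.
Proof.
move=> [mg ig]; have mt := vm3_trunc n mg.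
have i : ig3 (fun x => cn (trunc n g x)).
  apply: (ig3_le _ _ (ig3Z (1 + n%:R) ig)) => [|x]; first exact: vm3_cn.
  by rewrite ger0_norm ?cn_ge0 ?trunc_le.
split=> //; rewrite -I3Z//; apply: le_I3 => //; first exact: ig3Z.
by move=> x; exact: trunc_le.
Qed.

Lemma fsub_trunc n g h : fsub (trunc n g) (trunc n h) = trunc n (fsub g h).
Proof. by apply/funext => x; apply/funext => j; rewrite /fsub /trunc mulrBr. Qed.

Lemma nn_triangle g h : fld g -> fld h -> nn g <= nn h + nn (fsub g h).
Proof.
move=> fg fh; have fs := fld_sub fg fh; rewrite -I3D; [|exact: fh.2|exact: fs.2].
apply: le_I3; [exact: fg.2|exact: ig3D fh.2 fs.2|move=> x].
rewrite /wcn -mulrDr ler_wpM2l ?invr_ge0 ?(ltW (w0 x))//.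
by have := cn_dist (g x) (h x); rewrite /fsub; have := ler_norm (cn (g x) - cn (h x)); lra.
Qed.

Lemma nn_ge0 g : 0 <= nn g. Proof. by apply: I3_ge0 => x; exact: wcn_ge0. Qed.

Lemma tcont_Btrunc S n m M : mlt 1 M m ->
  tcont (fun t => Bf (sel S (trunc n (G t))) (trunc n (G t)) m).
Proof.
move=> mM; have M0 := mlt_ge0 mM; apply: tcont_dist => t tT.
set q : R := 1 + n%:R; have q0 : 0 <= q by rewrite addr_ge0.
have N0 := nn_ge0 (G t).
exists (2 * M * (q * (nn (G t) + 2) + q * nn (G t)) * (q * 2)).
  by rewrite !mulr_ge0 ?addr_ge0 ?mulr_ge0 ?addr_ge0.
move=> s sT d1; have fs := G_fld sT; have ft := G_fld tT.
have [Ls ns] := L1f_trunc n fs; have [Lt nt] := L1f_trunc n ft.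
have [Ld nd] := L1f_trunc n (fld_sub fs ft).
apply: (le_trans (Bf_diff S Ls Lt mM)); rewrite fsub_trunc -[leRHS]mulrA.
have d0 := dist_ge0 s t; have nd2 := nn_dist sT tT; have tri := nn_triangle fs ft.
have n0 g : 0 <= n1 g by apply: I3_ge0 => x; exact: cn_ge0.
have ns2 : nn (G s) <= nn (G t) + 2.
  rewrite (le_trans tri)// lerD2l (le_trans nd2)// -[leRHS]mulr1 ler_wpM2l//.
apply: ler_pM; [by rewrite !mulr_ge0 ?addr_ge0|exact: n0| |].
  rewrite -!mulrA ler_wpM2l// ler_wpM2l// lerD//.
  by rewrite (le_trans ns)// ler_wpM2l.
by rewrite (le_trans nd)// -mulrA ler_wpM2l.
Qed.

Lemma cvg_trunc (x : V) : (\1_(cube n%:R) x : R) @[n --> \oo] --> (1 : R).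
Proof.
apply: cvg_near_cst; exists (Num.trunc `|x|).+1 => // n /= kn.
rewrite indicE mem_set// /cube/= ltW// (lt_le_trans (truncnS_gt _))// ler_nat//.
Qed.

Lemma trunc_n1_cvg g : L1f g -> n1 (fsub (trunc n g) g) @[n --> \oo] --> 0.
Proof.
move=> [mg ig].
have E n : (fun x => cn (fsub (trunc n g) g x)) = fun x => (1 - \1_(cube n%:R) x) * cn (g x).
  apply/funext => x; rewrite (_ : fsub _ _ x = fun j => (\1_(cube n%:R) x - 1)%:C%C * g x j).
    by rewrite cnZ normc_real distrC ger0_norm// indicE subr_ge0; case: (x \in _).
  by apply/funext => j; rewrite /fsub /trunc rmorphB mulrBl mul1r.
rewrite (_ : 0 = I3 (fun=> 0 : R)); last by rewrite I3_0.
rewrite /n1; under eq_fun do rewrite E.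
apply: (@I3_dominated _ (fun n x => (1 - \1_(cube n%:R) x) * cn (g x)) (fun=> 0) (fun x => cn (g x)) _ _ _ _).2.
- move=> n; apply: meas3M; last exact: vm3_cn.
  by apply: meas3B; [exact: meas3_cst|apply: measurable_indic; exact: measurable_cube].
- move=> x; rewrite -(mul0r (cn (g x))); apply: cvgMl; rewrite -(subrr 1).
  by apply: cvgB; [exact: cvg_cst|exact: cvg_trunc].
- move=> n x; rewrite normrM (ger0_norm (cn_ge0 _)) ler_piMl ?cn_ge0// indicE.
  by case: (_ \in _); rewrite ?subrr ?subr0 ?normr0 ?normr1.
- exact: ig.
Qed.

Lemma n1_ge0 g : 0 <= n1 g. Proof. by apply: I3_ge0 => x; exact: cn_ge0. Qed.

Lemma Bf_trunc_cvg S g m M : L1f g -> mlt 1 M m ->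
  Bf (sel S (trunc n g)) (trunc n g) m @[n --> \oo] --> Bf (sel S g) g m.
Proof.
move=> Lg mM; have M0 := mlt_ge0 mM; have fg := L1f_fld Lg.
apply: (@cvgR_dist _ _ (fun n => 2 * M * (n1 g + n1 g) * n1 (fsub (trunc n g) g))) => [n|].
  have [Lt _] := L1f_trunc n fg.
  apply: (le_trans (Bf_diff S Lt Lg mM)); rewrite ler_wpM2r ?n1_ge0//.
  rewrite ler_wpM2l ?mulr_ge0// lerD2r; apply: le_I3; [exact: Lt.2|exact: Lg.2|move=> x].
  by rewrite cn_trunc ler_piMl ?cn_ge0// indicE; case: (_ \in _).
by rewrite -[X in _ --> X](mulr0 (2 * M * (n1 g + n1 g))); apply: cvgMr; exact: trunc_n1_cvg.
Qed.
End Evolution.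

Section TimeIntegrals.
Context {R : realType}.
Local Notation V := (R3 R).
Local Notation M1 := (measurableTypeR R).
Local Notation mu1 := (@lebesgue_measure R).

Local Notation C := R[i].
Local Notation im := (@complex.Im R).
Local Notation cn := (@cnorm3 R).
Local Notation field := (V -> 'I_3 -> C).
Implicit Types (g h m : field).
Context (nu Omega T : R) (u : R -> vdist R) (hC : C_chi T (-1) u) (hL : L1_chi T 1 u).
Context (N : set M1) (mN : measurable N) (N0 : mu1 N = 0%E)
  (NP : forall t, 0 < t < T -> ~ N t -> in_chi 1 (u t)).
Local Notation G t := (hatf (u t)).

(* Removing the null set [N] makes the integrand meaningful at every point; by
   [integral_setD_null] it changes no integral, even of a nonmeasurable function. *)
Definition good_times (s t : R) : set M1 := `]s, t[%classic `\` N.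
Local Notation J := good_times.

Lemma measurable_J s t : measurable (J s t).
Proof. by apply: measurableD => //; exact: measurable_itv. Qed.

Lemma J_sub s t : 0 <= s -> t <= T -> J s t `<=` J 0 T.
Proof.
move=> s0 tT x [/= ]; rewrite in_itv/= => /andP[sx xt] Nx; split=> //=.
by rewrite in_itv/= (le_lt_trans s0 sx) (lt_le_trans xt tT).
Qed.

Lemma J_bound t : J 0 T t -> 0 <= t < T.
Proof. by move=> [/=]; rewrite in_itv/= => /andP[/ltW -> ->]. Qed.

Lemma J_ep t : J 0 T t -> ig3 (ep (G t)) /\ L1f (G t).
Proof.
move=> Jt; have tT := J_bound Jt; have [/= tI Nt] := Jt.
have ie : ig3 (ep (G t)) by apply: (in_chi_ep _).2; apply: NP => //; move: tI; rewrite in_itv.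
by split=> //; apply: fld_L1f => //; exact: (G_fld hC).
Qed.

Lemma J_chi t : J 0 T t -> chi_norm 1 (u t) = (xp (G t))%:E.
Proof. by move=> /J_ep[ie _]; rewrite chi_normE I3E. Qed.

(** The chi^1 norm need not be continuous in time, but its truncations to cubes are, and [xp] is
    measurable as their limit. *)
Definition xpn (n : nat) g : R := I3 (fun x => \1_(cube n%:R) x * ep g x).

Lemma xpn_pt n g (x : V) : \1_(cube n%:R) x * ep g x <= 2 * n%:R * (1 + n%:R) * wcn g x.
Proof.
rewrite indicE; have [xn|xn] := boolP (x \in _); last first.
  rewrite mul0r; apply: mulr_ge0; last exact: wcn_ge0.
  by rewrite !mulr_ge0 ?addr_ge0.
move: xn; rewrite inE /cube/= => xn; rewrite mul1r /ep /wcn mulrA ler_wpM2r ?cn_ge0//.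
rewrite ler_pdivlMr ?w0// ler_pM ?enorm_ge0 ?(ltW (w0 x)) ?lerD2l//.
by rewrite (le_trans (enorm_le_norm x))// ler_wpM2l.
Qed.

Lemma xpn_ig n g : fld g -> ig3 (fun x => \1_(cube n%:R) x * ep g x).
Proof.
move=> [mg ig]; apply: (ig3_le _ _ (ig3Z (2 * n%:R * (1 + n%:R)) ig)) => [|x].
  by apply: meas3M; [apply: measurable_indic; exact: measurable_cube|exact: meas3_ep].
by rewrite ger0_norm ?xpn_pt// mulr_ge0 ?ep_ge0// indicE.
Qed.

Lemma tcont_xpn n : tcont T (fun t => xpn n (G t)).
Proof.
apply: (tcont_dist hC) => t tT; set q : R := 2 * n%:R * (1 + n%:R).
have q0 : 0 <= q by rewrite !mulr_ge0// addr_ge0.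
exists (q * 2); first by rewrite mulr_ge0.
move=> s sT _; have fs := G_fld hC sT; have ft := G_fld hC tT.
have fst := fld_sub fs ft.
rewrite /xpn -I3B; [|exact: xpn_ig|exact: xpn_ig].
rewrite (le_trans (le_norm_I3 (ig3B (xpn_ig n fs) (xpn_ig n ft))))// -mulrA.
rewrite (@le_trans _ _ (q * nn (fsub (G s) (G t))))//; last by rewrite ler_wpM2l// (nn_dist hC).
rewrite -I3Z; last exact: fst.2.
apply: le_I3; [by apply: ig3_norm; apply: ig3B; exact: xpn_ig|exact: ig3Z fst.2|move=> x].
apply: le_trans (xpn_pt n (fsub (G s) (G t)) x).
rewrite -mulrBr normrM ger0_norm ?indicE// ler_wpM2l// /ep -mulrBr normrM.
by rewrite ger0_norm ?enorm_ge0// ler_wpM2l ?enorm_ge0//; exact: cn_dist.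
Qed.

Lemma xpn_cvg g : vm3 g -> ig3 (ep g) -> xpn n g @[n --> \oo] --> xp g.
Proof.
move=> mg ie.
apply: (@I3_dominated _ (fun n x => \1_(cube n%:R) x * ep g x) _ (ep g) _ _ _ _).2 => //.
- by move=> n; apply: meas3M; [apply: measurable_indic; exact: measurable_cube|exact: meas3_ep].
- by move=> x; rewrite -[X in _ --> X]mul1r; apply: cvgMl; exact: cvg_trunc.
- move=> n x; rewrite normrM (ger0_norm (ep_ge0 g x)); apply: ler_piMl; first exact: ep_ge0.
  by rewrite indicE; case: (_ \in _); rewrite ?normr0 ?normr1.
Qed.

Lemma measurable_tcont (f : R -> R) : tcont T f -> measurable_fun (J 0 T) f.
Proof.
move=> cf; apply: (measurable_funS _ _ (tcont_measurable cf)) => //; exact: subDsetl.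
Qed.

Lemma measurable_xp : measurable_fun (J 0 T) (fun t => xp (G t)).
Proof.
apply: (@measurable_fun_cvg _ M1 R (J 0 T) (fun n t => xpn n (G t))).
  by move=> n; apply: measurable_tcont; exact: tcont_xpn.
by move=> t Jt; have [ie [mg _]] := J_ep Jt; exact: xpn_cvg.
Qed.

Lemma measurable_Bf S m M : mlt 1 M m ->
  measurable_fun (J 0 T) (fun t => Bf (sel S (G t)) (G t) m).
Proof.
move=> mM; apply: (@measurable_fun_cvg _ M1 R (J 0 T)
  (fun n t => Bf (sel S (trunc n (G t))) (trunc n (G t)) m)).
  by move=> n; apply: measurable_tcont; exact: (tcont_Btrunc hC S n mM).
by move=> t Jt; have [_ L] := J_ep Jt; exact: Bf_trunc_cvg mM.
Qed.

Lemma xp_ge0 g : 0 <= xp g. Proof. by apply: I3_ge0 => x; exact: ep_ge0. Qed.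
Lemma xm_ge0 g : 0 <= xm g. Proof. by apply: I3_ge0 => x; exact: em_ge0. Qed.

Lemma integrable_xp : mu1.-integrable (J 0 T) (EFin \o (fun t => xp (G t))).
Proof.
apply: integrable_EFin_ltey; [exact: measurable_J|exact: measurable_xp|].
have [_ _ hi] := hL; suff -> : (\int[mu1]_(x in J 0 T) `|xp (G x)|%:E = \int[mu1]_(t in `]0%R, T[) chi_norm 1 (u t))%E by [].
rewrite (@integral_setD_null _ _ M1 mu1 `]0, T[%classic N)//.
apply: eq_integral => t; rewrite inE => Jt.
by rewrite ger0_norm ?xp_ge0// J_chi.
Qed.

Lemma lty_J s t : (mu1 (J s t) < +oo)%E.
Proof.
apply: (@le_lt_trans _ _ (mu1 `]s, t[%classic)).
  by apply: le_measure; rewrite ?inE//; [exact: measurable_J|exact: subDsetl].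
by rewrite lebesgue_measure_itv/=; case: ifP => // _; rewrite -EFinD ltry.
Qed.

Lemma integrable_cst s t (c : R) : mu1.-integrable (J s t) (EFin \o (fun=> c)).
Proof.
apply: integrable_EFin_ltey; [exact: measurable_J|exact: measurable_cst|].
rewrite integral_cst; last exact: measurable_J.
by rewrite lte_mul_pinfty// lty_J.
Qed.

Lemma integrable_Kf m M s t : 0 <= s -> s <= t -> t < T -> mlt 1 M m ->
  mu1.-integrable (J s t) (EFin \o (fun t => Kf (G t) m)).
Proof.
move=> s0 st tT mM; have ck := tcont_Kf hC mM.
have [B BP] := tcont_bounded ck s0 st tT; have mJ := measurable_J s t.
have sub := @J_sub s t s0 (ltW tT).
apply: (@integrable_EFin_le R _ M1 mu1 (J s t) _ (fun=> B)) => //.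
- by apply: measurable_funS (measurable_tcont ck) => //; exact: measurable_J.
- by move=> x [/=]; rewrite in_itv/= => /andP[/ltW sx /ltW xt] _; rewrite BP// sx.
- exact: integrable_cst.
Qed.

Lemma Bf_bound S g m M : L1f g -> ig3 (em g) -> ig3 (ep g) -> mlt 1 M m ->
  `|Bf (sel S g) g m| <= 2 * M * (xm g * xp g).
Proof.
move=> Lg im ip mM; have [Ls ns] := L1f_sel S Lg.
rewrite (le_trans (Bf_le Ls Lg mM))// -mulrA ler_wpM2l//.
  by rewrite mulr_ge0// (mlt_ge0 mM).
apply: le_trans (sqr_n1_le Lg im ip); rewrite expr2 ler_wpM2r//.
by apply: I3_ge0 => x; exact: cn_ge0.
Qed.

(** By Cauchy-Schwarz the integrand is at most 2 M [xm] [xp], where [xm] is bounded on [s, t] and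
    [xp] is integrable. *)
Lemma integrable_Bf S m M s t : 0 <= s -> s <= t -> t < T -> mlt 1 M m ->
  mu1.-integrable (J s t) (EFin \o (fun t => Bf (sel S (G t)) (G t) m)).
Proof.
move=> s0 st tT mM; have [B BP] := tcont_bounded (tcont_xm hC) s0 st tT.
have mJ := measurable_J s t; have mJT := measurable_J 0 T.
have sub := @J_sub s t s0 (ltW tT); have M0 := mlt_ge0 mM.
apply: (@integrable_EFin_le R _ M1 mu1 (J s t) _ (fun t => 2 * M * B * xp (G t))) => //.
- exact: measurable_funS (measurable_Bf S mM).
- move=> x Jx; have [ie L] := J_ep (sub _ Jx); have xT := J_bound (sub _ Jx).
  rewrite (le_trans (Bf_bound S L (G_em hC xT) ie mM))// -[leRHS]mulrA ler_wpM2l ?mulr_ge0//.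
  rewrite ler_wpM2r ?xp_ge0// -[leLHS]ger0_norm ?xm_ge0// BP//.
  by move: Jx => [/=]; rewrite in_itv/= => /andP[/ltW -> /ltW ->].
- apply: integrable_EFinZ => //; apply: integrableS integrable_xp => //.
Qed.

Definition rot3 m : field := fun x j =>
  if j == 0 then m x 1 else if j == 1 then - m x 0 else 0.
(* The viscous and Coriolis terms moved to the multiplier; [rot3] is the transpose of
   e3 x _. *)
Definition Lm m : field := fun x j =>
  (nu * enorm x ^+ 2)%:C%C * m x j + Omega%:C%C * rot3 m x j.

Lemma cn_rot m x : cn (rot3 m x) <= cn (m x).
Proof.
rewrite /cnorm3 ler_wsqrtr// !sum3E (_ : rot3 m x 0 = m x 1)// (_ : rot3 m x 1 = - m x 0)//.
rewrite (_ : rot3 m x 2%:R = 0)// (@normcN R) Normc.normc0 expr0n addr0.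
by rewrite [leLHS]addrC lerDl exprn_ge0// normc_ge0.
Qed.

Lemma cn_Lm m x : cn (Lm m x) <= (`|nu| * enorm x ^+ 2 + `|Omega|) * cn (m x).
Proof.
rewrite (le_trans (cnD _ _))// !cnZ !normc_real normrM (ger0_norm (exprn_ge0 _ (enorm_ge0 _))).
by rewrite mulrDl lerD2l ler_wpM2l// cn_rot.
Qed.

Lemma vm3_Lm m : vm3 m -> vm3 (Lm m).
Proof.
move=> mm j; apply: cmeasD.
  apply: cmeasM => //; apply: cmeas_real; apply: meas3M; first exact: meas3_cst.
  by apply: meas3X; exact: meas3_enorm.
apply: cmeasM; first exact: cmeas_cst.
rewrite /rot3; case: (j == 0); first exact: mm.
case: (j == 1); last exact: cmeas_cst.
rewrite (_ : (fun x => - m x 0) = fun x => 0 - m x 0).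
  by apply: cmeasB; [exact: cmeas_cst|exact: mm].
by apply/funext => x; rewrite sub0r.
Qed.

(** The Laplacian costs two powers of decay, which is why the evolution identity is stated for
    multipliers of decay 3. The 4 is the square of the constant in [enorm_le_norm]. *)
Lemma mlt_Lm m M : mlt 3 M m -> mlt 1 ((4 * `|nu| + `|Omega|) * M) (Lm m).
Proof.
move=> mM; have M0 := mlt_ge0 mM; split; first exact: vm3_Lm mM.1.
move=> x; rewrite (le_trans (cn_Lm m x))// expr1.
have w := w0 x; have c0 := cn_ge0 (m x); have H := mM.2 x.
have e2 : enorm x ^+ 2 <= 4 * (1 + `|x|) ^+ 2.
  rewrite (_ : 4 = 2 ^+ 2 :> R) -?exprMn; last by rewrite -natrX.
  rewrite lerXn2r ?nnegrE ?enorm_ge0 ?mulr_ge0 ?(ltW w)//.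
  by rewrite (le_trans (enorm_le_norm x))// ler_wpM2l// lerDr.
have w1 : 1 <= (1 + `|x|) ^+ 2 by rewrite exprn_ege1// lerDl.
apply: (@le_trans _ _ ((4 * `|nu| + `|Omega|) * (1 + `|x|) ^+ 2 * cn (m x))).
  rewrite ler_wpM2r// mulrDl lerD//; last by rewrite ler_peMr.
  by rewrite [4 * _]mulrC -mulrA ler_wpM2l.
rewrite -mulrA -[leRHS]mulrA ler_wpM2l ?addr_ge0 ?mulr_ge0//.
apply: le_trans (ler_wpM2l (exprn_ge0 2 (ltW w)) H) _.
by rewrite mulrCA ler_wpM2l// [_ ^+ 3]exprS invfM mulrCA mulfV ?mulr1// expf_neq0// gt_eqF.
Qed.

(** For admissible [m] this is minus the time derivative of [Kf (G t) m]. The factor (2 pi)^-3 is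
    that of the transform of a product. *)
Definition Ff m (t : R) : R := Kf (G t) (Lm m) + (2 * pi) ^- 3 * Bf (G t) (G t) m.

Lemma integrable_Ff m M s t : 0 <= s -> s <= t -> t < T -> mlt 3 M m ->
  mu1.-integrable (J s t) (EFin \o Ff m).
Proof.
move=> s0 st tT mM; have mJ := measurable_J s t.
apply: integrable_EFinD => //; first exact: integrable_Kf (mlt_Lm mM).
by apply: integrable_EFinZ => //; exact: (integrable_Bf xpredT s0 st tT (mltS (mltS mM))).
Qed.
End TimeIntegrals.

(** * From test functions of time to intervals *)

Section Localization.
Context {R : realType}.
Local Notation M1 := (measurableTypeR R).
Local Notation mu1 := (@lebesgue_measure R).

Local Notation I1 D f := (Rintegral mu1 D f).

Lemma Rintegral_supp (D : set M1) (f : R -> R) : (forall x, ~ D x -> f x = 0) ->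
  I1 D f = I1 setT f.
Proof.
move=> fD; rewrite /Rintegral integral_mkcond; congr fine; apply: eq_integral => x _.
rewrite patchE; case: ifPn => //; rewrite notin_setE => /fD ->//.
Qed.

(** [S] is the primitive of a normalised [bump1]; it is smooth by [smoothI] for the class made of
    [S] and all smooth functions. *)
Lemma smooth_step (a b : R) : a < b -> exists rho S : R -> R,
  [/\ smooth S, forall x : R, is_derive x 1 S (rho x), continuous rho,
    (forall x, 0 <= rho x) & forall x, ~ (a < x < b) -> rho x = 0] /\
  [/\ mu1.-integrable setT (EFin \o rho), I1 setT rho = 1, forall x, x <= a -> S x = 0,
    forall x, b <= x -> S x = 1 & forall x, 0 <= S x <= 1].
Proof.
move=> ab; pose be (x : R) := bump1 0 a b x.
have sb : smooth be.
  by apply: (@smooth_bump1 R R (fun x => x)) => // x; exact: cvg_id.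
have cb : continuous be by exact: smooth_continuous.
have bout x : ~ (a < x < b) -> be x = 0 by move=> /negP; exact: bump1_out.
have b0 x : 0 <= be x by exact: bump1_ge0.
have ib : mu1.-integrable setT (EFin \o be).
  apply: (@integrable_EFin_le R _ M1 mu1 setT be (fun x => \1_(`[a, b]%classic) x)) => //.
  - exact: continuous_measurable_fun.
  - move=> x _; rewrite ger0_norm// indicE; case: (boolP (x \in _)) => [_|]; first exact: bump1_le1.
    rewrite notin_setE /= in_itv/= => /negP xab; rewrite bout// => /andP[ax xb].
    by move: xab; rewrite !ltW.
  - apply: integrable_EFin_ltey => //; first exact: measurable_indic.
    under eq_integral do rewrite ger0_norm ?indicE ?ler0n//.
    rewrite (_ : (\int[mu1]_x _)%E = mu1 `[a, b]%classic).
      by rewrite lebesgue_measure_itv/= lte_fin ab -EFinD ltry.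
    by have := @integral_indic _ M1 R mu1 setT measurableT `[a, b]%classic (measurable_itv _);
      rewrite setIT => <-.
pose c := I1 setT be.
(* An integral equal to 0 would make the bump vanish almost everywhere, but it is positive on ]a,
   b[. *)
have c0 : 0 < c.
  rewrite lt_def; apply/andP; split; last by apply: Rintegral_ge0 => x _; exact: b0.
  apply/eqP => c0.
  have := (@ae_eq_integral_abs _ M1 R mu1 setT measurableT (EFin \o be) _).1.
  move=> /(_ _) [||N [mN N0 NP]].
  - by apply/measurable_EFinP; exact: continuous_measurable_fun.
  - under eq_integral do rewrite /= ger0_norm//.
    by rewrite -(fineK (integrable_fin_num measurableT ib)) -/(Rintegral _ _ _) -/c c0.
  have : (mu1 `]a, b[%classic <= mu1 N)%E.
    apply: le_measure; rewrite ?inE// => x; rewrite /= in_itv/= => xab.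
    apply: NP => /= H; have /eqP := H I; rewrite /= eqe /be /bump1 !flat1E.
    by move: xab => /andP[ax xb]; rewrite !pmulr_rgt0// !subr_gt0 ax xb mulf_eq0 !gt_eqF// expR_gt0.
  by rewrite N0 lebesgue_measure_itv/= lte_fin ab -EFinD lee_fin; lra.
pose rho x := c^-1 * be x.
have crho : continuous rho by apply: continuous_mul => // x; exact: cvg_cst.
have irho : mu1.-integrable setT (EFin \o rho) by exact: integrable_EFinZ.
have Irho : I1 setT rho = 1 by rewrite RintegralZl// -/c mulVf// gt_eqF.
have rout x : ~ (a < x < b) -> rho x = 0 by move=> /bout; rewrite /rho => ->; rewrite mulr0.
have r0 x : 0 <= rho x by rewrite mulr_ge0// invr_ge0 ltW.
pose S x := I1 `]-oo, x] rho.
have iS x : mu1.-integrable `]-oo, x] (EFin \o rho) by apply: integrableS irho.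
have dS (x : R) : is_derive x 1 S (rho x).
  have x1 : x < x + 1 by rewrite ltrDl.
  have [d E] := @continuous_FTC1 R rho (BInfty _ true) x (x + 1) x1 (iS _) (ltNyr _) (crho x).
  by apply: DeriveDef; [exact: d|rewrite -derive1E; exact: E].
have S0 x : x <= a -> S x = 0.
  move=> xa; rewrite /S -[RHS](mul0r 0) /Rintegral integral0_eq ?mul0r// => y.
  rewrite /= in_itv/= => yx; rewrite rout// => /andP[ay _].
  by have := lt_le_trans ay yx; rewrite ltNge xa.
have S1 x : b <= x -> S x = 1.
  move=> bx; rewrite /S Rintegral_supp// => y; rewrite /= in_itv/= => /negP; rewrite -ltNge => xy.
  by apply: rout => /andP[_ yb]; have := lt_trans xy yb; rewrite ltNge bx.
have S01 x : 0 <= S x <= 1.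
  apply/andP; split; first by apply: Rintegral_ge0 => y _; exact: r0.
  rewrite -[leRHS]Irho.
  apply: fine_le; [exact: integrable_fin_num|exact: integrable_fin_num|].
  apply: ge0_subset_integral => //; first by apply/measurable_EFinP; exact: continuous_measurable_fun.
  by move=> y _; rewrite lee_fin.
exists rho, S; split; split=> //.
apply: (@smoothI R R [set f | f = S \/ smooth f]); last by left.
- move=> f [->|sf]; last exact: smooth_continuous.
  by move=> x; apply/differentiable_continuous/derivable1_diffP; have [] := dS x.
- move=> f x v [->|sf]; last exact: smooth_derivable.
  have [d _] := is_derive1_dir v (dS x); exact: d.
- move=> f v [->|sf]; right; last exact: smooth_derive.
  rewrite (_ : 'D_v S = fun x => v * (c^-1 * be x)).
    by apply: smoothZ; exact: smoothZ.
  by apply/funext => x; have [_ ->] := is_derive1_dir v (dS x).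
Qed.

Section Localize.
Context (T : R) (N : set M1) (mN : measurable N) (N0 : mu1 N = 0%E).
Context (K F : R -> R) (cK : tcont T K).
Local Notation J s t := (good_times N s t).

Lemma integral_rho_K (rho : R -> R) (a b p e : R) : 0 <= a -> b <= T -> 0 <= e -> continuous rho ->
  (forall x, 0 <= rho x) -> (forall x, ~ (a < x < b) -> rho x = 0) ->
  mu1.-integrable setT (EFin \o rho) -> I1 setT rho = 1 ->
  (forall x, a < x < b -> `|K x - K p| <= e) ->
  mu1.-integrable (J 0 T) (EFin \o (fun x => rho x * K x)) /\
  `|I1 (J 0 T) (fun x => rho x * K x) - K p| <= e.
Proof.
move=> a0 bT e0 cr r0 rout ir Ir HK.
have mJ : measurable (J 0 T) by exact: measurable_J.
have irJ : mu1.-integrable (J 0 T) (EFin \o rho) by apply: integrableS ir.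
have IrJ : I1 (J 0 T) rho = 1.
  rewrite -Ir -(@Rintegral_supp `]0, T[%classic) /Rintegral.
    by rewrite (@integral_setD_null _ _ M1 mu1 `]0, T[%classic N).
  move=> x H; apply: rout => /andP[ax xb]; apply: H.
  by rewrite /= in_itv/= (le_lt_trans a0 ax) (lt_le_trans xb bT).
have mK : measurable_fun (J 0 T) K.
  by apply: measurable_funS (tcont_measurable cK) => //; exact: subDsetl.
have mr : measurable_fun (J 0 T) rho by apply: measurable_funTS; exact: continuous_measurable_fun.
have D x : `|rho x * (K x - K p)| <= e * rho x.
  have [xab|xab] := boolP (a < x < b); last by rewrite rout ?mul0r ?normr0 ?mulr0//; exact/negP.
  by rewrite normrM (ger0_norm (r0 x)) mulrC ler_wpM2r// HK.
have i1 : mu1.-integrable (J 0 T) (EFin \o (fun x => rho x * (K x - K p))).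
  apply: (@integrable_EFin_le R _ M1 mu1 (J 0 T) _ (fun x => e * rho x)) => //.
    by apply: measurable_funM => //; apply: measurable_funB.
  exact: integrable_EFinZ.
have E x : rho x * K x = rho x * (K x - K p) + K p * rho x by ring.
split.
  rewrite (_ : (fun x => _) = fun x => rho x * (K x - K p) + K p * rho x).
    by apply: integrable_EFinD => //; exact: integrable_EFinZ.
  by apply/funext.
under eq_Rintegral do rewrite E.
have i2 : mu1.-integrable (J 0 T) (EFin \o (fun x => K p * rho x)) by exact: integrable_EFinZ.
rewrite RintegralD// RintegralZl// IrJ mulr1 addrK.
apply: (le_trans (le_normr_Rintegral mJ i1)).
apply: (@le_trans _ _ (I1 (J 0 T) (fun x => e * rho x))).
  apply: le_Rintegral => //; first exact: integrable_EFin_norm.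
  exact: integrable_EFinZ.
by rewrite RintegralZl// IrJ mulr1.
Qed.

(** The difference of two steps rises from 0 to 1 just after s and falls back just before t. Its
    derivative averages [K] near s and near t with opposite signs, while the function itself tends
    to 1 on ]s, t[. *)
Lemma time_localize s t : 0 <= s -> s < t -> t < T ->
  mu1.-integrable (J s t) (EFin \o F) ->
  (forall b b' : R -> R, smooth b -> (forall x : R, is_derive x 1 b (b' x)) ->
    (exists a c : R, [/\ 0 < a, c < T & forall x, ~ (a <= x <= c) -> b x = 0 /\ b' x = 0]) ->
    I1 (J 0 T) (fun x => b' x * K x) = I1 (J 0 T) (fun x => b x * F x)) ->
  K s - K t = I1 (J s t) F.
Proof.
move=> s0 st tT iF W.
(* Since 2 [ep n] is at most (t - s)/2, the rising and the falling layer do not overlap. *)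
pose de := (t - s) / 4; have de0 : 0 < de by rewrite divr_gt0// subr_gt0.
pose ep n : R := de * n.+1%:R^-1.
have ep0 n : 0 < ep n by rewrite mulr_gt0// invr_gt0.
have ep1 n : ep n <= de.
  by rewrite ler_piMr ?(ltW de0)// invf_le1 ?ler1n.
have epc : ep n @[n --> \oo] --> 0.
  by rewrite -[X in _ --> X](mulr0 de); apply: cvgMr; exact: cvg_harmonic.
have de4 : 4 * de = t - s by rewrite /de; lra.
have h1 n : s + ep n < s + 2 * ep n by have := ep0 n; lra.
have h2 n : t - 2 * ep n < t - ep n by have := ep0 n; lra.
have /choice[r1 H1] := fun n => smooth_step (h1 n).
have /choice[r2 H2] := fun n => smooth_step (h2 n).
have {H1} /choice[S1 P1] := H1.
have {H2} /choice[S2 P2] := H2.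
have sT : 0 <= s < T by rewrite s0 (lt_trans st).
have tT' : 0 <= t < T by rewrite tT (le_trans s0 (ltW st)).
have near_small (d : R) : 0 < d -> \forall n \near \oo, 2 * ep n < d.
  move=> d0; have : 2 * ep n @[n --> \oo] --> 0.
    by rewrite -[X in _ --> X](mulr0 2); apply: cvgMr.
  by move=> c; exact: (cvgr_lt _ c).
have B1 n e : 0 <= e -> (forall x, s + ep n < x < s + 2 * ep n -> `|K x - K s| <= e) ->
    mu1.-integrable (J 0 T) (EFin \o (fun x => r1 n x * K x)) /\
    `|I1 (J 0 T) (fun x => r1 n x * K x) - K s| <= e.
  move=> e0; have [[_ _ c p o] [ir Ir _ _ _]] := P1 n.
  have := ep0 n; have := ep1 n => e1 e2.
  by apply: integral_rho_K => //; lra.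
have B2 n e : 0 <= e -> (forall x, t - 2 * ep n < x < t - ep n -> `|K x - K t| <= e) ->
    mu1.-integrable (J 0 T) (EFin \o (fun x => r2 n x * K x)) /\
    `|I1 (J 0 T) (fun x => r2 n x * K x) - K t| <= e.
  move=> e0; have [[_ _ c p o] [ir Ir _ _ _]] := P2 n.
  have := ep0 n; have := ep1 n => e1 e2.
  by apply: integral_rho_K => //; lra.
have [BK BKP] := tcont_bounded cK s0 (ltW st) tT.
have st' : s <= s <= t by rewrite lexx ltW.
have tt' : s <= t <= t by rewrite lexx ltW.
have BK0 : 0 <= BK by exact: le_trans (BKP s st').
have i1 n : mu1.-integrable (J 0 T) (EFin \o (fun x => r1 n x * K x)).
  apply: (B1 n (BK + BK) _ _).1 => [|x /andP[x1 x2]]; first by rewrite addr_ge0.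
  rewrite (le_trans (ler_normB _ _))// lerD// BKP//.
  by have := ep0 n; have := ep1 n => e1 e2; apply/andP; split; lra.
have i2 n : mu1.-integrable (J 0 T) (EFin \o (fun x => r2 n x * K x)).
  apply: (B2 n (BK + BK) _ _).1 => [|x /andP[x1 x2]]; first by rewrite addr_ge0.
  rewrite (le_trans (ler_normB _ _))// lerD// BKP//.
  by have := ep0 n; have := ep1 n => e1 e2; apply/andP; split; lra.
have c1 : I1 (J 0 T) (fun x => r1 n x * K x) @[n --> \oo] --> K s.
  apply/cvgrPdist_le => e e0; have [d d0 dP] := @cK _ _ sT e0.
  apply: filterS (near_small d d0) => n nd; rewrite distrC.
  have := ep0 n; have := ep1 n => e1 e2.
  apply: (B1 n e (ltW e0) _).2 => x /andP[x1 x2]; apply/ltW/dP; first by apply/andP; split; lra.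
  by rewrite ltr_norml; apply/andP; split; lra.
have c2 : I1 (J 0 T) (fun x => r2 n x * K x) @[n --> \oo] --> K t.
  apply/cvgrPdist_le => e e0; have [d d0 dP] := @cK _ _ tT' e0.
  apply: filterS (near_small d d0) => n nd; rewrite distrC.
  have := ep0 n; have := ep1 n => e1 e2.
  apply: (B2 n e (ltW e0) _).2 => x /andP[x1 x2]; apply/ltW/dP; first by apply/andP; split; lra.
  by rewrite ltr_norml; apply/andP; split; lra.
pose b n x := S1 n x - S2 n x.
have bout n x : ~ (s + ep n <= x <= t - ep n) -> b n x = 0.
  move=> H; have [_ [_ _ z1 o1 _]] := P1 n; have [_ [_ _ z2 o2 _]] := P2 n.
  have := ep0 n; have := ep1 n => e1 e2.
  have [xs|xs] := leP x (s + ep n); first by rewrite /b z1// z2 ?subrr//; lra.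
  have [xt|xt] := leP (t - ep n) x; first by rewrite /b o1 ?o2 ?subrr//; lra.
  by exfalso; apply: H; rewrite !ltW.
have mJ a c : measurable (J a c) by exact: measurable_J.
have Wn n : I1 (J 0 T) (fun x => r1 n x * K x) - I1 (J 0 T) (fun x => r2 n x * K x) =
    I1 (J s t) (fun x => b n x * F x).
  have [[s1 d1 _ _ _] _] := P1 n; have [[s2 d2 _ _ _] _] := P2 n.
  rewrite -RintegralB//.
  transitivity (I1 (J 0 T) (fun x => b n x * F x)).
    rewrite -(W (b n) (fun x => r1 n x - r2 n x)).
    - by apply: eq_Rintegral => x _; rewrite mulrBl.
    - rewrite (_ : b n = fun x => S1 n x + -1 * S2 n x).
        by apply: smoothD; [exact: s1|exact: smoothZ].
      by apply/funext => x; rewrite mulN1r.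
    - exists (s + ep n), (t - ep n); have := ep0 n => e1.
      split; [lra|lra|move=> x xab; split; first exact: bout].
      have [[_ _ _ _ o1] _] := P1 n; have [[_ _ _ _ o2] _] := P2 n.
      rewrite o1 ?o2 ?subrr//; apply: contra_not xab => /andP[? ?]; apply/andP; have := ep1 n;
        split; lra.
  (* With this factor the integrand vanishes outside J 0 T and outside J s t alike, so both
     integrals equal the one over the whole line. *)
  pose f x := (b n \* F) x * \1_(~` N) x.
  transitivity (I1 setT f).
    rewrite -(@Rintegral_supp (J 0 T)).
      apply: eq_Rintegral => x; rewrite inE => -[_ Nx].
      by rewrite /f indicE mem_set// mulr1.
    move=> x Jx; rewrite /f; have [Nx|Nx] := pselect (N x).
      by rewrite indicE memNset ?mulr0// => /(_ Nx).
    rewrite /= bout ?mul0r// => /andP[sx xt]; apply: Jx; split=> //=.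
    by rewrite in_itv/=; have := ep0 n => e1; apply/andP; split; lra.
  rewrite -(@Rintegral_supp (J s t)).
    apply: eq_Rintegral => x; rewrite inE => -[_ Nx].
    by rewrite /f indicE mem_set// mulr1.
  move=> x Jx; rewrite /f; have [Nx|Nx] := pselect (N x).
    by rewrite indicE memNset ?mulr0// => /(_ Nx).
  rewrite /= bout ?mul0r// => /andP[sx xt]; apply: Jx; split=> //=.
  by rewrite in_itv/=; have := ep0 n => e1; apply/andP; split; lra.
have c3 : I1 (J s t) (fun x => b n x * F x) @[n --> \oo] --> K s - K t.
  rewrite (_ : (fun n => _) = fun n => I1 (J 0 T) (fun x => r1 n x * K x) -
      I1 (J 0 T) (fun x => r2 n x * K x)); first exact: cvgB.
  by apply/funext => n; rewrite Wn.
apply: (cvgR_unique c3).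
have mF : measurable_fun (J s t) F by exact: integrable_EFin_measurable iF.
apply: (@Rintegral_dominated R _ M1 mu1 (J s t) (fun n x => b n x * F x) F (fun x => `|F x|) _ _ _ _ _).2.
- exact: mJ.
- move=> n; apply: measurable_funM => //; apply: measurable_funTS.
  have [[s1 _ _ _ _] _] := P1 n; have [[s2 _ _ _ _] _] := P2 n.
  by apply: measurable_funB; apply: continuous_measurable_fun; exact: smooth_continuous.
- move=> x [/=]; rewrite in_itv/= => /andP[sx xt] _.
  rewrite -[X in _ --> X]mul1r; apply: cvgMl; apply: cvg_near_cst.
  have d0 : 0 < Num.min (x - s) (t - x) by rewrite lt_min !subr_gt0 sx xt.
  apply: filterS (near_small _ d0) => n; rewrite lt_min => /andP[n1 n2].
  have [_ [_ _ _ o1 _]] := P1 n; have [_ [_ _ z2 _ _]] := P2 n.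
  by rewrite /b o1 ?z2 ?subr0//; lra.
- move=> n x _; rewrite normrM ler_piMl//.
  have [_ [_ _ _ _ /(_ x)/andP[a1 a2]]] := P1 n; have [_ [_ _ _ _ /(_ x)/andP[a3 a4]]] := P2 n.
  by rewrite /b ler_norml; apply/andP; split; lra.
- exact: integrable_EFin_norm.
Qed.
End Localize.
End Localization.

(** * The weak equation in frequency space *)

Section Convection.
Context {R : realType}.
Local Notation V := (R3 R).
Local Notation M1 := (measurableTypeR R).
Local Notation M3 := (M1 * M1 * M1)%type.

Local Notation C := R[i].
Local Notation normc := (@Normc.normc R).
Local Notation field := (V -> 'I_3 -> C).
Local Notation "'Cf' w" := (Tr 0 w) (at level 10, w at level 8).
Local Notation "'Sf' w" := (Tr (- (pi / 2)) w) (at level 10, w at level 8).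
Implicit Types (a b w psi : V -> R) (f : vdist R) (g m : field).

(** The real form of the rule that multiplying an inverse transform by exp(i x.xi) translates the
    transform by xi. *)
Lemma Tr_shift c a (xi x : V) : ig3 a ->
  ig3 (fun z : V => a (z - xi)) /\
  cos (dot xi x) * Tr c a x - sin (dot xi x) * Tr (c - pi / 2) a x =
  Tr c (fun z => a (z - xi)) x.
Proof.
move=> ia; have n1 : (1 : R) != 0 by exact: oner_neq0.
have sh (k : V -> R) : ig3 k -> ig3 (fun z : V => k (z - xi)) /\
    I3 (fun z : V => k (z - xi)) = I3 k.
  move=> ik; have [i E] := I3_affine (- xi) n1 ik.
  rewrite normr1 expr1n invr1 mul1r in E.
  rewrite (_ : (fun z => k (z - xi)) = fun z => k (1 *: z - xi))//.
  by apply/funext => z; rewrite scale1r.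
split; first exact: (sh _ ia).1.
have iac := ig3_cosM c x ia; have ias := ig3_cosM (c - pi / 2) x ia.
have ik : ig3 (fun y => cos (dot y x + dot xi x + c) * a y).
  have := ig3_cosM (dot xi x + c) x ia; congr ig3; apply/funext => y.
  by rewrite addrA.
have [_ E] := sh _ ik.
rewrite !TrE -!I3Z// -I3B; [|exact: ig3Z|exact: ig3Z].
transitivity (I3 (fun y => cos (dot y x + dot xi x + c) * a y)).
  apply: eq_I3 => y; rewrite addrA cosB_pihalf (addrAC (dot y x)) (cosD (_ + c)); ring.
rewrite -E; apply: eq_I3 => z; congr (cos _ * _).
by rewrite !dotE/=; ring.
Qed.

Lemma I3_shift a (xi : V) : ig3 a ->
  ig3 (fun z : V => a (z - xi)) /\ I3 (fun z : V => a (z - xi)) = I3 a.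
Proof.
have n1 : (1 : R) != 0 by exact: oner_neq0.
move=> ik; have [i E] := I3_affine (- xi) n1 ik.
rewrite normr1 expr1n invr1 mul1r in E.
rewrite (_ : (fun z => a (z - xi)) = fun z => a (1 *: z - xi))//.
by apply/funext => z; rewrite scale1r.
Qed.

Lemma Tr_Npi_ig3 a x : ig3 a -> Tr (- (pi / 2) - pi / 2) a x = - Tr 0 a x.
Proof.
move=> ia; rewrite !TrE -I3N; last exact: ig3_cosM.
apply: eq_I3 => y; rewrite -opprD -splitr addr0 -mulNr.
by rewrite -cosN opprB addrC -[in RHS]cosN -cosDpi.
Qed.

(* The complex conjugate of the Fourier transform of the real function [psi]. *)
Definition Qt psi (xi : V) : C := (Cf psi xi +i* Sf psi xi)%C.

Lemma Qt_derive psi k xi : test psi ->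
  Qt ('D_(ebasis R k) psi) xi = - ('i * (xcoord xi k)%:C * Qt psi xi)%C.
Proof.
move=> tpsi.
have h1 := Tr_mul (- (pi / 2)) xi (ebasis R k) tpsi.
have h2 := Tr_mul (- (pi / 2) - pi / 2) xi (ebasis R k) tpsi.
rewrite addNr in h1; rewrite subrK in h2.
rewrite /Qt -h1 -h2 Tr_Npi; last exact: test_bcs.
rewrite dot_ebasis; apply/eqP; rewrite eq_complex /=.
by apply/andP; split; apply/eqP; ring.
Qed.

Lemma Qt_bound1 psi : test psi -> exists M : R, forall x, normc (Qt psi x) <= M * (1 + `|x|)^-1.
Proof.
move=> tpsi; have [M1 H1] := Tr_bound1 0 tpsi; have [M2 H2] := Tr_bound1 (- (pi / 2)) tpsi.
exists (M1 + M2) => x; apply: (le_trans (normc_le _)); rewrite mulrDl /=.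
exact: lerD (H1 x) (H2 x).
Qed.

Lemma cmeas_Qt psi : test psi -> @cmeas R _ M3 (Qt psi).
Proof. by move=> tpsi; split; exact: meas3_Tr. Qed.

Lemma function_of_meas (f : functional V) : meas3 (function_of f).
Proof.
rewrite /function_of; case: xgetP => [h _ [[mh _] _]|_]; first exact: mh.
exact: meas3_cst.
Qed.

Lemma I3_Tr_translate c a w (xi : V) : ig3 a -> ig3 w ->
  ig3 (fun eta => a eta * Tr c w (xi + eta)) /\
  I3 (fun eta => a eta * Tr c w (xi + eta)) =
  I3 (fun x => Tr c (fun z => a (z - xi)) x * w x).
Proof.
move=> ia iw; have [ia1 _] := I3_shift xi ia.
have [q1 _ q2] := I3_Tr_swap c ia1 iw.
pose k (z : V) := a (z - xi) * Tr c w z.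
have [q3 q4] := @I3_shift k (- xi) q1.
have E : (fun eta => a eta * Tr c w (xi + eta)) = fun z => k (z - - xi).
  by apply/funext => z; rewrite /k opprK addrK (addrC xi).
by rewrite E; split; [exact: q3|rewrite q4; exact: q2].
Qed.

Lemma I3_lin4 (c d : R) (p1 p2 p3 p4 : V -> R) : ig3 p1 -> ig3 p2 -> ig3 p3 -> ig3 p4 ->
  I3 (fun x => c * (p1 x - p2 x) - d * (p3 x + p4 x)) =
  c * (I3 p1 - I3 p2) - d * (I3 p3 + I3 p4).
Proof.
move=> i1 i2 i3 i4; have iB := ig3B i1 i2; have iD := ig3D i3 i4.
by rewrite I3B; [rewrite !I3Z// I3B// I3D//|exact: ig3Z|exact: ig3Z].
Qed.

(* With H = F^-1 g (without its constant), the factor w H H' is moved to the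
   Fourier side one variable at a time. *)
Lemma conv_fourier a b a' b' w : ig3 a -> ig3 b -> ig3 a' -> ig3 b' -> test w ->
  let X x := Cf a x - Sf b x in let Y x := Sf a x + Cf b x in
  let X' x := Cf a' x - Sf b' x in let Y' x := Sf a' x + Cf b' x in
  ig3 (fun x => X x * (X' x * w x) - Y x * (Y' x * w x)) /\
  I3 (fun x => X x * (X' x * w x) - Y x * (Y' x * w x)) =
  I3 (fun xi => I3 (fun eta => (a xi * a' eta - b xi * b' eta) * Cf w (xi + eta)
    - (a xi * b' eta + b xi * a' eta) * Sf w (xi + eta))).
Proof.
move=> ia ib ia' ib' tw X Y X' Y'; have bw := test_bcs tw; have iw := ig3_bcs bw.
have cT c k : ig3 k -> continuous (Tr c k) by exact: continuous_Tr_ig3.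
have cX' : continuous X' by move=> x; apply: cvgB; exact: cT.
have cY' : continuous Y' by move=> x; apply: cvgD; exact: cT.
have iX : ig3 (fun x => X' x * w x) by apply: ig3_bcs; exact: bcsM.
have iY : ig3 (fun x => Y' x * w x) by apply: ig3_bcs; exact: bcsM.
have iR : ig3 (fun x => X x * (X' x * w x) - Y x * (Y' x * w x)).
  have [ia1 ja1 _] := I3_Tr_swap 0 ia iX; have [_ ja2 _] := I3_Tr_swap (- (pi / 2)) ib iX.
  have [_ ja3 _] := I3_Tr_swap (- (pi / 2)) ia iY; have [_ ja4 _] := I3_Tr_swap 0 ib iY.
  have := ig3B (ig3B ja1 ja2) (ig3D ja3 ja4); congr ig3; apply/funext => x.
  by rewrite /X /Y; ring.
have [i1 j1 e1] := I3_Tr_swap 0 ia iX; have [i2 j2 e2] := I3_Tr_swap (- (pi / 2)) ib iX.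
have [i3 j3 e3] := I3_Tr_swap (- (pi / 2)) ia iY; have [i4 j4 e4] := I3_Tr_swap 0 ib iY.
split; first exact: iR.
transitivity (I3 (fun x => 1 * (Cf a x * (X' x * w x) - Sf b x * (X' x * w x)) -
   1 * (Sf a x * (Y' x * w x) + Cf b x * (Y' x * w x)))).
  by apply: eq_I3 => x; rewrite /X /Y; ring.
rewrite (I3_lin4 1 1 j1 j2 j3 j4).
transitivity (1 * (I3 (fun x => a x * Cf (fun x => X' x * w x) x) -
    I3 (fun x => b x * Sf (fun x => X' x * w x) x)) -
  1 * (I3 (fun x => a x * Sf (fun x => Y' x * w x) x) +
    I3 (fun x => b x * Cf (fun x => Y' x * w x) x))).
  have K (p q r s p' q' r' s' : R) : p = p' -> q = q' -> r = r' -> s = s' ->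
    1 * (p' - q') - 1 * (r' + s') = 1 * (p - q) - 1 * (r + s) by do 4!move=> ->.
  exact: K e1 e2 e3 e4.
rewrite -(I3_lin4 1 1 i1 i2 i3 i4).
(* For fixed xi the phases in x.xi are absorbed by translating a' and b' by xi; a second exchange
   puts the transform on [w], evaluated at xi + eta. *)
apply: eq_I3 => xi.
have [k1 s1] := I3_shift xi ia'; have [k2 s2] := I3_shift xi ib'.
pose a1 (z : V) := a' (z - xi); pose b1 (z : V) := b' (z - xi).
have [ia1 T1] := (fun c x => proj1 (Tr_shift c xi x ia'), fun c x => proj2 (Tr_shift c xi x ia')).
have T2 c x := proj2 (Tr_shift c xi x ib').
have ib1 : ig3 b1 by exact: k2.
have ia1' : ig3 a1 by exact: k1.
have sw c := I3_Tr_translate c xi ia' iw; have sw' c := I3_Tr_translate c xi ib' iw.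
have [u1 v1] := sw 0; have [u2 v2] := sw (- (pi / 2)).
have [u3 v3] := sw' 0; have [u4 v4] := sw' (- (pi / 2)).
have jT c k : ig3 k -> ig3 (fun x => Tr c k x * w x).
  by move=> ik; have [] := I3_Tr_swap c ik iw.
have co c k : ig3 k -> ig3 (fun y => cos (dot y xi + c) * k y) by exact: ig3_cosM.
have P1 : Cf (fun x => X' x * w x) xi - Sf (fun x => Y' x * w x) xi =
    I3 (fun eta => a' eta * Cf w (xi + eta)) - I3 (fun eta => b' eta * Sf w (xi + eta)).
  rewrite v1 v4 !TrE -!I3B; [|exact: jT|exact: jT|exact: co|exact: co].
  apply: eq_I3 => x; rewrite -(T1 0) -(T2 (- (pi / 2))) sub0r Tr_Npi_ig3//.
  by rewrite addr0 cosB_pihalf (dotC x xi) /X' /Y'; ring.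
have P2 : Sf (fun x => X' x * w x) xi + Cf (fun x => Y' x * w x) xi =
    I3 (fun eta => a' eta * Sf w (xi + eta)) + I3 (fun eta => b' eta * Cf w (xi + eta)).
  rewrite v2 v3 !TrE -!I3D; [|exact: jT|exact: jT|exact: co|exact: co].
  apply: eq_I3 => x; rewrite -(T1 (- (pi / 2))) -(T2 0) sub0r Tr_Npi_ig3//.
  by rewrite addr0 cosB_pihalf (dotC x xi) /X' /Y'; ring.
transitivity (a xi * (Cf (fun x => X' x * w x) xi - Sf (fun x => Y' x * w x) xi) -
    b xi * (Sf (fun x => X' x * w x) xi + Cf (fun x => Y' x * w x) xi)); first by ring.
apply: etrans (congr2 (fun p q => a xi * p - b xi * q) P1 P2) _.
rewrite -(I3_lin4 (a xi) (b xi) u1 u4 u2 u3).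
by apply: eq_I3 => eta; ring.
Qed.

(* The inverse transforms are real, so Re (H H') = Re H Re H'. *)
Lemma dmul_fourier (f f' : functional V) a b a' b' w :
  fpair f a b -> fpair f' a' b' -> ig3 a -> ig3 b -> ig3 a' -> ig3 b' -> test w ->
  (2 * pi) ^+ 6 * dmul f f' w =
  I3 (fun xi => I3 (fun eta => (a xi * a' eta - b xi * b' eta) * Cf w (xi + eta)
    - (a xi * b' eta + b xi * a' eta) * Sf w (xi + eta))).
Proof.
move=> Hf Hf' ia ib ia' ib' tw.
have A := aeI (function_of_inversion Hf ia ib) (function_of_inversion Hf' ia' ib').
have [iR <-] := conv_fourier ia ib ia' ib' tw; set F := (fun x => _ - _) in iR *.
have K0 : (2 * pi) ^+ 3 != 0 :> R by rewrite expf_neq0// mulf_neq0// gt_eqF// pi_gt0.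
rewrite (_ : dmul f f' w = I3 (fun x => ((2 * pi) ^+ 6)^-1 * F x)).
  rewrite I3Z// mulrA mulfV ?mul1r//.
  by rewrite (_ : 6 = 3 + 3)%N// exprD mulf_neq0.
apply: ae_I3; [|by apply: meas3M; [exact: meas3_cst|exact: ig3_meas]|].
  apply: meas3M; last exact: (test_bcs tw).1.
  by apply: meas3M; exact: function_of_meas.
apply: aeS A => x [[h1 h2] [h3 h4]]; rewrite /F h2 mul0r subr0 -h1 -h3.
have : 2 * pi != 0 :> R by rewrite mulf_neq0// gt_eqF// pi_gt0.
by move: (2 * pi) => r r0; field.
Qed.

(** Replacing a + i b by i (a + i b) = - b + i a in [conv_fourier] turns the left side into the
    integral of minus the imaginary part of H H' w, which is 0 because both inverse transforms are
    real almost everywhere. *)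
Lemma conv_fourier_im (f f' : functional V) a b a' b' w :
  fpair f a b -> fpair f' a' b' -> ig3 a -> ig3 b -> ig3 a' -> ig3 b' -> test w ->
  I3 (fun xi => I3 (fun eta => (-1 * b xi * a' eta - a xi * b' eta) * Cf w (xi + eta)
    - (-1 * b xi * b' eta + a xi * a' eta) * Sf w (xi + eta))) = 0.
Proof.
move=> Hf Hf' ia ib ia' ib' tw.
have A := aeI (function_of_inversion Hf ia ib) (function_of_inversion Hf' ia' ib').
have ib1 : ig3 (fun x => -1 * b x) by exact: ig3Z.
have [iR <-] := conv_fourier ib1 ia ia' ib' tw; set F := (fun x => _ - _) in iR *.
have ZN c x : Tr c (fun x => -1 * b x) x = - Tr c b x.
  rewrite !TrE -I3N; last exact: ig3_cosM.
  by apply: eq_I3 => y; rewrite mulN1r mulrN.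
rewrite (_ : I3 F = I3 (fun=> 0)); last first.
  apply: ae_I3; [exact: ig3_meas|exact: meas3_cst|].
  apply: aeS A => x [[_ h2] [_ h4]]; rewrite /F h4 mul0r mulr0 subr0 !ZN.
  by rewrite -opprD addrC h2 oppr0 mul0r.
by rewrite -[RHS](mul0r (I3 F)) -I3Z//; apply: eq_I3 => x; rewrite mul0r.
Qed.
End Convection.

Section Tensor.
Context {R : realType}.
Local Notation V := (R3 R).
Local Notation mu1 := (@lebesgue_measure R).

Local Notation C := R[i].
Local Notation field := (V -> 'I_3 -> C).
Implicit Types (psi : V -> R) (b : R -> R) (g m : field).
Local Notation S4 := (spacetime R).

Definition tens b psi : S4 -> R := fun z => b z.1 * psi z.2.

(** The directions [dir_t] and [dir_x k] each have a zero component, so one factor of a tensor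
    product is differentiated in direction 0. *)
Lemma derive0v (W : normedModType R) (k : W -> R) x : is_derive x 0 k 0.
Proof.
have E : (fun h : R => h^-1 *: (k (h *: 0 + x) - k x)) = fun=> 0.
  by apply/funext => h; rewrite scaler0 add0r subrr scaler0.
apply: DeriveDef.
  by rewrite /derivable E; exact: is_cvg_cst.
by rewrite /derive E; exact: lim_cst.
Qed.

Lemma fst_affine (x : S4) (h : R) (v : S4) : (h *: v + x).1 = h *: v.1 + x.1. Proof. by []. Qed.
Lemma snd_affine (x : S4) (h : R) (v : S4) : (h *: v + x).2 = h *: v.2 + x.2. Proof. by []. Qed.

Lemma is_derive_fst (k : R -> R) (z v : S4) (d : R) :
  is_derive z.1 v.1 k d -> is_derive z v (fun y : S4 => k y.1) d.
Proof.
move=> [kd E]; apply: DeriveDef.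
  exact: (@derivable_affine R S4 R (fun y : S4 => y.1) (fun y : S4 => y.1) fst_affine k z v kd).
have := @derive_affine R S4 R (fun y : S4 => y.1) (fun y : S4 => y.1) fst_affine k v.
by move=> /(congr1 (fun q => q z)) /= ->.
Qed.

Lemma is_derive_snd (k : V -> R) (z v : S4) (d : R) :
  is_derive z.2 v.2 k d -> is_derive z v (fun y : S4 => k y.2) d.
Proof.
move=> [kd E]; apply: DeriveDef.
  exact: (@derivable_affine R S4 V (fun y : S4 => y.2) (fun y : S4 => y.2) snd_affine k z v kd).
have := @derive_affine R S4 V (fun y : S4 => y.2) (fun y : S4 => y.2) snd_affine k v.
by move=> /(congr1 (fun q => q z)) /= ->.
Qed.

Lemma derive_tens_t b b' psi : (forall x : R, is_derive x 1 b (b' x)) -> smooth psi ->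
  'D_(dir_t R) (tens b psi) = tens b' psi.
Proof.
move=> db sp; apply/funext => z.
have d1 : is_derive z (dir_t R) (fun y : S4 => b y.1) (b' z.1) by apply: is_derive_fst; exact: db.
have d2 : is_derive z (dir_t R) (fun y : S4 => psi y.2) 0 by apply: is_derive_snd; exact: derive0v.
have [_] := is_derive_mul d1 d2; rewrite mulr0 add0r mulrC => ->//.
Qed.

Lemma derive_tens_x b psi k : smooth psi ->
  'D_(dir_x R k) (tens b psi) = tens b ('D_(ebasis R k) psi).
Proof.
move=> sp; apply/funext => z.
have d1 : is_derive z (dir_x R k) (fun y : S4 => b y.1) 0 by apply: is_derive_fst; exact: derive0v.
have d2 : is_derive z (dir_x R k) (fun y : S4 => psi y.2) ('D_(ebasis R k) psi z.2).
  by apply: is_derive_snd; exact: is_derive_smooth.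
by have [_] := is_derive_mul d1 d2; rewrite mulr0 addr0.
Qed.

Lemma test_tens (T a c : R) b psi : 0 < a -> c < T -> smooth b ->
  (forall x, ~ (a <= x <= c) -> b x = 0) -> test psi -> test_function (strip T) (tens b psi).
Proof.
move=> a0 cT sb bout /testP[sp [N sN]]; split.
  apply: smoothM.
    apply: (@smooth_affine R S4 R (fun y : S4 => y.1) (fun y : S4 => y.1) fst_affine b) => //.
    by move=> z; exact: cvg_fst.
  apply: (@smooth_affine R S4 V (fun y : S4 => y.2) (fun y : S4 => y.2) snd_affine psi) => //.
  by move=> z; exact: cvg_snd.
exists (`[a, c]%classic `*` cube N); split.
- by apply: compact_setX; [exact: segment_compact|exact: compact_cube].
- move=> z [/=]; rewrite in_itv/= => /andP[az zc] _.
  by rewrite /strip/= (lt_le_trans a0 az) (le_lt_trans zc cT).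
- move=> z Kz; rewrite /tens; have [z1|z1] := pselect (a <= z.1 <= c); last by rewrite bout ?mul0r.
  have [z2|z2] := pselect (cube N z.2); last by rewrite sN ?mulr0.
  by exfalso; apply: Kz; split=> //=; rewrite in_itv.
Qed.

Lemma tempered_lin (f : functional V) : tempered f ->
  (forall (a : R) phi, schwartz phi -> f (fun x => a * phi x) = a * f phi) /\
  forall phi phi', schwartz phi -> schwartz phi' -> f (fun x => phi x + phi' x) = f phi + f phi'.
Proof.
move=> [lf _].
have A phi phi' : schwartz phi -> schwartz phi' -> f (fun x => phi x + phi' x) = f phi + f phi'.
  move=> sp sp'; have := lf 1 _ _ sp sp'; rewrite mul1r => <-.
  by congr f; apply/funext => x; rewrite mul1r.
split=> // a phi sp.
have s0 : schwartz (fun _ : V => 0 : R).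
  have := schwartzZ 0 sp; congr schwartz; apply/funext => x; rewrite mul0r//.
have f0 : f (fun=> 0) = 0.
  have := A _ _ s0 s0; under [X in f X]eq_fun do rewrite addr0.
  by move=> h; lra.
have := lf a _ _ sp s0; rewrite f0 addr0 => <-.
by congr f; apply/funext => x; rewrite addr0.
Qed.

Lemma st_tens (T : R) (f : R -> functional V) b psi :
  (forall t, 0 < t < T -> tempered (f t)) -> schwartz psi ->
  st T f (tens b psi) = Rintegral mu1 `]0, T[ (fun t => b t * f t psi).
Proof.
move=> tf sp; apply: eq_Rintegral => t; rewrite inE/= in_itv/= => tT.
by rewrite /tens /= (tempered_lin (tf t tT)).1.
Qed.
End Tensor.

Section WeakPointwise.
Context {R : realType}.
Local Notation V := (R3 R).
Local Notation M1 := (measurableTypeR R).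

Local Notation C := R[i].
Local Notation re := (@complex.Re R).
Local Notation im := (@complex.Im R).
Local Notation field := (V -> 'I_3 -> C).
Implicit Types (psi : V -> R) (g m : field) (phi : 'I_3 -> V -> R) (f : vdist R).
Local Notation K3 := ((2 * pi : R) ^+ 3).

Definition qs (j : 'I_3) psi : field := fun xi i => if i == j then Qt psi xi else 0.
Definition qf phi : field := fun xi j => Qt (phi j) xi.

Lemma mlt_qs j psi : test psi -> exists M, mlt 1 M (qs j psi).
Proof.
move=> tpsi; have [M HM] := Qt_bound1 tpsi; exists M; split.
  by move=> i; rewrite /qs; case: (i == j); [exact: cmeas_Qt|exact: cmeas_cst].
move=> x; rewrite expr1 (le_trans _ (HM x))// (le_trans (cn_le_sum _))// (bigD1 j)//= /qs eqxx.
by rewrite big1 ?addr0// => i /negPf ->; rewrite Normc.normc0.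
Qed.

Lemma mlt_qf k phi : (forall j, test (phi j)) -> exists M, mlt k M (qf phi).
Proof.
move=> tphi.
have H c : exists M : 'I_3 -> R, forall j x, `|Tr c (phi j) x| <= M j * (1 + `|x|) ^- k.
  have /choice[M HM] : forall j, exists M : R, forall x, `|Tr c (phi j) x| <= M * (1 + `|x|) ^- k.
    move=> j; have [M HM] := Tr_decay c k (tphi j); exists M => x.
    by rewrite ler_pdivlMr ?exprn_gt0 ?w0// mulrC; exact: HM.
  by exists M.
have [M1 H1] := H 0; have [M2 H2] := H (- (pi / 2)).
exists (\sum_j (M1 j + M2 j)); split; first by move=> j; exact: cmeas_Qt.
move=> x; rewrite (le_trans (cn_le_sum _))// mulr_suml ler_sum// => j _.
rewrite (le_trans (normc_le _))// mulrDl; exact: lerD (H1 j x) (H2 j x).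
Qed.

Lemma re_sum3 (c : 'I_3 -> C) : re (\sum_(j < 3) c j) = \sum_(j < 3) re (c j).
Proof. by rewrite !sum3E !reD. Qed.

Definition component (j : 'I_3) m : field := fun x i => if i == j then m x i else 0.

(** [dmul] multiplies one pair of components, so the convection form is split along the same
    pairs. *)
Lemma Bpt_split g h m z :
  Bpt g h m z = \sum_(j < 3) \sum_(k < 3) Bpt (sel (pred1 k) g) h (component j m) z.
Proof.
have S (v w : 'I_3 -> C) : \sum_(k < 3) cdot v (fun i => if i == k then w i else 0) = cdot v w.
  apply: eq_bigr => k _; rewrite /cdot (bigD1 k)//= eqxx big1 ?addr0// => i /negPf ->.
  by rewrite mulr0.
rewrite /Bpt -(S (h z.2)) -(S (cvec (z.1 + z.2))) mulr_sumr mulr_sumr re_sum3.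
apply: eq_bigr => j _; rewrite mulr_suml mulr_sumr re_sum3.
by apply: eq_bigr.
Qed.

Section Pointwise.
Context (f : vdist R) (cf : in_chi (-1) f).
Local Notation G := (hatf f).

Definition Pj (j : 'I_3) psi : R := I3 (fun xi => re (G xi j * Qt psi xi)).

Lemma Pj_ig j psi : test psi -> ig3 (fun xi => re (G xi j * Qt psi xi)).
Proof.
move=> tpsi; have [_ wa wb _] := in_chi_fpair j cf.
have := ig3B (wig_Tr 0 wa tpsi) (wig_Tr (- (pi / 2)) wb tpsi); congr ig3.
by apply/funext => xi; rewrite reM.
Qed.

Lemma PjE j psi : test psi -> K3 * f j psi = Pj j psi.
Proof.
move=> tpsi; rewrite (fpair_inversion (in_chi_fpair j cf) tpsi).1.
by apply: eq_I3 => xi; rewrite reM.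
Qed.

Lemma Pj_Kf j psi : Pj j psi = Kf G (qs j psi).
Proof.
apply: eq_I3 => xi; rewrite /cdot re_sum3 (bigD1 j)//= /qs eqxx big1 ?addr0// => i /negPf ->.
by rewrite mulr0.
Qed.

Lemma Kf_qf phi : (forall j, test (phi j)) ->
  Kf G (qf phi) = K3 * \sum_(j < 3) f j (phi j).
Proof.
move=> tphi; rewrite mulr_sumr; under eq_bigr do rewrite PjE//.
rewrite -I3_sum; last by move=> j; exact: Pj_ig.
by apply: eq_I3 => xi; rewrite /cdot re_sum3.
Qed.

Lemma Qt_derive2 psi k xi : test psi ->
  Qt ('D_(ebasis R k) ('D_(ebasis R k) psi)) xi = - ((xcoord xi k ^+ 2)%:C%C * Qt psi xi).
Proof.
move=> tpsi; rewrite Qt_derive; last exact: test_derive.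
rewrite Qt_derive// mulrN opprK !mulrA.
rewrite -mulNr; congr (_ * _); apply/eqP; rewrite eq_complex/=.
by apply/andP; split; apply/eqP; ring.
Qed.

Lemma cdot_Lm (nu Omega : R) (z : 'I_3 -> C) m x : re (cdot z (Lm nu Omega m x)) =
  - nu * (\sum_(j < 3) \sum_(k < 3) - (xcoord x k ^+ 2 * re (z j * m x j)))
  + Omega * (re (z 0 * m x 1) - re (z 1 * m x 0)).
Proof.
have e2 : enorm x ^+ 2 = xcoord x 0 ^+ 2 + xcoord x 1 ^+ 2 + xcoord x 2%:R ^+ 2.
  by rewrite /enorm sqr_sqrtr /dot sum3E -!expr2// !addr_ge0 ?sqr_ge0.
rewrite !sum3E /cdot sum3E /Lm e2 (_ : rot3 m x 0 = m x 1)//.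
rewrite (_ : rot3 m x 1 = - m x 0)// (_ : rot3 m x 2%:R = 0)//.
move: (xcoord x 0) (xcoord x 1) (xcoord x 2%:R) => a b c.
move: (z 0) (z 1) (z 2%:R) (m x 0) (m x 1) (m x 2%:R).
move=> [? ?] [? ?] [? ?] [? ?] [? ?] [? ?] /=; ring.
Qed.

Lemma Kf_Lm (nu Omega : R) phi : (forall j, test (phi j)) ->
  Kf G (Lm nu Omega (qf phi)) =
  K3 * (- nu * (\sum_(j < 3) \sum_(k < 3) f j ('D_(ebasis R k) ('D_(ebasis R k) (phi j))))
    + Omega * (f 0 (phi 1) - f 1 (phi 0))).
Proof.
move=> tphi; rewrite mulrDr mulrCA (mulrCA _ Omega) mulrBr !PjE//.
have tD j k : test ('D_(ebasis R k) ('D_(ebasis R k) (phi j))).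
  by apply: test_derive; exact: test_derive.
have i1 j k := Pj_ig j (tD j k).
have -> : K3 * (\sum_(j < 3) \sum_(k < 3) f j ('D_(ebasis R k) ('D_(ebasis R k) (phi j)))) =
    I3 (fun xi => \sum_(j < 3) \sum_(k < 3) re (G xi j * Qt ('D_(ebasis R k) ('D_(ebasis R k) (phi j))) xi)).
  rewrite mulr_sumr I3_sum; last by move=> j; exact: ig3_sum.
  apply: eq_bigr => j _; rewrite I3_sum// mulr_sumr; apply: eq_bigr => k _; exact: PjE.
have iS : ig3 (fun xi => \sum_(j < 3) \sum_(k < 3) re (G xi j * Qt ('D_(ebasis R k) ('D_(ebasis R k) (phi j))) xi)).
  by apply: ig3_sum => j; exact: ig3_sum.
have iB : ig3 (fun xi => re (G xi 0 * Qt (phi 1) xi) - re (G xi 1 * Qt (phi 0) xi)).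
  by apply: ig3B; exact: Pj_ig.
rewrite /Pj -I3B; [|exact: Pj_ig|exact: Pj_ig].
rewrite -!I3Z// -I3D; [|exact: ig3Z|exact: ig3Z].
apply: eq_I3 => xi; rewrite (cdot_Lm nu Omega (G xi) (qf phi) xi).
congr (- nu * _ + _); apply: eq_bigr => j _; apply: eq_bigr => k _.
rewrite (Qt_derive2 k xi (tphi j)) mulrN mulrCA; move: (G xi j * _) => [c d] /=; ring.
Qed.

Section Regular.
Context (cf1 : in_chi 1 f).
Let LG : L1f G := fld_L1f (in_chi_fld cf) (in_chi_ep cf1).2.

Lemma ig3_comp j : ig3 (fun x => re (G x j)) /\ ig3 (fun x => im (G x j)).
Proof.
have [mG iG] := LG; split; apply: (ig3_le _ _ iG) => [|x].
- exact: (mG j).1.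
- by rewrite (le_trans (normr_re_le _))// (normc_le_cn (G x) j).
- exact: (mG j).2.
- by rewrite (le_trans (normr_im_le _))// (normc_le_cn (G x) j).
Qed.

(** [Qt_derive] turns the derivative of [psi] into the factor -i (xi + eta)_k, and [dmul_fourier]
    identifies the resulting double integral with the product of the two components. *)
Lemma Bf_dmul k j psi : test psi ->
  Bf (sel (pred1 k) G) G (qs j psi) =
  - ((2 * pi) ^+ 6 * dmul (f k) (f j) ('D_(ebasis R k) psi)).
Proof.
move=> tpsi; have [ik ik'] := ig3_comp k; have [ij ij'] := ig3_comp j.
have [M mM] := mlt_qs j tpsi.
rewrite (dmul_fourier (in_chi_fpair k cf) (in_chi_fpair j cf))//; last exact: test_derive.
have i6 := Bf_ig (L1f_sel (pred1 k) LG).1 LG mM.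
have -> : Bf (sel (pred1 k) G) G (qs j psi) = - I6 (fun z => -1 * Bpt (sel (pred1 k) G) G (qs j psi) z).
  by rewrite I6Z// mulN1r opprK.
congr (- _); rewrite (I6_fubini (ig6Z (-1) i6)).1.
apply: eq_I3 => xi; apply: eq_I3 => eta; rewrite /Bpt /=.
have -> : cdot (cvec (xi + eta)) (sel (pred1 k) G xi) = (xcoord (xi + eta) k)%:C%C * G xi k.
  rewrite /cdot (bigD1 k)//= /sel /= eqxx big1 ?addr0// => i /negPf ik0.
  by rewrite /= ik0 mulr0.
have -> : cdot (G eta) (qs j psi (xi + eta)) = G eta j * Qt psi (xi + eta).
  rewrite /cdot (bigD1 j)//= /qs eqxx big1 ?addr0// => i /negPf ->; by rewrite mulr0.
have := Qt_derive k (xi + eta) tpsi; rewrite {1}/Qt => /eqP; rewrite eq_complex/= => /andP[/eqP -> /eqP ->].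
rewrite /Qt; move: (G xi k) (G eta j) => [? ?] [? ?] /=; ring.
Qed.

Lemma Bf_qf phi : (forall j, test (phi j)) ->
  (2 * pi) ^- 3 * Bf G G (qf phi) =
  - (K3 * \sum_(j < 3) \sum_(k < 3) dmul (f k) (f j) ('D_(ebasis R k) (phi j))).
Proof.
move=> tphi; have K0 : (2 * pi : R) != 0 by rewrite mulf_neq0// gt_eqF// pi_gt0.
have E : Bf G G (qf phi) = \sum_(j < 3) \sum_(k < 3) Bf (sel (pred1 k) G) G (qs j (phi j)).
  have ib j k : ig6 (Bpt (sel (pred1 k) G) G (qs j (phi j))).
    by have [M mM] := mlt_qs j (tphi j); exact: Bf_ig (L1f_sel (pred1 k) LG).1 LG mM.
  rewrite /Bf; under eq_bigr do rewrite -I6_sum//.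
  rewrite -I6_sum; last by move=> j; exact: ig6_sum.
  apply: eq_I6 => z; rewrite Bpt_split; apply: eq_bigr => j _; apply: eq_bigr => k _.
  congr (Bpt _ _ _ z); apply/funext => x; apply/funext => i.
  by rewrite /component /qf /qs; have [->|] := eqVneq i j.
rewrite E; under eq_bigr do under eq_bigr do rewrite Bf_dmul//.
under eq_bigr do rewrite sumrN; rewrite sumrN mulrN; congr (- _).
under eq_bigr do rewrite -mulr_sumr; rewrite -mulr_sumr mulrA; congr (_ * _).
by move: (2 * pi) K0 => r r0; field.
Qed.

(** Needed to take the time factor out of the convection term. Homogeneity of the integral uses
    integrability, which holds because the two factors agree almost everywhere with continuous
    functions. *)
Lemma dmulZ k j (c : R) psi : test psi ->
  dmul (f k) (f j) (fun x => c * psi x) = c * dmul (f k) (f j) psi.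
Proof.
move=> tpsi; have [ik ik'] := ig3_comp k; have [ij ij'] := ig3_comp j.
have A := aeI (function_of_inversion (in_chi_fpair k cf) ik ik')
  (function_of_inversion (in_chi_fpair j cf) ij ij').
have cT d a : ig3 a -> continuous (Tr d a) by exact: continuous_Tr_ig3.
pose h i (x : V) := Tr 0 (fun x => re (G x i)) x - Tr (- (pi / 2)) (fun x => im (G x i)) x.
have ch i : continuous (h i).
  by move=> x; have [? ?] := ig3_comp i; apply: cvgB; exact: cT.
have ib : ig3 (fun x => ((2 * pi) ^+ 6)^-1 * (h k x * (h j x * psi x))).
  by apply: ig3Z; apply: ig3_bcs; do 2!(apply: bcsM => //); exact: test_bcs.
have i : ig3 (fun x => function_of (f k) x * function_of (f j) x * psi x).
  apply: (ae_ig3 _ ib).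
    apply: meas3M; last exact: (test_bcs tpsi).1.
    by apply: meas3M; exact: function_of_meas.
  apply: aeS A => x [[h1 _] [h2 _]]; rewrite /h -h1 -h2.
  have : 2 * pi != 0 :> R by rewrite mulf_neq0// gt_eqF// pi_gt0.
  by move: (2 * pi) => r r0; field.
rewrite /dmul -[RHS]I3Z//; apply: eq_I3 => x; ring.
Qed.
End Regular.
End Pointwise.
End WeakPointwise.

Section WeakIdentity.
Context {R : realType}.
Local Notation V := (R3 R).
Local Notation M1 := (measurableTypeR R).
Local Notation mu1 := (@lebesgue_measure R).

Local Notation C := R[i].
Local Notation field := (V -> 'I_3 -> C).
Local Notation S4 := (spacetime R).
Local Notation K3 := ((2 * pi : R) ^+ 3).
Local Notation I1 D f := (Rintegral mu1 D f).
Local Notation int1 D f := (mu1.-integrable D (EFin \o f)).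
Implicit Types (psi : V -> R) (phi : 'I_3 -> V -> R) (b : R -> R).

Lemma bounded_mul_integrable (D : set M1) (a c : R) b (F : R -> R) : measurable D -> continuous b ->
  (forall x, ~ (a <= x <= c) -> b x = 0) -> int1 D F -> int1 D (fun x => b x * F x).
Proof.
move=> mD cb bout iF; have mb : measurable_fun D b.
  by apply: measurable_funTS; exact: continuous_measurable_fun.
have [M MP] : exists M : R, forall x, `|b x| <= M.
  have K := @segment_compact R a c.
  have cbK : {within `[a, c], continuous b} by apply: continuous_subspaceT => x; exact: cb.
  have /compact_bounded[M [_ HM]] := continuous_compact cbK K.
  exists (`|M| + 1) => x; have [xac|xac] := pselect (a <= x <= c); last first.
    by rewrite bout// normr0 addr_ge0.
  apply: (HM (`|M| + 1)); first by rewrite (le_lt_trans (ler_norm M))// ltrDl.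
  by exists x => //=; rewrite in_itv.
have M0 : 0 <= M by exact: le_trans (MP 0).
apply: (@integrable_EFin_le R _ M1 mu1 D _ (fun x => M * `|F x|)) => //.
- by apply: measurable_funM => //; exact: (integrable_EFin_measurable iF).
- by move=> x _; rewrite normrM ler_wpM2r.
- by apply: integrable_EFinZ => //; apply: integrable_EFin_norm.
Qed.

Context (nu Omega T : R) (u : R -> vdist R) (T_gt0 : 0 < T) (hC : C_chi T (-1) u)
  (hL : L1_chi T 1 u).
Local Notation G t := (hatf (u t)).
Context (N : set M1) (mN : measurable N) (N0 : mu1 N = 0%E)
  (NP : forall t, 0 < t < T -> ~ N t -> in_chi 1 (u t)).
Local Notation J s t := (good_times N s t).

(** The time factor is supported in [a, c] with c < T, so the integrals may stop at some t < T, and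
    on J 0 t the pairings are integrable. *)
Lemma I1_reduce (a c : R) : c < T ->
  exists2 t : R, 0 < t < T &
  forall F : R -> R, (forall x, ~ (a <= x <= c) -> F x = 0) ->
   I1 `]0, T[ F = I1 (J 0 t) F /\ I1 (J 0 T) F = I1 (J 0 t) F.
Proof.
move=> cT; have [m [m0 cm mT]] : exists m : R, [/\ 0 <= m, c <= m & m < T].
  by case: (leP c 0) => c0; [exists 0|exists c; rewrite ltW].
exists ((m + T) / 2); first by apply/andP; split; lra.
set t := _ / 2; have ct : c < t by rewrite /t; lra.
have tT : t < T by rewrite /t; lra.
move=> f fout.
have E : I1 (J 0 T) f = I1 (J 0 t) f.
  rewrite /Rintegral [in LHS]integral_mkcond [in RHS]integral_mkcond.
  congr fine; apply: eq_integral => x _; rewrite /= !patchE.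
  have [xc|xc] := pselect (a <= x <= c); last by rewrite fout// !if_same.
  have xt : x < t by case/andP: xc => _ /le_lt_trans; apply.
  congr (if _ then _ else _); rewrite /good_times; apply/idP/idP; rewrite !inE/= !in_itv/= => -[/andP[-> _] nx].
    by rewrite xt.
  by rewrite (lt_trans xt tT).
by split=> //; rewrite -E /Rintegral (@integral_setD_null _ _ M1 mu1 `]0, T[%classic N).
Qed.

Lemma dmul_int t k j psi : 0 < t < T -> test psi ->
  int1 (J 0 t) (fun x => dmul (u x k) (u x j) ('D_(ebasis R k) psi)).
Proof.
move=> /andP[t0 tT] tpsi; have [M mM] := mlt_qs j tpsi; have mJ := measurable_J mN 0 t.
have := integrable_Bf hC hL mN N0 NP (pred1 k) (lexx 0) (ltW t0) tT mM.
move=> /(integrable_EFinZ (- ((2 * pi) ^+ 6)^-1) mJ).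
apply: eq_integrable => // x; rewrite inE => Jx.
have JT : J 0 T x by apply: J_sub Jx => //; exact: ltW.
have xT := J_bound JT; have /= [xI nx] := JT.
have cx : in_chi 1 (u x) by apply: NP => //; move: xI; rewrite in_itv.
rewrite /= (Bf_dmul (G_chi hC xT) cx k j tpsi); congr EFin.
have : 2 * pi != 0 :> R by rewrite mulf_neq0// gt_eqF// pi_gt0.
by move: (2 * pi) => r r0; field.
Qed.

Lemma pair_int t j psi : 0 < t < T -> test psi -> int1 (J 0 t) (fun x => u x j psi).
Proof.
move=> /andP[t0 tT] tpsi; have [M mM] := mlt_qs j tpsi; have mJ := measurable_J mN 0 t.
have := integrable_Kf hC mN (lexx 0) (ltW t0) tT mM.
move=> /(integrable_EFinZ K3^-1 mJ).
apply: eq_integrable => // x; rewrite inE => Jx.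
have JT : J 0 T x by apply: J_sub Jx => //; exact: ltW.
rewrite /= -Pj_Kf -(PjE (G_chi hC (J_bound JT)) j tpsi) mulrA mulVf ?mul1r//.
by rewrite expf_neq0// mulf_neq0// gt_eqF// pi_gt0.
Qed.

Context (p : functional S4) (hp : distribution_on (strip T) p)
  (mom : momentum_eq nu Omega T u p).

(** The pressure is linear on test functions, and the three tensor products add up to [b] times div
    phi, which is 0. *)
Lemma pressure_cancel (a c : R) b phi : 0 < a -> c < T -> smooth b ->
  (forall x, ~ (a <= x <= c) -> b x = 0) -> (forall j, test (phi j)) ->
  (forall x, \sum_(j < 3) 'D_(ebasis R j) (phi j) x = 0) ->
  \sum_(j < 3) p (tens b ('D_(ebasis R j) (phi j))) = 0.
Proof.
move=> a0 cT sb bout tphi div.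
have tt j : test_function (strip T) (tens b ('D_(ebasis R j) (phi j))).
  by apply: (test_tens a0 cT) => //; exact: test_derive.
have tz : test_function (strip T) (fun _ : S4 => 0).
  have t0 : test (fun x : V => 0 * 'D_(ebasis R 0) (phi 0) x).
    by apply: testZ; exact: test_derive.
  have := test_tens a0 cT sb bout t0; congr test_function.
  by apply/funext => z; rewrite /tens mul0r mulr0.
have [lp _] := hp.
have p0 : p (fun=> 0) = 0.
  have := lp 1 _ _ tz tz; under [X in p X]eq_fun do rewrite mulr0 addr0.
  by move=> h; lra.
have p1 := lp 1 _ _ (tt 0) (tt 1).
have t01 : test_function (strip T) (fun x => 1 * tens b ('D_(ebasis R 0) (phi 0)) x
    + tens b ('D_(ebasis R 1) (phi 1)) x).
  have : test (fun x : V => 'D_(ebasis R 0) (phi 0) x + 'D_(ebasis R 1) (phi 1) x).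
    by apply: testD; exact: test_derive.
  move=> /(test_tens a0 cT sb bout); congr test_function.
  by apply/funext => z; rewrite /tens mul1r mulrDr.
have := lp 1 _ _ t01 (tt 2%:R); rewrite p1 !mul1r sum3E => <-; rewrite -[RHS]p0; congr p.
by apply/funext => z; rewrite /tens !mul1r -!mulrDr; have := div z.2; rewrite sum3E => ->; rewrite mulr0.
Qed.

Lemma congr5 (A A' B B' D D' E E' F F' : R) : A = A' -> B = B' -> D = D' -> E = E' -> F = F' ->
  A - nu * B + Omega * D + E + F = A' - nu * B' + Omega * D' + E' + F'.
Proof. by do 5!move=> ->. Qed.

Lemma cross_e3 (h : 'I_3 -> R) :
  [/\ cross (e3 R) h 0 = - h 1, cross (e3 R) h 1 = h 0 & cross (e3 R) h 2%:R = 0].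
Proof.
have o (i j : 'I_3) : i == j -> i = j by move/eqP.
rewrite /cross /e3; split.
- rewrite (o (0 + 1) 1)// (o (0 + 2%:R) 2%:R)// /=; ring.
- rewrite (o (1 + 1) 2%:R)// (o (1 + 2%:R) 0)// /=; ring.
- rewrite (o (2%:R + 1) 0)// (o (2%:R + 2%:R) 1)// /=; ring.
Qed.

Lemma sum_momentum (X Y Z P : 'I_3 -> R) (h : 'I_3 -> 'I_3 -> R) :
  (forall j, - X j - nu * Y j + Omega * cross (e3 R) (h j) j - Z j - P j = 0) ->
  \sum_(j < 3) P j = 0 ->
  \sum_(j < 3) X j = - nu * (\sum_(j < 3) Y j) + Omega * (h 1 0 - h 0 1) - \sum_(j < 3) Z j.
Proof.
move=> E; rewrite !sum3E; have := E 0; have := E 1; have := E 2%:R.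
have [-> _ _] := cross_e3 (h 0); have [_ -> _] := cross_e3 (h 1).
have [_ _ ->] := cross_e3 (h 2%:R).
move: (X 0) (X 1) (X 2%:R) (Y 0) (Y 1) (Y 2%:R) (Z 0) (Z 1) (Z 2%:R) (P 0) (P 1) (P 2%:R).
by move=> *; lra.
Qed.

(** The convection term keeps [b t] inside [dmul], since [dmulZ] is available only at times when
    u(t) lies in chi^1; it is taken out later, off the null set. *)
Lemma momentum_tens (a c : R) b b' j psi : 0 < a -> c < T -> smooth b ->
  (forall x : R, is_derive x 1 b (b' x)) ->
  (forall x, ~ (a <= x <= c) -> b x = 0 /\ b' x = 0) -> test psi ->
  - I1 `]0, T[ (fun t => b' t * u t j psi)
  - nu * (\sum_(k < 3) I1 `]0, T[ (fun t => b t * u t j ('D_(ebasis R k) ('D_(ebasis R k) psi))))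
  + Omega * cross (e3 R) (fun k => I1 `]0, T[ (fun t => b t * u t k psi)) j
  - \sum_(k < 3) I1 `]0, T[ (fun t => dmul (u t k) (u t j) (fun x => b t * 'D_(ebasis R k) psi x))
  - p (tens b ('D_(ebasis R j) psi)) = 0.
Proof.
move=> a0 cT sb db out tpsi.
have bout x : ~ (a <= x <= c) -> b x = 0 by move=> /out[].
have tem k t : 0 < t < T -> tempered (u t k).
  by move=> /andP[t0 tT]; have [/(_ k)[]] := G_chi hC (introT andP (conj (ltW t0) tT)).
have spsi := tpsi.1.
have sch k : schwartz ('D_(ebasis R k) ('D_(ebasis R k) psi)).
  by apply: test_schwartz; apply: test_derive; exact: test_derive.
have sD k : smooth ('D_(ebasis R k) psi) by exact: smooth_derive.
have Dt := derive_tens_t db spsi.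
have Dx k : 'D_(dir_x R k) (tens b psi) = tens b ('D_(ebasis R k) psi) by exact: derive_tens_x.
have Dxx k : 'D_(dir_x R k) ('D_(dir_x R k) (tens b psi)) =
    tens b ('D_(ebasis R k) ('D_(ebasis R k) psi)) by apply: etrans (congr1 (fun h : S4 -> R => 'D_(dir_x R k) h) (Dx k)) _; exact: derive_tens_x.
have M := mom (test_tens a0 cT sb bout tpsi) j; cbv zeta beta in M.
apply: etrans M; rewrite -sumrN; apply: congr5.
- by rewrite /dderive Dt (st_tens b' (tem j) (test_schwartz tpsi)).
- apply: eq_bigr => k _; rewrite /dderive opprK (Dxx k).
  by rewrite (st_tens b (tem j) (sch k)).
- congr (cross _ _ j); apply/funext => k.
  by rewrite (st_tens b (tem k) (test_schwartz tpsi)).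
- by apply: eq_bigr => k _; rewrite /dderive (Dx k).
- by rewrite /dderive (Dx j).
Qed.

(** Summing the components of the equation over a divergence-free [phi] removes the pressure; after
    multiplication by (2 pi)^3 the remaining terms are read in frequency through [Kf_qf], [Kf_Lm]
    and [Bf_qf]. *)
Lemma weak_identity (a c : R) b b' phi : 0 < a -> c < T -> smooth b ->
  (forall x : R, is_derive x 1 b (b' x)) ->
  (forall x, ~ (a <= x <= c) -> b x = 0 /\ b' x = 0) -> (forall j, test (phi j)) ->
  (forall x, \sum_(j < 3) 'D_(ebasis R j) (phi j) x = 0) ->
  I1 (J 0 T) (fun x => b' x * Kf (G x) (qf phi)) =
  I1 (J 0 T) (fun x => b x * Ff nu Omega u (qf phi) x).
Proof.
move=> a0 cT sb db out tphi div.
have bout x : ~ (a <= x <= c) -> b x = 0 by move=> /out[].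
have b'out x : ~ (a <= x <= c) -> b' x = 0 by move=> /out[].
have [t tT red] := I1_reduce a cT.
have JT x : J 0 t x -> J 0 T x by apply: J_sub => //; case/andP: tT => _ /ltW.
have mJ := measurable_J mN 0 t.
have cb := smooth_continuous sb.
have cb' : continuous b'.
  have -> : b' = 'D_1 b by apply/funext => x; have [_ ->] := db x.
  by apply: smooth_continuous; exact: smooth_derive.
have td k j : test ('D_(ebasis R k) (phi j)) by exact: test_derive.
have tdd k j : test ('D_(ebasis R k) ('D_(ebasis R k) (phi j))) by exact: test_derive.
have ib j psi : test psi -> int1 (J 0 t) (fun x => b x * u x j psi).
  by move=> tpsi; apply: (bounded_mul_integrable mJ cb bout); exact: pair_int.
have ib' j psi : test psi -> int1 (J 0 t) (fun x => b' x * u x j psi).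
  by move=> tpsi; apply: (bounded_mul_integrable mJ cb' b'out); exact: pair_int.
have id k j : int1 (J 0 t) (fun x => b x * dmul (u x k) (u x j) ('D_(ebasis R k) (phi j))).
  by apply: (bounded_mul_integrable mJ cb bout); exact: dmul_int.
rewrite (red _ _).2; last by move=> x /b'out ->; rewrite mul0r.
rewrite (red _ _).2; last by move=> x /bout ->; rewrite mul0r.
have eL x : x \in J 0 t -> b' x * Kf (G x) (qf phi) = K3 * \sum_(j < 3) (b' x * u x j (phi j)).
  rewrite inE => /JT /J_bound xT; rewrite (Kf_qf (G_chi hC xT) tphi) mulrCA; congr (_ * _).
  by rewrite mulr_sumr.
have eR x : x \in J 0 t -> b x * Ff nu Omega u (qf phi) x =
    K3 * (- nu * (\sum_(j < 3) \sum_(k < 3) (b x * u x j ('D_(ebasis R k) ('D_(ebasis R k) (phi j)))))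
     + Omega * (b x * u x 0 (phi 1) - b x * u x 1 (phi 0))
     - \sum_(j < 3) \sum_(k < 3) (b x * dmul (u x k) (u x j) ('D_(ebasis R k) (phi j)))).
  rewrite inE => /JT Jx; have xT := J_bound Jx; have /= [xI nx] := Jx.
  have cx : in_chi 1 (u x) by apply: NP => //; move: xI; rewrite in_itv.
  rewrite /Ff (Kf_Lm (G_chi hC xT) nu Omega tphi) (Bf_qf (G_chi hC xT) cx tphi).
  have P (f : 'I_3 -> 'I_3 -> R) : \sum_(j < 3) \sum_(k < 3) (b x * f j k) =
      b x * \sum_(j < 3) \sum_(k < 3) f j k.
    by rewrite mulr_sumr; apply: eq_bigr => j _; rewrite mulr_sumr.
  rewrite !P; ring.
rewrite (eq_Rintegral _ eL) (eq_Rintegral _ eR).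
have iL : int1 (J 0 t) (fun x => \sum_(j < 3) (b' x * u x j (phi j))).
  by apply: integrable_EFin_sum => // j; exact: ib'.
have i1 j : int1 (J 0 t) (fun x => \sum_(k < 3) (b x * u x j ('D_(ebasis R k) ('D_(ebasis R k) (phi j))))).
  by apply: integrable_EFin_sum => // k; exact: ib.
have i1s : int1 (J 0 t) (fun x => \sum_(j < 3) \sum_(k < 3) (b x * u x j ('D_(ebasis R k) ('D_(ebasis R k) (phi j))))).
  exact: integrable_EFin_sum.
have i2 : int1 (J 0 t) (fun x => b x * u x 0 (phi 1) - b x * u x 1 (phi 0)).
  by apply: integrable_EFinB => //; exact: ib.
have i3 j : int1 (J 0 t) (fun x => \sum_(k < 3) (b x * dmul (u x k) (u x j) ('D_(ebasis R k) (phi j)))).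
  exact: integrable_EFin_sum.
have i3s : int1 (J 0 t) (fun x => \sum_(j < 3) \sum_(k < 3) (b x * dmul (u x k) (u x j) ('D_(ebasis R k) (phi j)))).
  exact: integrable_EFin_sum.
have i12 := integrable_EFinD mJ (integrable_EFinZ (- nu) mJ i1s) (integrable_EFinZ Omega mJ i2).
rewrite !RintegralZl//; last exact: integrable_EFinB.
rewrite RintegralB// RintegralD//; [|exact: integrable_EFinZ|exact: integrable_EFinZ].
rewrite !RintegralZl// RintegralB//; [|exact: ib|exact: ib].
rewrite [X in _ * X = _]Rintegral_sum//; last by move=> j; exact: ib'.
have e1 : I1 (J 0 t) (fun x => \sum_(j < 3) \sum_(k < 3) (b x * u x j ('D_(ebasis R k) ('D_(ebasis R k) (phi j))))) =
    \sum_(j < 3) \sum_(k < 3) I1 (J 0 t) (fun x => b x * u x j ('D_(ebasis R k) ('D_(ebasis R k) (phi j)))).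
  by rewrite Rintegral_sum//; apply: eq_bigr => j _; rewrite Rintegral_sum// => k; exact: ib.
have e2 : I1 (J 0 t) (fun x => \sum_(j < 3) \sum_(k < 3) (b x * dmul (u x k) (u x j) ('D_(ebasis R k) (phi j)))) =
    \sum_(j < 3) \sum_(k < 3) I1 (J 0 t) (fun x => b x * dmul (u x k) (u x j) ('D_(ebasis R k) (phi j))).
  by rewrite Rintegral_sum//; apply: eq_bigr => j _; rewrite Rintegral_sum// => k; exact: ib.
rewrite e1 e2.
congr (_ * _).
pose Id k j := I1 (J 0 t) (fun x => b x * dmul (u x k) (u x j) ('D_(ebasis R k) (phi j))).
pose Ik k j := I1 (J 0 t) (fun x => b x * u x j ('D_(ebasis R k) ('D_(ebasis R k) (phi j)))).
apply: (@sum_momentum (fun j => I1 (J 0 t) (fun x => b' x * u x j (phi j)))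
  (fun j => \sum_(k < 3) Ik k j) (fun j => \sum_(k < 3) Id k j)
  (fun j => p (tens b ('D_(ebasis R j) (phi j))))
  (fun j k => I1 (J 0 t) (fun x => b x * u x k (phi j)))); last first.
  exact: (pressure_cancel a0 cT).
move=> j; apply: etrans (momentum_tens j a0 cT sb db out (tphi j)); apply: congr5.
- by rewrite (red _ _).1// => x /b'out ->; rewrite mul0r.
- by apply: eq_bigr => k _; rewrite (red _ _).1// => x /bout ->; rewrite mul0r.
- congr (cross _ _ j); apply/funext => k.
  by rewrite (red _ _).1// => x /bout ->; rewrite mul0r.
- congr (- _); apply: eq_bigr => k _; rewrite (red _ _).1; last first.
    move=> x /bout ->; rewrite /dmul /Rintegral integral0_eq// => y _.
    by rewrite mul0r mulr0.
  apply: eq_Rintegral => x; rewrite inE => /JT Jx; have xT := J_bound Jx; have /= [xI nx] := Jx.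
  have cx : in_chi 1 (u x) by apply: NP => //; move: xI; rewrite in_itv.
  by rewrite (dmulZ (G_chi hC xT) cx).
- by [].
Qed.

Lemma evolution_test s t phi : 0 <= s -> s < t -> t < T -> (forall j, test (phi j)) ->
  (forall x, \sum_(j < 3) 'D_(ebasis R j) (phi j) x = 0) ->
  Kf (G s) (qf phi) - Kf (G t) (qf phi) = I1 (J s t) (Ff nu Omega u (qf phi)).
Proof.
move=> s0 st tT tphi div; have [M3' mM3] := mlt_qf 3 tphi.
apply: (@time_localize R T N mN N0 (fun x => Kf (G x) (qf phi)) (Ff nu Omega u (qf phi))) => //.
- exact: tcont_Kf hC _ _ (mltS (mltS mM3)).
- exact: (integrable_Ff nu Omega hC hL mN N0 NP s0 (ltW st) tT mM3).
- by move=> b b' sb db [a [c [a0 cT out]]]; exact: (weak_identity a0 cT sb db out tphi div).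
Qed.
End WeakIdentity.

(** * Multipliers of the form i times a transform *)

Section Imaginary.
Context {R : realType}.
Local Notation V := (R3 R).

Local Notation C := R[i].
Local Notation re := (@complex.Re R).
Local Notation im := (@complex.Im R).
Local Notation normc := (@Normc.normc R).
Local Notation field := (V -> 'I_3 -> C).
Implicit Types (psi : V -> R) (phi : 'I_3 -> V -> R) (g m : field) (q : V -> C).

(** Since the solution is real, pairings with i times the transform of a real field vanish, in the
    linear and in the convection terms. This gives the evolution identity for these multipliers at
    no cost and makes complex combinations available. *)
Definition rI m : field := fun x j => ('i * m x j)%C.

Section Pointwise.
Context (f : vdist R) (cf : in_chi (-1) f).
Local Notation G := (hatf f).

Lemma Pj_im j psi : test psi -> ig3 (fun xi => re (G xi j * ('i * Qt psi xi)%C)) /\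
  I3 (fun xi => re (G xi j * ('i * Qt psi xi)%C)) = 0.
Proof.
move=> tpsi; have fp := in_chi_fpair j cf; have [_ wa wb _] := fp.
have i0 := ig3D (wig_Tr (- (pi / 2)) wa tpsi) (wig_Tr 0 wb tpsi).
have E : (fun xi => re (G xi j * ('i * Qt psi xi)%C)) =
    fun xi => - (re (G xi j) * Tr (- (pi / 2)) psi xi + im (G xi j) * Tr 0 psi xi).
  by apply/funext => xi; rewrite /Qt; move: (G xi j) => [a b] /=; ring.
rewrite E; split; first exact: ig3N.
by rewrite I3N// (fpair_inversion fp tpsi).2 oppr0.
Qed.

Lemma Kf_qf_im phi : (forall j, test (phi j)) -> Kf G (rI (qf phi)) = 0.
Proof.
move=> tphi; rewrite /Kf.
rewrite (_ : (fun _ => _) = fun xi => \sum_(j < 3) re (G xi j * ('i * Qt (phi j) xi)%C)).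
  rewrite I3_sum; last by move=> j; exact: (Pj_im j (tphi j)).1.
  by apply: big1 => j _; exact: (Pj_im j (tphi j)).2.
by apply/funext => xi; rewrite /cdot re_sum3.
Qed.

Lemma Kf_Lm_im (nu Omega : R) phi : (forall j, test (phi j)) ->
  Kf G (Lm nu Omega (rI (qf phi))) = 0.
Proof.
move=> tphi.
have tD j k : test ('D_(ebasis R k) ('D_(ebasis R k) (phi j))).
  by apply: test_derive; exact: test_derive.
pose Z j psi xi := re (G xi j * ('i * Qt psi xi)%C).
have iZ j psi : test psi -> ig3 (Z j psi) by move=> h; exact: (Pj_im j h).1.
have Z0 j psi : test psi -> I3 (Z j psi) = 0 by move=> h; exact: (Pj_im j h).2.
have i1 j : ig3 (fun xi => \sum_(k < 3) Z j ('D_(ebasis R k) ('D_(ebasis R k) (phi j))) xi).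
  by apply: ig3_sum => k; exact: iZ.
have iS : ig3 (fun xi => \sum_(j < 3) \sum_(k < 3) Z j ('D_(ebasis R k) ('D_(ebasis R k) (phi j))) xi).
  exact: ig3_sum.
have iB : ig3 (fun xi => Z 0 (phi 1) xi - Z 1 (phi 0) xi) by apply: ig3B; exact: iZ.
rewrite /Kf (_ : (fun _ => _) = fun xi =>
    - nu * (\sum_(j < 3) \sum_(k < 3) Z j ('D_(ebasis R k) ('D_(ebasis R k) (phi j))) xi) +
    Omega * (Z 0 (phi 1) xi - Z 1 (phi 0) xi)).
  rewrite I3D; [|exact: ig3Z|exact: ig3Z].
  rewrite !I3Z// I3B; [|exact: iZ|exact: iZ].
  rewrite !Z0// I3_sum// big1 ?mulr0 ?subrr ?mulr0 ?addr0// => j _.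
  by rewrite I3_sum => [|k]; [rewrite big1// => k _; exact: Z0|exact: iZ].
apply/funext => xi; rewrite (cdot_Lm nu Omega (G xi) (rI (qf phi)) xi).
congr (- nu * _ + _); apply: eq_bigr => j _; apply: eq_bigr => k _.
rewrite /Z (Qt_derive2 k xi (tphi j)) /rI /qf.
by move: (G xi j) (Qt (phi j) xi) => [a b] [c d] /=; ring.
Qed.

Section Regular.
Context (cf1 : in_chi 1 f).
Let LG : L1f G := fld_L1f (in_chi_fld cf) (in_chi_ep cf1).2.

Lemma mlt_rI k M m : mlt k M m -> mlt k M (rI m).
Proof.
move=> [mm mM]; split=> [j|x]; first by apply: cmeasM => //; exact: cmeas_cst.
by rewrite (cnZ 'i%C (m x)) (_ : normc 'i%C = 1) ?mul1r// normc_sqrtE/= expr0n expr1n add0r sqrtr1.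
Qed.

Lemma Bf_im k j psi : test psi -> Bf (sel (pred1 k) G) G (rI (qs j psi)) = 0.
Proof.
move=> tpsi; have [ik ik'] := ig3_comp cf cf1 k; have [ij ij'] := ig3_comp cf cf1 j.
have [M mM'] := mlt_qs j tpsi; have mM := mlt_rI mM'.
have i6 := Bf_ig (L1f_sel (pred1 k) LG).1 LG mM.
have -> : Bf (sel (pred1 k) G) G (rI (qs j psi)) = - I6 (fun z => -1 * Bpt (sel (pred1 k) G) G (rI (qs j psi)) z).
  by rewrite I6Z// mulN1r opprK.
rewrite (I6_fubini (ig6Z (-1) i6)).1 -[RHS]oppr0; congr (- _).
rewrite -(conv_fourier_im (in_chi_fpair k cf) (in_chi_fpair j cf) ik ik' ij ij' (test_derive (ebasis R k) tpsi)).
apply: eq_I3 => xi; apply: eq_I3 => eta; rewrite /Bpt /=.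
have -> : cdot (cvec (xi + eta)) (sel (pred1 k) G xi) = (xcoord (xi + eta) k)%:C%C * G xi k.
  rewrite /cdot (bigD1 k)//= /sel /= eqxx big1 ?addr0// => i /negPf ik0.
  by rewrite /= ik0 mulr0.
have -> : cdot (G eta) (rI (qs j psi) (xi + eta)) = G eta j * ('i * Qt psi (xi + eta))%C.
  rewrite /cdot (bigD1 j)//= /rI /qs eqxx big1 ?addr0// => i /negPf ->.
  by rewrite !mulr0.
have := Qt_derive k (xi + eta) tpsi; rewrite {1}/Qt => /eqP; rewrite eq_complex/= => /andP[/eqP -> /eqP ->].
rewrite /Qt; move: (G xi k) (G eta j) => [? ?] [? ?] /=; ring.
Qed.

Lemma Bf_qf_im phi : (forall j, test (phi j)) -> Bf G G (rI (qf phi)) = 0.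
Proof.
move=> tphi.
have ib j k : ig6 (Bpt (sel (pred1 k) G) G (rI (qs j (phi j)))).
  by have [M mM] := mlt_qs j (tphi j); exact: Bf_ig (L1f_sel (pred1 k) LG).1 LG (mlt_rI mM).
have -> : Bf G G (rI (qf phi)) = \sum_(j < 3) \sum_(k < 3) Bf (sel (pred1 k) G) G (rI (qs j (phi j))).
  rewrite /Bf; under eq_bigr do rewrite -I6_sum//.
  rewrite -I6_sum; last by move=> j; exact: ig6_sum.
  apply: eq_I6 => z; rewrite Bpt_split; apply: eq_bigr => j _; apply: eq_bigr => k _.
  congr (Bpt _ _ _ z); apply/funext => x; apply/funext => i.
  by rewrite /component /rI /qf /qs; have [->|] := eqVneq i j; rewrite ?mulr0.
by rewrite big1// => j _; rewrite big1// => k _; exact: Bf_im.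
Qed.
End Regular.
End Pointwise.
End Imaginary.

(** * Solenoidal multipliers *)

Section Density.
Context {R : realType}.
Local Notation V := (R3 R).
Local Notation M1 := (measurableTypeR R).
Local Notation M3 := (M1 * M1 * M1)%type.
Local Notation mu1 := (@lebesgue_measure R).

Local Notation C := R[i].
Local Notation re := (@complex.Re R).
Local Notation im := (@complex.Im R).
Local Notation cn := (@cnorm3 R).
Local Notation normc := (@Normc.normc R).
Local Notation field := (V -> 'I_3 -> C).
Local Notation K3 := ((2 * pi : R) ^+ 3).
Local Notation I1 D f := (Rintegral mu1 D f).
Implicit Types (psi w : V -> R) (phi : 'I_3 -> V -> R) (g m : field) (q : V -> C).

Lemma Tr_lin (r c : R) x (a b : V -> R) : ig3 a -> ig3 b ->
  Tr c (fun y => r * a y + b y) x = r * Tr c a x + Tr c b x.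
Proof.
move=> ia ib; have ja := ig3_cosM c x ia; have jb := ig3_cosM c x ib.
rewrite !TrE -I3Z// -I3D//; last exact: ig3Z.
by apply: eq_I3 => y; ring.
Qed.

(** If the transforms agree, the regularised inversion of the difference is 0 for every n, while it
    tends to (2 pi)^3 times the difference. *)
Lemma Qt_inj (a b : V -> R) : test a -> test b -> Qt a =1 Qt b -> a = b.
Proof.
move=> ta tb Q; pose de x := -1 * a x + b x.
have tde : test de by apply: testD => //; exact: testZ.
have Td c x := Tr_lin (-1) c x (ig3_bcs (test_bcs ta)) (ig3_bcs (test_bcs tb)).
have T0 x : Tr 0 de x = 0 /\ Tr (- (pi / 2)) de x = 0.
  have := Q x; rewrite /Qt => /eqP; rewrite eq_complex /= => /andP[/eqP h1 /eqP h2].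
  by rewrite /de !Td h1 h2; split; ring.
have I0 c x : Tr c (fun _ : V => 0 : R) x = 0.
  rewrite TrE -[RHS](mul0r (Tr c a x)) TrE -I3Z; last first.
    by apply: ig3_cosM; apply: ig3_bcs; exact: test_bcs.
  by apply: eq_I3 => y; ring.
have Z n x : Tn n de x = 0.
  rewrite -TnE// (_ : (fun xi => _ * Tr 0 _ _) = fun=> 0); last first.
    by apply/funext => xi; rewrite (T0 xi).1 mulr0.
  rewrite (_ : (fun xi => _ * Tr _ _ _) = fun=> 0) ?I0 ?addr0//.
  by apply/funext => xi; rewrite (T0 xi).2 mulr0.
have [B HB] := Tn_cvg_bound 0 tde.
have D0 x : de x = 0.
  have c : Tn n de x @[n --> \oo] --> I3 (@Ker R) * de x.
    apply: (@cvgR_dist _ _ (fun n => B * n.+1%:R^-1)) => [n|].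
      by have := HB n x; rewrite expr0 mul1r.
    by rewrite -[X in _ --> X](mulr0 B); apply: cvgMr; exact: cvg_harmonic.
  have c0 : Tn n de x @[n --> \oo] --> (0 : R).
    by under eq_fun do rewrite Z; exact: cvg_cst.
  have /eqP := cvgR_unique c c0; rewrite I3_Ker mulf_eq0 => /orP[|/eqP//].
  by rewrite gt_eqF// exprn_gt0// mulr_gt0// pi_gt0.
by apply/funext => x; have := D0 x; rewrite /de; lra.
Qed.

(** On the Fourier side both mixed derivatives carry the symmetric factor xi_j xi_k, and the
    transform is injective. *)
Lemma derive_commute psi j k x : test psi ->
  'D_(ebasis R j) ('D_(ebasis R k) psi) x = 'D_(ebasis R k) ('D_(ebasis R j) psi) x.
Proof.
move=> tpsi; have tD i : test ('D_(ebasis R i) psi) by exact: test_derive.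
suff E : 'D_(ebasis R j) ('D_(ebasis R k) psi) = 'D_(ebasis R k) ('D_(ebasis R j) psi).
  by have := congr1 (fun h : V -> R => h x) E.
apply: Qt_inj; [exact: test_derive (tD k)|exact: test_derive (tD j)|move=> {}x].
have E i l := etrans (Qt_derive i x (tD l))
  (congr1 (fun z : C => - ('i * (xcoord x i)%:C * z)%C) (Qt_derive l x tpsi)).
apply: etrans (E j k) _; apply: etrans _ (esym (E k j)).
by move: (Qt psi x) (xcoord x j)%:C%C (xcoord x k)%:C%C ('i%C : C) => a b c d; ring.
Qed.

(* As a vector field this is [q] times the cross product of xi with a basis vector;
   it is orthogonal to xi. *)
Definition Aq (j k : 'I_3) q : field := fun x i =>
  (if i == j then (xcoord x k)%:C%C * q x else 0) - (if i == k then (xcoord x j)%:C%C * q x else 0).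

(** [Aq] multiplies by a coordinate and so costs one power, which leaves the decay 3 that [mlt_Lm]
    asks for. *)
Definition dec4 (M : R) q : Prop :=
  @cmeas R _ M3 q /\ forall x, normc (q x) <= M * (1 + `|x|) ^- 4.

Lemma cn_Aq j k q x : cn (Aq j k q x) <= 6 * `|x| * normc (q x).
Proof.
have b l (p : bool) : normc (if p then (xcoord x l)%:C%C * q x else 0) <= `|x| * normc (q x).
  case: p; last by rewrite Normc.normc0 mulr_ge0 ?normc_ge0.
  by rewrite Normc.normcM normc_real ler_wpM2r ?normc_ge0// xcoord_le_norm.
have B i : normc (Aq j k q x i) <= `|x| * normc (q x) + `|x| * normc (q x).
  by rewrite /Aq (le_trans (normcD_le _ _))// normcN lerD.
rewrite (le_trans (cn_le_sum _))// sum3E.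
have -> : 6 * `|x| * normc (q x) = `|x| * normc (q x) + `|x| * normc (q x) +
  (`|x| * normc (q x) + `|x| * normc (q x)) + (`|x| * normc (q x) + `|x| * normc (q x)) by ring.
by rewrite lerD ?lerD.
Qed.

Lemma mlt_Aq j k M q : dec4 M q -> mlt 3 (6 * M) (Aq j k q).
Proof.
move=> [mq Mq]; split.
  move=> i; apply: cmeasB.
    case: (i == j); last exact: cmeas_cst.
    by apply: cmeasM => //; apply: cmeas_real; exact: meas3_xcoord.
  case: (i == k); last exact: cmeas_cst.
  by apply: cmeasM => //; apply: cmeas_real; exact: meas3_xcoord.
move=> x; have w := w0 x; rewrite (le_trans (cn_Aq _ _ _ _))// -!mulrA ler_wpM2l//.
apply: (@le_trans _ _ ((1 + `|x|) * (M * (1 + `|x|) ^- 4))).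
  by rewrite ler_pM ?normc_ge0// lerDr.
by rewrite mulrCA [_ ^+ 4]exprS invfM mulVKf// gt_eqF.
Qed.

Lemma pcvg_Aq j k (q_ : nat -> V -> C) q :
  (forall x, normc (q_ n x - q x) @[n --> \oo] --> 0) -> pcvg (fun n => Aq j k (q_ n)) (Aq j k q).
Proof.
move=> qc x; apply: (@squeeze_cvgr _ _ _ _ (fun=> 0) (fun n => 6 * `|x| * normc (q_ n x - q x))).
- apply: nearW => n; rewrite cn_ge0/=; apply: le_trans (cn_Aq j k (fun x => q_ n x - q x) x).
  apply: eq_ler; congr cn; apply/funext => i; rewrite /Aq.
  by case: (i == j); case: (i == k); ring.
- exact: cvg_cst.
- by rewrite -[X in _ --> X](mulr0 (6 * `|x|)); apply: cvgMr; exact: qc.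
Qed.

Lemma Aq_lin j k (a : R) q q' :
  Aq j k (fun x => a%:C%C * q x + q' x) = flin a (Aq j k q) (Aq j k q').
Proof.
apply/funext => x; apply/funext => i; rewrite /Aq /flin.
by case: (i == j); case: (i == k); ring.
Qed.

Lemma dec4_lin (a M M' : R) q q' : dec4 M q -> dec4 M' q' ->
  dec4 (`|a| * M + M') (fun x => a%:C%C * q x + q' x).
Proof.
move=> [mq Mq] [mq' Mq']; split.
  by apply: cmeasD => //; apply: cmeasM => //; exact: cmeas_cst.
move=> x; rewrite (le_trans (normcD_le _ _))// mulrDl lerD// Normc.normcM normc_real -mulrA.
by rewrite ler_wpM2l.
Qed.

Lemma dec4Z c M q : dec4 M q -> dec4 (normc c * M) (fun x => c * q x).
Proof.
move=> [mq Mq]; split; first by apply: cmeasM => //; exact: cmeas_cst.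
by move=> x; rewrite Normc.normcM -mulrA ler_wpM2l// normc_ge0.
Qed.

Lemma dec4_Qt psi : test psi -> exists M, dec4 M (Qt psi).
Proof.
move=> tpsi; have [A HA] := Tr_decay 0 4 tpsi; have [B HB] := Tr_decay (- (pi / 2)) 4 tpsi.
exists (A + B); split; first exact: cmeas_Qt.
move=> x; have w : 0 < (1 + `|x|) ^+ 4 by rewrite exprn_gt0// w0.
rewrite (le_trans (normc_le _))// mulrDl.
by apply: lerD; rewrite ler_pdivlMr// mulrC; [exact: HA|exact: HB].
Qed.

Lemma bcs_supported w (M N : R) : meas3 w -> (forall x, `|w x| <= M) ->
  supported_in (cube N) w -> dec4 (M * (1 + `|N|) ^+ 4) (fun x => (w x)%:C%C).
Proof.
move=> mw wM wN; split; first exact: cmeas_real.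
move=> x; have w1 : 0 < (1 + `|x|) ^+ 4 by rewrite exprn_gt0// w0.
have M0 : 0 <= M by exact: le_trans (wM 0).
rewrite normc_real ler_pdivlMr//; have [xN|xN] := pselect (cube N x); last first.
  by rewrite wN// normr0 mul0r mulr_ge0// exprn_ge0// addr_ge0.
rewrite ler_pM ?exprn_ge0 ?addr_ge0// lerXn2r ?nnegrE ?addr_ge0// lerD2l.
by rewrite (le_trans xN)// ler_norm.
Qed.

Lemma dec4_bcs w : bcs w -> exists M, dec4 M (fun x => (w x)%:C%C).
Proof. by move=> [mw [N [M [wM wN]]]]; exists (M * (1 + `|N|) ^+ 4); exact: bcs_supported. Qed.

(** The evolution identity and orthogonality to gradients are both preserved by real linear
    combinations and by pointwise limits under a common decay bound; the density argument is carried
    out once for such properties. *)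
Definition dec4_closed (P : (V -> C) -> Prop) : Prop :=
  (forall (a : R) q q' M M', dec4 M q -> dec4 M' q' -> P q -> P q' ->
     P (fun x => a%:C%C * q x + q' x)) /\
  forall (q_ : nat -> V -> C) q M, (forall n, dec4 M (q_ n)) ->
    (forall x, normc (q_ n x - q x) @[n --> \oo] --> 0) -> (forall n, P (q_ n)) -> P q.

Section Closed.
Context (P : (V -> C) -> Prop) (cP : dec4_closed P)
  (PQ : forall psi, test psi -> P (fun x => - ('i * Qt psi x)%C) /\ P (Qt psi)).

Lemma closed_Qt psi c : test psi -> P (fun x => c * Qt psi x).
Proof.
move=> tpsi; have [e1 e2] := PQ tpsi; have [M dM] := dec4_Qt tpsi.
pose q := fun x => - ('i * Qt psi x)%C.
have dq : dec4 (normc (- 'i%C) * M) q.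
  by have := dec4Z (- 'i%C) dM; congr (dec4 _ _); apply/funext => x; rewrite /q mulNr.
(* The rule for combinations adds one full copy of its second argument, hence the coefficient
   [re c - 1] in the next step. *)
have e3 := cP.1 (- im c) _ _ _ _ dq dM e1 e2.
have := cP.1 (re c - 1) _ _ _ _ dM (dec4_lin (- im c) dq dM) e2 e3; congr P.
have alg (z w : C) : (re z - 1)%:C%C * w + ((- im z)%:C%C * - ('i * w)%C + w) = z * w.
  case: z w => [a b] [d e]; apply/eqP; rewrite eq_complex/=.
  by apply/andP; split; apply/eqP; ring.
by apply/funext => x; exact: alg.
Qed.

(** The regularised inversion [Tn n w] is a complex combination of transforms of test functions and
    tends to (2 pi)^3 w with uniform decay of order 4, by [Tn_cvg_bound]. *)
Lemma closed_test c w : test w -> P (fun x => c * (w x)%:C%C).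
Proof.
move=> tw; have E n x : Qt (fun xi => chin n xi * Tr 0 w xi) x +
    - 'i%C * Qt (fun xi => chin n xi * Tr (- (pi / 2)) w xi) x = (Tn n w x)%:C%C.
  have alg (a b d : R) : (a +i* b)%C + - 'i%C * (b +i* d)%C = (a + d)%:C%C.
    by apply/eqP; rewrite eq_complex/=; apply/andP; split; apply/eqP; ring.
  by rewrite -TnE// /Qt (Tn_sin n x tw); exact: alg.
have eT n : P (fun x => c * (Tn n w x)%:C%C).
  have [A dA] := dec4_Qt (test_chinTr n 0 tw).
  have [B dB] := dec4_Qt (test_chinTr n (- (pi / 2)) tw).
  have := cP.1 1 _ _ _ _ (dec4Z c dA) (dec4Z (c * - 'i%C) dB)
    (closed_Qt c (test_chinTr n 0 tw)) (closed_Qt (c * - 'i%C) (test_chinTr n (- (pi / 2)) tw)).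
  congr P; apply/funext => x.
  by rewrite -E rmorph1 mul1r mulrDr mulrA.
have [B HB] := Tn_cvg_bound 4 tw; rewrite I3_Ker in HB.
have [L [_ dL]] := dec4_bcs (bcsD0 K3 (test_bcs tw)).
have B0 : 0 <= B.
  have h0 := HB 0 0; rewrite invr1 mulr1 in h0; apply: le_trans h0.
  by rewrite mulr_ge0// exprn_ge0// addr_ge0.
have TM n x : `|Tn n w x - K3 * w x| <= B * (1 + `|x|) ^- 4 * n.+1%:R^-1.
  have w4 : 0 < (1 + `|x|) ^+ 4 by rewrite exprn_gt0// w0.
  by rewrite [leRHS]mulrAC ler_pdivlMr// mulrC; exact: HB.
have dT n : dec4 (normc c * (B + L)) (fun x => c * (Tn n w x)%:C%C).
  apply: dec4Z; split.
    have mT a b (h : test b) : meas3 (Tr a b) by exact: meas3_Tr.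
    apply: cmeas_real; rewrite (_ : Tn n w = fun x => Tr 0 (fun xi => chin n xi * Tr 0 w xi) x +
      Tr (- (pi / 2)) (fun xi => chin n xi * Tr (- (pi / 2)) w xi) x).
      by apply: meas3D; apply: mT; exact: test_chinTr.
    by apply/funext => x; rewrite TnE.
  move=> x; rewrite normc_real mulrDl -[Tn n w x](subrK (K3 * w x)).
  rewrite (le_trans (ler_normD _ _))// lerD//; last by have := dL x; rewrite normc_real.
  have w4 : 0 <= (1 + `|x|) ^- 4 by rewrite invr_ge0 exprn_ge0// addr_ge0.
  rewrite (le_trans (TM n x))// ler_piMr ?mulr_ge0//.
  by rewrite invf_le1 ?ler1n.
have eK : P (fun x => c * (K3 * w x)%:C%C).
  apply: (cP.2 _ _ _ dT _ eT) => x.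
  apply: (@squeeze_cvgr _ _ _ _ (fun=> 0) (fun n => normc c * (B * (1 + `|x|) ^- 4) * n.+1%:R^-1)).
  - apply: nearW => n; rewrite normc_ge0/= -mulrBr Normc.normcM -rmorphB normc_real -mulrA.
    by rewrite ler_wpM2l ?normc_ge0.
  - exact: cvg_cst.
  - rewrite -[X in _ --> X](mulr0 (normc c * (B * (1 + `|x|) ^- 4))); apply: cvgMr.
    exact: cvg_harmonic.
have [L' dL'] := dec4_bcs (bcsD0 K3 (test_bcs tw)).
have dK := dec4Z c dL'.
have := cP.1 (K3^-1 - 1) _ _ _ _ dK dK eK eK; congr P.
apply/funext => x.
have K0 : K3 != 0 by rewrite expf_neq0// mulf_neq0// gt_eqF// pi_gt0.
rewrite [in RHS](_ : w x = (K3^-1 - 1) * (K3 * w x) + K3 * w x); last first.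
  by move: K3 K0 => r r0; field.
by rewrite rmorphD rmorphM; ring.
Qed.

Lemma closed_bcs c w : bcs w -> P (fun x => c * (w x)%:C%C).
Proof.
move: w; apply: bcs_density; last by move=> w; exact: closed_test.
split=> [a f g bf bg ef eg|f_ f N' M bf ef fM fN fc].
  have [A dA] := dec4_bcs bf; have [B dB] := dec4_bcs bg.
  have := cP.1 a _ _ _ _ (dec4Z c dA) (dec4Z c dB) ef eg; congr P; apply/funext => x.
  by rewrite rmorphD rmorphM; ring.
have d n := dec4Z c (bcs_supported (bf n).1 (fM n) (fN n)).
apply: (cP.2 _ _ _ d _ ef) => x.
apply: (@squeeze_cvgr _ _ _ _ (fun=> 0) (fun n => normc c * `|f_ n x - f x|)).
- by apply: nearW => n; rewrite normc_ge0/= -mulrBr Normc.normcM -rmorphB normc_real.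
- exact: cvg_cst.
- rewrite -[X in _ --> X](mulr0 (normc c)); apply: cvgMr.
  by rewrite -[X in _ --> X](@normr0 _ R) -(subrr (f x)); apply: cvg_norm; apply: cvgB => //; exact: cvg_cst.
Qed.

Lemma closed_cbcs q : bcs (fun x => re (q x)) -> bcs (fun x => im (q x)) -> P q.
Proof.
move=> b1 b2; have [A dA] := dec4_bcs b1; have [B dB] := dec4_bcs b2.
have := cP.1 1 _ _ _ _ (dec4Z 1 dA) (dec4Z 'i%C dB) (closed_bcs 1 b1) (closed_bcs 'i%C b2).
congr P; apply/funext => x.
by case: (q x) => a b; apply/eqP; rewrite eq_complex/=; apply/andP; split; apply/eqP; ring.
Qed.
End Closed.

Context (nu Omega T : R) (u : R -> vdist R) (hC : C_chi T (-1) u) (hL : L1_chi T 1 u).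
Local Notation G t := (hatf (u t)).
Context (N : set M1) (mN : measurable N) (N0 : mu1 N = 0%E)
  (NP : forall t, 0 < t < T -> ~ N t -> in_chi 1 (u t)).
Local Notation J s t := (good_times N s t).
Context (s t : R) (s0 : 0 <= s) (st : s < t) (tT : t < T).

Definition Ev m : Prop := Kf (G s) m - Kf (G t) m = I1 (J s t) (Ff nu Omega u m).

Let sT : 0 <= s < T. Proof. by rewrite s0 (lt_trans st). Qed.
Let tT' : 0 <= t < T. Proof. by rewrite tT (le_trans s0 (ltW st)). Qed.
Let JT x : J s t x -> J 0 T x. Proof. by apply: J_sub => //; exact: ltW. Qed.
Let mJ := measurable_J mN s t.
Let intF m M := integrable_Ff nu Omega hC hL mN N0 NP s0 (ltW st) tT (m := m) (M := M).

Lemma Lm_flin a m m' : Lm nu Omega (flin a m m') = flin a (Lm nu Omega m) (Lm nu Omega m').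
Proof.
apply/funext => x; apply/funext => j; rewrite /Lm /rot3 /flin.
by case: (j == 0); case: (j == 1); ring.
Qed.

Lemma Ev_lin a m m' M M' : mlt 3 M m -> mlt 3 M' m' -> Ev m -> Ev m' -> Ev (flin a m m').
Proof.
move=> mM mM' e e'; have m1 := mltS (mltS mM); have m1' := mltS (mltS mM').
rewrite /Ev (Kf_lin a (G_fld hC sT) m1 m1') (Kf_lin a (G_fld hC tT') m1 m1').
have E x : x \in J s t -> Ff nu Omega u (flin a m m') x =
    a * Ff nu Omega u m x + Ff nu Omega u m' x.
  rewrite inE => /JT Jx; have [_ LG] := J_ep hC NP Jx.
  rewrite /Ff Lm_flin (Kf_lin a (G_fld hC (J_bound Jx)) (mlt_Lm nu Omega mM) (mlt_Lm nu Omega mM')).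
  by rewrite (Bf_lin a LG LG m1 m1'); ring.
rewrite (eq_Rintegral _ E) RintegralD//; [|by apply: integrable_EFinZ => //; exact: intF mM|exact: intF mM'].
rewrite RintegralZl//; last exact: intF mM.
by rewrite -e -e'; ring.
Qed.

(** Dominated convergence in frequency at each good time, then in time: the linear part is bounded
    by the maximum of [xm] on [s, t], the convection part by a multiple of [xp]. *)
Lemma Ev_lim (m_ : nat -> field) m M : (forall n, mlt 3 M (m_ n)) -> pcvg m_ m ->
  (forall n, Ev (m_ n)) -> Ev m.
Proof.
move=> mM mc e; have m1 n := mltS (mltS (mM n)).
have k1 x : 0 <= x < T -> Kf (G x) (m_ n) @[n --> \oo] --> Kf (G x) m.
  by move=> xT; exact: Kf_lim (G_fld hC xT) m1 mc.
have L1 n := mlt_Lm nu Omega (mM n).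
have Lc : pcvg (fun n => Lm nu Omega (m_ n)) (Lm nu Omega m).
  move=> x; apply: (@squeeze_cvgr _ _ _ _ (fun=> 0) (fun n => (`|nu| * enorm x ^+ 2 + `|Omega|) *
      cn (fun j => m_ n x j - m x j))).
  - apply: nearW => n; rewrite cn_ge0/=.
    have := cn_Lm nu Omega (flin (-1) m (m_ n)) x; rewrite Lm_flin.
    rewrite [X in cn X](_ : _ = fun j => Lm nu Omega (m_ n) x j - Lm nu Omega m x j).
      rewrite [X in _ * cn X](_ : _ = fun j => m_ n x j - m x j)//.
      by apply/funext => j; rewrite /flin rmorphN mulN1r addrC.
    by apply/funext => j; rewrite /flin rmorphN mulN1r addrC.
  - exact: cvg_cst.
  - rewrite -[X in _ --> X](mulr0 (`|nu| * enorm x ^+ 2 + `|Omega|)); apply: cvgMr; exact: mc.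
have [B BP] := tcont_bounded (tcont_xm hC) s0 (ltW st) tT.
have [D DP] : exists D : R, forall n x, s <= x <= t -> `|Kf (G x) (Lm nu Omega (m_ n))| <= D.
  exists ((4 * `|nu| + `|Omega|) * M * (2 * B)) => n x xst.
  have xT : 0 <= x < T by case/andP: xst => sx xt; rewrite (le_trans s0 sx) (le_lt_trans xt tT).
  rewrite (le_trans (Kf_le (G_fld hC xT) (L1 n)))// ler_wpM2l ?(mlt_ge0 (L1 n))//.
  rewrite (le_trans (nn_le_xm (G_fld hC xT) (G_em hC xT)))// ler_wpM2l//.
  by rewrite -[leLHS]ger0_norm ?xm_ge0// BP.
have I2 := @Rintegral_dominated _ _ M1 mu1 (J s t) (fun n => Ff nu Omega u (m_ n)) (Ff nu Omega u m)
  (fun x => D + (2 * pi) ^- 3 * (2 * M * B * xp (G x))) mJ.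
have c2 : I1 (J s t) (Ff nu Omega u (m_ n)) @[n --> \oo] --> I1 (J s t) (Ff nu Omega u m).
  apply: (I2 _ _ _ _).2.
  - by move=> n; exact: integrable_EFin_measurable (intF (mM n)).
  - move=> x Jx; have [_ LG] := J_ep hC NP (JT Jx).
    apply: cvgD; first exact: Kf_lim (G_fld hC (J_bound (JT Jx))) L1 Lc.
    apply: cvgMr.
    exact: (Bf_lim LG LG m1 mc).
  - move=> n x Jx; have xT := J_bound (JT Jx); have [ie LG] := J_ep hC NP (JT Jx).
    have xst : s <= x <= t by move: Jx => [/=]; rewrite in_itv/= => /andP[/ltW -> /ltW ->].
    rewrite (le_trans (ler_normD _ _))// lerD ?DP// normrM ger0_norm; last first.
      by rewrite invr_ge0 exprn_ge0// mulr_ge0// pi_ge0.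
    rewrite ler_wpM2l//; first by rewrite invr_ge0 exprn_ge0// mulr_ge0// pi_ge0.
    apply: (le_trans (Bf_bound xpredT LG (G_em hC xT) ie (m1 n))).
    rewrite -[leRHS]mulrA ler_wpM2l ?mulr_ge0 ?(mlt_ge0 (mM n))//.
    by rewrite ler_wpM2r ?xp_ge0// -[leLHS]ger0_norm ?xm_ge0// BP.
  - apply: integrable_EFinD => //; first exact: integrable_cst.
    apply: integrable_EFinZ => //; apply: integrable_EFinZ => //.
    by apply: integrableS (integrable_xp hC hL mN N0 NP) => //; exact: measurable_J.
have c1 : Kf (G s) (m_ n) - Kf (G t) (m_ n) @[n --> \oo] --> Kf (G s) m - Kf (G t) m.
  by apply: cvgB; exact: k1.
by apply: cvgR_unique c1 _; rewrite (_ : (fun n => _ - _) = fun n => I1 (J s t) (Ff nu Omega u (m_ n)))//; apply/funext => n; exact: e.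
Qed.

Lemma Ev_im phi : (forall j, test (phi j)) -> Ev (rI (qf phi)).
Proof.
move=> tphi; rewrite /Ev (Kf_qf_im (G_chi hC sT) tphi) (Kf_qf_im (G_chi hC tT') tphi) subrr.
rewrite /Rintegral integral0_eq// => x /JT Jx.
have xT := J_bound Jx; have /= [xI nx] := Jx.
have cx : in_chi 1 (u x) by apply: NP => //; move: xI; rewrite in_itv.
by rewrite /Ff (Kf_Lm_im (G_chi hC xT) nu Omega tphi) (Bf_qf_im (G_chi hC xT) cx tphi) mulr0 addr0.
Qed.

Context (evt : forall phi, (forall j, test (phi j)) ->
  (forall x, \sum_(j < 3) 'D_(ebasis R j) (phi j) x = 0) -> Ev (qf phi)).

Lemma Qt_Z (r : R) (a : V -> R) x : test a -> Qt (fun y => r * a y) x = r%:C%C * Qt a x.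
Proof.
move=> ta; have Z c : Tr c (fun y => r * a y) x = r * Tr c a x.
  rewrite !TrE -I3Z; last by apply: ig3_cosM; apply: ig3_bcs; exact: test_bcs.
  by apply: eq_I3 => y; ring.
by rewrite /Qt !Z; apply/eqP; rewrite eq_complex/=; apply/andP; split; apply/eqP; ring.
Qed.

Lemma derive_Z (r : R) (a : V -> R) v x : test a -> 'D_v (fun y => r * a y) x = r * 'D_v a x.
Proof.
by move=> ta; have [_] := is_derive_mull r (is_derive_smooth x v ta.1).
Qed.

(** The field with component [j] equal to the k-th derivative of [psi] and component [k] equal to
    minus the j-th derivative is divergence free, since derivatives commute. *)
Lemma Aq_curl j k psi : j != k -> test psi -> exists2 phi : 'I_3 -> V -> R,
  (forall i, test (phi i)) /\ (forall x, \sum_(i < 3) 'D_(ebasis R i) (phi i) x = 0) &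
  qf phi = Aq j k (fun x => - ('i * Qt psi x)%C).
Proof.
move=> jk tpsi; have tD i : test ('D_(ebasis R i) psi) by exact: test_derive.
pose phi (i : 'I_3) : V -> R := if i == j then 'D_(ebasis R k) psi else
  if i == k then (fun x => -1 * 'D_(ebasis R j) psi x) else (fun x => 0 * psi x).
have kj : (k == j) = false by rewrite eq_sym (negPf jk).
have tphi i : test (phi i).
  by rewrite /phi; case: (i == j) => //; case: (i == k); exact: testZ.
exists phi; [split=> // x|].
  have D i : i != j -> i != k -> 'D_(ebasis R i) (phi i) x = 0.
    by rewrite /phi => /negPf -> /negPf ->; rewrite (derive_Z 0 _ _ tpsi) mul0r.
  have Dj : 'D_(ebasis R j) (phi j) x = 'D_(ebasis R k) ('D_(ebasis R j) psi) x.
    have -> : phi j = 'D_(ebasis R k) psi by rewrite /phi eqxx.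
    exact: (derive_commute j k x tpsi).
  have Dk : 'D_(ebasis R k) (phi k) x = -1 * 'D_(ebasis R k) ('D_(ebasis R j) psi) x.
    by rewrite /phi kj eqxx; exact: derive_Z.
  rewrite (bigD1 j)//= (bigD1 k)/=; last by rewrite eq_sym.
  rewrite big1 => [|i /andP[? ?]]; last exact: D.
  by rewrite Dj Dk mulN1r addr0 subrr.
apply/funext => x; apply/funext => i; rewrite /qf /Aq /phi.
have [->|ij] := eqVneq i j.
  rewrite (negPf jk) subr0; apply: etrans (Qt_derive k x tpsi) _.
  by move: (Qt psi x) (xcoord x k)%:C%C ('i%C : C) => a b c; ring.
have [_|ik] := eqVneq i k.
  apply: etrans (Qt_Z (-1) x (tD j)) _; apply: etrans (congr1 _ (Qt_derive j x tpsi)) _.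
  rewrite rmorphN; by move: (Qt psi x) (xcoord x j)%:C%C ('i%C : C) => a b c; ring.
by rewrite (Qt_Z 0 x tpsi) mul0r subrr.
Qed.

(** The density argument needs [q] = -i [Qt psi], given by the curl field of [Aq_curl], and [q] =
    [Qt psi], which is i times it and follows from [Ev_im]. *)
Lemma Ev_cbcs j k q : j != k -> bcs (fun x => re (q x)) -> bcs (fun x => im (q x)) -> Ev (Aq j k q).
Proof.
move=> jk; apply: (@closed_cbcs (fun q => Ev (Aq j k q))).
  split=> [a q1 q2 M M' d1 d2 e1 e2|q_ q0 M d qc e].
    by rewrite Aq_lin; exact: Ev_lin (mlt_Aq j k d1) (mlt_Aq j k d2) e1 e2.
  by apply: (Ev_lim (fun n => mlt_Aq j k (d n))) e; exact: pcvg_Aq.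
move=> psi tpsi; have [phi [tphi div] E] := Aq_curl jk tpsi.
have e1 := evt tphi div; have e2 := Ev_im tphi.
have E2 : rI (qf phi) = Aq j k (Qt psi).
  rewrite E; apply/funext => x; apply/funext => i; rewrite /rI /Aq.
  have K (b : C) : ('i * (b * - ('i * Qt psi x)))%C = b * Qt psi x.
    move: (Qt psi x) b => [d e] [b1 b2].
    by apply/eqP; rewrite eq_complex/=; apply/andP; split; apply/eqP; ring.
  by rewrite mulrBr; case: (i == j); case: (i == k); rewrite ?mulr0 ?K.
by split; [rewrite -E|rewrite -E2].
Qed.

(* m = |xi|^-2 xi x (m x xi) componentwise, as m is orthogonal to xi. *)
Lemma Ev_solenoidal m (M B r : R) : vm3 m -> 0 < r -> (forall x, cn (m x) <= M) ->
  (forall x, ~ (cube B x /\ r <= enorm x) -> forall j, m x j = 0) ->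
  (forall x, cdot (cvec x) (m x) = 0) -> Ev m.
Proof.
move=> mm r0 mM mout orth.
have M0 : 0 <= M by exact: le_trans (cn_ge0 _) (mM 0).
pose ie (x : V) := (enorm x ^- 2)%:C%C.
pose X k (x : V) := (xcoord x k)%:C%C.
(* A component of |xi|^-2 m x xi. The sum of [Aq j k (q j k)] over j < k is |xi|^-2 (|xi|^2 m -
   (xi.m) xi), and [q] is bounded because [m] vanishes near the origin. *)
pose q j k x := ie x * (m x j * X k x - m x k * X j x).
have mie : meas3 (fun x : V => enorm x ^- 2).
  rewrite (_ : (fun x => _) = fun x => (enorm x `^ (-1)) ^+ 2); last first.
    by apply/funext => x; rewrite powR_inv1 ?enorm_ge0// exprVn.
  apply: meas3X; apply: (@meas3_comp _ (fun r => r `^ (-1))); first exact: measurable_powR.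
  exact: meas3_enorm.
have mq j k : @cmeas R _ M3 (q j k).
  apply: cmeasM; first exact: cmeas_real.
  by apply: cmeasB; apply: cmeasM => //; apply: cmeas_real; exact: meas3_xcoord.
have qM j k x : normc (q j k x) <= r ^- 2 * (2 * M * `|B|).
  have [[xB rx]|nx] := pselect (cube B x /\ r <= enorm x); last first.
    rewrite /q !(mout x nx) !mul0r subrr mulr0 Normc.normc0.
    by rewrite !mulr_ge0// invr_ge0 exprn_ge0// ltW.
  have xB' : `|x| <= `|B| by rewrite (le_trans xB)// ler_norm.
  rewrite /q Normc.normcM normc_real ger0_norm ?invr_ge0 ?exprn_ge0 ?enorm_ge0//.
  apply: ler_pM; rewrite ?invr_ge0 ?exprn_ge0 ?enorm_ge0 ?normc_ge0//.
    by rewrite lef_pV2 ?posrE ?exprn_gt0// ?(lt_le_trans r0)// lerXn2r ?nnegrE ?enorm_ge0// ltW.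
  have b i l : normc (m x i * X l x) <= M * `|B|.
    rewrite Normc.normcM normc_real ler_pM ?normc_ge0//.
      by rewrite (le_trans (normc_le_cn _ _)).
    by rewrite (le_trans (xcoord_le_norm x l)).
  rewrite (le_trans (normcD_le _ _))// normcN -mulrA mulr_natl mulr2n.
  by apply: lerD; exact: b.
have bq j k : bcs (fun x => re (q j k x)) /\ bcs (fun x => im (q j k x)).
  have z x : ~ cube B x -> q j k x = 0.
    move=> nB; have nx : ~ (cube B x /\ r <= enorm x) by case.
    by rewrite /q !(mout x nx) !mul0r subrr mulr0.
  split; (split; first by have [] := mq j k); exists B, (r ^- 2 * (2 * M * `|B|)); split => x.
  - exact: le_trans (normr_re_le _) (qM _ _ _).
  - by move=> /z ->.
  - exact: le_trans (normr_im_le _) (qM _ _ _).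
  - by move=> /z ->.
have e j k : j != k -> Ev (Aq j k (q j k)).
  by move=> jk; have [b1 b2] := bq j k; exact: Ev_cbcs.
have d j k : exists D, dec4 D (q j k).
  have [b1 b2] := bq j k; have [D1 h1] := dec4_bcs b1; have [D2 h2] := dec4_bcs b2.
  exists (D1 + D2); split=> // x; rewrite (le_trans (normc_le _))// mulrDl.
  by apply: lerD; [have := h1.2 x|have := h2.2 x]; rewrite normc_real.
have [D1 d1] := d 0 1; have [D2 d2] := d 0 2%:R; have [D3 d3] := d 1 2%:R.
have e12 := Ev_lin 1 (mlt_Aq 0 1 d1) (mlt_Aq 0 2%:R d2) (e 0 1 isT) (e 0 2%:R isT).
have m12 : mlt 3 (6 * D1 + 6 * D2) (flin 1 (Aq 0 1 (q 0 1)) (Aq 0 2%:R (q 0 2%:R))).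
  have [v1 c1] := mlt_Aq 0 1 d1; have [v2 c2] := mlt_Aq 0 2%:R d2; split.
    by move=> j; apply: cmeasD => //; apply: cmeasM => //; exact: cmeas_cst.
  move=> x; rewrite /flin mulrDl (le_trans (cnD _ _))// lerD// cnZ normc_real normr1 mul1r.
  exact: c1.
have := Ev_lin 1 m12 (mlt_Aq 1 2%:R d3) e12 (e 1 2%:R isT); congr Ev.
apply/funext => x; have o := orth x; rewrite /cdot /cvec sum3E -!/(X _ x) in o.
(* Near the origin [m] is 0; elsewhere |xi|^-2 |xi|^2 = 1. *)
have I : (forall j, m x j = 0) \/ ie x * (X 0 x * X 0 x + X 1 x * X 1 x + X 2%:R x * X 2%:R x) = 1.
  have [[_ rx]|/mout nx] := pselect (cube B x /\ r <= enorm x); [right|by left].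
  rewrite /ie /X -!rmorphM -!rmorphD -rmorphM.
  have -> : xcoord x 0 * xcoord x 0 + xcoord x 1 * xcoord x 1 + xcoord x 2%:R * xcoord x 2%:R = enorm x ^+ 2.
    by rewrite /enorm sqr_sqrtr /dot sum3E// -!expr2 !addr_ge0 ?sqr_ge0.
  by rewrite mulVf ?rmorph1// expf_neq0// gt_eqF// (lt_le_trans r0).
have F j : m x j = 0 \/ ie x * (X 0 x * X 0 x + X 1 x * X 1 x + X 2%:R x * X 2%:R x) = 1.
  by case: I => [h|h]; [left|right].
have key j (Z : C) : Z = m x j * (ie x * (X 0 x * X 0 x + X 1 x * X 1 x + X 2%:R x * X 2%:R x))
    - ie x * X j x * (X 0 x * m x 0 + X 1 x * m x 1 + X 2%:R x * m x 2%:R) -> Z = m x j.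
  by rewrite o mulr0 subr0 => ->; case: (F j) => ->; rewrite ?mul0r ?mulr1.
apply/funext => j; apply: key; rewrite /flin /Aq /q -!/(X _ x) rmorph1.
have c01 : (0 : 'I_3) == 1 = false by []. have c10 : (1 : 'I_3) == 0 = false by [].
have c02 : (0 : 'I_3) == 2%:R = false by []. have c20 : (2%:R : 'I_3) == 0 = false by [].
have c12 : (1 : 'I_3) == 2%:R = false by []. have c21 : (2%:R : 'I_3) == 1 = false by [].
elim/ord3_ind: j; rewrite ?eqxx ?c01 ?c10 ?c02 ?c20 ?c12 ?c21.
- ring.
- ring.
- ring.
Qed.
End Density.

(** * Orthogonality of the transform to xi at every time *)

Section DivergenceFree.
Context {R : realType}.
Local Notation V := (R3 R).
Local Notation M1 := (measurableTypeR R).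
Local Notation M3 := (M1 * M1 * M1)%type.
Local Notation mu1 := (@lebesgue_measure R).
Local Notation mu3 := (@leb3 R).

Local Notation aeq P := {ae mu3, forall x, P x}.
Local Notation C := R[i].
Local Notation re := (@complex.Re R).
Local Notation cn := (@cnorm3 R).
Local Notation normc := (@Normc.normc R).
Local Notation field := (V -> 'I_3 -> C).
Local Notation K3 := ((2 * pi : R) ^+ 3).
Local Notation I1 D f := (Rintegral mu1 D f).
Local Notation int1 D f := (mu1.-integrable D (EFin \o f)).
Implicit Types (psi w : V -> R) (phi : 'I_3 -> V -> R) (g m : field) (q : V -> C).

(** For [q] = -i [Qt psi] this is the multiplier of the gradient of [psi], against which the
    divergence is tested. *)
Definition Cq q : field := fun x i => (xcoord x i)%:C%C * q x.

Lemma cn_Cq q x : cn (Cq q x) = enorm x * normc (q x).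
Proof. by rewrite -(cn_cvec x) mulrC -cnZ; congr cn; apply/funext => i; rewrite /Cq mulrC. Qed.

Lemma mlt_Cq M q : dec4 M q -> mlt 1 (2 * M) (Cq q).
Proof.
move=> [mq Mq]; split.
  by move=> i; apply: cmeasM => //; apply: cmeas_real; exact: meas3_xcoord.
move=> x; have w := w0 x; rewrite cn_Cq expr1 ler_pdivlMr//.
have M0 : 0 <= M by have := le_trans (normc_ge0 _) (Mq 0); rewrite pmulr_lge0.
apply: (@le_trans _ _ (2 * (1 + `|x|) * (M * (1 + `|x|) ^- 4) * (1 + `|x|))).
  rewrite ler_wpM2r ?(ltW w)// ler_pM ?enorm_ge0 ?normc_ge0//.
  by rewrite (le_trans (enorm_le_norm x))// ler_wpM2l// lerDr.
have -> : 2 * (1 + `|x|) * (M * (1 + `|x|) ^- 4) * (1 + `|x|) = 2 * M * (1 + `|x|) ^- 2.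
  by move: (1 + `|x|) w => y /lt0r_neq0 y0; field.
by rewrite ler_piMr ?mulr_ge0//; have /andP[] := wV_le1 x 2.
Qed.

Context (T : R) (u : R -> vdist R) (T_gt0 : 0 < T) (hC : C_chi T (-1) u).
Local Notation G t := (hatf (u t)).
Context (N : set M1) (mN : measurable N) (N0 : mu1 N = 0%E).
Local Notation J s t := (good_times N s t).

Lemma I1_cst s t (c : R) : s <= t -> I1 (J s t) (fun=> c) = c * (t - s).
Proof.
move=> st; rewrite /Rintegral -(@integral_setD_null _ _ M1 mu1 `]s, t[%classic N)//.
rewrite integral_cst//= (lebesgue_measure_itv `]s, t[)/= lte_fin.
by move: st; rewrite le_eqVlt => /predU1P[->|->]; rewrite ?ltxx/= ?subrr// mulr0.
Qed.

(** The two open intervals miss the point [b], a null set. *)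
Lemma I1_split a b c (F : R -> R) : a <= b -> b <= c -> int1 (J a c) F ->
  I1 (J a c) F = I1 (J a b) F + I1 (J b c) F.
Proof.
move=> ab bc iF; have b0 : mu1 [set b : M1] = 0%E by rewrite lebesgue_measure_set1.
have E : J a c `\` [set b] = J a b `|` J b c.
  apply/seteqP; split=> [x [[/=]]|x []].
    rewrite in_itv/= => /andP[ax xc] nx xb; have [xlb|bx] := ltP x b; [left|right].
      by split=> //=; rewrite in_itv/= ax.
    by split=> //=; rewrite in_itv/= xc andbT lt_neqAle bx andbT; apply/eqP => h; apply: xb.
  - move=> [/=]; rewrite in_itv/= => /andP[ax xb] nx; split; last by move=> /= h; rewrite h ltxx in xb.
    by split=> //=; rewrite in_itv/= ax (lt_le_trans xb bc).
  - move=> [/=]; rewrite in_itv/= => /andP[bx xc] nx; split; last by move=> /= h; rewrite h ltxx in bx.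
    by split=> //=; rewrite in_itv/= xc (le_lt_trans ab bx).
have -> : I1 (J a c) F = I1 (J a c `\` [set b]) F.
  by rewrite /Rintegral (@integral_setD_null _ _ M1 mu1 (J a c) [set b])//; exact: measurable_J.
have iF' : int1 (J a b `|` J b c) F.
  rewrite -E; apply: integrableS iF; [exact: measurable_J| |exact: subDsetl].
  by apply: measurableD => //; exact: measurable_J.
rewrite E Rintegral_setU//; try exact: measurable_J.
apply/disj_setPLR => x [/=]; rewrite in_itv/= => /andP[ax xb] nx [/=].
by rewrite in_itv/= => /andP[bx _] _; have := lt_trans xb bx; rewrite ltxx.
Qed.

Context (dv : divergence_free T u).

Lemma weak_div (a c : R) b psi : 0 < a -> c < T -> smooth b ->
  (forall x, ~ (a <= x <= c) -> b x = 0) -> test psi ->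
  \sum_(k < 3) I1 `]0, T[ (fun t => b t * u t k ('D_(ebasis R k) psi)) = 0.
Proof.
move=> a0 cT sb bout tpsi.
have tem k t : 0 < t < T -> tempered (u t k).
  by move=> /andP[t0 tT]; have [/(_ k)[]] := G_chi hC (introT andP (conj (ltW t0) tT)).
apply: oppr_inj; rewrite oppr0; apply: etrans (dv (test_tens a0 cT sb bout tpsi)).
rewrite -sumrN; apply: eq_bigr => k _; rewrite /dderive; congr (- _).
have -> : 'D_(dir_x R k) (tens b psi) = tens b ('D_(ebasis R k) psi).
  by apply: derive_tens_x; exact: tpsi.1.
by rewrite (st_tens b (tem k))//; apply: test_schwartz; exact: test_derive.
Qed.

Lemma tcont_cst (c : R) : tcont T (fun=> c).
Proof. by move=> t e _ e0; exists 1 => // s _ _; rewrite subrr normr0. Qed.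

Definition grad psi : 'I_3 -> V -> R := fun k => 'D_(ebasis R k) psi.

(** The divergence equation holds only weakly in time. [time_localize] with [K] = 0 shows that the
    pairing has integral 0 over every interval, and the pairing is continuous, so it vanishes at
    each time, including time 0. *)
Lemma Kf_grad r psi : 0 <= r < T -> test psi -> Kf (G r) (qf (grad psi)) = 0.
Proof.
move=> rT tpsi; have tD k : test (grad psi k) by exact: test_derive.
have [M mM] := mlt_qf 1 tD.
pose F t := Kf (G t) (qf (grad psi)); have cF : tcont T F := tcont_Kf hC mM.
have iF s t : 0 <= s -> s <= t -> t < T -> int1 (J s t) F.
  by move=> s0 st tT; exact: (integrable_Kf hC mN s0 st tT mM).
have Z s t : 0 <= s -> s < t -> t < T -> I1 (J s t) F = 0.
  move=> s0 st tT; rewrite -(@time_localize R T N mN N0 (fun=> 0) F (tcont_cst 0) s t s0 st tT); first by rewrite subrr.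
    exact: iF (ltW st) tT.
  move=> b b' sb db [a [c [a0 cT out]]].
  have bout x : ~ (a <= x <= c) -> b x = 0 by move=> /out[].
  have [t1 t1T red] := I1_reduce T_gt0 mN N0 a cT.
  rewrite (_ : (fun x => b' x * 0) = fun=> 0); last by apply/funext => x; rewrite mulr0.
  rewrite {1}/Rintegral integral0//= (red _ _).2; last by move=> x /bout ->; rewrite mul0r.
  have mJ := measurable_J mN 0 t1.
  have ib k : int1 (J 0 t1) (fun x => b x * u x k (grad psi k)).
    apply: (bounded_mul_integrable mJ (smooth_continuous sb) bout).
    exact: (pair_int hC mN k t1T (tD k)).
  have E x : x \in J 0 t1 -> b x * F x = K3 * \sum_(k < 3) (b x * u x k (grad psi k)).
    rewrite inE => Jx; have JT : J 0 T x by apply: J_sub Jx => //; case/andP: t1T => _ /ltW.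
    by rewrite /F (Kf_qf (G_chi hC (J_bound JT)) tD) mulrCA mulr_sumr.
  rewrite (eq_Rintegral _ E) RintegralZl//; last exact: integrable_EFin_sum.
  rewrite Rintegral_sum//.
  have -> : \sum_(k < 3) I1 (J 0 t1) (fun x => b x * u x k (grad psi k)) =
      \sum_(k < 3) I1 `]0, T[ (fun x => b x * u x k (grad psi k)).
    by apply: eq_bigr => k _; rewrite (red _ _).1// => x /bout ->; rewrite mul0r.
  by rewrite (weak_div a0 cT sb bout tpsi) mulr0.
apply/eqP; rewrite -normr_le0; apply/ler_addgt0Pr => e e0; rewrite add0r -/(F r).
have [d d0 dP] := cF r e rT e0; case/andP: rT => r0 rT.
pose h := Num.min (d / 2) ((T - r) / 2).
have h0 : 0 < h by rewrite lt_min; apply/andP; split; lra.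
have hd : h < d by rewrite gt_min; apply/orP; left; lra.
have hT : r + h < T by rewrite -ltrBrDl gt_min; apply/orP; right; lra.
have rh : r < r + h by rewrite ltrDl.
have mJ := measurable_J mN r (r + h).
have ic := integrable_cst mN r (r + h).
have H : `|I1 (J r (r + h)) (fun x => F r - F x)| <= e * h.
  have iB : int1 (J r (r + h)) (fun x => F r - F x).
    by apply: integrable_EFinB => //; exact: iF (ltW rh) hT.
  rewrite (le_trans (le_normr_Rintegral mJ iB))//.
  have <- : I1 (J r (r + h)) (fun=> e) = e * h by rewrite (I1_cst e (ltW rh)) addrAC subrr add0r.
  apply: le_Rintegral => //; first exact: integrable_EFin_norm.
  move=> x [/=]; rewrite in_itv/= => /andP[rx xh] _; rewrite distrC ltW// dP//.
    by rewrite (le_trans r0 (ltW rx)) (lt_trans xh hT).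
  by rewrite ger0_norm ?subr_ge0 ?(ltW rx)// ltrBlDl (lt_trans xh)// ltrD2l.
move: H; rewrite RintegralB//; last exact: iF (ltW rh) hT.
rewrite (Z _ _ r0 rh hT) (I1_cst (F r) (ltW rh)) subr0 addrAC subrr add0r normrM (gtr0_norm h0).
by rewrite ler_pM2r.
Qed.

(** By density the pairing with q(xi) xi is 0 for every constant times a bounded function of compact
    support; the constants 1 and -i then give the real and the imaginary part of xi.g. *)
Lemma div_free r : 0 <= r < T -> aeq (fun x => cdot (cvec x) (G r x) = 0).
Proof.
move=> rT; have fG := G_fld hC rT.
have Kz c w : bcs w -> Kf (G r) (Cq (fun x => c * (w x)%:C%C)) = 0.
  apply: (@closed_bcs R (fun q => Kf (G r) (Cq q) = 0)).
    split=> [a q1 q2 M M' d1 d2 e1 e2|q_ q M d qc e].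
      rewrite (_ : Cq _ = flin a (Cq q1) (Cq q2)).
        by rewrite (Kf_lin a fG (mlt_Cq d1) (mlt_Cq d2)) e1 e2 mulr0 addr0.
      by apply/funext => x; apply/funext => i; rewrite /Cq /flin; ring.
    have pc : pcvg (fun n => Cq (q_ n)) (Cq q).
      move=> x; rewrite (_ : (fun n => _) = fun n => enorm x * normc (q_ n x - q x)).
        by rewrite -[X in _ --> X](mulr0 (enorm x)); apply: cvgMr; exact: qc.
      apply/funext => n; rewrite -(cn_Cq (fun x => q_ n x - q x)); congr cn.
      by apply/funext => i; rewrite /Cq mulrBr.
    apply: cvgR_unique (Kf_lim fG (fun n => mlt_Cq (d n)) pc) _.
    by rewrite (_ : (fun n => _) = fun=> 0); [exact: cvg_cst|apply/funext => n; exact: e].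
  move=> psi tpsi; have tD k : test (grad psi k) by exact: test_derive.
  have E1 : qf (grad psi) = Cq (fun x => - ('i * Qt psi x)%C).
    apply/funext => x; apply/funext => i; rewrite /qf /Cq /grad; apply: etrans (Qt_derive i x tpsi) _.
    by move: (Qt psi x) (xcoord x i)%:C%C ('i%C : C) => a b c'; ring.
  have E2 : rI (qf (grad psi)) = Cq (Qt psi).
    rewrite E1; apply/funext => x; apply/funext => i; rewrite /rI /Cq.
    move: (Qt psi x) (xcoord x i) => [d e] b.
    by apply/eqP; rewrite eq_complex/=; apply/andP; split; apply/eqP; ring.
  by split; [rewrite -E1 Kf_grad|rewrite -E2 (Kf_qf_im (G_chi hC rT) tD)].
pose D x := cdot (cvec x) (G r x).
have E c w x : re (cdot (G r x) (Cq (fun x => c * (w x)%:C%C) x)) = re (c * D x) * w x.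
  rewrite /D /cdot !sum3E /Cq /cvec; move: (G r x 0) (G r x 1) (G r x 2%:R) c (w x).
  by move=> [a1 b1] [a2 b2] [a3 b3] [c1 c2] y /=; ring.
have mD : @cmeas R _ M3 D.
  by apply: cmeas_dot; [move=> j; apply: cmeas_real; exact: meas3_xcoord|exact: fG.1].
have L c : loc3 (fun x => re (c * D x)).
  split; first by apply: (cmeasM _ mD).1; exact: cmeas_cst.
  move=> w bw; have [M dM] := dec4_bcs bw.
  have := Kf_ig fG (mlt_Cq (dec4Z c dM)); congr ig3; apply/funext => x; exact: E.
have Z c : aeq (fun x => re (c * D x) = 0).
  apply: (loc3_eq0 (L c)) => w tw; rewrite -(Kz c w (test_bcs tw)); apply: eq_I3 => x.
  by rewrite E.
apply: aeS (aeI (Z 1) (Z (- 'i%C))) => x []; rewrite -/(D x).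
case: (D x) => a b /= h1 h2; apply/eqP; rewrite eq_complex/=.
by apply/andP; split; apply/eqP; lra.
Qed.
End DivergenceFree.

(** * The energy inequality *)

Section Multiplier.
Context {R : realType}.
Local Notation V := (R3 R).
Local Notation M1 := (measurableTypeR R).
Local Notation M3 := (M1 * M1 * M1)%type.
Local Notation mu3 := (@leb3 R).

Local Notation aeq P := {ae mu3, forall x, P x}.
Local Notation C := R[i].
Local Notation re := (@complex.Re R).
Local Notation im := (@complex.Im R).
Local Notation cn := (@cnorm3 R).
Local Notation field := (V -> 'I_3 -> C).
Implicit Types (g h m : field).

(** The inner radius keeps |xi|^-1 bounded, the outer one makes the multiplier compactly supported;
    the shells increase to the complement of the origin. *)
Definition sh (n : nat) : set V := [set x | n.+1%:R^-1 <= enorm x <= n.+1%:R].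

Lemma measurable_sh n : @measurable _ M3 (sh n).
Proof.
have := meas3_enorm (R := R) measurableT (measurable_itv `[n.+1%:R^-1, n.+1%:R]).
by rewrite setTI; congr measurable; apply/seteqP; split=> x /=; rewrite in_itv.
Qed.

Lemma cvg_sh (x : V) : x != 0 -> (\1_(sh n) x : R) @[n --> \oo] --> (1 : R).
Proof.
rewrite -enorm_gt0 => x0; apply: cvg_near_cst.
exists (Num.trunc (enorm x) + Num.trunc (enorm x)^-1)%N => // n /= kn.
have H (y : R) : 0 <= y -> (Num.trunc y <= n)%N -> y <= n.+1%:R.
  by move=> y0 yn; rewrite ltW// (lt_le_trans (truncnS_gt _))// ler_nat ltnS.
rewrite indicE mem_set// /sh/= H ?enorm_ge0 ?(leq_trans _ kn) ?leq_addr//.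
rewrite andbT -[leRHS]invrK lef_pV2 ?posrE ?invr_gt0//.
by rewrite H ?invr_ge0 ?enorm_ge0// (leq_trans _ kn)// leq_addl.
Qed.

Definition an n g : R := I3 (fun x => \1_(sh n) x * em g x).
(** On the shell |xi| is at most (n + 1)^2 |xi|^-1, so this truncation of the chi^1 norm is finite
    and continuous at every time, unlike [xp]. *)
Definition bn n g : R := I3 (fun x => \1_(sh n) x * ep g x).

Lemma ind_sh n x : 0 <= (\1_(sh n) x : R) <= 1.
Proof. by rewrite indicE; case: (_ \in _); rewrite ?lexx ler01. Qed.

Lemma meas3_sh n : meas3 (\1_(sh n) : V -> R).
Proof. by apply: measurable_indic; exact: measurable_sh. Qed.

Lemma an_ig n g : vm3 g -> ig3 (em g) -> ig3 (fun x => \1_(sh n) x * em g x).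
Proof.
move=> mg ig; apply: (ig3_le _ _ ig) => [|x].
  by apply: meas3M; [exact: meas3_sh|exact: meas3_em].
have /andP[i0 i1] := ind_sh n x.
by rewrite (ger0_norm (mulr_ge0 i0 (em_ge0 g x))) ler_piMl ?em_ge0.
Qed.

Lemma ep_sh n g x : \1_(sh n) x * ep g x <= n.+1%:R ^+ 2 * em g x.
Proof.
rewrite indicE; have [|_] := boolP (x \in _); last first.
  by rewrite mul0r mulr_ge0 ?em_ge0// exprn_ge0.
rewrite inE /sh/= mul1r /ep /em mulrA => /andP[x1 x2]; rewrite ler_wpM2r ?cn_ge0//.
have e0 : 0 < enorm x by rewrite (lt_le_trans _ x1)// invr_gt0.
by rewrite ler_pdivlMr// -expr2 lerXn2r ?nnegrE ?enorm_ge0.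
Qed.

Lemma bn_ig n g : vm3 g -> ig3 (em g) -> ig3 (fun x => \1_(sh n) x * ep g x).
Proof.
move=> mg ig; apply: (ig3_le _ _ (ig3Z (n.+1%:R ^+ 2) ig)) => [|x].
  by apply: meas3M; [exact: meas3_sh|exact: meas3_ep].
have /andP[i0 i1] := ind_sh n x.
by rewrite (ger0_norm (mulr_ge0 i0 (ep_ge0 g x))); exact: ep_sh.
Qed.

Lemma an_cvg g : vm3 g -> ig3 (em g) -> an n g @[n --> \oo] --> xm g.
Proof.
move=> mg ie; apply: (@I3_dominated _ (fun n x => \1_(sh n) x * em g x) _ (em g) _ _ _ _).2 => //.
- by move=> n; apply: meas3M; [exact: meas3_sh|exact: meas3_em].
- move=> x; rewrite -[X in _ --> X]mul1r; have [->|x0] := eqVneq x 0.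
    rewrite (_ : em g 0 = 0); last first.
      by rewrite /em (_ : enorm 0 = 0) ?invr0 ?mul0r//; apply/eqP; rewrite enorm_eq0.
    by rewrite mulr0; under eq_fun do rewrite mulr0; exact: cvg_cst.
  by apply: cvgMl; exact: cvg_sh.
- move=> n x; have /andP[i0 i1] := ind_sh n x.
  by rewrite (ger0_norm (mulr_ge0 i0 (em_ge0 g x))) ler_piMl ?em_ge0.
Qed.

Lemma bn_cvg g : vm3 g -> ig3 (ep g) -> bn n g @[n --> \oo] --> xp g.
Proof.
move=> mg ie; apply: (@I3_dominated _ (fun n x => \1_(sh n) x * ep g x) _ (ep g) _ _ _ _).2 => //.
- by move=> n; apply: meas3M; [exact: meas3_sh|exact: meas3_ep].
- move=> x; rewrite -[X in _ --> X]mul1r; have [->|x0] := eqVneq x 0.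
    rewrite (_ : ep g 0 = 0); last first.
      by rewrite /ep (_ : enorm 0 = 0) ?mul0r//; apply/eqP; rewrite enorm_eq0.
    by rewrite mulr0; under eq_fun do rewrite mulr0; exact: cvg_cst.
  by apply: cvgMl; exact: cvg_sh.
- move=> n x; have /andP[i0 i1] := ind_sh n x.
  by rewrite (ger0_norm (mulr_ge0 i0 (ep_ge0 g x))) ler_piMl ?ep_ge0.
Qed.

Lemma bn_le n g : vm3 g -> ig3 (em g) -> ig3 (ep g) -> 0 <= bn n g <= xp g.
Proof.
move=> mg ie ip; have i0 x := andP (ind_sh n x); apply/andP; split.
  by apply: I3_ge0 => x; have [? ?] := i0 x; rewrite mulr_ge0 ?ep_ge0.
by apply: le_I3 => // [|x]; [exact: bn_ig|have [? ?] := i0 x; rewrite ler_piMl ?ep_ge0].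
Qed.

Definition cj (z : C) : C := (re z -i* im z)%C.

(** Orthogonality to xi is known almost everywhere; cutting to the points where it holds makes the
    multiplier orthogonal to xi everywhere, as [Ev_solenoidal] asks. *)
Definition divfree g (n : nat) : set V := sh n `&` [set x | cdot (cvec x) (g x) = 0].

(** Where [g] vanishes the last factor is 0 by the convention 0^-1 = 0, so no case distinction is
    needed. *)
Definition mr_coef n g (x : V) : R := \1_(divfree g n) x * (enorm x)^-1 * (cn (g x))^-1.

(* The dual element of [g] for the norm [an n], restricted to the directions
   orthogonal to xi. *)
Definition mr n g : field := fun x j => (mr_coef n g x)%:C%C * cj (g x j).

Section Facts.
Context (n : nat) (g : field).
Local Notation A := (divfree g n).

Lemma cn_cj x : cn (fun j => cj (g x j)) = cn (g x).
Proof.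
rewrite /cnorm3; congr Num.sqrt; apply: eq_bigr => j _; congr (_ ^+ 2).
by rewrite !normc_sqrtE /cj/= sqrrN.
Qed.

Lemma mr_coef_ge0 x : 0 <= mr_coef n g x.
Proof. by rewrite !mulr_ge0 ?invr_ge0 ?enorm_ge0 ?cn_ge0// indicE. Qed.

Lemma ind_A x : \1_A x <= \1_(sh n) x :> R.
Proof.
rewrite !indicE ler_nat; have [|//] := boolP (x \in A).
by rewrite inE => -[h _]; rewrite mem_set.
Qed.

Lemma mr_coef_cn x : mr_coef n g x * cn (g x) = \1_A x * (enorm x)^-1 * (cn (g x) != 0)%:R.
Proof.
rewrite /mr_coef -[LHS]mulrA; congr (_ * _).
by have [->|z] := eqVneq (cn (g x)) 0; [rewrite mulr0|rewrite mulVf].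
Qed.

Lemma cn_mr x : cn (mr n g x) <= \1_(sh n) x * (enorm x)^-1.
Proof.
rewrite cnZ normc_real ger0_norm ?mr_coef_ge0// cn_cj mr_coef_cn.
apply: (@le_trans _ _ (\1_A x * (enorm x)^-1)).
  apply: ler_piMr; last by case: (_ != 0).
  by rewrite mulr_ge0 ?invr_ge0 ?enorm_ge0// indicE.
by rewrite ler_wpM2r ?invr_ge0 ?enorm_ge0// ind_A.
Qed.

Lemma re_cdot_mr x : re (cdot (g x) (mr n g x)) = \1_A x * em g x.
Proof.
have -> : re (cdot (g x) (mr n g x)) = mr_coef n g x * cn (g x) ^+ 2.
  rewrite sqr_cn /cdot !sum3E /mr /cj !sqr_normcE; move: (mr_coef n g x).
  by case: (g x 0) (g x 1) (g x 2%:R) => [? ?] [? ?] [? ?] ? /=; ring.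
rewrite expr2 mulrA mr_coef_cn /em -!mulrA; congr (_ * (_ * _)).
by have [->|_] := eqVneq (cn (g x)) 0; rewrite ?mulr0 ?mul1r.
Qed.

Lemma orth_mr x : cdot (cvec x) (mr n g x) = 0.
Proof.
have [xA|xA] := boolP (x \in A); last first.
  rewrite /cdot big1// => j _; rewrite /mr /mr_coef indicE (negPf xA) !mul0r.
  by rewrite mulr0.
move: xA; rewrite inE => -[_ /= D].
have -> : cdot (cvec x) (mr n g x) = (mr_coef n g x)%:C%C * cj (cdot (cvec x) (g x)).
  rewrite /cdot !sum3E /mr /cvec /cj; move: (mr_coef n g x) (xcoord x 0) (xcoord x 1) (xcoord x 2%:R).
  move: (g x 0) (g x 1) (g x 2%:R) => [? ?] [? ?] [? ?] ? ? ? ? /=.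
  by apply/eqP; rewrite eq_complex/=; apply/andP; split; apply/eqP; ring.
by rewrite D /cj/= oppr0 mulr0.
Qed.

Lemma vm3_mr : vm3 g -> vm3 (mr n g).
Proof.
move=> mg.
have mD : @cmeas R _ M3 (fun x => cdot (cvec x) (g x)).
  by apply: cmeas_dot => // j; apply: cmeas_real; exact: meas3_xcoord.
have mA : @measurable _ M3 A.
  apply: measurableI; first exact: measurable_sh.
  have h1 := mD.1 measurableT [set 0] (measurable_set1 0).
  have h2 := mD.2 measurableT [set 0] (measurable_set1 0).
  rewrite !setTI in h1 h2; have := measurableI _ _ h1 h2; congr measurable.
  apply/seteqP; split=> x /=; first by move=> [r i]; apply/eqP; rewrite eq_complex r i !eqxx.
  by move=> ->.
have inv (f : V -> R) : (forall x, 0 <= f x) -> meas3 f -> meas3 (fun x => (f x)^-1).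
  move=> f0 mf; rewrite (_ : (fun x => _) = fun x => f x `^ (-1)).
    by apply: (@meas3_comp _ (fun r => r `^ (-1))) => //; exact: measurable_powR.
  by apply/funext => x; rewrite powR_inv1.
have mk : meas3 (mr_coef n g).
  apply: meas3M; last by apply: inv; [move=> x; exact: cn_ge0|exact: vm3_cn].
  apply: meas3M; first exact: measurable_indic.
  by apply: inv; [exact: enorm_ge0|exact: meas3_enorm].
move=> j; apply: cmeasM; first exact: cmeas_real.
split; first exact: (mg j).1.
have := meas3M (meas3_cst (-1)) (mg j).2.
by congr meas3; apply/funext => x; rewrite mulN1r.
Qed.

Lemma mr_out x : ~ (cube n.+1%:R x /\ n.+1%:R^-1 <= enorm x) -> forall j, mr n g x j = 0.
Proof.
move=> nx j; have xA : (x \in A) = false.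
  apply/negbTE; rewrite notin_setE => -[/= /andP[x1 x2] _]; apply: nx; split=> //.
  by rewrite /cube/= (le_trans (norm_le_enorm x)).
by rewrite /mr /mr_coef indicE xA !mul0r.
Qed.

Lemma sh_inv x : \1_(sh n) x * (enorm x)^-1 <= n.+1%:R.
Proof.
rewrite indicE; have [|_] := boolP (x \in _); last by rewrite mul0r.
rewrite inE /sh/= mul1r => /andP[x1 x2].
by rewrite -[leRHS]invrK lef_pV2 ?posrE ?invr_gt0// (lt_le_trans _ x1)// invr_gt0.
Qed.

Lemma mlt_mr : vm3 g -> mlt 3 (n.+1%:R * (1 + n.+1%:R) ^+ 3) (mr n g).
Proof.
move=> mg; split; first exact: vm3_mr.
move=> x; have w := w0 x; rewrite ler_pdivlMr ?exprn_gt0//.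
have [xB|xB] := boolP (`|x| <= n.+1%:R).
  apply: ler_pM; rewrite ?cn_ge0 ?exprn_ge0 ?(ltW w)//.
    exact: le_trans (cn_mr x) (sh_inv x).
  by rewrite lerXn2r ?nnegrE ?(ltW w) ?addr_ge0// lerD2l.
rewrite (_ : cn (mr n g x) = 0) ?mul0r ?mulr_ge0 ?exprn_ge0 ?addr_ge0//.
rewrite /cnorm3 big1 ?sqrtr0// => j _; rewrite mr_out ?Normc.normc0 ?expr0n//.
by move=> [h _]; move/negP: xB; apply.
Qed.

Lemma enorm_cn_mr x : enorm x * cn (mr n g x) <= 1.
Proof.
apply: (le_trans (ler_wpM2l (enorm_ge0 x) (cn_mr x))).
have /andP[i0 i1] := ind_sh n x; rewrite mulrCA.
have [->|x0] := eqVneq (enorm x) 0; first by rewrite mul0r mulr0.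
by rewrite mulfV// mulr1.
Qed.

(** The Coriolis term is a multiple of the real part of g_0 conj(g_1) - g_1 conj(g_0), which is
    purely imaginary; the viscous symbol nu |xi|^2 turns the weight |xi|^-1 into |xi|. *)
Lemma re_cdot_Lm_mr nu Omega x :
  re (cdot (g x) (Lm nu Omega (mr n g) x)) = nu * (\1_A x * ep g x).
Proof.
have e2 : enorm x ^+ 2 = xcoord x 0 ^+ 2 + xcoord x 1 ^+ 2 + xcoord x 2%:R ^+ 2.
  by rewrite /enorm sqr_sqrtr /dot sum3E -!expr2// !addr_ge0 ?sqr_ge0.
have E : re (cdot (g x) (Lm nu Omega (mr n g) x)) = nu * (enorm x ^+ 2 * re (cdot (g x) (mr n g x))).
  rewrite cdot_Lm e2 !sum3E /cdot sum3E /mr /cj.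
  move: (mr_coef n g x) (xcoord x 0) (xcoord x 1) (xcoord x 2%:R).
  by move: (g x 0) (g x 1) (g x 2%:R) => [? ?] [? ?] [? ?] ? ? ? ? /=; ring.
rewrite E re_cdot_mr /em /ep; congr (_ * _); rewrite mulrCA; congr (_ * _).
rewrite mulrA; congr (_ * _); have [->|x0] := eqVneq (enorm x) 0; first by rewrite expr0n mul0r.
by rewrite expr2 mulfK.
Qed.
End Facts.

Section Pairing.
Context (n : nat) (g : field) (fg : fld g) (ig : ig3 (em g)) (nu Omega : R).
Context (dg : aeq (fun x => cdot (cvec x) (g x) = 0)).

Lemma ae_divfree : aeq (fun x => \1_(divfree g n) x = \1_(sh n) x :> R).
Proof.
apply: aeS dg => x D; rewrite !indicE; congr (_%:R); congr nat_of_bool.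
by apply/idP/idP; rewrite !inE; [case|move=> h; split].
Qed.

Lemma Kf_mr : Kf g (mr n g) = an n g.
Proof.
have iK := Kf_ig fg (mltS (mltS (mlt_mr n fg.1))).
apply: ae_I3; [exact: ig3_meas|exact: ig3_meas (an_ig n fg.1 ig)|].
by apply: aeS ae_divfree => x; rewrite re_cdot_mr => ->.
Qed.

Lemma Kf_Lm_mr : Kf g (Lm nu Omega (mr n g)) = nu * bn n g.
Proof.
have iK := Kf_ig fg (mlt_Lm nu Omega (mlt_mr n fg.1)).
have ib := bn_ig n fg.1 ig; rewrite /bn -I3Z//.
apply: ae_I3; [exact: ig3_meas|exact: ig3_meas (ig3Z nu ib)|].
by apply: aeS ae_divfree => x; rewrite re_cdot_Lm_mr => ->.
Qed.

Lemma Kf_mr_le h : fld h -> ig3 (em h) -> Kf h (mr n g) <= an n h.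
Proof.
move=> fh ih; apply: le_I3; [exact: Kf_ig (mltS (mltS (mlt_mr n fg.1)))|exact: an_ig fh.1 ih|move=> x].
rewrite (le_trans (ler_norm _))// (le_trans (normr_re_le _))// (le_trans (cdot_le _ _))//.
rewrite /em mulrA [leLHS]mulrC ler_wpM2r ?cn_ge0//; exact: cn_mr.
Qed.

(** The factor |xi + eta| of the derivative is absorbed by |xi| |m| <= 1, so the constant is exactly
    1, and [sqr_n1_le] bounds the square of the L^1 norm. The general bound [Bf_bound] would lose a
    constant depending on [m]. *)
Lemma Bf_mr_le h : L1f h -> ig3 (em h) -> ig3 (ep h) -> `|Bf h h (mr n g)| <= xm h * xp h.
Proof.
move=> Lh im ip; have mM := mltS (mltS (mlt_mr n fg.1)).
have iB := Bf_ig Lh Lh mM; have [ic Ec] := ig6_cncn 1 Lh Lh.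
rewrite (le_trans (le_norm_I6 iB))// (le_trans _ (sqr_n1_le Lh im ip))// expr2 -[leRHS]mul1r mulrA -Ec.
apply: le_I6 => //; first exact: ig6_norm.
move=> z; rewrite (le_trans (Bpt_le _ _ _ _))// -[leRHS]mulrA ler_wpM2r ?mulr_ge0 ?cn_ge0//.
exact: enorm_cn_mr.
Qed.
End Pairing.

Lemma bn_diff n g h : vm3 g -> vm3 h -> ig3 (em g) -> ig3 (em h) -> ig3 (em (fsub g h)) ->
  `|bn n g - bn n h| <= n.+1%:R ^+ 2 * xm (fsub g h).
Proof.
move=> mg mh ig ih id; have i1 := bn_ig n mg ig; have i2 := bn_ig n mh ih.
rewrite /bn -I3B// (le_trans (le_norm_I3 (ig3B i1 i2)))// -I3Z//.
apply: le_I3; [by apply: ig3_norm; exact: ig3B|exact: ig3Z|move=> x].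
apply: le_trans (ep_sh n (fsub g h) x); have /andP[i0 _] := ind_sh n x.
rewrite -mulrBr normrM (ger0_norm i0) ler_wpM2l// /ep -mulrBr normrM.
by rewrite ger0_norm ?enorm_ge0// ler_wpM2l ?enorm_ge0//; exact: cn_dist.
Qed.
End Multiplier.

(** * Local estimates, their summation and the continuity argument *)

Section Energy.
Context {R : realType}.
Local Notation V := (R3 R).
Local Notation M1 := (measurableTypeR R).
Local Notation mu1 := (@lebesgue_measure R).
Local Notation mu3 := (@leb3 R).

Local Notation aeq P := {ae mu3, forall x, P x}.
Local Notation C := R[i].
Local Notation cn := (@cnorm3 R).
Local Notation field := (V -> 'I_3 -> C).
Local Notation I1 D f := (Rintegral mu1 D f).
Local Notation int1 D f := (mu1.-integrable D (EFin \o f)).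
Implicit Types (g h m : field).

Lemma arith_norm (x z d a b : R) : a <= z -> z <= b -> `|a - x| < d -> `|b - x| < d ->
  `|z - x| < d.
Proof. by move=> ? ?; rewrite !ltr_norml => /andP[? ?] /andP[? ?]; apply/andP; split; lra. Qed.

Lemma arith_close (z x a e q X : R) : `|z - x| < e -> `|a - x| < e -> a <= X -> e + e = q - X ->
  z <= q.
Proof. by rewrite !ltr_norml => /andP[? ?] /andP[? ?]; lra. Qed.

Lemma arith_add (a b c i j e x y z : R) : b - a + i <= e * (y - x) -> c - b + j <= e * (z - y) ->
  c - a + (i + j) <= e * (z - x).
Proof. by move=> ? ?; lra. Qed.

Lemma arith_dist (d1 d2 d3 e : R) : d1 <= d2 + d3 -> d2 < e -> d3 < e -> d1 <= 2 * e.
Proof. by lra. Qed.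

Lemma arith_energy (c e M n kB kx K br bx : R) : - (M * (2 * e)) <= K - br ->
  bx - br <= c * (n * e) -> - kx <= kB -> bx - kx - (c * n + M * 2) * e <= K + kB.
Proof. by move=> ? ? ?; lra. Qed.

Lemma arith_star (Ks ar as_ I D h e : R) : Ks <= as_ -> I - D * e * h <= Ks - ar ->
  ar - as_ + I <= D * e * h.
Proof. by move=> ? ?; lra. Qed.

Lemma arith_subr (a b c : R) : a - b + c <= 0 -> a + c <= b.
Proof. by lra. Qed.

(** At the supremum of the r with [Q s r] the local property extends [Q] further unless t is
    reached. It is used to add up small errors and to propagate a bound. *)
Lemma interval_induction (Q : R -> R -> Prop) (s t : R) : s <= t ->
  (forall x, s <= x <= t -> exists2 d : R, 0 < d & forall a b, s <= a -> a <= b -> b <= t ->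
     `|a - x| < d -> `|b - x| < d -> Q a b) ->
  (forall a b c, s <= a -> a <= b -> b <= c -> c <= t -> Q a b -> Q b c -> Q a c) ->
  Q s t.
Proof.
move=> st loc add; pose A := [set r | s <= r <= t /\ Q s r].
have As : A s.
  have [|d d0 dQ] := loc s; first by rewrite lexx.
  by split; [rewrite lexx|apply: dQ => //; rewrite subrr normr0].
have bA : has_ubound A by exists t => r [/andP[_ rt] _].
have sA : has_sup A by split; [exists s|].
pose x := sup A.
have sx : s <= x by exact: ub_le_sup.
have xt : x <= t by apply: ge_sup => [|r [/andP[_ rt] _]//]; exists s.
have [|d d0 dQ] := loc x; first by rewrite sx.
have [r [/andP[sr rt] Qr] rx] := sup_adherent d0 sA.
have rlex : r <= x by apply: ub_le_sup => //; split=> //; rewrite sr.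
have rd : `|r - x| < d by rewrite distrC ger0_norm ?subr_ge0//; rewrite -/x in rx; lra.
pose y := Num.min t (x + d / 2).
have yt : y <= t by rewrite ge_min lexx.
have xy : x <= y by rewrite le_min xt/=; lra.
have yd : `|y - x| < d.
  rewrite ger0_norm ?subr_ge0// ltrBlDl gt_min; apply/orP; right; lra.
have Qy : Q s y.
  apply: (add s r y) => //; first exact: le_trans xy.
  by apply: dQ => //; exact: le_trans xy.
have yx : y <= x by apply: ub_le_sup => //; split=> //; rewrite yt (le_trans sx xy).
suff -> : t = y by [].
have := yx; rewrite /y ge_min => /orP[tx|]; last lra.
by apply/eqP; rewrite eq_le yt andbT (le_trans tx xy).
Qed.

Context (nu Omega T : R) (u : R -> vdist R) (nu_gt0 : 0 < nu) (hC : C_chi T (-1) u)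
  (hL : L1_chi T 1 u).
Local Notation G t := (hatf (u t)).
Context (N : set M1) (mN : measurable N) (N0 : mu1 N = 0%E)
  (NP : forall t, 0 < t < T -> ~ N t -> in_chi 1 (u t)).
Local Notation J s t := (good_times N s t).
Local Notation kV := ((2 * pi : R) ^- 3).
Context (hdiv : forall r, 0 <= r < T -> aeq (fun x => cdot (cvec x) (G r x) = 0))
  (evs : forall s t m (M B r : R), 0 <= s -> s < t -> t < T -> vm3 m -> 0 < r ->
    (forall x, cn (m x) <= M) ->
    (forall x, ~ (cube B x /\ r <= enorm x) -> forall j, m x j = 0) ->
    (forall x, cdot (cvec x) (m x) = 0) ->
    Kf (G s) m - Kf (G t) m = I1 (J s t) (Ff nu Omega u m)).

Lemma dist_em s t : 0 <= s < T -> 0 <= t < T -> ig3 (em (fsub (G s) (G t))).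
Proof. by move=> sT tT; have [] := xm_sub (G_chi hC sT) (G_chi hC tT). Qed.

Lemma dist_tri x s t : 0 <= x < T -> 0 <= s < T -> 0 <= t < T ->
  dist u s t <= dist u s x + dist u t x.
Proof.
move=> xT sT tT; have i1 := dist_em sT tT; have i2 := dist_em sT xT; have i3 := dist_em tT xT.
rewrite /dist /xm -I3D//; apply: le_I3 => // [|y]; first exact: ig3D.
rewrite /em -mulrDr ler_wpM2l ?invr_ge0 ?enorm_ge0//.
apply: le_trans (cnB _ _); apply: eq_ler; congr cn; apply/funext => j; rewrite /fsub; ring.
Qed.

Lemma measurable_tcontJ (f : R -> R) s t : tcont T f -> 0 <= s -> t < T ->
  measurable_fun (J s t) f.
Proof.
move=> cf s0 tT; apply: (measurable_funS _ _ (tcont_measurable cf)) => //.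
move=> x [/=]; rewrite !in_itv/= => /andP[sx xt] _.
by rewrite (le_lt_trans s0 sx) (lt_trans xt tT).
Qed.

Lemma tcont_int (f : R -> R) s t : tcont T f -> 0 <= s -> s <= t -> t < T -> int1 (J s t) f.
Proof.
move=> cf s0 st tT; have [B BP] := tcont_bounded cf s0 st tT.
apply: (@integrable_EFin_le R _ M1 mu1 (J s t) _ (fun=> B)).
- exact: measurable_J.
- exact: measurable_tcontJ.
- by move=> x [/=]; rewrite in_itv/= => /andP[/ltW sx /ltW xt] _; rewrite BP// sx.
- exact: integrable_cst.
Qed.

Lemma int_xp s t : 0 <= s -> t < T -> int1 (J s t) (fun x => xp (G x)).
Proof.
move=> s0 tT; apply: integrableS (integrable_xp hC hL mN N0 NP).
- exact: measurable_J.
- exact: measurable_J.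
- exact: J_sub (ltW tT).
Qed.

Lemma int_xmxp s t : 0 <= s -> s <= t -> t < T -> int1 (J s t) (fun x => xm (G x) * xp (G x)).
Proof.
move=> s0 st tT; have [B BP] := tcont_bounded (tcont_xm hC) s0 st tT.
have mJ := measurable_J mN s t; have sub := @J_sub R T N s t s0 (ltW tT).
apply: (@integrable_EFin_le R _ M1 mu1 (J s t) _ (fun x => B * xp (G x))) => //.
- apply: measurable_funM.
    exact: measurable_tcontJ (tcont_xm hC) s0 tT.
  exact: integrable_EFin_measurable (int_xp s0 tT).
- move=> x [/=]; rewrite in_itv/= => /andP[/ltW sx /ltW xt] _.
  by rewrite normrM (ger0_norm (xp_ge0 _)) ler_wpM2r ?xp_ge0// BP// sx.
- by apply: integrable_EFinZ => //; exact: int_xp.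
Qed.

Lemma tcont_bn n : tcont T (fun t => bn n (G t)).
Proof.
apply: (tcont_dist hC) => t tT; exists (n.+1%:R ^+ 2); first exact: exprn_ge0.
move=> s sT _; apply: bn_diff; [exact: (G_fld hC sT).1|exact: (G_fld hC tT).1|exact: (G_em hC sT)|
  exact: (G_em hC tT)|exact: dist_em].
Qed.

Definition Wn n x : R := nu * bn n (G x) - kV * (xm (G x) * xp (G x)).

Lemma int_Wn n s t : 0 <= s -> s <= t -> t < T -> int1 (J s t) (Wn n).
Proof.
move=> s0 st tT; have mJ := measurable_J mN s t.
apply: integrable_EFinB => //; apply: integrable_EFinZ => //; last exact: int_xmxp.
exact: tcont_int (tcont_bn n) s0 st tT.
Qed.

Lemma kV_ge0 : 0 <= kV. Proof. by rewrite invr_ge0 exprn_ge0// mulr_ge0// pi_ge0. Qed.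

(** Comparing times x and r costs nu (n + 1)^2 e for the truncated viscous term and 2 M' e for the
    pairing with [Lm m]; their sum is D e. Convection is estimated at the time x itself and costs
    nothing. *)
Lemma local_energy n : exists2 D : R, 0 <= D & forall s r (e : R), 0 <= s -> s < r -> r < T ->
  (forall x, s <= x <= r -> dist u x r <= e) ->
  an n (G r) - an n (G s) + I1 (J s r) (Wn n) <= D * e * (r - s).
Proof.
pose Mn : R := n.+1%:R * (1 + n.+1%:R) ^+ 3; pose M' := (4 * `|nu| + `|Omega|) * Mn.
have Mn0 : 0 <= Mn by rewrite mulr_ge0// exprn_ge0// addr_ge0.
have M'0 : 0 <= M' by rewrite mulr_ge0// addr_ge0// mulr_ge0.
exists (nu * n.+1%:R ^+ 2 + M' * 2).
  by rewrite addr_ge0 ?mulr_ge0 ?exprn_ge0// ltW.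
move=> s r e s0 sr rT de; have r0 := le_lt_trans s0 sr.
have sT : 0 <= s < T by rewrite s0 (lt_trans sr).
have rT' : 0 <= r < T by rewrite rT (ltW r0).
have [fr fs] := (G_fld hC rT', G_fld hC sT).
(* The multiplier is taken at the right end: there [Kf_mr] is an equality, and at s [Kf_mr_le] is an
   inequality in the favourable direction. *)
pose m := mr n (G r); have mM : mlt 3 Mn m := mlt_mr n fr.1.
have Ev : Kf (G s) m - Kf (G r) m = I1 (J s r) (Ff nu Omega u m).
  apply: (@evs s r m n.+1%:R n.+1%:R n.+1%:R^-1 s0 sr rT) => //.
  - exact: vm3_mr fr.1.
  - by move=> x; apply: le_trans (cn_mr n (G r) x) (sh_inv n x).
  - exact: mr_out.
  - exact: orth_mr.
have K1 := Kf_mr n fr (G_em hC rT') (hdiv rT').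
have K2 := Kf_mr_le n fr fs (G_em hC sT).
have iF := integrable_Ff nu Omega hC hL mN N0 NP s0 (ltW sr) rT mM.
have iW := int_Wn n s0 (ltW sr) rT; have mJ := measurable_J mN s r.
have L : I1 (J s r) (fun x => Wn n x - (nu * n.+1%:R ^+ 2 + M' * 2) * e) <= I1 (J s r) (Ff nu Omega u m).
  apply: le_Rintegral => //; first by apply: integrable_EFinB => //; exact: integrable_cst.
  move=> x Jx; have JT : J 0 T x by apply: J_sub Jx => //; exact: ltW.
  have xT := J_bound JT; have [ip Lx] := J_ep hC NP JT; have fx := G_fld hC xT.
  have xsr : s <= x <= r by move: Jx => [/=]; rewrite in_itv/= => /andP[/ltW -> /ltW ->].
  have dx := de x xsr.
  have b1 := bn_diff n fx.1 fr.1 (G_em hC xT) (G_em hC rT') (dist_em xT rT').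
  have b2 : `|Kf (G x) (Lm nu Omega m) - Kf (G r) (Lm nu Omega m)| <= M' * (2 * e).
    apply: le_trans (Kf_diff fx fr (mlt_Lm nu Omega mM)) _; rewrite ler_wpM2l//.
    by apply: le_trans (nn_dist hC xT rT') _; rewrite ler_wpM2l.
  have b3 := Bf_mr_le n fr Lx (G_em hC xT) ip.
  have b4 : `|bn n (G x) - bn n (G r)| <= n.+1%:R ^+ 2 * e.
    by apply: le_trans b1 _; rewrite ler_wpM2l// exprn_ge0.
  have kB : - (kV * (xm (G x) * xp (G x))) <= kV * Bf (G x) (G x) m.
    move: b3; rewrite ler_norml => /andP[b3 _].
    by have := ler_wpM2l kV_ge0 b3; rewrite mulrN.
  have K3 := Kf_Lm_mr n fr (G_em hC rT') nu Omega (hdiv rT').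
  have b6 := ler_wpM2l (ltW nu_gt0) b4.
  move: b2; rewrite K3 ler_norml => /andP[b2 _].
  have b7 : nu * bn n (G x) - nu * bn n (G r) <= nu * (n.+1%:R ^+ 2 * e).
    by rewrite -mulrBr (le_trans _ b6)// ler_wpM2l ?(ltW nu_gt0)// ler_norm.
  by rewrite /Wn /Ff; exact: arith_energy b2 b7 kB.
move: L; rewrite RintegralB//; last exact: integrable_cst.
rewrite (I1_cst mN N0 _ (ltW sr)) -Ev K1.
by move=> L; exact: arith_star K2 L.
Qed.

(** Near each point [local_energy] holds with an error at most e (b - a); such errors add up over
    adjacent intervals to e (t - s), and e is arbitrary. *)
Lemma energy_n n s t : 0 <= s -> s <= t -> t < T ->
  an n (G t) - an n (G s) + I1 (J s t) (Wn n) <= 0.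
Proof.
move=> s0 st tT; have [D D0 HD] := local_energy n.
have sup_e (e : R) : 0 < e -> an n (G t) - an n (G s) + I1 (J s t) (Wn n) <= e * (t - s).
  move=> e0; pose Q a b := an n (G b) - an n (G a) + I1 (J a b) (Wn n) <= e * (b - a).
  apply: (@interval_induction Q s t st); last first.
    move=> a b c sa ab bc ct; rewrite /Q => q1 q2.
    have iW : int1 (J a c) (Wn n).
      by apply: int_Wn; [exact: le_trans sa|exact: le_trans bc|exact: le_lt_trans tT].
    by rewrite (I1_split mN ab bc iW); exact: arith_add q1 q2.
  move=> x /andP[sx xt]; have xT : 0 <= x < T by rewrite (le_trans s0 sx) (le_lt_trans xt tT).
  (* Two times close to x are at chi^(-1) distance at most 2 e' from each other, and D (2 e') <=
     e. *)
  pose e' := e / (2 * (D + 1)).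
  have D1 : 0 < 2 * (D + 1) by rewrite mulr_gt0// ltr_wpDl.
  have e'0 : 0 < e' by rewrite divr_gt0.
  have [d d0 dP] := dist_cvg hC xT e'0.
  exists d => // a b sa ab bt ax bx; rewrite /Q.
  have [<-|nab] := eqVneq a b.
    rewrite (_ : J a a = set0); first by rewrite Rintegral_set0 !subrr addr0 mulr0.
    by apply/seteqP; split=> // y [/=]; rewrite in_itv/= => /andP[ay ya]; have := lt_trans ay ya; rewrite ltxx.
  have lab : a < b by rewrite lt_neqAle nab.
  have bT : b < T := le_lt_trans bt tT.
  apply: (le_trans (HD a b (2 * e') (le_trans s0 sa) lab bT _)).
    move=> y /andP[ay yb]; have yT : 0 <= y < T.
      by rewrite (le_trans s0 (le_trans sa ay)) (le_lt_trans yb bT).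
    have bT' : 0 <= b < T by rewrite bT (le_trans s0 (le_trans sa ab)).
    have yx : `|y - x| < d by exact: arith_norm ay yb ax bx.
    exact: arith_dist (dist_tri xT yT bT') (dP _ yT yx) (dP _ bT' bx).
  rewrite ler_wpM2r ?subr_ge0// /e'.
  rewrite (_ : D * (2 * (e / (2 * (D + 1)))) = e * (D / (D + 1))); last first.
    by move: D1; rewrite pmulr_rgt0// => /lt0r_neq0 ?; field.
  have D1' : 0 < D + 1 by rewrite ltr_wpDl.
  by rewrite ler_piMr ?(ltW e0)// ler_pdivrMr// mul1r lerDl.
apply/ler_addgt0Pr => e e0; rewrite add0r.
have ts : 0 < t - s + 1 by rewrite ltr_wpDl// subr_ge0.
apply: (le_trans (sup_e (e / (t - s + 1)) (divr_gt0 e0 ts))).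
by rewrite mulrAC ler_pdivrMr// ler_wpM2l ?(ltW e0)// lerDl.
Qed.

(** The truncated inequalities pass to the limit: [Wn n] is dominated by nu [xp] + (2 pi)^-3 [xm]
    [xp], integrable on J s t. *)
Lemma energy s t : 0 <= s -> s <= t -> t < T ->
  xm (G t) + I1 (J s t) (fun x => nu * xp (G x) - kV * (xm (G x) * xp (G x))) <= xm (G s).
Proof.
move=> s0 st tT; have tT' : 0 <= t < T by rewrite tT (le_trans s0 st).
have sT : 0 <= s < T by rewrite s0 (le_lt_trans st).
have mJ := measurable_J mN s t; have sub := @J_sub R T N s t s0 (ltW tT).
have c1 := an_cvg (G_fld hC tT').1 (G_em hC tT').
have c2 := an_cvg (G_fld hC sT).1 (G_em hC sT).
have ix := int_xp s0 tT; have ixx := int_xmxp s0 st tT.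
have c3 : I1 (J s t) (Wn n) @[n --> \oo] --> I1 (J s t) (fun x => nu * xp (G x) - kV * (xm (G x) * xp (G x))).
  apply: (@Rintegral_dominated _ _ M1 mu1 (J s t) Wn _
    (fun x => nu * xp (G x) + kV * (xm (G x) * xp (G x))) mJ _ _ _ _).2.
  - by move=> n; exact: integrable_EFin_measurable (int_Wn n s0 st tT).
  - move=> x Jx; have [ip _] := J_ep hC NP (sub _ Jx); have xT := J_bound (sub _ Jx).
    apply: cvgB; last exact: cvg_cst.
    apply: cvgMr; exact: (bn_cvg (G_fld hC xT).1 ip).
  - move=> n x Jx; have [ip _] := J_ep hC NP (sub _ Jx); have xT := J_bound (sub _ Jx).
    have /andP[b0 b1] := bn_le n (G_fld hC xT).1 (G_em hC xT) ip.
    rewrite (le_trans (ler_normB _ _))// lerD//.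
      by rewrite ger0_norm ?mulr_ge0 ?(ltW nu_gt0)// ler_wpM2l// ltW.
    by rewrite ger0_norm// !mulr_ge0 ?kV_ge0 ?xm_ge0 ?xp_ge0.
  - by apply: integrable_EFinD => //; exact: integrable_EFinZ.
have c : an n (G t) - an n (G s) + I1 (J s t) (Wn n) @[n --> \oo] -->
    xm (G t) - xm (G s) + I1 (J s t) (fun x => nu * xp (G x) - kV * (xm (G x) * xp (G x))).
  exact: (cvgD (cvgB c1 c2) c3).
apply: arith_subr.
by apply: (cvgR_le c) => n; exact: energy_n.
Qed.

Context (X0 : R) (X00 : xm (G 0) = X0) (X0_small : kV * X0 < nu).

(** A continuity argument. As long as (2 pi)^-3 [xm] is at most nu, the integrand of [energy] is
    nonnegative and [xm] stays below its value at the start of the interval; [Q] says that the bound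
    X0 passes from a to all of [a, b]. *)
Lemma xm_le t : 0 <= t < T -> xm (G t) <= X0.
Proof.
move=> /andP[t0 tT].
pose Q a b := xm (G a) <= X0 -> forall x, a <= x <= b -> xm (G x) <= X0.
suff : Q 0 t by apply; rewrite ?X00// t0 lexx.
have kp : 0 < kV by rewrite invr_gt0 exprn_gt0// mulr_gt0// pi_gt0.
apply: (@interval_induction Q 0 t t0); last first.
  move=> a b c a0 ab bc ct q1 q2 xa x /andP[ax xc]; have [xb|/ltW bx] := leP x b.
    by apply: q1; rewrite ?ax.
  apply: (q2 _ x); last by rewrite bx.
  by apply: (q1 xa b); rewrite ab lexx.
move=> x /andP[x0 xt]; have xT : 0 <= x < T by rewrite x0 (le_lt_trans xt tT).
(* Below the threshold q viscosity dominates convection. With e half the gap between X0 and q, the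
   bound X0 at a and an oscillation below e around x give at most X0 + 2 e = q on the interval. *)
have [q qE] : exists q : R, q = nu / kV by exists (nu / kV).
have [e eE] : exists e : R, e = (q - X0) / 2 by exists ((q - X0) / 2).
have e0 : 0 < e by rewrite eE divr_gt0// subr_gt0 qE ltr_pdivlMr// mulrC.
have he : e + e = q - X0 by rewrite eE; lra.
have [d d0 dP] := (tcont_xm hC) x e xT e0.
exists d => // a b a0 ab bt ax bx xa y /andP[ay yb].
have yT : y < T := le_lt_trans yb (le_lt_trans bt tT).
have aT : 0 <= a < T by rewrite a0 (le_lt_trans ay yT).
have near z : a <= z <= y -> kV * xm (G z) <= nu.
  move=> /andP[az zy]; have zT : 0 <= z < T by rewrite (le_trans a0 az) (le_lt_trans zy yT).
  have zx : `|z - x| < d := arith_norm az (le_trans zy yb) ax bx.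
  have := arith_close (dP _ zT zx) (dP _ aT ax) xa he.
  by rewrite qE ler_pdivlMr// mulrC.
have E := energy a0 ay yT.
apply: le_trans xa; apply: le_trans E; rewrite lerDl.
apply: Rintegral_ge0 => z [/=]; rewrite in_itv/= => /andP[az zy] _.
by rewrite mulrA -mulrBl mulr_ge0 ?xp_ge0// subr_ge0 near// (ltW az) (ltW zy).
Qed.

(** With [xm] at most X0, the coefficient nu - (2 pi)^-3 [xm] in [energy] is bounded below by a
    constant, which comes out of the integral. *)
Lemma energy_final t : 0 <= t < T ->
  xm (G t) + (nu - kV * X0) * I1 (J 0 t) (fun x => xp (G x)) <= X0.
Proof.
move=> tT'; have /andP[t0 tT] := tT'; have E := energy (lexx 0) t0 tT; rewrite X00 in E.
apply: le_trans E; rewrite lerD2l; have ix := int_xp (lexx 0) tT; have mJ := measurable_J mN 0 t.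
rewrite -RintegralZl//; apply: le_Rintegral => //.
- exact: integrable_EFinZ.
- by apply: integrable_EFinB => //; apply: integrable_EFinZ => //; exact: int_xmxp.
move=> x Jx; have xT : 0 <= x < T by apply: J_bound; apply: J_sub Jx => //; exact: ltW.
rewrite mulrA -mulrBl ler_wpM2r ?xp_ge0// lerD2l lerN2 ler_wpM2l ?kV_ge0//.
exact: xm_le.
Qed.
End Energy.

Theorem theorem1 (R : realType) (nu Omega : R) (u0 : vdist R)
    (T : R) (u : R -> vdist R)
    (nu_gt0 : 0 < nu)
    (u0_chi : in_chi (-1) u0)
    (div_u0 : forall phi, schwartz phi -> divergence u0 phi = 0)
    (u0_small : (chi_norm (-1) u0 < ((2 * pi) ^+ 3 * nu)%:E)%E)
    (T_gt0 : 0 < T)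
    (u_cont : C_chi T (-1) u)
    (u_sol : NSC_solution nu Omega T u0 u)
    (u_L1 : L1_chi T 1 u)
    (dtu_L1 : exists w, time_derivative T u w /\ L1_chi T (-1) w) :
  forall t : R, 0 <= t < T ->
    (chi_norm (-1) (u t)
     + (nu%:E - ((2 * pi) ^- 3)%:E * chi_norm (-1) u0)
       * \int[lebesgue_measure]_(tau in `]0%R, t[) chi_norm 1 (u tau)
     <= chi_norm (-1) u0)%E.
Proof.
move=> t tT; have [[p [dp mom]] dv init] := u_sol.
have [aeN _ _] := u_L1.
(* The exceptional times at which u(t) may fail to lie in chi^1 are fixed once and removed from
   every time integral. *)
have [N [mN N0 NS]] := aeN.
have NP s : 0 < s < T -> ~ N s -> in_chi 1 (u s).
  by move=> sT nN; apply: contrapT => h; apply: nN; apply: NS => /= /(_ sT).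
have T0 : 0 <= (0 : R) < T by rewrite lexx.
(* The initial condition equates [u 0] and [u0] on Schwartz functions only, which is all that [fhat]
   sees. *)
have E0 : chi_norm (-1) u0 = chi_norm (-1) (u 0).
  apply: eq_integral => x _; congr (_ * cnorm3 _)%:E; apply/funext => j.
  by rewrite (@eq_fhat R (u 0 j) (u0 j) (init j)).
have XE s : 0 <= s < T -> chi_norm (-1) (u s) = (xm (hatf (u s)))%:E.
  by move=> sT; rewrite chi_normE1 I3E//; exact: (G_em u_cont sT).
have small : (2 * pi) ^- 3 * xm (hatf (u 0)) < nu.
  move: u0_small; rewrite E0 (XE 0 T0) lte_fin => h.
  by rewrite mulrC ltr_pdivrMr ?exprn_gt0 ?mulr_gt0 ?pi_gt0// mulrC.
have hdiv := @div_free R T u T_gt0 u_cont N mN N0 dv.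
have evs s r m (M B d : R) : 0 <= s -> s < r -> r < T -> vm3 m -> 0 < d ->
    (forall x, cnorm3 (m x) <= M) ->
    (forall x, ~ (cube B x /\ d <= enorm x) -> forall j, m x j = 0) ->
    (forall x, cdot (cvec x) (m x) = 0) ->
    Kf (hatf (u s)) m - Kf (hatf (u r)) m = Rintegral lebesgue_measure (good_times N s r) (Ff nu Omega u m).
  move=> s0 sr rT mm d0 mM mout orth.
  apply: (Ev_solenoidal u_cont u_L1 mN N0 NP s0 sr rT _ mm d0 mM mout orth).
  move=> phi tphi dphi.
  exact: (evolution_test T_gt0 u_cont u_L1 mN N0 NP dp mom s0 sr rT tphi dphi).
have EF := energy_final nu_gt0 u_cont u_L1 mN N0 NP hdiv evs erefl small tT.
have /andP[t0 tT'] := tT.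
(* Off the null set the chi^1 norm is the finite number [xp], integrable up to t < T, so the
   extended-real integral is a real one. *)
have IE : (\int[lebesgue_measure]_(tau in `]0%R, t[) chi_norm 1 (u tau) =
    (Rintegral lebesgue_measure (good_times N 0 t) (fun x => xp (hatf (u x))))%:E)%E.
  rewrite (@integral_setD_null _ _ (measurableTypeR R) (@lebesgue_measure R) `]0%R, t[%classic N)// -/(good_times N 0 t).
  have ix := int_xp u_cont u_L1 mN N0 NP (lexx 0) tT'.
  rewrite /Rintegral fineK; last by apply: integrable_fin_num ix; exact: measurable_J.
  apply: eq_integral => x; rewrite inE => Jx; rewrite (J_chi u_cont NP)//.
  by apply: J_sub Jx => //; exact: ltW.
by rewrite E0 (XE 0 T0) (XE t tT) IE; rewrite -lee_fin in EF; exact: EF.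
Qed.
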